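(* Let $n\in\mathbb{N}$, $n\ge2$, and let $\Omega\subset\mathbb{R}^n$ be an open, bounded, nonempty Lipschitz domain. Let $a_\Theta$ be a closed, symmetric sesquilinear form in $L^2(\partial\Omega;d^{n-1}\omega)$ with domain $H^{1/2}(\partial\Omega)\times H^{1/2}(\partial\Omega)$, bounded from below by $c_\Theta\in\mathbb{R}$, and let $\widetilde\Theta\in\mathcal{B}(H^{1/2}(\partial\Omega),H^{-1/2}(\partial\Omega))$ be the associated operator, $\langle f,\widetilde\Theta g\rangle_{1/2}=a_\Theta(f,g)$ for $f,g\in H^{1/2}(\partial\Omega)$. Then the generalized Robin Laplacian $-\Delta_{\Theta,\Omega}$, defined by $$-\Delta_{\Theta,\Omega}=-\Delta,\quad \mathrm{dom}(-\Delta_{\Theta,\Omega})=\big\{u\in H^1(\Omega)\,\big|\,\Delta u\in L^2(\Omega;d^nx);\ (\widetilde\gamma_N+\widetilde\Theta\gamma_D)u=0\text{ in }H^{-1/2}(\partial\Omega)\big\},$$ is self-adjoint and bounded from below in $L^2(\Omega;d^nx)$. Moreover, $$\mathrm{dom}\big(|-\Delta_{\Theta,\Omega}|^{1/2}\big)=H^1(\Omega).$$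
   Context: Lipschitz domain: $\partial\Omega$ is covered by finitely many open sets in each of which, after a rigid motion, $\Omega$ coincides with the region above the graph of a Lipschitz function on $\mathbb{R}^{n-1}$; $d^{n-1}\omega$ is the surface measure. $\mathcal{B}(X,Y)$ denotes bounded linear operators. $X^*$ denotes the space of continuous conjugate-linear functionals on $X$. $H^{1/2}(\partial\Omega)$ is defined from $H^{1/2}(\mathbb{R}^{n-1})$ via partition of unity and local graph coordinates; $H^{-1/2}(\partial\Omega)=(H^{1/2}(\partial\Omega))^*$; $\langle\cdot,\cdot\rangle_{1/2}$ is the pairing of $H^{1/2}(\partial\Omega)$ with $H^{-1/2}(\partial\Omega)$ (antilinear in the first, linear in the second factor), equal to $\int_{\partial\Omega}d^{n-1}\omega\,\overline fg$ when $g\in L^2(\partial\Omega;d^{n-1}\omega)$. Boundedness from below of $a_\Theta$ by $c_\Theta$ means $a_\Theta(f,f)\ge c_\Theta\|f\|^2_{L^2(\partial\Omega;d^{n-1}\omega)}$; closedness means that $H^{1/2}(\partial\Omega)$ is complete under the norm $(a_\Theta(f,f)+(1-c_\Theta)\|f\|^2_{L^2})^{1/2}$. The self-adjoint operator $\Theta$ in $L^2(\partial\Omega;d^{n-1}\omega)$ associated with $a_\Theta$ is the part of $\widetilde\Theta$ in $L^2(\partial\Omega;d^{n-1}\omega)$. $\gamma_D\colon H^1(\Omega)\to H^{1/2}(\partial\Omega)$ is the Dirichlet trace. The weak Neumann trace of $u\in H^1(\Omega)$ with $\Delta u\in L^2(\Omega;d^nx)$ is the element $\widetilde\gamma_Nu\in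 H^{-1/2}(\partial\Omega)$ given by $\langle\phi,\widetilde\gamma_Nu\rangle_{1/2}=\int_\Omega d^nx\,\overline{\nabla\Phi}\cdot\nabla u+\int_\Omega d^nx\,\overline\Phi\,\Delta u$ for all $\phi\in H^{1/2}(\partial\Omega)$ and any $\Phi\in H^1(\Omega)$ with $\gamma_D\Phi=\phi$ (independent of the choice of $\Phi$). *)

(* Defs.v *)
From HB Require Import structures.
From mathcomp Require Import all_boot all_order all_algebra complex.
From mathcomp Require Import all_classical all_reals all_analysis.
From mathcomp Require Import measurable_realfun.
Import Order.TTheory GRing.Theory Num.Theory numFieldNormedType.Exports.
Set Implicit Arguments.
Unset Strict Implicit.
Unset Printing Implicit Defensive.
Local Open Scope classical_set_scope.
Local Open Scope ring_scope.

Definition measure_matrix_display : measure_display -> measure_display.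
Proof. exact. Qed.

(* Matrices carry the product sigma-algebra, generated by the entries; on row
   vectors over R it is the Borel sigma-algebra (see open_measurable_rV).  Using
   Borel rather than Lebesgue measurability does not change L^2 modulo null
   functions. *)
Section measurable_matrix.
Context {d} {T : measurableType d}.
Variables m n : nat.

Definition matrix_cylinder : set (set 'M[T]_(m, n)) :=
  [set B | exists i j, exists2 A, measurable A &
    B = [set M : 'M[T]_(m, n) | A (M i j)]].

Let cyl0 : <<s matrix_cylinder >> set0. Proof. exact: sigma_algebra0. Qed.
Let cylC A : <<s matrix_cylinder >> A -> <<s matrix_cylinder >> (~` A).
Proof. exact: sigma_algebraC. Qed.
Let cylU (F : _^nat) : (forall i, <<s matrix_cylinder >> (F i)) ->
  <<s matrix_cylinder >> (\bigcup_i F i).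
Proof. exact: sigma_algebra_bigcup. Qed.

HB.instance Definition _ := @isMeasurable.Build (measure_matrix_display d)
  'M[T]_(m, n) <<s matrix_cylinder >> cyl0 cylC cylU.

Lemma measurable_entry i j :
  measurable_fun [set: 'M[T]_(m, n)] (fun M => M i j).
Proof.
by move=> _ A mA; rewrite setTI; apply: sub_sigma_algebra; exists i, j, A.
Qed.

Lemma measurable_fun_matrix d' (T' : measurableType d') (D : set T')
    (f : T' -> 'M[T]_(m, n)) :
  (forall i j, measurable_fun D (fun x => f x i j)) -> measurable_fun D f.
Proof.
move=> mf mD; apply: (@measurability _ _ _ _ D f matrix_cylinder) => //.
by move=> _ [_ [i [j [A mA ->]]] <-]; exact: mf.
Qed.

End measurable_matrix.

Section lebesgue_rV.
Variable R : realType.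

Definition rV_cons n (p : measurableTypeR R * 'rV[R]_n) : 'rV[R]_n.+1 := row_mx (p.1 : R)%:M p.2.

Lemma measurable_rV_cons n : measurable_fun setT (@rV_cons n).
Proof.
apply: measurable_fun_matrix => i j; rewrite /rV_cons.
pose j' : 'I_(1 + n) := j.
case: (split_ordP j') => k jE.
  rewrite (_ : (fun x => _) = fst); first exact: measurable_fst.
  apply/funext => x; transitivity ((x.1 : R)%:M i k).
    by rewrite -[j]/j' jE; exact: row_mxEl.
  by rewrite (ord1 i) (ord1 k) !mxE.
rewrite (_ : (fun x => _) = (fun v : 'rV[R]_n => v i k) \o snd).
  by apply: measurableT_comp; [exact: measurable_entry|exact: measurable_snd].
by apply/funext => x; rewrite -[j]/j' jE; exact: row_mxEr.
Qed.

Definition rV_split n (v : 'rV[R]_n.+1) : measurableTypeR R * 'rV[R]_n :=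
  (v 0 0, rsubmx (v : 'rV[R]_(1 + n))).

Lemma measurable_rV_split n : measurable_fun setT (@rV_split n).
Proof.
apply/measurable_fun_pairP; split; first exact: measurable_entry.
apply: measurable_fun_matrix => i j; rewrite /rV_split /=.
rewrite (_ : (fun x => _) = (fun v : 'rV[R]_n.+1 => v i (rshift 1 j))).
  exact: measurable_entry.
by apply/funext => v; rewrite /= mxE.
Qed.

Lemma rV_consK n : cancel (@rV_cons n) (@rV_split n).
Proof.
move=> [x v]; rewrite /rV_split /rV_cons; congr pair; last by rewrite row_mxKr.
have -> : (0 : 'I_n.+1) = lshift n (0 : 'I_1) by apply/val_inj.
by apply: etrans (row_mxEl _ _ _ _) _; rewrite mxE.
Qed.

Section cons_measure.
Variables (leb : {sigma_finite_measure set (measurableTypeR R) -> \bar R}).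
Variables (n : nat) (mu : {sigma_finite_measure set 'rV[R]_n -> \bar R}).

Definition rV_cons_measure : set 'rV[R]_n.+1 -> \bar R :=
  pushforward (leb \x mu)%E (@rV_cons n).

Let cons0 : rV_cons_measure set0 = 0%E.
Proof. by rewrite /rV_cons_measure /pushforward preimage_set0 measure0. Qed.

Let cons_ge0 A : (0 <= rV_cons_measure A)%E.
Proof. by rewrite /rV_cons_measure /pushforward; exact: measure_ge0. Qed.

Let mcons A : measurable A -> measurable (@rV_cons n @^-1` A).
Proof. by move=> mA; rewrite -[X in measurable X]setTI; exact: measurable_rV_cons. Qed.

Let cons_sigma_additive : semi_sigma_additive rV_cons_measure.
Proof.
move=> F mF tF mUF; rewrite /rV_cons_measure /pushforward preimage_bigcup.
apply: measure_semi_sigma_additive.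
- by move=> k; exact: mcons.
- apply/trivIsetP => /= i j _ _ ij; rewrite -preimage_setI.
  by move/trivIsetP : tF => /(_ _ _ _ _ ij) ->//; rewrite preimage_set0.
- by rewrite -preimage_bigcup; exact: mcons.
Qed.

HB.instance Definition _ := isMeasure.Build _ _ _ rV_cons_measure
  cons0 cons_ge0 cons_sigma_additive.

Let cons_sigma_finite : sigma_finite setT rV_cons_measure.
Proof.
have [F UF FmF] : sigma_finite setT (leb \x mu)%E.
  have /sigma_finiteP[F [TF ndF Foo]] := sigma_finiteT leb.
  have /sigma_finiteP[G [TG ndG Goo]] := sigma_finiteT mu.
  exists (fun k => F k `*` G k).
    rewrite -setXTT TF TG predeqE => -[x y]; split.
      move=> [/= [i _ Fix] [k _ Gky]]; exists (maxn i k) => //; split.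
      - by move: x Fix; exact/subsetPset/ndF/leq_maxl.
      - by move: y Gky; exact/subsetPset/ndG/leq_maxr.
    by move=> [i _ []/= ? ?]; split; exists i.
  move=> k; have [? ?] := Foo k; have [? ?] := Goo k.
  split; first exact: measurableX.
  by rewrite product_measure1E// lte_mul_pinfty// ge0_fin_numE.
exists (fun k => @rV_split n @^-1` F k).
  by rewrite -preimage_bigcup -UF preimage_setT.
move=> k; have [mF muF] := FmF k; split.
  by rewrite -[X in measurable X]setTI; exact: measurable_rV_split.
rewrite /rV_cons_measure /pushforward -comp_preimage (_ : _ \o _ = id)//.
by apply/funext => x /=; rewrite rV_consK.
Qed.

HB.instance Definition _ := Measure_isSigmaFinite.Build _ _ _
  rV_cons_measure cons_sigma_finite.

End cons_measure.

Fixpoint rV_lebesgue n : {sigma_finite_measure set 'rV[R]_n -> \bar R} :=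
  if n is k.+1 then rV_cons_measure (@lebesgue_measure R) (rV_lebesgue k)
  else \d_(0 : 'rV[R]_0).

End lebesgue_rV.

Lemma open_measurable_rV (R : realType) n (U : set 'rV[R]_n) :
  open U -> measurable U.
Proof.
move=> oU.
pose box (p : 'rV[rat]_n * nat) := [set y : 'rV[R]_n |
  forall i, `|y 0 i - ratr (p.1 0 i)| < p.2.+1%:R^-1 :> R].
have mbox p : measurable (box p).
  rewrite (_ : box p = \bigcap_(i in [set: 'I_n])
     [set y : 'rV[R]_n | `|y 0 i - ratr (p.1 0 i)| < p.2.+1%:R^-1]); last first.
    by apply/seteqP; split => y //= h i; [move=> _; exact: h|exact: h].
  apply: fin_bigcap_measurable => // i _.
  rewrite (_ : [set _ | _] = (fun y : 'rV[R]_n => y 0 i) @^-1`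
     [set z | `|z - ratr (p.1 0 i)| < p.2.+1%:R^-1])//.
  rewrite -[X in measurable X]setTI; apply: measurable_entry => //.
  rewrite (_ : [set _ | _] = `]ratr (p.1 0 i) - p.2.+1%:R^-1,
                              ratr (p.1 0 i) + p.2.+1%:R^-1[%classic).
    exact: measurable_itv.
  by apply/seteqP; split => z; rewrite /= in_itv /= ltr_distl.
rewrite (_ : U = \bigcup_k (if unpickle k is Some p then
    (if `[< box p `<=` U >] then box p else set0) else set0)); last first.
  apply/seteqP; split => [x Ux|x [k _]]; last first.
    by case: unpickle => // p; case: asboolP => // + ?; apply.
  have /nbhs_ballP[e /= e0 eU] : nbhs x U by exact: open_nbhs_nbhs.
  have [k ke] : exists k : nat, k.+1%:R^-1 < e / 2.
    have e20 : 0 < e / 2 by rewrite divr_gt0.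
    have [k] := ltr_add_invr e20.
    by rewrite add0r => h; exists k.
  have xq i : exists q : rat, `|x 0 i - ratr q| < k.+1%:R^-1 :> R.
    have : x 0 i - k.+1%:R^-1 < x 0 i + k.+1%:R^-1 :> R.
      by rewrite ltrBlDr -addrA ltrDl addr_gt0// invr_gt0.
    move=> /rat_in_itvoo[q]; rewrite in_itv /= => /andP[h1 h2]; exists q.
    by rewrite distrC ltr_distl h1.
  pose q : 'rV[rat]_n := \row_i projT1 (cid (xq i)).
  exists (pickle (q, k)) => //; rewrite pickleK.
  have bx : box (q, k) x by move=> i; rewrite /= mxE; case: cid.
  case: asboolP => // -[] y yb; apply: eU.
  split=> // i j; rewrite (ord1 i) /ball /=.
  have h1 := bx j; have h2 := yb j.
  rewrite (_ : x 0 j - y 0 j = (x 0 j - ratr (q 0 j)) - (y 0 j - ratr (q 0 j))).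
    rewrite (le_lt_trans (ler_normB _ _))// [ltRHS]splitr ltrD//.
      exact: lt_trans ke.
    exact: lt_trans ke.
  by rewrite opprB addrA subrK.
apply: bigcupT_measurable => k; case: unpickle => // p.
by case: asboolP.
Qed.

Lemma continuous_measurable_rV (R : realType) n (f : 'rV[R]_n -> R) :
  continuous f -> measurable_fun setT f.
Proof.
move=> /continuousP cf.
apply: (measurability _ (RGenOpens.measurableE R)).
move=> _ [_ [a [b ->] <-]]; rewrite setTI; apply: open_measurable_rV.
exact/cf/interval_open.
Qed.

Lemma measurable_derive_rV (R : realType) n (f : 'rV[R]_n -> R) (v : 'rV[R]_n) :
  continuous f -> measurable_fun setT (fun x => 'D_v f x).
Proof.
move=> cf.
pose q (h : R) (x : 'rV[R]_n) : R := h^-1 *: ((f \o shift x) (h *: v) - f x).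
have cq h : continuous (q h).
  move=> x.
  have c1 : (f \o (fun y => h *: v + y)) @ x --> f (h *: v + x).
    apply: (@continuous_comp _ _ _ (fun y => h *: v + y) f x); last exact: cf.
    by apply: (@cvgD _ _ _ (nbhs x) _ (fun=> h *: v) id); [exact: cvg_cst|exact: cvg_id].
  have c2 := cvgB c1 (cf x).
  have c2' := c2 (nbhs_filter x).
  have c3 := cvgZl_tmp (k := h^-1) c2'.
  exact: c3.
pose D := [set x | cvg ((fun h => q h x) @ 0^')].
pose E (k m : nat) := [set x | forall h h', 0 < `|h| < m.+1%:R^-1 ->
  0 < `|h'| < m.+1%:R^-1 -> `|q h x - q h' x| <= k.+1%:R^-1].
have mE k m : measurable (E k m).
  rewrite -[E k m]setCK; apply: measurableC; apply: open_measurable_rV.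
  rewrite openC.
  rewrite (_ : E k m = \bigcap_(p in [set p : R * R |
      (0 < `|p.1| < m.+1%:R^-1) && (0 < `|p.2| < m.+1%:R^-1)])
      ((fun x => `|q p.1 x - q p.2 x|) @^-1` [set y | y <= k.+1%:R^-1])); last first.
    apply/seteqP; split=> x /=.
      by move=> h [a b] /= /andP[pa pb]; exact: h.
    by move=> h a b pa pb; apply: (h (a, b)); rewrite /= pa pb.
  apply: closed_bigI => p _; apply: preimage_closed; last exact: closed_le.
  move=> x _; have c1 : q p.1 @ nbhs x --> q p.1 x := cq _ x.
  have c2 : q p.2 @ nbhs x --> q p.2 x := cq _ x.
  have c := cvgB c1 c2.
  have c3 := cvg_norm (c (nbhs_filter x)).
  exact: c3.
have DE : D = \bigcap_k \bigcup_m E k m.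
  apply/seteqP; split=> x.
    move=> /cvg_ex[l /cvgrPdist_le /= xl] k _.
    have k0 : 0 < k.+1%:R^-1 / 2 :> R by rewrite divr_gt0// invr_gt0.
    have /nbhs_ballP[e /= e0 ex] := xl _ k0.
    have [m me] : exists m : nat, m.+1%:R^-1 < e.
      by have [m] := ltr_add_invr e0; rewrite add0r => me; exists m.
    have qe h : 0 < `|h| < m.+1%:R^-1 -> `|l - q h x| <= k.+1%:R^-1 / 2.
      move=> /andP[h0 hm]; apply: ex; last by rewrite -normr_gt0.
      by rewrite /ball /= sub0r normrN (lt_trans hm).
    exists m => // h h' /qe qh /qe qh'.
    rewrite (_ : q h x - q h' x = (l - q h' x) - (l - q h x)); last first.
      by rewrite opprB [RHS]addrC addrA subrK.
    by rewrite (le_trans (ler_normB _ _))// [leRHS]splitr lerD.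
  move=> h; apply/cauchy_cvgP/cauchy_exP => e e0.
  have [k ke] : exists k : nat, k.+1%:R^-1 < e.
    by have [k] := ltr_add_invr e0; rewrite add0r => ?; exists k.
  have [m _ xE] := h k I.
  have m0 : 0 < m.+1%:R^-1 :> R by rewrite invr_gt0.
  exists (q (m.+1%:R^-1 / 2) x); rewrite /fmap /=.
  apply/nbhs_ballP; exists m.+1%:R^-1 => //= h'.
  rewrite /ball /= sub0r normrN => h'm h'0.
  apply: le_lt_trans ke; apply: xE; last by rewrite normr_gt0 h'0.
  rewrite gtr0_norm ?divr_gt0//= ltr_pdivrMr// ltr_pMr//.
  by rewrite (_ : 2 = 1 + 1)// ltrDl.
have mD : measurable D.
  by rewrite DE; apply: bigcapT_measurable => k; exact: bigcupT_measurable.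
rewrite -(setUv D); apply/measurable_funU => //; first exact: measurableC.
split.
  apply: (@measurable_fun_cvg _ _ _ D (fun m => q m.+1%:R^-1)) => [m|x Dx].
    by apply: measurable_funTS; apply: continuous_measurable_rV; exact: cq.
  move/cvgr_dnbhsP: (Dx) => /(_ (fun m => m.+1%:R^-1)); apply; split.
    by move=> m; rewrite invr_eq0 pnatr_eq0.
  exact: cvg_harmonic.
apply: (@eq_measurable_fun _ _ _ _ _ (cst (point : R))) => [x|].
  by rewrite inE => Dx; rewrite /derive dvgP.
exact: measurable_cst.
Qed.

Local Open Scope complex_scope.

Section square_integrable.
Context {d} {T : measurableType d} {R : realType}.
Variables (mu : {measure set T -> \bar R}) (D : set T).
Implicit Types f g : T -> R[i].

Definition csqr (z : R[i]) : R := complex.Re z ^+ 2 + complex.Im z ^+ 2.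

Definition cintegral f : R[i] :=
  (\int[mu]_(x in D) complex.Re (f x)) +i* (\int[mu]_(x in D) complex.Im (f x)).

Definition L2sq f : \bar R := (\int[mu]_(x in D) (csqr (f x))%:E)%E.

Definition L2 : set (T -> R[i]) := [set f |
  [/\ measurable_fun D (fun x => complex.Re (f x)),
      measurable_fun D (fun x => complex.Im (f x)) & (L2sq f < +oo)%E]].

Definition ip f g : R[i] := cintegral (fun x => (f x)^* * g x).

End square_integrable.

(* Elements of L^2(D) are represented by functions on the whole type, modulo
   mu-almost everywhere equality on D; values outside D are irrelevant.  An
   unbounded operator is given by its graph, saturated under this equivalence.
   [adjoint G] is the adjoint relation; since the domain is required to be
   dense, [G = adjoint G] forces G to be the graph of a linear operator (single
   valued modulo null functions).  [ip] is antilinear in its first argument. *)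
Section operators.
Context {d} {T : measurableType d} {R : realType}.
Variables (mu : {measure set T -> \bar R}) (D : set T).
Local Notation F := (T -> R[i]).
Implicit Types G S : set (F * F).

Definition op_domain G : set F := [set u | exists w, G (u, w)].

Definition dense_in_L2 (V : set F) := forall f, L2 mu D f ->
  forall e : R, 0 < e -> exists2 u, V u & (L2sq mu D (f - u)%R < e%:E)%E.

Definition adjoint G : set (F * F) := [set vw |
  [/\ L2 mu D vw.1, L2 mu D vw.2 &
      forall u w, G (u, w) -> ip mu D vw.1 w = ip mu D vw.2 u]].

Definition selfadjoint G := dense_in_L2 (op_domain G) /\ G = adjoint G.

Definition bounded_from_below G := exists c : R, forall u w, G (u, w) ->
  (c * fine (L2sq mu D u))%:C <= ip mu D u w.

Definition nonnegative G := forall u w, G (u, w) -> 0 <= ip mu D u w.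

Definition then_apply G S : set (F * F) :=
  [set uw | exists v, G (uw.1, v) /\ S (v, uw.2)].

(* The nonnegative self-adjoint square root of a nonnegative self-adjoint
   operator, which is unique; the default set0 has empty domain. *)
Definition operator_sqrt G : set (F * F) := xget set0 [set S |
  [/\ selfadjoint S, nonnegative S & then_apply S S = G]].

(* |G| = (G^* G)^{1/2} *)
Definition operator_abs G : set (F * F) :=
  operator_sqrt (then_apply G (adjoint G)).

End operators.

Section calculus.
Context {R : realType} {n : nat}.
Implicit Types f phi : 'rV[R]_n -> R.

Definition partial (j : 'I_n) f : 'rV[R]_n -> R :=
  fun x => 'D_(delta_mx 0 j) f x.

Definition smooth f := forall s : seq 'I_n,
  continuous (foldr partial f s) /\
  forall j x, derivable (foldr partial f s) x (delta_mx 0 j).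

Definition csmooth (u : 'rV[R]_n -> R[i]) :=
  smooth (fun x => complex.Re (u x)) /\ smooth (fun x => complex.Im (u x)).

Definition tsupport f : set 'rV[R]_n := closure [set x | f x != 0].

Definition test_function (D : set 'rV[R]_n) phi :=
  [/\ smooth phi, compact (tsupport phi) & tsupport phi `<=` D].

Definition enorm (x : 'rV[R]_n) : R := Num.sqrt (\sum_j x 0 j ^+ 2).

Definition boundary (D : set 'rV[R]_n) := closure D `\` D^°.

End calculus.

Section sobolev.
Context {R : realType} {n : nat}.
Variable Omega : set 'rV[R]_n.
Local Notation F := ('rV[R]_n -> R[i]).
Local Notation leb := (rV_lebesgue R n).
Implicit Types u v g : F.

Definition weak_partial (j : 'I_n) u g := L2 leb Omega g /\
  forall phi, test_function Omega phi ->
    cintegral leb Omega (fun x => (phi x)%:C * g x) =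
    - cintegral leb Omega (fun x => (partial j phi x)%:C * u x).

Definition weak_laplacian u v := L2 leb Omega v /\
  forall phi, test_function Omega phi ->
    cintegral leb Omega (fun x => (phi x)%:C * v x) =
    cintegral leb Omega
      (fun x => (\sum_j partial j (partial j phi) x)%:C * u x).

Definition H1 : set F := [set u |
  L2 leb Omega u /\ forall j, exists g, weak_partial j u g].

(* Weak derivatives are unique up to null functions, so choosing one is
   harmless. *)
Definition wpartial j u : F := xget 0 [set g | weak_partial j u g].
Definition wlaplacian u : F := xget 0 [set v | weak_laplacian u v].

Definition H1sq u : \bar R :=
  (L2sq leb Omega u + \sum_j L2sq leb Omega (wpartial j u))%E.

Definition grad_ip u v : R[i] :=
  \sum_j ip leb Omega (wpartial j u) (wpartial j v).

End sobolev.

Section euclidean_Hhalf.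
Context {R : realType} {d : nat}.
Local Notation leb := (rV_lebesgue R d).
Implicit Types g : 'rV[R]_d -> R[i].

(* The Sobolev-Slobodeckij seminorm of order s = 1/2 on R^d, with kernel
   |x - y|^{-(d + 2s)}. *)
Definition gagliardo g : \bar R := (\int[leb]_x \int[leb]_y
  (csqr (g x - g y)%R / enorm (x - y) ^+ d.+1)%:E)%E.

Definition Hhalf_rV_sq g : \bar R := (L2sq leb setT g + gagliardo g)%E.

Definition Hhalf_rV : set ('rV[R]_d -> R[i]) := [set g |
  L2 leb setT g /\ (gagliardo g < +oo)%E].

End euclidean_Hhalf.

(* A cartesian frame of R^n given by an origin [base], n - 1 orthonormal rows
   [tangent] and a unit vector [axis] orthogonal to them: x, t |-> [place] x t is
   a rigid motion R^{n-1} x R -> R^n (orientation is immaterial, since a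
   reflection of R^{n-1} can be absorbed in [height]). *)
Record lipschitz_graph (R : realType) (n : nat) := LipschitzGraph {
  base : 'rV[R]_n ;
  tangent : 'M[R]_(n.-1, n) ;
  axis : 'rV[R]_n ;
  height : 'rV[R]_n.-1 -> R ;
  tangent_orthonormal : tangent *m tangent^T = 1%:M ;
  tangent_axis : tangent *m axis^T = 0 ;
  axis_unit : axis *m axis^T = 1%:M ;
  height_lipschitz : lipschitz height }.

Section lipschitz_graph_theory.
Context {R : realType} {n : nat}.
Variable G : lipschitz_graph R n.

Definition place (x : 'rV[R]_n.-1) (t : R) : 'rV[R]_n :=
  base G + x *m tangent G + t *: axis G.

Definition epigraph : set 'rV[R]_n :=
  [set y | exists x t, height G x < t /\ y = place x t].

Definition graph_point (x : 'rV[R]_n.-1) : 'rV[R]_n := place x (height G x).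

Definition area_density (x : 'rV[R]_n.-1) : R :=
  Num.sqrt (1 + \sum_j partial j (height G) x ^+ 2).

Lemma height_continuous : continuous (height G).
Proof.
have /pinfty_ex_gt0[M M0 hM] := height_lipschitz G.
move=> x; apply/(@cvgrPdist_lt _ _ _ _ (nbhs_filter x)) => e e0.
apply/nbhs_ballP.
exists (e / M); first by rewrite /= divr_gt0.
move=> y; rewrite -ball_normE /= => xy.
have := hM (x, y) (conj I I); rewrite /self_sub /= => /le_lt_trans; apply.
by rewrite mulrC -ltr_pdivlMr.
Qed.

Lemma measurable_graph_point : measurable_fun setT graph_point.
Proof.
apply: measurable_fun_matrix => i j.
rewrite (_ : (fun _ => _) = (fun x : 'rV[R]_n.-1 => base G i j +
   (\sum_k x i k * tangent G k j) + height G x * axis G i j)); last first.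
  by apply/funext => x; rewrite !mxE.
apply: measurable_funD; last first.
  apply: measurable_funM; last exact: measurable_cst.
  apply: continuous_measurable_rV. exact: height_continuous.
apply: measurable_funD; first exact: measurable_cst.
apply: measurable_sum => k; apply: measurable_funM; last exact: measurable_cst.
exact: measurable_entry.
Qed.

Lemma measurable_area_density : measurable_fun setT area_density.
Proof.
apply: (@measurableT_comp _ _ _ _ _ _ (@Num.sqrt R)).
  apply: continuous_measurable_fun. exact: sqrt_continuous.
apply: measurable_funD; first exact: measurable_cst.
apply: measurable_sum => j; apply: measurable_funX.
apply: measurable_derive_rV; exact: height_continuous.
Qed.

Lemma area_density_ge0 x : 0 <= area_density x.
Proof. exact: sqrtr_ge0. Qed.

End lipschitz_graph_theory.

Record lipschitz_atlas (R : realType) (n : nat) (Omega : set 'rV[R]_n) :=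
  LipschitzAtlas {
    npatch : nat ;
    patch : 'I_npatch -> set 'rV[R]_n ;
    coords : 'I_npatch -> lipschitz_graph R n ;
    patch_open : forall k, open (patch k) ;
    patch_cover : boundary Omega `<=` \bigcup_k patch k ;
    patch_epigraph : forall k,
      Omega `&` patch k = epigraph (coords k) `&` patch k }.

(* The partition of unity subordinate to the atlas that enters the definitions
   of the surface measure and of H^{1/2}; neither the surface measure nor the
   space H^{1/2} with its topology depends on the atlas or the partition. *)
Record partition_of_unity (R : realType) (n : nat) (Omega : set 'rV[R]_n)
    (A : lipschitz_atlas Omega) := PartitionOfUnity {
  cutoff : 'I_(npatch A) -> 'rV[R]_n -> R ;
  cutoff_test : forall k, test_function (patch k) (cutoff k) ;
  cutoff_ge0 : forall k x, 0 <= cutoff k x ;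
  cutoff_sum : forall x, boundary Omega x -> \sum_k cutoff k x = 1 }.

Section surface_measure.
Context {R : realType} {n : nat} {Omega : set 'rV[R]_n}
  {A : lipschitz_atlas Omega}.
Variable P : partition_of_unity A.
Local Open Scope ereal_scope.

Definition surface_density k (x : 'rV[R]_n.-1) : R :=
  (cutoff P k (graph_point (coords k) x) * area_density (coords k) x)%R.

(* d omega = sqrt (1 + |grad height|^2) dx' in each graph coordinate system. The
   gradient exists almost everywhere by Rademacher's theorem; elsewhere 'D_v
   takes a default value. *)
Definition surface_measure (E : set 'rV[R]_n) : \bar R :=
  \sum_k \int[rV_lebesgue R n.-1]_(x in graph_point (coords k) @^-1` E)
           (surface_density k x)%:E.

Let measurable_density k : measurable_fun setT (surface_density k).
Proof.
apply: measurable_funM; last exact: measurable_area_density.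
apply: measurableT_comp; last exact: measurable_graph_point.
have [/(_ [::])[+ _] _ _] := cutoff_test P k.
exact: continuous_measurable_rV.
Qed.

Let density_ge0 k x : 0 <= (surface_density k x)%:E.
Proof. by rewrite lee_fin mulr_ge0 ?cutoff_ge0 ?area_density_ge0. Qed.

Let surface0 : surface_measure set0 = 0.
Proof.
by rewrite /surface_measure big1// => k _; rewrite preimage_set0 integral_set0.
Qed.

Let surface_ge0 E : 0 <= surface_measure E.
Proof.
by apply: sume_ge0 => k _; apply: integral_ge0 => x _; exact: density_ge0.
Qed.

Let surface_sigma_additive : semi_sigma_additive surface_measure.
Proof.
move=> E mE tE mUE.
rewrite [X in _ --> X](_ : _ =
    lim ((fun m => \sum_(0 <= i < m) surface_measure (E i)) @ \oo)).
  by apply: is_cvg_ereal_nneg_natsum => k _; exact: surface_ge0.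
rewrite nneseries_sum//; last first.
  by move=> *; apply: integral_ge0 => x _; exact: density_ge0.
apply: eq_bigr => /= k _; rewrite preimage_bigcup.
apply: ge0_integral_bigcup => //.
- by move=> i; rewrite -[X in measurable X]setTI; exact: measurable_graph_point.
- by apply/measurable_EFinP; apply: measurable_funTS.
- apply/trivIsetP => /= i j _ _ ij; rewrite -preimage_setI.
  by move/trivIsetP : tE => /(_ _ _ _ _ ij) ->//; rewrite preimage_set0.
Qed.

HB.instance Definition _ := isMeasure.Build _ _ _ surface_measure
  surface0 surface_ge0 surface_sigma_additive.

End surface_measure.

Section boundary_spaces.
Context {R : realType} {n : nat} {Omega : set 'rV[R]_n}
  {A : lipschitz_atlas Omega}.
Variable P : partition_of_unity A.
Local Notation F := ('rV[R]_n -> R[i]).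
Local Notation leb := (rV_lebesgue R n).
Local Notation omega := (surface_measure P).
Local Notation dOmega := (boundary Omega).
Implicit Types (u v Phi f g h phi : F) (a : F -> F -> R[i]).

Definition localize k f : 'rV[R]_n.-1 -> R[i] := fun x =>
  (cutoff P k (graph_point (coords k) x))%:C * f (graph_point (coords k) x).

Definition Hhalf : set F := [set f |
  L2 omega dOmega f /\ forall k, Hhalf_rV (localize k f)].

Definition Hhalf_sq f : \bar R := (\sum_k Hhalf_rV_sq (localize k f))%E.

(* Bounded conjugate-linear functionals on H^{1/2}, hence compatible with almost
   everywhere equality; only their values on Hhalf matter. *)
Definition Hminushalf : set (F -> R[i]) := [set ell |
  (forall (z : R[i]) f g, Hhalf f -> Hhalf g ->
     ell (fun x => z * f x + g x) = z^* * ell f + ell g) /\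
  exists C : R, forall f, Hhalf f -> csqr (ell f) <= C * fine (Hhalf_sq f)].

(* Elements of B(H^{1/2}, H^{-1/2}): [Theta g] is the functional written
   f |-> < f, Theta g >_{1/2}. *)
Definition bounded_operator (Theta : F -> F -> R[i]) :=
  [/\ forall g, Hhalf g -> Hminushalf (Theta g),
      forall (z : R[i]) f g h, Hhalf f -> Hhalf g -> Hhalf h ->
        Theta (fun x => z * f x + g x) h = z * Theta f h + Theta g h &
      exists C : R, forall f g, Hhalf f -> Hhalf g ->
        csqr (Theta g f) <= C * fine (Hhalf_sq g) * fine (Hhalf_sq f)].

Definition pairing f (ell : F -> R[i]) : R[i] := ell f.

(* The last clause expresses that the form lives on classes modulo omega-almost
   everywhere equality. *)
Definition form_sesquilinear a :=
  [/\ forall (z : R[i]) f g h, Hhalf f -> Hhalf g -> Hhalf h ->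
        a (fun x => z * f x + g x) h = z^* * a f h + a g h,
      forall (z : R[i]) f g h, Hhalf f -> Hhalf g -> Hhalf h ->
        a h (fun x => z * f x + g x) = z * a h f + a h g &
      forall f f' g g', Hhalf f -> Hhalf f' -> Hhalf g -> Hhalf g' ->
        ae_eq omega dOmega f f' -> ae_eq omega dOmega g g' ->
        a f g = a f' g'].

Definition form_symmetric a :=
  forall f g, Hhalf f -> Hhalf g -> a f g = (a g f)^*.

Definition form_bounded_below a (c : R) := forall f, Hhalf f ->
  (c * fine (L2sq omega dOmega f))%:C <= a f f.

Definition form_normsq a (c : R) f : R :=
  complex.Re (a f f) + (1 - c) * fine (L2sq omega dOmega f).

Definition form_closed a (c : R) := forall f_ : nat -> F,
  (forall m, Hhalf (f_ m)) ->
  (forall e : R, 0 < e -> exists N, forall m k, (N <= m)%N -> (N <= k)%N ->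
     form_normsq a c (f_ m - f_ k) < e) ->
  exists2 f, Hhalf f & form_normsq a c (f_ m - f) @[m --> \oo] --> 0.

(* [dirichlet_trace u g] means gamma_D u = g: the graph of the bounded extension
   H^1(Omega) -> H^{1/2} of the restriction to the boundary of functions smooth
   up to the boundary is the closure of the graph of that restriction. *)
Definition dirichlet_trace u g := [/\ H1 Omega u, Hhalf g &
  exists v_ : nat -> F, [/\ forall m, csmooth (v_ m),
    H1sq Omega (v_ m - u) @[m --> \oo] --> 0%E &
    Hhalf_sq (v_ m - g) @[m --> \oo] --> 0%E]].

(* [neumann_trace u ell] means that ell is the weak Neumann trace of u. *)
Definition neumann_trace u (ell : F -> R[i]) := Hminushalf ell /\
  forall phi Phi, Hhalf phi -> dirichlet_trace Phi phi ->
    pairing phi ell =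
    grad_ip Omega Phi u + ip leb Omega Phi (wlaplacian Omega u).

Definition robin_domain (Theta : F -> F -> R[i]) : set F := [set u |
  [/\ H1 Omega u, exists v, weak_laplacian Omega u v &
   exists g ell, [/\ dirichlet_trace u g, neumann_trace u ell &
     forall phi, Hhalf phi ->
       pairing phi ell + pairing phi (Theta g) = 0]]].

(* The graph { (u, - Delta u) }. *)
Definition robin_laplacian (Theta : F -> F -> R[i]) : set (F * F) :=
  [set uw | robin_domain Theta uw.1 /\ weak_laplacian Omega uw.1 (- uw.2)].

End boundary_spaces.

(* Main.v *)
(* The real part of the inner product makes [L^2(Omega)] a real Hilbert space [H],
   on which multiplication by [i] is an isometry [J]; complex statements are
   recovered from real ones that are invariant under [J].

   Let [q u v] be the integral of [conj (grad u) . grad v] plus [a (tr u) (tr v)],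
   for [u] and [v] in [H^1(Omega)].  The definition of the weak Neumann trace makes
   [u] in the domain with [- Delta u = w] equivalent to [q Phi u = (Phi, w)] for all
   [Phi] in [H^1(Omega)].  The trace satisfies
     [|tr u|^2 <= eps |grad u|^2 + C_eps |u|^2] in [L^2(dOmega)],
     [|tr u|^2 <= C |u|_{H^1}^2]                in [H^{1/2}(dOmega)],
   so [q u u >= |grad u|^2 / 2 - K |u|^2] by the lower bound of [a], and
   [|q u u| <= M |u|_{H^1}^2] by the boundedness of [Theta]: some [q + C] is an inner
   product on [H^1(Omega)] that is equivalent to the standard one.

   By the Riesz theorem the operator [T] of [q] is self-adjoint; it is the relation
   [N B^-1] for the commuting symmetric contractions [B = (T + C)^-1 / C] and [N],
   and [|T|], [|T|^{1/2}] are similar relations built from square roots of such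
   contractions, which are limits of a monotone iteration.  The domain of
   [|T|^{1/2}] is the range of [B^{1/2}], which is the form domain.

   The trace estimates hold for smooth functions, which are dense in [H^1(Omega)]
   by the cone property.  In graph coordinates the bound in [H^{1/2}] uses Hardy's
   inequality for vertical increments and the mean value inequality, over small
   steps, for horizontal ones. *)
From HB Require Import structures.
Require Import Defs.
From mathcomp Require Import all_boot all_order all_algebra complex.
From mathcomp Require Import all_classical all_reals all_analysis.
From mathcomp Require Import measurable_realfun.
From mathcomp Require Import ring lra.
Import Order.TTheory GRing.Theory Num.Theory numFieldNormedType.Exports.
Set Implicit Arguments.
Unset Strict Implicit.
Unset Printing Implicit Defensive.
Local Open Scope classical_set_scope.
Local Open Scope ring_scope.

(** Two obstacles shape the proof. [operator_sqrt] selects a root among all nonnegative self-adjoint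
    graphs, so explicit formulas for [|T|] and [|T|^{1/2}] settle nothing before such roots are
    known to be unique for unbounded operators. Uniqueness is reduced to that of square roots of
    contractions: a nonnegative self-adjoint relation [G] is determined by the contraction
    [(1 + G^2)^-1], hence by [G^2]. No spectral measure occurs.

    The other obstacle is the trace. Changes of variables in R^n are confined to Tonelli's theorem,
    translations and affine maps of the line, so rigid motions, polar coordinates and the flattening
    of a graph are treated by inequalities with unspecified constants. This suffices because the
    estimates are used up to a constant; only the factor of the gradient in the [L^2] bound on the
    boundary has to be small. Norms enter through their squares, with factors 2 or 4 in place of the
    triangle inequality. *)

Notation mfunT := (measurable_fun setT).

(** * Elementary inequalities and null sequences *)

Lemma le_of_eq d (T : porderType d) (x y : T) : x = y -> (x <= y)%O.
Proof. by move->. Qed.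

Ltac meas_step := intros; first [ assumption | lazymatch goal with
  | |- measurable_fun _ (fun x => (_ + - _)%R) => apply: measurable_funB
  | |- measurable_fun _ (fun x => (_ + _)%R) => apply: measurable_funD
  | |- measurable_fun _ (fun x => (_ * _)%R) => apply: measurable_funM
  | |- measurable_fun _ (fun x => (_ ^+ _)%R) => apply: measurable_funX
  | |- measurable_fun _ (fun x => _%:E) => apply: (iffRL (measurable_EFinP _ _))
  | |- measurable_fun _ (fun x => (_ + _)%E) => apply: emeasurable_funD
  | |- measurable_fun _ (fun x => (_ * _)%E) => apply: emeasurable_funM
  | |- measurable_fun _ (fun x => x) => exact: measurable_id
  | |- measurable_fun _ fst => exact: measurable_fst
  | |- measurable_fun _ snd => exact: measurable_snd
  | |- measurable_fun _ (fun x => x.1) => exact: measurable_fst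
  | |- measurable_fun _ (fun x => x.2) => exact: measurable_snd
  | |- measurable_fun _ \1__ => apply: measurable_indic
  | |- measurable_fun _ (fun x => ?c) => exact: measurable_cst
  | |- measurable _ => exact: measurable_itv
  end
  | match goal with H : measurable_fun _ ?f |- measurable_fun _ (fun x => ?f _) =>
      apply: (measurableT_comp H) end
  | tryif match goal with |- measurable_fun ?D _ => unify D (@setT _) end
    then fail else apply: measurable_funTS
  | done ].

Ltac meas := by repeat meas_step.

Ltac pos_step := intros; first [ assumption | lazymatch goal with
  | |- is_true (Order.le _ ?x) => lazymatch x with
    | _%:E => rewrite lee_fin
    | (_ + _)%E => apply: adde_ge0
    | (_ * _)%E => apply: mule_ge0
    | integral _ _ _ => apply: integral_ge0
    | (_ + _)%R => apply: addr_ge0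
    | (_ * _)%R => apply: mulr_ge0
    | (_ ^+ 2)%R => exact: sqr_ge0
    | (_ ^+ _)%R => apply: exprn_ge0
    | (_^-1)%R => rewrite invr_ge0
    | Num.sqrt _ => exact: sqrtr_ge0
    | bigop _ _ _ => first [apply: sumr_ge0 | apply: sume_ge0]
    end
  | |- is_true (Order.lt _ ?x) => lazymatch x with
    | (_ * _)%R => apply: mulr_gt0
    | (_ ^+ _)%R => apply: exprn_gt0
    | (_^-1)%R => rewrite invr_gt0
    end
  end | exact: ltW | done ].

Ltac pos := by repeat pos_step.

(** The quadratic polynomial is evaluated at its minimum [t = - b / c]. If [c = 0] it is affine, and
    for [b != 0] it would take the value -1 at the point chosen below. *)
Lemma discriminant_le (R : realFieldType) (a b c : R) : 0 <= c ->
  (forall t, 0 <= a + 2 * t * b + t ^+ 2 * c) -> b ^+ 2 <= a * c.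
Proof.
move=> c0 H; have [c00|cN0] := eqVneq c 0.
  rewrite c00 mulr0; have [->|bN0] := eqVneq b 0; first by rewrite expr0n.
  have := H (- (a + 1) / (2 * b)); rewrite c00 mulr0 addr0.
  rewrite (_ : 2 * (- (a + 1) / (2 * b)) * b = - (a + 1)); last by field.
  by rewrite opprD addrA subrr sub0r ler0N1.
have cp : 0 < c by rewrite lt_neqAle eq_sym cN0.
have := H (- b / c).
rewrite (_ : a + _ + _ = a - b ^+ 2 / c); last by field.
by rewrite subr_ge0 ler_pdivrMr.
Qed.

(** Only an upper bound is asked for: on squared norms this is convergence to 0, and no topology on
    the vector spaces is involved. *)
Definition vanishing (R : realType) (s : nat -> R) :=
  forall e : R, 0 < e -> exists N, forall m, (N <= m)%N -> s m < e.

Lemma vanishing_le0 (R : realType) (s : nat -> R) (x : R) :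
  vanishing s -> (forall m, x <= s m) -> x <= 0.
Proof.
move=> s0 xs; rewrite leNgt; apply/negP => x0.
by have [N /(_ N (leqnn N))] := s0 _ x0; rewrite ltNge xs.
Qed.

Lemma vanishing_inv (R : realType) : vanishing (fun m => m.+1%:R^-1 : R).
Proof.
move=> e e0; have [k] := ltr_add_invr e0; rewrite add0r => ke.
exists k => m km; apply: le_lt_trans ke.
by rewrite lef_pV2 ?posrE// ler_nat ltnS.
Qed.

Lemma vanishingD (R : realType) (s t : nat -> R) :
  vanishing s -> vanishing t -> vanishing (fun m => s m + t m).
Proof.
move=> hs ht e e0; have e2 : 0 < e / 2 by rewrite divr_gt0.
have [N1 h1] := hs _ e2; have [N2 h2] := ht _ e2.
exists (maxn N1 N2) => m; rewrite geq_max => /andP[m1 m2].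
by rewrite [ltRHS]splitr ltrD// ?h1// h2.
Qed.

Lemma vanishing_le (R : realType) (s t : nat -> R) :
  (forall m, t m <= s m) -> vanishing s -> vanishing t.
Proof.
move=> ts hs e e0; have [N h] := hs _ e0.
by exists N => m /h; exact: le_lt_trans.
Qed.

Lemma vanishingZ (R : realType) (s : nat -> R) (c : R) : 0 <= c ->
  vanishing s -> vanishing (fun m => c * s m).
Proof.
move=> c0 hs e e0.
have ec : 0 < e / (c + 1) by rewrite divr_gt0// ltr_wpDl.
have [N h] := hs _ ec; exists N => m /h sm.
have c1 : 0 < c + 1 by rewrite ltr_wpDl.
have [s0|s0] := leP (s m) 0.
  by apply: le_lt_trans e0; rewrite mulr_ge0_le0.
apply: (@le_lt_trans _ _ ((c + 1) * s m)).
  by rewrite ler_pM2r// lerDl.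
by rewrite mulrC -ltr_pdivlMr.
Qed.

(** * Semi-inner products and the Riesz representation theorem *)

Section semi_inner_product.
Context {R : realType} {V : lmodType R}.
Variables (D : set V) (q : V -> V -> R).

(** The form may be degenerate and lives on a subspace [D]. The same results then serve functions
    before the passage to classes, form domains, and closures of ranges. *)
Record semi_ip := SemiIp {
  semi_ip_dom0 : D 0 ;
  semi_ip_dom : forall a x y, D x -> D y -> D (a *: x + y) ;
  semi_ip_linear : forall a x y z, D x -> D y -> D z ->
    q (a *: x + y) z = a * q x z + q y z ;
  semi_ip_sym : forall x y, D x -> D y -> q x y = q y x ;
  semi_ip_ge0 : forall x, D x -> 0 <= q x x }.

Definition semi_cauchy (u_ : nat -> V) := forall e : R, 0 < e ->
  exists N, forall m k, (N <= m)%N -> (N <= k)%N ->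
    q (u_ m - u_ k) (u_ m - u_ k) < e.

Definition semi_complete := forall u_, (forall k, D (u_ k)) ->
  semi_cauchy u_ ->
  exists2 u, D u & vanishing (fun m => q (u_ m - u) (u_ m - u)).

Hypothesis Q : semi_ip.

Let D0 := semi_ip_dom0 Q.
Let DL := semi_ip_dom Q.
Let qL := semi_ip_linear Q.
Let qC := semi_ip_sym Q.
Let q0 := semi_ip_ge0 Q.

Lemma semi_ipDD x y : D x -> D y -> D (x + y).
Proof. by move=> Dx Dy; rewrite -[x]scale1r; exact: DL. Qed.

Lemma semi_ipDZ a x : D x -> D (a *: x).
Proof. by move=> Dx; rewrite -[_ *: _]addr0; exact: DL. Qed.

Lemma semi_ipDN x : D x -> D (- x).
Proof. by move=> Dx; rewrite -scaleN1r; exact: semi_ipDZ. Qed.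

Lemma semi_ipDB x y : D x -> D y -> D (x - y).
Proof. by move=> Dx Dy; apply: semi_ipDD => //; exact: semi_ipDN. Qed.

Lemma semi_ipDl x y z : D x -> D y -> D z -> q (x + y) z = q x z + q y z.
Proof. by move=> *; rewrite -[x in LHS]scale1r qL// mul1r. Qed.

Lemma semi_ip0l z : D z -> q 0 z = 0.
Proof.
move=> Dz; apply: (@addrI _ (q 0 z)).
by rewrite -semi_ipDl// !addr0.
Qed.

Lemma semi_ipZl a x z : D x -> D z -> q (a *: x) z = a * q x z.
Proof. by move=> *; rewrite -[_ *: _]addr0 qL// semi_ip0l// addr0. Qed.

Lemma semi_ipNl x z : D x -> D z -> q (- x) z = - q x z.
Proof. by move=> *; rewrite -scaleN1r semi_ipZl// mulN1r. Qed.

Lemma semi_ipBl x y z : D x -> D y -> D z -> q (x - y) z = q x z - q y z.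
Proof. by move=> *; rewrite semi_ipDl ?semi_ipNl//; exact: semi_ipDN. Qed.

Lemma semi_ipZr a x z : D x -> D z -> q z (a *: x) = a * q z x.
Proof.
by move=> Dx Dz; rewrite qC ?semi_ipZl 1?[q x z]qC//; exact: semi_ipDZ.
Qed.

Lemma semi_ipDr x y z : D x -> D y -> D z -> q z (x + y) = q z x + q z y.
Proof.
by move=> *; rewrite qC ?semi_ipDl 1?[q x z]qC 1?[q y z]qC//; exact: semi_ipDD.
Qed.

Lemma semi_ipBr x y z : D x -> D y -> D z -> q z (x - y) = q z x - q z y.
Proof.
by move=> *; rewrite qC ?semi_ipBl 1?[q x z]qC 1?[q y z]qC//; exact: semi_ipDB.
Qed.

Lemma semi_ip_shift t x y : D x -> D y ->
  q (x + t *: y) (x + t *: y) = q x x + 2 * t * q x y + t ^+ 2 * q y y.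
Proof.
move=> Dx Dy; have Dty := semi_ipDZ t Dy.
have Ds := semi_ipDD Dx Dty.
rewrite semi_ipDl// !semi_ipDr// !semi_ipZl// !semi_ipZr// (qC Dy Dx).
by ring.
Qed.

Lemma semi_ip_CS x y : D x -> D y -> q x y ^+ 2 <= q x x * q y y.
Proof.
move=> Dx Dy; apply: discriminant_le => [|t]; first exact: q0.
by rewrite -semi_ip_shift// q0//; apply: semi_ipDD => //; exact: semi_ipDZ.
Qed.

(* The representative minimizes [q v v - 2 l v]; minimizing sequences are Cauchy
   by the parallelogram identity. *)
Theorem semi_riesz (l : V -> R) (M : R) : 0 <= M -> semi_complete ->
  (forall a x y, D x -> D y -> l (a *: x + y) = a * l x + l y) ->
  (forall x, D x -> l x ^+ 2 <= M * q x x) ->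
  exists2 u, D u & forall v, D v -> q u v = l v.
Proof.
move=> M0 cpl lL lM.
have l0 : l 0 = 0.
  by have := lL 1 0 0 D0 D0; rewrite scale1r addr0 mul1r => h; lra.
have lZ a x : D x -> l (a *: x) = a * l x.
  by move=> Dx; rewrite -[_ *: _]addr0 lL// l0 addr0.
have lD x y : D x -> D y -> l (x + y) = l x + l y.
  by move=> Dx Dy; rewrite -[x in LHS]scale1r lL// mul1r.
pose J v := q v v - 2 * l v.
pose S := [set J v | v in D].
have JM v : D v -> - M <= J v.
  move=> Dv; rewrite /J.
  have h3 := lM _ Dv; have h2 := q0 Dv.
  rewrite lerBrDr.
  (* Since [(l v)^2 <= M q v v], the inequality between geometric and arithmetic means bounds [J]
     from below. *)
  have : 2 * l v <= M + q v v.
    rewrite leNgt; apply/negP => h.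
    have : (M + q v v) ^+ 2 < (2 * l v) ^+ 2.
      by rewrite ltr_pXn2r// nnegrE ?addr_ge0// (le_trans _ (ltW h))// addr_ge0.
    have := sqr_ge0 (M - q v v); nra.
  by lra.
have Slb : has_lbound S by exists (- M) => _ [v Dv <-]; exact: JM.
have Sinf : has_inf S by split=> //; exists (J 0), 0.
pose m := inf S.
have mJ v : D v -> m <= J v by move=> Dv; apply: ge_inf => //; exists v.
have uex k : exists u, D u /\ J u < m + k.+1%:R^-1.
  have k0 : 0 < k.+1%:R^-1 :> R by rewrite invr_gt0.
  by have [_ [u Du <-] uk] := inf_adherent k0 Sinf; exists u.
have [u_ uP] := choice uex.
have Du k : D (u_ k) by have [] := uP k.
have par x y : D x -> D y -> q (x - y) (x - y) <= 2 * (J x - m) + 2 * (J y - m).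
  move=> Dx Dy; have Ds := semi_ipDD Dx Dy.
  have := mJ _ (semi_ipDZ 2^-1 Ds).
  rewrite /J lZ// lD// semi_ipZl ?semi_ipZr//; last exact: semi_ipDZ.
  rewrite !semi_ipBl ?semi_ipBr ?semi_ipDl ?semi_ipDr ?(qC Dy Dx)//; last exact: semi_ipDB.
  by move=> h; lra.
have [u Du' uu] : exists2 u, D u & vanishing (fun k => q (u_ k - u) (u_ k - u)).
  apply: cpl => // e e0.
  have e4 : 0 < e / 4 by rewrite divr_gt0.
  have [N hN] := vanishing_inv e4; exists N => i j /hN iN /hN jN.
  apply: le_lt_trans (par _ _ (Du i) (Du j)) _.
  have [_ h1] := uP i; have [_ h2] := uP j.
  move: iN jN h1 h2; move: (i.+1%:R^-1) (j.+1%:R^-1) => a b; lra.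
exists u => // v Dv.
pose c := q v v; have c0 : 0 <= c by exact: q0.
have key k : (q u v - l v) ^+ 2 <=
    2 * c * (k.+1%:R^-1 + q (u_ k - u) (u_ k - u)).
  (* An almost minimizer almost solves the Euler equation: [J (u_ k + t v) >= m] for all [t], and
     the discriminant of this quadratic polynomial bounds the defect. *)
  have h1 : (q (u_ k) v - l v) ^+ 2 <= (J (u_ k) - m) * c.
    apply: discriminant_le => // t; have Dt := semi_ipDZ t Dv.
    have := mJ _ (semi_ipDD (Du k) Dt).
    rewrite /J semi_ip_shift// lD// lZ// /c => h; lra.
  have h2 := semi_ip_CS (semi_ipDB (Du k) Du') Dv.
  rewrite semi_ipBl// in h2.
  have [_ h3] := uP k.
  have h4 : (J (u_ k) - m) * c <= k.+1%:R^-1 * c by rewrite ler_wpM2r// lerBlDl ltW.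
  rewrite -/c in h2.
  have := sqr_ge0 ((q (u_ k) v - l v) + (q (u_ k) v - q u v)).
  move: h1 h2 h4; move: (k.+1%:R^-1) (q (u_ k - u) (u_ k - u)) => s t; lra.
have : (q u v - l v) ^+ 2 <= 0.
  apply: (vanishing_le0 _ key); apply: vanishingZ; first by rewrite mulr_ge0.
  by apply: vanishingD => //; exact: vanishing_inv.
move=> h.
by apply/eqP; rewrite -subr_eq0 -sqrf_eq0 eq_le h sqr_ge0.
Qed.

End semi_inner_product.

(** * Symmetric operators on a real Hilbert space and their square roots *)

Record hilbert (R : realType) := Hilbert {
  hvec :> lmodType R ;
  hip : hvec -> hvec -> R ;
  hip_semi : semi_ip setT hip ;
  hip_def : forall x, hip x x = 0 -> x = 0 ;
  hip_complete : semi_complete setT hip }.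

Section hilbert_operators.
Context {R : realType} {H : hilbert R}.
Implicit Types (x y z u v w : H) (X Y W : H -> H).
Local Notation "<< x , y >>" := (hip x y) (at level 0, format "<< x ,  y >>").
Let Q := hip_semi H.

Lemma hipC x y : <<x, y>> = <<y, x>>. Proof. exact: (semi_ip_sym Q). Qed.
Lemma hipDl x y z : <<x + y, z>> = <<x, z>> + <<y, z>>.
Proof. exact: (semi_ipDl Q). Qed.
Lemma hipDr x y z : <<z, x + y>> = <<z, x>> + <<z, y>>.
Proof. exact: (semi_ipDr Q). Qed.
Lemma hipBl x y z : <<x - y, z>> = <<x, z>> - <<y, z>>.
Proof. exact: (semi_ipBl Q). Qed.
Lemma hipBr x y z : <<z, x - y>> = <<z, x>> - <<z, y>>.
Proof. exact: (semi_ipBr Q). Qed.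
Lemma hipZl a x z : <<a *: x, z>> = a * <<x, z>>.
Proof. exact: (semi_ipZl Q). Qed.
Lemma hipZr a x z : <<z, a *: x>> = a * <<z, x>>.
Proof. exact: (semi_ipZr Q). Qed.
Lemma hipNl x z : <<- x, z>> = - <<x, z>>.
Proof. exact: (semi_ipNl Q). Qed.
Lemma hipNr x z : <<z, - x>> = - <<z, x>>.
Proof. by rewrite hipC hipNl hipC. Qed.
Lemma hip0l z : <<0, z>> = 0. Proof. exact: (semi_ip0l Q). Qed.
Lemma hip0r z : <<z, 0>> = 0. Proof. by rewrite hipC hip0l. Qed.
Lemma hip_ge0 x : 0 <= <<x, x>>. Proof. exact: (semi_ip_ge0 Q). Qed.
Lemma hip_CS x y : <<x, y>> ^+ 2 <= <<x, x>> * <<y, y>>.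
Proof. exact: (semi_ip_CS Q). Qed.

Lemma hip_ext x y : (forall z, <<x, z>> = <<y, z>>) -> x = y.
Proof.
move=> xy; apply/eqP; rewrite -subr_eq0; apply/eqP/hip_def.
by rewrite hipBl xy subrr.
Qed.

(** A linear identity between vectors becomes a scalar identity, within reach of [ring], after
    pairing with an arbitrary vector. *)
Ltac vector_identity := apply: hip_ext => ?;
  rewrite !(hipDl, hipNl, hipZl, hip0l); ring.

Definition hnorm x := Num.sqrt <<x, x>>.

Lemma hnorm_ge0 x : 0 <= hnorm x. Proof. exact: sqrtr_ge0. Qed.

Lemma sqr_hnorm x : hnorm x ^+ 2 = <<x, x>>.
Proof. by rewrite sqr_sqrtr// hip_ge0. Qed.

Lemma hnorm0 : hnorm 0 = 0. Proof. by rewrite /hnorm hip0l sqrtr0. Qed.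

Lemma hnorm_eq0 x : hnorm x = 0 -> x = 0.
Proof. by move=> x0; apply: hip_def; rewrite -sqr_hnorm x0 expr0n. Qed.

Lemma hnormN x : hnorm (- x) = hnorm x.
Proof. by rewrite /hnorm hipNl hipNr opprK. Qed.

Lemma hnormB x y : hnorm (x - y) = hnorm (y - x).
Proof. by rewrite -hnormN opprB. Qed.

Lemma hnormZ a x : hnorm (a *: x) = `|a| * hnorm x.
Proof. by rewrite /hnorm hipZl hipZr mulrA -expr2 sqrtrM ?sqr_ge0// sqrtr_sqr. Qed.

Lemma ler_hip x y : <<x, y>> <= hnorm x * hnorm y.
Proof.
apply: le_trans (ler_norm _) _; rewrite -sqrtr_sqr -sqrtrM ?hip_ge0//.
by rewrite ler_wsqrtr// hip_CS.
Qed.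

Lemma ler_hnormD x y : hnorm (x + y) <= hnorm x + hnorm y.
Proof.
rewrite -(@ler_pXn2r _ 2) ?nnegrE ?addr_ge0 ?hnorm_ge0//.
rewrite sqr_hnorm hipDl !hipDr sqrrD !sqr_hnorm (hipC y x).
have := ler_hip x y; lra.
Qed.

Lemma hnorm_le_sqr x (c : R) : 0 <= c -> <<x, x>> <= c ^+ 2 -> hnorm x <= c.
Proof.
by move=> c0 xc; rewrite -(@ler_pXn2r _ 2) ?nnegrE ?hnorm_ge0// sqr_hnorm.
Qed.

Definition hcvg (u_ : nat -> H) u := vanishing (fun m => hnorm (u_ m - u)).

Lemma hnorm_complete (u_ : nat -> H) :
  (forall e : R, 0 < e -> exists N, forall m k, (N <= m)%N -> (N <= k)%N ->
    hnorm (u_ m - u_ k) < e) -> exists u, hcvg u_ u.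
Proof.
move=> cu; have [//|e e0|u _ uu] := @hip_complete _ H u_.
  have [|N hN] := cu (Num.sqrt e); first by rewrite sqrtr_gt0.
  exists N => m k mN kN; rewrite -sqr_hnorm -[ltRHS]sqr_sqrtr ?ltW//.
  by rewrite ltr_pXn2r// ?nnegrE ?hnorm_ge0 ?sqrtr_ge0//; exact: hN.
exists u => e e0; have [|N hN] := uu (e ^+ 2); first by rewrite exprn_gt0.
exists N => m /hN; rewrite -sqr_hnorm ltr_pXn2r// ?nnegrE ?hnorm_ge0//.
exact: ltW.
Qed.

Lemma hcvg_unique (u_ : nat -> H) u v : hcvg u_ u -> hcvg u_ v -> u = v.
Proof.
move=> uu uv; apply/eqP; rewrite -subr_eq0; apply/eqP/hnorm_eq0/le_anti.
rewrite hnorm_ge0 andbT; apply: vanishing_le0 (vanishingD uu uv) _ => m.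
rewrite -{1}(subrK (u_ m) u) -addrA (hnormB (u_ m) u).
by apply: le_trans (ler_hnormD _ _) _.
Qed.

Lemma hcvg_hip (u_ : nat -> H) u v (c : R) : hcvg u_ u -> (forall m, <<u_ m, v>> <= c) ->
  <<u, v>> <= c.
Proof.
move=> uu h; rewrite -subr_le0.
apply: (vanishing_le0 (vanishingZ (hnorm_ge0 v) uu)) => m.
apply: (@le_trans _ _ (<<u, v>> - <<u_ m, v>>)); first by rewrite lerB.
by rewrite -hipBl mulrC hnormB ler_hip.
Qed.

(** Wider than the symmetric operators: the commutation clause of the square root is also applied to
    the isometry [J], which is antisymmetric. *)
Definition additive_bounded W := (forall x y, W (x + y) = W x + W y) /\
  exists M : R, 0 <= M /\ forall x, hnorm (W x) <= M * hnorm x.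

Lemma additive_boundedB W x y : additive_bounded W -> W (x - y) = W x - W y.
Proof.
move=> [WD _]; apply: (@addIr _ (W y)); rewrite -WD !subrK.
by [].
Qed.

Lemma hcvg_additive_bounded W (u_ : nat -> H) u : additive_bounded W -> hcvg u_ u ->
  hcvg (fun m => W (u_ m)) (W u).
Proof.
move=> bW uu; have [_ [M [M0 WM]]] := bW.
apply: vanishing_le (vanishingZ M0 uu) => m.
by rewrite -additive_boundedB.
Qed.

Definition symmetric_op X := forall x y, <<X x, y>> = <<x, X y>>.

(** Symmetry of an everywhere defined map forces linearity, because it moves the map to the other
    factor of the inner product. *)
Lemma symmetric_op_linear X a x y : symmetric_op X ->
  X (a *: x + y) = a *: X x + X y.
Proof.
move=> sX; apply: hip_ext => z.
by rewrite sX !hipDl !hipZl !sX.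
Qed.

Lemma symmetric_opD X x y : symmetric_op X -> X (x + y) = X x + X y.
Proof.
by move=> sX; rewrite -[x in LHS]scale1r symmetric_op_linear// scale1r.
Qed.

Lemma symmetric_op0 X : symmetric_op X -> X 0 = 0.
Proof. by move=> sX; apply: hip_ext => z; rewrite sX !hip0l. Qed.

Lemma symmetric_opZ X a x : symmetric_op X -> X (a *: x) = a *: X x.
Proof.
by move=> sX; rewrite -[_ *: x]addr0 symmetric_op_linear// symmetric_op0// addr0.
Qed.

Lemma symmetric_opB X x y : symmetric_op X -> X (x - y) = X x - X y.
Proof.
by move=> sX; rewrite symmetric_opD// -scaleN1r symmetric_opZ// scaleN1r.
Qed.

Record pcontr X := PContr {
  pcontr_sym : symmetric_op X ;
  pcontr_ge0 : forall x, 0 <= <<X x, x>> ;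
  pcontr_le : forall x, <<X x, x>> <= <<x, x>> }.

Lemma psd_CS X x y : symmetric_op X -> (forall x, 0 <= <<X x, x>>) ->
  <<X x, y>> ^+ 2 <= <<X x, x>> * <<X y, y>>.
Proof.
move=> sX X0.
have S : semi_ip setT (fun x y => <<X x, y>>).
  split=> // [a {}x {}y z _ _ _|{}x {}y _ _].
    by rewrite symmetric_op_linear// hipDl hipZl.
  by rewrite sX hipC.
exact: (semi_ip_CS S).
Qed.

(** Cauchy-Schwarz for the form [<<X x, y>>] at [y = X x], where [<<X y, y>> <= <<y, y>>]. *)
Lemma pcontr_sqr X x : pcontr X -> <<X x, X x>> <= <<X x, x>>.
Proof.
move=> pX; have := psd_CS x (X x) (pcontr_sym pX) (pcontr_ge0 pX).
have := pcontr_le pX (X x); have := pcontr_ge0 pX x.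
have := pcontr_ge0 pX (X x); have := hip_ge0 (X x).
set a := <<X x, X x>>; set b := <<X x, x>>; set c := <<X (X x), X x>>.
move=> a0 c0 b0 ca ab.
have [a00|aN] := eqVneq a 0; first by rewrite a00.
have ap : 0 < a by rewrite lt_neqAle eq_sym aN.
by rewrite -(ler_pM2r ap); nra.
Qed.

Lemma pcontr_hnorm X x : pcontr X -> hnorm (X x) <= hnorm x.
Proof.
move=> pX; apply: hnorm_le_sqr; rewrite ?hnorm_ge0// sqr_hnorm.
exact: le_trans (pcontr_sqr _ pX) (pcontr_le pX _).
Qed.

Lemma pcontr_additive_bounded X : pcontr X -> additive_bounded X.
Proof.
move=> pX; split=> [x y|]; first exact/symmetric_opD/pcontr_sym.
by exists 1; split=> // x; rewrite mul1r pcontr_hnorm.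
Qed.

Lemma pcontr_eq0 X x : pcontr X -> <<X x, x>> = 0 -> X x = 0.
Proof.
move=> pX X0; apply: hip_def; apply/eqP; rewrite eq_le hip_ge0 andbT -X0.
exact: pcontr_sqr.
Qed.

Lemma pcontr_onem X : pcontr X -> pcontr (fun x => x - X x).
Proof.
move=> pX; split=> [x y|x|x].
- by rewrite hipBl hipBr (pcontr_sym pX).
- by rewrite hipBl subr_ge0 pcontr_le.
- by rewrite hipBl gerBl pcontr_ge0.
Qed.

Definition commute X W := forall x, X (W x) = W (X x).

Section square_root_iteration.
Variables (X : H -> H) (pX : pcontr X).

Let Z x := x - X x.
Let pZ : pcontr Z. Proof. exact: pcontr_onem. Qed.

(** A fixed point [P = (Z + P^2) / 2] with [Z = 1 - X] satisfies [(1 - P)^2 = 1 - Z = X]. The root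
    is sought as [1 - P], with the iteration for [P] started at 0. *)
Fixpoint root_iter n : H -> H := if n is k.+1
  then fun x => 2^-1 *: (Z x + root_iter k (root_iter k x)) else fun=> 0.

(** The scalar iteration for [Z = 1]. It majorizes the operator iteration, so monotone convergence
    of a real sequence is all that is used. *)
Fixpoint root_bound n : R := if n is k.+1
  then 2^-1 * (1 + root_bound k ^+ 2) else 0.

Lemma root_bound_ge0 n : 0 <= root_bound n.
Proof.
by case: n => //= k; rewrite mulr_ge0 ?invr_ge0// addr_ge0// sqr_ge0.
Qed.

Lemma root_bound_le1 n : root_bound n <= 1.
Proof.
elim: n => [|k ih] //=; have := root_bound_ge0 k; nra.
Qed.

Lemma root_bound_leS n : root_bound n <= root_bound n.+1.
Proof. by have /= := sqr_ge0 (1 - root_bound n); lra. Qed.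

Lemma root_bound_homo m n : (m <= n)%N -> root_bound m <= root_bound n.
Proof.
by move: m n; apply/nondecreasing_seqP/root_bound_leS.
Qed.

Lemma root_iter_sym n : symmetric_op (root_iter n).
Proof.
elim: n => [x y|k ih x y] /=; first by rewrite hip0l hip0r.
by rewrite hipZl hipZr hipDl hipDr (pcontr_sym pZ) !ih.
Qed.

Lemma root_iter_commute W : additive_bounded W -> commute X W ->
  (forall x, W (2^-1 *: x) = 2^-1 *: W x) -> forall n, commute (root_iter n) W.
Proof.
move=> bW XW WZ; have [WD _] := bW.
elim=> [|k ih] x /=.
  by apply: (@addrI _ (W 0)); rewrite -WD !addr0.
by rewrite WZ WD /Z XW additive_boundedB// !ih.
Qed.

Lemma root_iter_le n x : hnorm (root_iter n x) <= root_bound n * hnorm x.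
Proof.
elim: n x => [|k ih] x /=; first by rewrite hnorm0 mul0r.
rewrite hnormZ ger0_norm ?invr_ge0// -mulrA ler_pM2l ?invr_gt0//.
apply: le_trans (ler_hnormD _ _) _; rewrite mulrDl mul1r.
apply: lerD; first exact: pcontr_hnorm.
apply: le_trans (ih _) _; rewrite expr2 -mulrA.
by rewrite ler_wpM2l// root_bound_ge0.
Qed.

Lemma root_iter_comm m n : commute (root_iter m) (root_iter n).
Proof.
have XW k : commute X (root_iter k).
  elim: k => [|k ih] x /=; first by rewrite (symmetric_op0 (pcontr_sym pX)).
  rewrite (symmetric_opZ _ _ (pcontr_sym pX)) (symmetric_opD _ _ (pcontr_sym pX)).
  by rewrite !ih /Z (symmetric_opB _ _ (pcontr_sym pX)).
apply: root_iter_commute => //; last first.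
  by move=> x; rewrite (symmetric_opZ _ _ (@root_iter_sym n)).
split=> [x y|]; first exact/symmetric_opD/root_iter_sym.
exists (root_bound n); split; first exact: root_bound_ge0.
exact: root_iter_le.
Qed.

(** The iterates commute, so the difference of consecutive steps factors as [(A - B) (A + B) / 2].
    The bounds satisfy the same identity [(a - b) (a + b) / 2], and the induction hypothesis is
    applied to the vector [A x + B x]. *)
Lemma root_iter_sub m n x : (m <= n)%N ->
  hnorm (root_iter n x - root_iter m x) <= (root_bound n - root_bound m) * hnorm x.
Proof.
elim: m n x => [|m ih] n x mn /=.
  by rewrite !subr0 root_iter_le.
case: n mn => // n; rewrite ltnS => mn /=.
set A := root_iter n; set B := root_iter m.
rewrite -scalerBr opprD addrACA subrr add0r.
rewrite (_ : A (A x) - B (B x) = A (A x + B x) - B (A x + B x)); last first.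
  rewrite /A /B !(symmetric_opD _ _ (root_iter_sym _)) (root_iter_comm m n x).
  by vector_identity.
rewrite hnormZ ger0_norm ?invr_ge0// -mulrBr -mulrA ler_pM2l ?invr_gt0//.
apply: le_trans (ih _ _ mn) _.
rewrite opprD addrACA subrr add0r subr_sqr -mulrA.
rewrite ler_wpM2l ?subr_ge0 ?root_bound_homo//.
apply: le_trans (ler_hnormD _ _) _.
by rewrite mulrDl lerD// root_iter_le.
Qed.

Lemma root_iter_cvg x : exists y, hcvg (fun n => root_iter n x) y.
Proof.
apply: hnorm_complete => e e0.
have rc : cvgn root_bound.
  apply: nondecreasing_is_cvgn; first exact/nondecreasing_seqP/root_bound_leS.
  by exists 1 => _ [n _ <-]; exact: root_bound_le1.
have h1 : 0 < hnorm x + 1 by rewrite ltr_wpDl// hnorm_ge0.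
have e1 : 0 < e / (hnorm x + 1) by rewrite divr_gt0.
have [N _ hN] := (cvgrPdist_lt _ _).1 rc _ e1.
have bl n : root_bound n <= limn root_bound.
  by apply: nondecreasing_cvgn_le => //; exact/nondecreasing_seqP/root_bound_leS.
have key m k : (N <= m)%N -> (m <= k)%N ->
    hnorm (root_iter k x - root_iter m x) < e.
  move=> Nm mk; apply: le_lt_trans (root_iter_sub x mk) _.
  apply: (@le_lt_trans _ _ ((limn root_bound - root_bound m) * (hnorm x + 1))).
    rewrite ler_pM ?subr_ge0 ?root_bound_homo ?hnorm_ge0//; last by rewrite lerDl.
    by rewrite lerB.
  rewrite -ltr_pdivlMr//; apply: le_lt_trans (ler_norm _) _.
  exact: hN.
exists N => m k Nm Nk; have [km|mk] := leqP k m; first exact: key.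
by rewrite hnormB; apply: key => //; exact: ltnW.
Qed.

(** The root is [1 - P] with [P] the strong limit of the iteration. Each iterate is a polynomial in
    [X], hence commutes with every bounded [W] that commutes with [X], and this passes to the
    limit. *)
Theorem pcontr_sqrt : exists Y, [/\ pcontr Y, forall x, Y (Y x) = X x &
  forall W, additive_bounded W -> (forall a x, W (a *: x) = a *: W x) ->
    commute X W -> commute Y W].
Proof.
have [P Pcvg] := choice root_iter_cvg.
have Psym : symmetric_op P.
  move=> x y; apply/eqP; rewrite -subr_eq0 -normr_le0.
  have := vanishingD (vanishingZ (hnorm_ge0 y) (Pcvg x)) (vanishingZ (hnorm_ge0 x) (Pcvg y)).
  move=> h; apply: (vanishing_le0 h) => m.
  have -> : <<P x, y>> - <<x, P y>> =
     <<P x - root_iter m x, y>> - <<x, P y - root_iter m y>>.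
    by rewrite hipBl hipBr root_iter_sym; ring.
  have tr (a b : R) c d : `|a| <= c -> `|b| <= d -> `|a - b| <= c + d.
    by move=> ac bd; apply: le_trans (ler_normB _ _) _; exact: lerD.
  have nip u v : `|<<u, v>>| <= hnorm u * hnorm v.
    by rewrite ler_norml ler_hip andbT -hnormN lerNl -hipNl ler_hip.
  apply: tr; first by rewrite mulrC hnormB nip.
  by rewrite (hnormB _ (P y)) nip.
have Ple x : hnorm (P x) <= hnorm x.
  rewrite -subr_le0; apply: (vanishing_le0 (Pcvg x)) => m.
  rewrite hnormB lerBlDr.
  apply: (@le_trans _ _ (hnorm (P x - root_iter m x) + hnorm (root_iter m x))).
    by rewrite -[X in hnorm X](subrK (root_iter m x)) ler_hnormD.
  rewrite lerD2l; apply: le_trans (root_iter_le _ _) _.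
  by rewrite ler_piMl ?hnorm_ge0 ?root_bound_le1.
have PZ x : P x = 2^-1 *: (Z x + P (P x)).
  apply: (@hcvg_unique (fun m => root_iter m.+1 x)).
    by move=> e /(Pcvg x)[N hN]; exists N => m Nm; apply: hN; exact: leqW.
  have h := vanishingD (Pcvg x) (Pcvg (P x)).
  apply: vanishing_le h => m /=.
  rewrite -scalerBr opprD addrACA subrr add0r hnormZ ger0_norm ?invr_ge0//.
  have -> : root_iter m (root_iter m x) - P (P x) =
     root_iter m (root_iter m x - P x) + (root_iter m (P x) - P (P x)).
    by rewrite (symmetric_opB _ _ (@root_iter_sym m)) addrA subrK.
  apply: (@le_trans _ _ (hnorm (root_iter m (root_iter m x - P x) + (root_iter m (P x) - P (P x))))).
    by rewrite ler_piMl ?hnorm_ge0// invf_le1 ?ler1n.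
  apply: le_trans (ler_hnormD _ _) _; rewrite lerD2r.
  apply: le_trans (root_iter_le _ _) _.
  by rewrite ler_piMl ?hnorm_ge0 ?root_bound_le1.
(* At each step [2 <<root_iter m.+1 x, x>>] equals [<<Z x, x>> + |root_iter m x|^2]. *)
have P0 x : 0 <= <<P x, x>>.
  rewrite -oppr_le0 -hipNr; apply: (hcvg_hip (Pcvg x)) => m.
  rewrite hipNr oppr_le0; case: m => [|m] /=; first by rewrite hip0l.
  rewrite hipZl mulr_ge0 ?invr_ge0// hipDl addr_ge0 ?(pcontr_ge0 pZ)//.
  by rewrite root_iter_sym hip_ge0.
have Pp : pcontr P.
  split=> // x; apply: le_trans (ler_hip _ _) _.
  by rewrite -sqr_hnorm expr2 ler_wpM2r ?hnorm_ge0.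
exists (fun x => x - P x); split; first exact: pcontr_onem.
- move=> x; rewrite symmetric_opB//.
  have h : P (P x) = 2%:R *: P x - x + X x.
    have := congr1 (fun z => 2%:R *: z) (PZ x).
    rewrite scalerA divff ?pnatr_eq0// scale1r => ->.
    by rewrite /Z; vector_identity.
  by rewrite h; vector_identity.
- move=> W bW WZ XW x; rewrite additive_boundedB//; congr (_ - _).
  apply: (@hcvg_unique (fun m => root_iter m (W x))); first exact: Pcvg.
  have h := hcvg_additive_bounded bW (Pcvg x).
  by apply: vanishing_le h => m; rewrite root_iter_commute.
Qed.

End square_root_iteration.

(** For commuting roots and [d = X z - Y z], one has [(X + Y) d = 0], so [X d = Y d = 0] by
    positivity and [|d|^2 = <<z, X d - Y d>> = 0]. In general both roots commute with their common
    square, hence with the root of it constructed by iteration, and both equal that one. *)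
Lemma pcontr_sqrt_unique X Y : pcontr X -> pcontr Y ->
  (forall x, X (X x) = Y (Y x)) -> X = Y.
Proof.
have aux X1 Y1 : pcontr X1 -> pcontr Y1 -> commute X1 Y1 ->
    (forall x, X1 (X1 x) = Y1 (Y1 x)) -> X1 = Y1.
  move=> pX pY c XY; apply/funext => z.
  pose d := X1 z - Y1 z.
  have h : <<X1 d, d>> + <<Y1 d, d>> = 0.
    rewrite -hipDl (_ : X1 d + Y1 d = 0) ?hip0l// /d.
    rewrite (symmetric_opB _ _ (pcontr_sym pX)) (symmetric_opB _ _ (pcontr_sym pY)).
    by rewrite c XY addrA subrK subrr.
  have hX := pcontr_ge0 pX d; have hY := pcontr_ge0 pY d.
  have X0 : X1 d = 0 by apply: pcontr_eq0 => //; lra.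
  have Y0 : Y1 d = 0 by apply: pcontr_eq0 => //; lra.
  apply/eqP; rewrite -subr_eq0 -/d; apply/eqP/hip_def.
  by rewrite {1}/d hipBl (pcontr_sym pX) (pcontr_sym pY) X0 Y0 subrr.
move=> pX pY XY.
have pX2 : pcontr (fun x => X (X x)).
  split=> [x y|x|x]; first by rewrite !(pcontr_sym pX).
    by rewrite (pcontr_sym pX) hip_ge0.
  rewrite (pcontr_sym pX).
  exact: le_trans (pcontr_sqr _ pX) (pcontr_le pX _).
have [S [pS SS Sc]] := pcontr_sqrt pX2.
have cS W : pcontr W -> (forall x, W (W x) = X (X x)) -> W = S.
  move=> pW WX; apply: aux => //; last by move=> x; rewrite SS.
  move=> x; rewrite Sc//; first exact: pcontr_additive_bounded.
    by move=> a y; exact/symmetric_opZ/pcontr_sym.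
  by move=> y; rewrite -!WX.
by rewrite (cS X)// (cS Y).
Qed.

(** With [K] the root of [Y], which commutes with [X], the quadratic form of the product is
    [<<X (K x), K x>>]. *)
Lemma pcontr_mul X Y : pcontr X -> pcontr Y -> commute X Y ->
  pcontr (fun x => X (Y x)).
Proof.
move=> pX pY c; have [K [pK KK Kc]] := pcontr_sqrt pY.
have KX : commute K X.
  apply: Kc; [exact: pcontr_additive_bounded| |by move=> x; rewrite c].
  by move=> a x; exact/symmetric_opZ/pcontr_sym.
have E x : <<X (Y x), x>> = <<X (K x), K x>>.
  by rewrite -KK -KX (pcontr_sym pK).
split=> [x y|x|x].
- by rewrite (pcontr_sym pX) (pcontr_sym pY) c.
- by rewrite E pcontr_ge0.
- rewrite E; apply: le_trans (pcontr_le pX _) _.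
  by rewrite (pcontr_sym pK) KK hipC pcontr_le.
Qed.

(** * Self-adjoint relations and their nonnegative roots *)

Definition relation_sa (G : H -> H -> Prop) := forall v x,
  G v x <-> forall u w, G u w -> <<v, w>> = <<x, u>>.

Definition relation_nonneg (G : H -> H -> Prop) :=
  forall u w, G u w -> 0 <= <<u, w>>.

Definition relation_comp (G S : H -> H -> Prop) u w :=
  exists v, G u v /\ S v w.

Section relation_theory.
Variable G : H -> H -> Prop.
Hypothesis saG : relation_sa G.

Lemma relation_sa_ip u w u' w' : G u w -> G u' w' -> <<u, w'>> = <<w, u'>>.
Proof. by move=> /saG h; exact: h. Qed.

(** A relation that equals its adjoint is an orthogonal complement, hence a closed subspace. Density
    of the domain is kept apart, in [relation_dense]. *)
Lemma relation_sa_linear a u w u' w' : G u w -> G u' w' ->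
  G (a *: u + u') (a *: w + w').
Proof.
move=> Gu Gu'; apply/saG => v x Gv; rewrite !hipDl !hipZl.
by rewrite (relation_sa_ip Gu Gv) (relation_sa_ip Gu' Gv).
Qed.

Lemma relation_sa0 : G 0 0.
Proof. by apply/saG => v x Gv; rewrite !hip0l. Qed.

Lemma relation_saB u w u' w' : G u w -> G u' w' -> G (u - u') (w - w').
Proof.
move=> Gu Gu'; rewrite [u - u']addrC [w - w']addrC -[- u']scaleN1r -[- w']scaleN1r.
exact: relation_sa_linear.
Qed.

Lemma relation_sa_closed (u_ w_ : nat -> H) u w : (forall m, G (u_ m) (w_ m)) ->
  hcvg u_ u -> hcvg w_ w -> G u w.
Proof.
move=> Guw uu ww; apply/saG => v x Gv.
have le (u1_ w1_ : nat -> H) u1 w1 v1 x1 : hcvg u1_ u1 -> hcvg w1_ w1 ->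
    (forall m, <<u1_ m, x1>> = <<w1_ m, v1>>) -> <<u1, x1>> - <<w1, v1>> <= 0.
  move=> uu1 ww1 h.
  apply: (vanishing_le0 (vanishingD (vanishingZ (hnorm_ge0 x1) uu1)
     (vanishingZ (hnorm_ge0 v1) ww1))) => m.
  have -> : <<u1, x1>> - <<w1, v1>> =
      <<u1 - u1_ m, x1>> + <<w1_ m - w1, v1>> by rewrite !hipBl h; ring.
  by rewrite lerD// mulrC ?(hnormB (u1_ m)) ler_hip.
have E m : <<u_ m, x>> = <<w_ m, v>> by exact: relation_sa_ip.
apply/le_anti; rewrite -subr_le0 (le _ _ _ _ _ _ uu ww E)/= -subr_le0.
by apply: (le _ _ _ _ _ _ ww uu) => m.
Qed.

Hypothesis G0 : relation_nonneg G.

Lemma relation_sum_norm u w : G u w ->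
  <<u, u>> + <<w, w>> <= <<u + w, u + w>>.
Proof.
move=> /G0; rewrite !hipDl !hipDr (hipC w u); lra.
Qed.

(* The range of [1 + G] is closed, and its orthogonal complement [y] satisfies
   [G y (- y)]. *)
Lemma relation_resolvent_ex z : exists u, G u (z - u).
Proof.
pose M := [set m | exists u w, G u w /\ m = u + w].
have M0 : M 0 by exists 0, 0; split; [exact: relation_sa0|rewrite addr0].
have S : semi_ip M (@hip R H).
  split=> // [a _ _ [u [w [Gu ->]]] [u' [w' [Gu' ->]]]|a x y y' *|x y *|x _].
  - exists (a *: u + u'), (a *: w + w'); split; first exact: relation_sa_linear.
    by rewrite scalerDr addrACA.
  - by rewrite hipDl hipZl.
  - exact: hipC.
  - exact: hip_ge0.
have cM : semi_complete M (@hip R H).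
  move=> m_ Mm cm.
  have [u_ hu] := choice (fun k => Mm k).
  have [w_ hw] := choice hu.
  have E k : m_ k = u_ k + w_ k by have [] := hw k.
  have Guw k : G (u_ k) (w_ k) by have [] := hw k.
  have sub (e : R) (i k : nat) : 0 < e -> <<m_ i - m_ k, m_ i - m_ k>> < e ^+ 2 ->
      hnorm (u_ i - u_ k) < e /\ hnorm (w_ i - w_ k) < e.
    move=> e0; have := relation_sum_norm (relation_saB (Guw i) (Guw k)).
    rewrite (_ : _ + (w_ i - w_ k) = m_ i - m_ k); last first.
      by rewrite !E opprD addrACA.
    have := hip_ge0 (u_ i - u_ k); have := hip_ge0 (w_ i - w_ k).
    rewrite -(ltr_pXn2r (_ : (0 < 2)%N) (hnorm_ge0 _) (ltW e0)) ?sqr_hnorm//.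
    rewrite -(ltr_pXn2r (_ : (0 < 2)%N) (hnorm_ge0 (w_ i - w_ k)) (ltW e0)) ?sqr_hnorm//.
    by move=> h1 h2 h3 h4; split; lra.
  have [u uu] : exists u, hcvg u_ u.
    apply: hnorm_complete => e e0; have [|N hN] := cm (e ^+ 2).
      by rewrite exprn_gt0.
    by exists N => i k iN kN; have [] := sub _ _ _ e0 (hN i k iN kN).
  have [w ww] : exists w, hcvg w_ w.
    apply: hnorm_complete => e e0; have [|N hN] := cm (e ^+ 2).
      by rewrite exprn_gt0.
    by exists N => i k iN kN; have [] := sub _ _ _ e0 (hN i k iN kN).
  exists (u + w); first by exists u, w; split=> //; exact: (relation_sa_closed Guw).
  have h := vanishingD uu ww.
  move=> e e0; have [|N hN] := h (Num.sqrt e); first by rewrite sqrtr_gt0.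
  exists N => k /hN; rewrite E => hk.
  rewrite -sqr_hnorm -(sqr_sqrtr (ltW e0)) ltr_pXn2r ?nnegrE ?hnorm_ge0 ?sqrtr_ge0//.
  apply: le_lt_trans hk; rewrite opprD addrACA; exact: ler_hnormD.
have [m [u [w [Guw mE]]] mP] := @semi_riesz _ _ _ _ S (hip z) <<z, z>> (hip_ge0 z) cM
  (fun a x y _ _ => etrans (hipDr _ _ _) (congr1 (+%R^~ _) (hipZr _ _ _)))
  (fun x _ => hip_CS z x).
have y0 : G (z - m) (- (z - m)).
  apply/saG => u' w' Guw'.
  have : <<z - m, u' + w'>> = 0.
    by rewrite hipBl mP ?subrr//; exists u', w'.
  by rewrite hipDr hipNl; lra.
have /eqP : <<z - m, z - m>> = 0.
  have := G0 y0; rewrite hipNr; have := hip_ge0 (z - m); lra.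
move=> /eqP/hip_def/eqP; rewrite subr_eq0 => /eqP zm.
by exists u; rewrite zm mE addrC addKr.
Qed.

Lemma relation_resolvent_unique z u u' : G u (z - u) -> G u' (z - u') -> u = u'.
Proof.
move=> Gu Gu'; have := relation_sum_norm (relation_saB Gu Gu').
rewrite (_ : _ + (_ - _) = 0); last by vector_identity.
rewrite hip0l => h; apply/eqP; rewrite -subr_eq0; apply/eqP/hip_def.
have := hip_ge0 (u - u'); have := hip_ge0 (z - u - (z - u')); lra.
Qed.

(** The sum [z = u + w] parametrizes the graph, and [b = (1 + G)^-1] recovers [u]. Nonnegativity of
    [G] places [b] between 0 and 1. *)
Lemma relation_resolvent : exists b, pcontr b /\
  forall u w, G u w <-> exists z, u = b z /\ w = z - b z.
Proof.
have [b bP] := choice relation_resolvent_ex.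
have bip z y : <<b z, y>> = <<b z, b y>> + <<b z, y - b y>>.
  by rewrite -hipDr addrC subrK.
exists b; split.
  split=> [z y|z|z].
  - rewrite bip (relation_sa_ip (bP z) (bP y)) -hipDl.
    by rewrite addrC subrK.
  - by rewrite bip addr_ge0 ?hip_ge0// G0.
  - rewrite -subr_ge0 -hipBl.
    rewrite (_ : <<z - b z, z>> = <<z - b z, b z>> + <<z - b z, z - b z>>).
      by rewrite addr_ge0 ?hip_ge0// hipC G0.
    by rewrite -hipDr [X in _ = <<_, X>>]addrC subrK.
move=> u w; split=> [Gu|[z [-> ->]]]; last exact: bP.
exists (u + w).
have -> : b (u + w) = u.
  by apply: (relation_resolvent_unique (bP _)); rewrite addrC addKr.
by split=> //; rewrite addrC addKr.
Qed.

End relation_theory.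

(** Riesz representation for the form [<<X x, y>>], which is complete because it is equivalent to
    the inner product. It inverts the operator [E >= 1/2] below. *)
Lemma coercive_surjective X : symmetric_op X ->
  (forall x, <<x, x>> <= 2 * <<X x, x>>) -> (forall x, <<X x, x>> <= <<x, x>>) ->
  forall z, exists y, X y = z.
Proof.
move=> sX Xge Xle z.
have S : semi_ip setT (fun x y => <<X x, y>>).
  split=> // [a x y y' *|x y *|x _].
  - by rewrite symmetric_op_linear// hipDl hipZl.
  - by rewrite sX hipC.
  - by have := Xge x; have := hip_ge0 x; lra.
have cX : semi_complete setT (fun x y => <<X x, y>>).
  move=> u_ _ cu.
  have [||u _ uu] := @hip_complete _ H u_ => //.
    move=> e e0; have [|N hN] := cu (e / 2); first by rewrite divr_gt0.
    exists N => m k mN kN; have := hN m k mN kN; have := Xge (u_ m - u_ k); lra.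
  by exists u => //; apply: vanishing_le uu => m.
have [|||y _ yP] := @semi_riesz _ _ _ _ S (hip z) (2 * <<z, z>>) _ cX.
- by rewrite mulr_ge0// hip_ge0.
- by move=> a x y _ _; rewrite hipDr hipZr.
- move=> x _; apply: le_trans (hip_CS z x) _.
  by have := Xge x; have := hip_ge0 z; nra.
by exists y; apply: hip_ext => v; exact: yP.
Qed.

(* With [b = (1 + G)^-1] and [E = b^2 + (1 - b)^2 >= 1/2], the operator
   [r = b^2 E^-1 = (1 + G^2)^-1] depends on [G^2] only, and
   [b = sqrt r sqrt E], [1 - b = sqrt (1 - r) sqrt E]. *)
Lemma relation_root_canonical G : relation_sa G -> relation_nonneg G ->
  exists r, [/\ pcontr r, forall z, relation_comp G G (r z) (z - r z) &
    forall k l, pcontr k -> pcontr l -> (forall z, k (k z) = r z) ->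
      (forall z, l (l z) = z - r z) ->
      forall u w, G u w <-> exists z, u = k z /\ w = l z].
Proof.
move=> saG G0; have [b [pb Gb]] := relation_resolvent saG G0.
have [c [cE pc]] : exists c, (forall z, c z = z - b z) /\ pcontr c.
  by exists (fun z => z - b z); split=> //; exact: pcontr_onem.
have [E Edef] : exists E, forall z, E z = b (b z) + c (c z) by eexists.
have bB := symmetric_opB _ _ (pcontr_sym pb).
have bZ := symmetric_opZ _ _ (pcontr_sym pb).
have sE : symmetric_op E.
  by move=> x y; rewrite !Edef !hipDl !hipDr !(pcontr_sym pb) !(pcontr_sym pc).
have bc : commute b c by move=> x; rewrite !cE bB.
have EE x : E x = x - 2 *: b (c x).
  by rewrite Edef !cE !bB; vector_identity.
have pbc : pcontr (fun x => b (c x)) by exact: pcontr_mul.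
have Ele x : <<E x, x>> <= <<x, x>>.
  by rewrite EE hipBl hipZl; have := pcontr_ge0 pbc x; lra.
(* From [b + c = 1] follows [2 E = 2 b^2 + 2 c^2 = 1 + (b - c)^2]. *)
have Ege x : <<x, x>> <= 2 * <<E x, x>>.
  have <- : <<b x - c x, b x - c x>> + <<x, x>> = 2 * <<E x, x>>.
    have -> : <<E x, x>> = <<b x, b x>> + <<c x, c x>>.
      by rewrite Edef hipDl (pcontr_sym pb) (pcontr_sym pc).
    by rewrite !cE !(hipBl, hipBr) (hipC x (b x)); ring.
  by rewrite lerDr hip_ge0.
have pE : pcontr E.
  by split=> // x; have := Ege x; have := hip_ge0 x; lra.
have Esurj := coercive_surjective sE Ege Ele.
have [F EF] := choice Esurj.
have Einj x y : E x = E y -> x = y.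
  move=> xy; apply/eqP; rewrite -subr_eq0; apply/eqP/hip_def.
  have := Ege (x - y); rewrite (symmetric_opB _ _ sE) xy subrr hip0l mulr0.
  have := hip_ge0 (x - y); lra.
have FE x : F (E x) = x by apply: Einj.
have bE : commute b E by move=> x; rewrite !EE bB bZ bc.
have bF : commute b F by move=> x; apply: Einj; rewrite -bE !EF.
pose r z := b (b (F z)).
have rE z : r (E z) = b (b z) by rewrite /r FE.
have crE z : E z - r (E z) = c (c z) by rewrite rE Edef addrC addKr.
have sF : symmetric_op F.
  by move=> x y; rewrite -{1}(EF y) -sE EF.
have pr : pcontr r.
  split=> [x y|x|x].
  - by rewrite /r !(pcontr_sym pb) sF -!bF.
  - have [y <-] := Esurj x; rewrite rE Edef hipDr addr_ge0 ?hip_ge0//.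
    by rewrite (pcontr_sym pb) bc -(pcontr_sym pc) -bc hip_ge0.
  - have [y <-] := Esurj x; rewrite -subr_ge0 -hipBl crE Edef hipDr addr_ge0 ?hip_ge0//.
    by rewrite hipC (pcontr_sym pb) bc -(pcontr_sym pc) -bc hip_ge0.
exists r; split => // [z|k l pk pl kk ll u w].
  have [y <-] := Esurj z; rewrite crE rE; exists (b (c y)); split.
    by apply/Gb; exists (b y); split=> //; rewrite bc.
  by apply/Gb; exists (c y).
(* By uniqueness [k] and [l] are the roots constructed by iteration, so they inherit the commutation
   with everything that commutes with [r]. *)
have comm W : pcontr W -> commute r W -> commute k W /\ commute l W.
  move=> pW rW.
  have hk : exists S, [/\ pcontr S, (forall x, S (S x) = r x) & commute S W].
    have [S [pS SS Sc]] := pcontr_sqrt pr; exists S; split=> //.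
    apply: Sc => //; first exact: pcontr_additive_bounded.
    by move=> a x; exact/symmetric_opZ/pcontr_sym.
  have hl : exists S, [/\ pcontr S, (forall x, S (S x) = x - r x) & commute S W].
    have [S [pS SS Sc]] := pcontr_sqrt (pcontr_onem pr); exists S; split=> //.
    apply: Sc => //; first exact: pcontr_additive_bounded.
      by move=> a x; exact/symmetric_opZ/pcontr_sym.
    by move=> x; rewrite rW (symmetric_opB _ _ (pcontr_sym pW)).
  have [S [pS SS Sc]] := hk; have [S' [pS' SS' Sc']] := hl.
  rewrite (pcontr_sqrt_unique pk pS) => [|x]; last by rewrite SS kk.
  by rewrite (pcontr_sqrt_unique pl pS') => [|x]; last by rewrite SS' ll.
have rEc : commute r E by move=> x; rewrite rE /r -!bE EF.
have [T [pT TT Tc]] := pcontr_sqrt pE.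
have [kE lE] := comm E pE rEc.
have Tk W : pcontr W -> commute W E -> commute W T.
  move=> pW WE x; rewrite -Tc//; first exact: pcontr_additive_bounded.
  by move=> a y; exact/symmetric_opZ/pcontr_sym.
have kT := Tk k pk kE; have lT := Tk l pl lE.
(* Both sides are positive contractions with the same square, since [(k T)^2 = r E = b^2]; likewise
   [(l T)^2 = (1 - r) E = c^2] for [l] and [c]. *)
have kTb x : k (T x) = b x.
  move: x; apply/funeqP; apply: pcontr_sqrt_unique => //; first exact: pcontr_mul.
  by move=> {}x; rewrite -kT kk TT rE.
have lTc x : l (T x) = c x.
  move: x; apply/funeqP; apply: pcontr_sqrt_unique => //; first exact: pcontr_mul.
  by move=> {}x; rewrite -lT ll TT crE.
rewrite Gb; split=> -[z [-> ->]].
  by exists (T z); rewrite kTb lTc cE.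
(* As [E = T^2] is onto, the parameter [z] can be written as [T (T y)], which turns the
   parametrization by [k] and [l] into that by [b] and [c]. *)
have [y <-] := Esurj z; rewrite -TT; exists (T y).
by rewrite kTb lTc cE.
Qed.

Theorem relation_root_unique G1 G2 : relation_sa G1 -> relation_nonneg G1 ->
  relation_sa G2 -> relation_nonneg G2 ->
  (forall u w, relation_comp G1 G1 u w <-> relation_comp G2 G2 u w) ->
  forall u w, G1 u w <-> G2 u w.
Proof.
move=> s1 p1 s2 p2 G12 u w.
have [r1 [pr1 h1 c1]] := relation_root_canonical s1 p1.
have [r2 [pr2 h2 c2]] := relation_root_canonical s2 p2.
(* Both [(r1 z, z - r1 z)] and [(r2 z, z - r2 z)] lie in [G2 G2]. With [d = r1 z - r2 z], the
   symmetry of [G2] along the two intermediate vectors gives [- |d|^2 = |v - v'|^2], so [d = 0]. *)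
have r12 z : r1 z = r2 z.
  have [v [Gv Gv']] := (G12 _ _).1 (h1 z).
  have [v' [Gw Gw']] := h2 z.
  have Gd := relation_saB s2 Gv Gw.
  have Gd' := relation_saB s2 Gv' Gw'.
  have := relation_sa_ip s2 Gd Gd'.
  rewrite (_ : z - r1 z - (z - r2 z) = - (r1 z - r2 z)); last by vector_identity.
  rewrite hipNr => h; apply/eqP; rewrite -subr_eq0; apply/eqP/hip_def.
  have := hip_ge0 (r1 z - r2 z); have := hip_ge0 (v - v'); lra.
have [k [pk kk _]] := pcontr_sqrt pr1.
have [l [pl ll _]] := pcontr_sqrt (pcontr_onem pr1).
rewrite (c1 k l)// (c2 k l)// => z; rewrite ?kk ?ll ?r12//.
Qed.

(** The unbounded operator [E K^-1], given by two bounded ones. No single-valuedness is built in; it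
    comes from injectivity of [K]. *)
Definition pair_relation K E u w := exists z : H, u = K z :> H /\ w = E z :> H.

(** The last hypothesis makes the graph maximal: a pair [(v, x)] in the adjoint satisfies
    [E v = K x], and [v] must be shown to lie in the range of [K]. *)
Lemma pair_relation_sa K E : symmetric_op K -> symmetric_op E -> commute K E ->
  injective K -> (forall v z, E v = K z -> exists y, v = K y) ->
  relation_sa (pair_relation K E).
Proof.
move=> sK sE KE Kinj EK v x; split=> [[z [-> ->]] _ _ [y [-> ->]]|h].
  by rewrite sK sE KE.
have EvKx : E v = K x.
  by apply: hip_ext => z; rewrite sE sK; apply: h; exists z.
have [y vy] := EK _ _ EvKx; exists y; split=> //.
by apply: Kinj; rewrite KE -vy.
Qed.

Lemma pair_relation_nonneg K E : pcontr K -> pcontr E -> commute K E ->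
  relation_nonneg (pair_relation K E).
Proof.
move=> pK pE KE _ _ [z [-> ->]].
by rewrite hipC -(pcontr_sym pK) (pcontr_ge0 (pcontr_mul pK pE KE)).
Qed.

(** The range condition is what turns [E K^-1 E K^-1] into [E^2 K^-2]: an intermediate vector
    [E z = K z'] forces [z] into the range of [K]. *)
Lemma pair_relation_comp K E : commute K E -> injective K ->
  (forall v z, E v = K z -> exists y, v = K y) ->
  forall u w, relation_comp (pair_relation K E) (pair_relation K E) u w <->
    pair_relation (fun z => K (K z)) (fun z => E (E z)) u w.
Proof.
move=> KE Kinj EK u w; split.
  move=> [v [[z [-> ->]] [z' [Ez ->]]]].
  have [y zy] := EK _ _ Ez; exists y; split; first by rewrite zy.
  by congr (E _); apply: Kinj; rewrite -Ez KE zy.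
by move=> [z [-> ->]]; exists (K (E z)); split; [exists (K z)|exists (E z)].
Qed.

Lemma pair_relation_dense K E : symmetric_op K -> injective K ->
  forall x, (forall u w, pair_relation K E u w -> <<x, u>> = 0) -> x = 0.
Proof.
move=> sK Kinj x h; apply: Kinj; rewrite symmetric_op0//.
apply: hip_ext => z; rewrite hip0l sK; apply: h; exists z.
by split; reflexivity.
Qed.

(** The projection [m] of [z] onto the closure [M] of the range satisfies [<<z - m, K y>> = 0] for
    all [y], that is [K z = K m]. *)
Lemma injective_range_dense K : pcontr K -> injective K ->
  forall z (e : R), 0 < e -> exists y, hnorm (z - K y) < e.
Proof.
move=> pK Kinj z.
pose M := [set x | forall e : R, 0 < e -> exists y, hnorm (x - K y) < e].
have MK y : M (K y) by move=> e e0; exists y; rewrite subrr hnorm0.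
have S : semi_ip M (@hip R H).
  split=> [|a x y Mx My e e0|a x y y' *|x y *|x _].
  - by rewrite -(symmetric_op0 (pcontr_sym pK)).
  - have [|x' xx'] := Mx (e / (`|a| + 1) / 2); first by rewrite !divr_gt0.
    have [|y' yy'] := My (e / 2); first by rewrite divr_gt0.
    exists (a *: x' + y').
    rewrite (symmetric_op_linear _ _ _ (pcontr_sym pK)) opprD addrACA -scalerBr.
    apply: le_lt_trans (ler_hnormD _ _) _; rewrite hnormZ [ltRHS]splitr ltr_leD// ?(ltW yy')//.
    apply: (@le_lt_trans _ _ ((`|a| + 1) * hnorm (x - K x'))).
      by rewrite ler_wpM2r ?hnorm_ge0// lerDl.
    by rewrite mulrC -ltr_pdivlMr// mulrAC.
  - by rewrite hipDl hipZl.
  - exact: hipC.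
  - exact: hip_ge0.
have cM : semi_complete M (@hip R H).
  move=> u_ Mu cu; have [||u _ uu] := @hip_complete _ H u_ => //.
  exists u => // e e0.
  have [|N hN] := uu ((e / 2) ^+ 2); first by rewrite exprn_gt0// divr_gt0.
  have [|y uy] := Mu N (e / 2); first by rewrite divr_gt0.
  exists y; rewrite -(subrK (u_ N) u) -addrA.
  apply: le_lt_trans (ler_hnormD _ _) _; rewrite [ltRHS]splitr ltrD// hnormB.
  rewrite -(ltr_pXn2r (_ : (0 < 2)%N)) ?nnegrE ?hnorm_ge0 ?divr_ge0 ?ltW//.
  by rewrite sqr_hnorm hN.
have [m Mm mP] := @semi_riesz _ _ _ _ S (hip z) <<z, z>> (hip_ge0 z) cM
  (fun a x y _ _ => etrans (hipDr _ _ _) (congr1 (+%R^~ _) (hipZr _ _ _)))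
  (fun x _ => hip_CS z x).
suff -> : z = m by [].
apply: Kinj; apply: hip_ext => y; rewrite !(pcontr_sym pK).
by rewrite mP.
Qed.

(** * The operator of a semibounded form, its absolute value and the root of that *)

Section form_operator.
Variables (h1 : set H) (q : H -> H -> R) (C : R).
Hypothesis C2 : 2 <= C.

(** Hypothesis [q1_ge] says [T + C >= 1]. The outer factor [C] gives [B = (T + C)^-1 / C <= 1 / C],
    so that the numerator [T B = 1 / C - C B] is a contraction as well. *)
Definition shifted_form u v := C * (q u v + C * <<u, v>>).
Local Notation q1 := shifted_form.

Hypothesis q1_semi : semi_ip h1 q1.
Hypothesis q1_complete : semi_complete h1 q1.
Hypothesis q1_ge : forall u, h1 u -> C * <<u, u>> <= q1 u u.
Hypothesis h1_dense : forall x, (forall v, h1 v -> <<x, v>> = 0) -> x = 0.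

Definition form_operator u w := h1 u /\ forall v, h1 v -> q v u = <<v, w>>.

Let C0 : 0 < C. Proof. by apply: lt_le_trans C2. Qed.

Let q1_ge1 u : h1 u -> <<u, u>> <= q1 u u.
Proof.
move=> /q1_ge; apply: le_trans; rewrite ler_peMl ?hip_ge0//.
by apply: le_trans C2; rewrite ler1n.
Qed.

Let resolvent_ex z : exists u, h1 u /\ forall v, h1 v -> q1 u v = <<z, v>>.
Proof.
have [|||u] := @semi_riesz _ _ _ _ q1_semi (hip z) <<z, z>> _ q1_complete.
- exact: hip_ge0.
- by move=> a x y _ _; rewrite hipDr hipZr.
- move=> x hx; apply: le_trans (hip_CS z x) _.
  by rewrite ler_wpM2l ?hip_ge0// q1_ge1.
by exists u.
Qed.

Lemma form_resolvent : exists B, [/\ pcontr B, injective B,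
  forall z, h1 (B z) & forall z v, h1 v -> q1 (B z) v = <<z, v>>].
Proof.
have [B BP] := choice resolvent_ex.
have hB z : h1 (B z) by have [] := BP z.
have qB z v : h1 v -> q1 (B z) v = <<z, v>> by have [_] := BP z; exact.
have sB : symmetric_op B.
  by move=> x y; rewrite hipC -(qB y _ (hB x)) -(qB x _ (hB y)) (semi_ip_sym q1_semi).
exists B; split=> //.
  have B0 x : 0 <= <<B x, x>> by rewrite hipC -(qB x _ (hB x)) (semi_ip_ge0 q1_semi).
  have Bx x : <<B x, B x>> <= <<B x, x>>.
    by rewrite [leRHS]hipC -(qB x _ (hB x)) q1_ge1.
  split=> // x; have := Bx x; have := hip_ge0 (x - B x).
  by rewrite !(hipBl, hipBr) (hipC x (B x)); lra.
move=> x y xy; apply/eqP; rewrite -subr_eq0; apply/eqP/h1_dense => v hv.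
by rewrite hipBl -!qB// xy subrr.
Qed.

Section with_resolvent.
Variable B : H -> H.
Hypotheses (pB : pcontr B) (Binj : injective B).
Hypotheses (hB : forall z, h1 (B z)).
Hypothesis qB : forall z v, h1 v -> q1 (B z) v = <<z, v>>.

Let BB x y := symmetric_opB x y (pcontr_sym pB).
Let BD x y := symmetric_opD x y (pcontr_sym pB).
Let BZ a x := symmetric_opZ a x (pcontr_sym pB).

Definition form_numerator z := C^-1 *: z - C *: B z.
Local Notation N := form_numerator.

Lemma form_numerator_sym : symmetric_op N.
Proof.
by move=> x y; rewrite /N hipBl hipBr !hipZl !hipZr (pcontr_sym pB).
Qed.

Lemma form_numerator_commute : commute B N.
Proof. by move=> x; rewrite /N BB !BZ. Qed.

Lemma form_numeratorE z : z = C *: N z + C ^+ 2 *: B z.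
Proof.
rewrite /N scalerBr !scalerA divff ?gt_eqF// scale1r -expr2.
by vector_identity.
Qed.
Local Notation NE := form_numeratorE.

Lemma form_operatorE u w : form_operator u w <-> pair_relation B N u w.
Proof.
split=> [[hu uw]|[z [-> ->]]]; last first.
  split=> // v hv; rewrite /N hipBr !hipZr.
  rewrite [<<v, z>>]hipC -(qB z hv) (semi_ip_sym q1_semi)// /q1.
  by rewrite mulrA mulVf ?gt_eqF// mul1r addrK.
(* The preimage of [u] under [B] is [C (T + C) u], where [T u = w]. *)
exists (C *: w + C ^+ 2 *: u).
have uE : u = B (C *: w + C ^+ 2 *: u).
  have hBu := hB (C *: w + C ^+ 2 *: u).
  set u' := B _ in hBu *.
  have hd := semi_ipDB q1_semi hu hBu.
  have : q1 (u - u') (u - u') = 0.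
    rewrite (semi_ipBl q1_semi)// qB// (semi_ip_sym q1_semi)// /q1 uw//.
    by rewrite [<<C *: w + _, _>>]hipC hipDr !hipZr; ring.
  move=> h; apply/eqP; rewrite -subr_eq0; apply/eqP/hip_def/le_anti.
  by rewrite hip_ge0 andbT -h q1_ge1.
split=> //; rewrite /N -uE scalerDr !scalerA mulVf ?gt_eqF// scale1r.
by rewrite expr2 mulrA mulVf ?gt_eqF// mul1r addrK.
Qed.

(** In [v = C N v + C^2 B v] the first summand lies in the range of [B] by hypothesis, the second
    always. *)
Lemma form_range_condition v z : N v = B z -> exists y, v = B y.
Proof.
move=> Nv; exists (C *: z + C ^+ 2 *: v).
by rewrite BD !BZ -Nv -NE.
Qed.

Lemma form_operator_sa : relation_sa form_operator.
Proof.
have h := pair_relation_sa (pcontr_sym pB) form_numerator_sym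
  form_numerator_commute Binj form_range_condition.
move=> v x; rewrite form_operatorE h; split=> H1 u w.
  by rewrite form_operatorE; exact: H1.
by rewrite -form_operatorE; exact: H1.
Qed.

(** The two bounds [C |B x|^2 <= <<B x, x>>] and [C <<B x, x>> <= |x|^2], combined with the sign of
    [C - 2], give [|N x|^2 <= (1 - C^-1)^2 |x|^2]. *)
Lemma form_numerator_le x : <<N x, N x>> <= <<x, x>>.
Proof.
have bd : C * <<B x, B x>> <= <<B x, x>>.
  by apply: le_trans (q1_ge (hB x)) _; rewrite qB// hipC.
have ab : C * <<B x, x>> <= <<x, x>>.
  have := hip_ge0 (x - C *: B x).
  rewrite !(hipBl, hipBr, hipZl, hipZr) (hipC x (B x)).
  have := ler_wpM2l (ltW C0) bd; lra.
rewrite /N !(hipBl, hipBr, hipZl, hipZr) (hipC x (B x)).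
have := pcontr_ge0 pB x; have := hip_ge0 x.
move: <<x, x>> <<B x, x>> <<B x, B x>> ab bd => a b d ab bd a0 b0.
have cC : C^-1 * C = 1 by rewrite mulVf ?gt_eqF.
have c0 : 0 < C^-1 by rewrite invr_gt0.
have c1 : C^-1 <= 2^-1 by rewrite lef_pV2 ?posrE.
have h1' : C * (C * d) <= C * b by rewrite ler_wpM2l// ltW.
have h2' : C^-1 * ((C - 2) * (C * b)) <= C^-1 * ((C - 2) * a).
  apply: ler_wpM2l; first exact: ltW.
  by apply: ler_wpM2l => //; rewrite subr_ge0.
rewrite (_ : C^-1 * ((C - 2) * (C * b)) = (C^-1 * C) * ((C - 2) * b)) in h2'; last by ring.
rewrite (_ : C^-1 * ((C - 2) * a) = (C^-1 * C) * a - 2 * C^-1 * a) in h2'; last by ring.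
rewrite (_ : C^-1 * (C^-1 * a) - C^-1 * (C * b) - (C * (C^-1 * b) - C * (C * d)) =
  C^-1 ^+ 2 * a - 2 * (C^-1 * C) * b + C * (C * d)); last by ring.
rewrite cC in h2' *; have h3 : C^-1 * (C^-1 * a) <= 2 * (C^-1 * a).
  have : C^-1 <= 2 by apply: le_trans c1 _; lra.
  by apply: ler_wpM2r; rewrite mulr_ge0// ltW.
lra.
Qed.

Section root.
Variable K : H -> H.
Hypotheses (pK : pcontr K) (KK : forall x, K (K x) = B x).

Let Kinj : injective K.
Proof. by move=> x y xy; apply: Binj; rewrite -!KK xy. Qed.

Let KB := fun x y => symmetric_opB x y (pcontr_sym pK).

(** One has [q1 (B y) (B y) = |K y|^2]. If [K y_k] tends to [z], then [B y_k = K (K y_k)] is Cauchy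
    for [q1] and converges to [K z]. The constant 4 is a crude substitute for 1; it only serves to
    bound a functional below. *)
Lemma form_root_dom z : h1 (K z) /\ q1 (K z) (K z) <= 4 * <<z, z>>.
Proof.
have [y_ zy] : exists y_ : nat -> H, forall k, hnorm (z - K (y_ k)) < k.+1%:R^-1.
  have ex k : exists y, hnorm (z - K y) < k.+1%:R^-1.
    by apply: injective_range_dense => //.
  by have [y_] := choice ex; exists y_.
have qBB a b : q1 (B a - B b) (B a - B b) = hnorm (K a - K b) ^+ 2.
  by rewrite -BB qB// -KK -(pcontr_sym pK) -sqr_hnorm KB.
have zv : vanishing (fun k => hnorm (z - K (y_ k))).
  move=> e e0; have [N hN] := vanishing_inv e0.
  by exists N => m /hN; exact: lt_trans (zy m).
have [|e e0|u hu uu] := q1_complete (u_ := fun k => B (y_ k)).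
- by move=> k.
- have [|N hN] := zv (Num.sqrt e / 2); first by rewrite divr_gt0// sqrtr_gt0.
  exists N => m k /hN Nm /hN Nk; rewrite qBB -[ltRHS]sqr_sqrtr ?ltW//.
  rewrite ltr_pXn2r ?nnegrE ?hnorm_ge0 ?sqrtr_ge0//.
  rewrite -(subrK z (K (y_ m))) -addrA; apply: le_lt_trans (ler_hnormD _ _) _.
  by rewrite hnormB [ltRHS]splitr ltrD.
have uE : u = K z.
  apply: (@hcvg_unique (fun k => B (y_ k))).
    move=> e e0; have [|N hN] := uu (e ^+ 2); first by rewrite exprn_gt0.
    exists N => m /hN h; rewrite -(ltr_pXn2r (_ : (0 < 2)%N)) ?nnegrE ?hnorm_ge0 ?(ltW e0)//.
    apply: le_lt_trans h; rewrite sqr_hnorm q1_ge1//.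
    exact: (semi_ipDB q1_semi).
  apply: vanishing_le zv => k; rewrite hnormB -KK -KB.
  exact: pcontr_hnorm.
rewrite -uE; split=> //; rewrite -subr_le0.
pose s k := q1 (B (y_ k) - u) (B (y_ k) - u).
have key k : q1 u u - 4 * <<z, z>> <= 2 * s k + 4 * (hnorm (z - K (y_ k)) ^+ 2).
  have hBu := hB (y_ k); have hd := semi_ipDB q1_semi hBu hu.
  have h1' := semi_ip_shift q1_semi 1 hBu hd.
  have h2' := semi_ip_shift q1_semi (-1) hBu hd.
  have h3' : q1 (B (y_ k)) (B (y_ k)) = hnorm (K (y_ k)) ^+ 2.
    by have := qBB (y_ k) 0; rewrite (symmetric_op0 (pcontr_sym pB)) (symmetric_op0 (pcontr_sym pK)) !subr0.
  have h4' : hnorm (K (y_ k)) ^+ 2 <= 2 * <<z, z>> + 2 * hnorm (z - K (y_ k)) ^+ 2.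
    rewrite !sqr_hnorm; have := hip_ge0 (z + (z - K (y_ k))).
    by rewrite !(hipDl, hipDr, hipNl, hipNr) (hipC z (K _)); lra.
  rewrite !scaleN1r !scale1r in h1' h2'.
  rewrite (_ : B (y_ k) - (B (y_ k) - u) = u) in h2'; last by rewrite opprB addrC subrK.
  have := semi_ip_ge0 q1_semi (semi_ipDD q1_semi hBu hd); rewrite /s; lra.
apply: (vanishing_le0 _ key); apply: vanishingD; apply: vanishingZ => //.
move=> e e0; have [|N hN] := zv (Num.sqrt e); first by rewrite sqrtr_gt0.
exists N => m /hN; rewrite -[in X in _ -> X](sqr_sqrtr (ltW e0)) => h.
by rewrite ltr_pXn2r ?nnegrE ?hnorm_ge0 ?sqrtr_ge0.
Qed.

(** For [u] in the form domain, Riesz represents the bounded functional [w -> q1 u (K w)] by some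
    [y]. Then [<<K y, z>> = q1 u (B z) = <<u, z>>] for all [z], so [u = K y]. *)
Lemma form_root_range u : h1 u <-> exists z, u = K z.
Proof.
split=> [hu|[z ->]]; last by have [] := form_root_dom z.
have hK z := (form_root_dom z).1.
have [|||y _ yP] := @semi_riesz _ _ _ _ (hip_semi H) (fun w => q1 u (K w))
  (q1 u u * 4) _ (@hip_complete _ H).
- by rewrite mulr_ge0// (semi_ip_ge0 q1_semi).
- move=> a x y _ _; rewrite (symmetric_op_linear _ _ _ (pcontr_sym pK)).
  rewrite (semi_ipDr q1_semi) ?(semi_ipZr q1_semi)//.
  exact: (semi_ipDZ q1_semi).
- move=> x _; apply: le_trans (semi_ip_CS q1_semi hu (hK x)) _.
  rewrite -mulrA ler_wpM2l ?(semi_ip_ge0 q1_semi)//.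
  by have [] := form_root_dom x.
exists y; apply: hip_ext => z.
by rewrite (pcontr_sym pK) yP// KK (semi_ip_sym q1_semi)// qB// hipC.
Qed.

End root.
End with_resolvent.

Variable J : H -> H.
Hypothesis JD : forall x y, J (x + y) = J x + J y.
Hypothesis JZ : forall a x, J (a *: x) = a *: J x.
Hypothesis Jip : forall x y, <<J x, J y>> = <<x, y>>.
Hypothesis JJ : forall x, J (J x) = - x.
Hypothesis Jh1 : forall x, h1 x -> h1 (J x).
Hypothesis Jq : forall x y, h1 x -> h1 y -> q (J x) (J y) = q x y.

Definition relation_dense (G : H -> H -> Prop) :=
  forall x, (forall u w, G u w -> <<x, u>> = 0) -> x = 0.

Definition relation_invariant (G : H -> H -> Prop) :=
  forall u w, G u w -> G (J u) (J w).

Lemma form_operator_invariant : relation_invariant form_operator.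
Proof.
move=> u w [hu uw]; split=> [|v hv]; first exact: Jh1.
have hJv := semi_ipDN q1_semi (Jh1 hv).
have vE : v = J (- J v) by rewrite -scaleN1r JZ JJ scaleN1r opprK.
by rewrite {1}vE Jq// uw// vE Jip -vE.
Qed.

(** With [D] the root of [N^2], [K] the root of [B] and [E] the root of [D], the relations are
    [T = N B^-1], [A = D B^-1] and [S = E K^-1]. Then [A A = T T] because [D^2 = N^2], and
    [S S = A]. Invariance under [J] passes from [B] and [N] to the roots by their commutation
    clause. *)
Theorem form_operator_roots :
  [/\ relation_sa form_operator, relation_dense form_operator &
   exists A S, [/\
     [/\ relation_sa A, relation_nonneg A, relation_dense A,
         relation_invariant A &
         forall u w, relation_comp A A u w <->
           relation_comp form_operator form_operator u w],
     [/\ relation_sa S, relation_nonneg S, relation_dense S,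
         relation_invariant S &
         forall u w, relation_comp S S u w <-> A u w] &
     forall u, h1 u <-> exists w, S u w]].
Proof.
have [B [pB Binj hB qB]] := form_resolvent.
have sN := form_numerator_sym pB.
have NE := form_numeratorE B.
have NB := form_numerator_commute pB.
have N_le x : <<form_numerator B x, form_numerator B x>> <= <<x, x>>.
  exact: form_numerator_le.
have opE u w : form_operator u w <-> pair_relation B (form_numerator B) u w.
  exact: form_operatorE.
have range v z : form_numerator B v = B z -> exists y, v = B y.
  exact: form_range_condition.
have root_range K : pcontr K -> (forall x, K (K x) = B x) ->
  forall u, h1 u <-> exists z, u = K z by exact: form_root_range.
move: (form_numerator B) sN NE NB N_le opE range => N sN NE NB N_le opE range.
have BD x y := symmetric_opD x y (pcontr_sym pB).
have BZ a x := symmetric_opZ a x (pcontr_sym pB).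
have pNN : pcontr (fun x => N (N x)).
  by split=> [x y|x|x]; [rewrite !sN|rewrite sN hip_ge0|rewrite sN N_le].
have bJ : additive_bounded J.
  split=> //; exists 1; split=> // x; rewrite mul1r.
  by rewrite /hnorm Jip.
have lin W : pcontr W -> forall a x, W (a *: x) = a *: W x.
  by move=> pW a x; exact/symmetric_opZ/pcontr_sym.
have [D [pD DD Dc]] := pcontr_sqrt pNN.
have [K [pK KK Kc]] := pcontr_sqrt pB.
have [E [pE EE Ec]] := pcontr_sqrt pD.
have DB : commute D B.
  apply: Dc; [exact: pcontr_additive_bounded|exact: lin|].
  by move=> x; rewrite -!NB.
have BDc : commute B D by move=> x.
have KD : commute K D.
  by apply: Kc; [exact: pcontr_additive_bounded|exact: lin|].
have EK : commute E K.
  by apply: Ec; [exact: pcontr_additive_bounded|exact: lin|move=> x; rewrite KD].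
have KE : commute K E by move=> x.
have Kinj : injective K by move=> x y xy; apply: Binj; rewrite -!KK xy.
(* The identity [v = C N v + C^2 B v] is inserted into itself, which produces [N^2 = D^2]. Both
   range conditions, for [D] over [B] and for [E] over [K], follow from it. *)
have vE v : v = C ^+ 2 *: D (D v) + B (C ^+ 3 *: N v + C ^+ 2 *: v).
  rewrite DD BD !BZ {1}(NE v) {1}(NE (N v)).
  by vector_identity.
have rD v z : D v = B z -> exists y, v = B y.
  move=> Dv; exists (C ^+ 2 *: D z + (C ^+ 3 *: N v + C ^+ 2 *: v)).
  by rewrite BD BZ -DB -Dv -vE.
have rE v z : E v = K z -> exists y, v = K y.
  move=> Ev; exists (C ^+ 2 *: E (E (E z)) + K (C ^+ 3 *: N v + C ^+ 2 *: v)).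
  rewrite (symmetric_opD _ _ (pcontr_sym pK)) (lin K pK) !KE KK -Ev.
  by rewrite EE EE -vE.
(* [J] preserves both forms and the form domain, so [J (B x)] solves the equation that defines
   [B (J x)]. *)
have JB : commute J B.
  move=> x; apply: esym; apply/eqP; rewrite -subr_eq0; apply/eqP.
  have hJB := Jh1 (hB x).
  have hd := semi_ipDB q1_semi (hB (J x)) hJB.
  apply/hip_def/le_anti; rewrite hip_ge0 andbT; apply: le_trans (q1_ge1 hd) _.
  rewrite (semi_ipBl q1_semi)// qB//.
  set d := _ - _ in hd *.
  have hJd := semi_ipDN q1_semi (Jh1 hd).
  have dE : d = J (- J d) by rewrite -scaleN1r JZ JJ scaleN1r opprK.
  rewrite [X in q1 _ X]dE [X in <<_, X>>]dE /q1 Jq// !Jip.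
  by rewrite -[C * _]/(q1 (B x) (- J d)) qB// subrr.
have JN : commute J N.
  move=> x; have h := NE (J x); have h' := congr1 J (NE x).
  rewrite JD !JZ JB {1}h in h'.
  have := congr1 (fun z => C^-1 *: (z - C ^+ 2 *: B (J x))) h'.
  by rewrite !addrK !scalerA mulVf ?gt_eqF// !scale1r => ->.
have JDc : commute D J by apply: Dc => // x; rewrite -!JN.
have JK : commute K J by apply: Kc => // x.
have JE : commute E J by apply: Ec.
have inv X Y : commute X J -> commute Y J -> relation_invariant (pair_relation X Y).
  by move=> XJ YJ u w [z [-> ->]]; exists (J z).
split.
- exact: form_operator_sa hB qB.
- move=> x hx; apply: (pair_relation_dense (pcontr_sym pB) Binj (E := N)).
  by move=> u w /opE; exact: hx.
exists (pair_relation B D), (pair_relation K E); split.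
- split.
  + exact: (pair_relation_sa (pcontr_sym pB) (pcontr_sym pD) BDc Binj rD).
  + exact: pair_relation_nonneg.
  + exact: (pair_relation_dense (pcontr_sym pB) Binj).
  + by apply: inv => // x.
  + move=> u w; rewrite (pair_relation_comp BDc Binj rD).
    rewrite (_ : (fun z => D (D z)) = fun z => N (N z)); last exact/funext.
    rewrite -(pair_relation_comp NB Binj range).
    by split=> -[v [/opE h /opE h']]; exists v.
- split.
  + exact: (pair_relation_sa (pcontr_sym pK) (pcontr_sym pE) KE Kinj rE).
  + exact: pair_relation_nonneg.
  + exact: (pair_relation_dense (pcontr_sym pK) Kinj).
  + exact: inv.
  + move=> u w; rewrite (pair_relation_comp KE Kinj rE).
    rewrite (_ : (fun z => E (E z)) = D); last exact/funext.
    by rewrite (_ : (fun z => K (K z)) = B); last exact/funext.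
- move=> u; rewrite (root_range K pK KK); split=> [[z ->]|[_ [z [-> _]]]].
    by exists (E z), z.
  by exists z.
Qed.

End form_operator.

End hilbert_operators.

(** * Completeness of L^2 *)

Section measure_generalities.
Context {d} {T : measurableType d} {R : realType}.
Variables (mu : {measure set T -> \bar R}) (D : set T).
Hypothesis mD : measurable D.
Local Open Scope ereal_scope.

Lemma limn_einf_le (u : (\bar R)^nat) (c : \bar R) N :
  (forall k, (N <= k)%N -> u k <= c) -> limn_einf u <= c.
Proof.
move=> uc; rewrite limn_einf_lim; apply: lime_le; first exact: is_cvg_einfs.
apply: nearW => n; apply: (@le_trans _ _ (u (maxn n N))).
  by apply: ereal_inf_lbound; exists (maxn n N) => //=; exact: leq_maxl.
by apply: uc; exact: leq_maxr.
Qed.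

Lemma fatou_le (g_ : nat -> T -> \bar R) (g : T -> \bar R) (c : \bar R) N :
  (forall k, measurable_fun D (g_ k)) -> measurable_fun D g ->
  (forall k x, D x -> 0 <= g_ k x) -> (forall x, D x -> 0 <= g x) ->
  {ae mu, forall x, D x -> g_ k x @[k --> \oo] --> g x} ->
  (forall k, (N <= k)%N -> \int[mu]_(x in D) g_ k x <= c) ->
  \int[mu]_(x in D) g x <= c.
Proof.
move=> mg_ mg g_0 g0 gg gc.
rewrite (@ge0_ae_eq_integral _ _ _ mu D g (fun x => limn_einf (g_^~ x)))//; first last.
- by apply: filterS gg => x gx Dx; rewrite (cvg_limn_einf_sup (gx Dx)).
- move=> x Dx; rewrite limn_einf_lim; apply: lime_ge; first exact: is_cvg_einfs.
  by apply: nearW => n; apply: le_ereal_inf_tmp => _ [m _ <-]; exact: g_0.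
- apply: measurableT_comp => //; apply: measurable_fun_limn_esup => k.
  exact: measurableT_comp.
apply: (le_trans (fatou mu mD mg_ g_0)).
exact: (@limn_einf_le _ c N).
Qed.

End measure_generalities.

Section square_summable.
Context {R : realType}.

Lemma cvg_of_geometric_steps (u : nat -> R) (S : R) :
  (forall k, 4 ^+ k * (u k.+1 - u k) ^+ 2 <= S) -> cvgn u.
Proof.
move=> uS.
have S0 : 0 <= S by apply: le_trans (uS 0%N); rewrite mul1r sqr_ge0.
have step k : `|u k.+1 - u k| <= (S + 1) * 2^-1 ^+ k.
  rewrite -(@ler_pXn2r _ 2) ?nnegrE ?mulr_ge0 ?addr_ge0 ?exprn_ge0 ?invr_ge0//.
  rewrite real_normK ?num_real// exprMn -exprM mulnC exprM.
  rewrite (_ : 2^-1 ^+ 2 = 4^-1 :> R); last by lra.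
  rewrite -ler_pdivrMr ?exprn_gt0 ?invr_gt0// -exprVn invrK mulrC.
  by apply: le_trans (uS k) _; nra.
rewrite (_ : u = cst (u 0%N) \+ series (telescope u)); last first.
  by apply/funext => n /=; rewrite [LHS]eq_sum_telescope.
apply: is_cvgD; first exact: is_cvg_cst.
apply: normed_cvg; apply: (@series_le_cvg _ _ (geometric (S + 1) 2^-1)) => [n|n|n|].
- exact: normr_ge0.
- by rewrite /= mulr_ge0 ?addr_ge0 ?exprn_ge0 ?invr_ge0.
- exact: step.
- apply: is_cvg_geometric_series.
  by rewrite ger0_norm ?invr_ge0// invf_lt1// ltr1n.
Qed.

Context {d} {T : measurableType d}.
Variables (mu : {measure set T -> \bar R}) (D : set T).
Hypothesis mD : measurable D.

(** The integral of the sum of [4^k (u k.+1 - u k)^2] is at most the sum of [4^k 8^-k = 2^-k]. The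
    sum is therefore finite almost everywhere, and there the steps are bounded by a multiple of
    [2^-k]. *)
Lemma ae_cvg_of_geometric_steps (u : nat -> T -> R) :
  (forall k, measurable_fun D (u k)) ->
  (forall k, \int[mu]_(x in D) ((u k.+1 x - u k x) ^+ 2)%:E <= (8^-1 ^+ k)%:E)%E ->
  {ae mu, forall x, D x -> cvgn (u^~ x)}.
Proof.
move=> mu_ us.
pose g k x := (4 ^+ k * (u k.+1 x - u k x) ^+ 2)%:E.
have g0 k x : (0 <= g k x)%E.
  by rewrite lee_fin mulr_ge0 ?sqr_ge0// exprn_ge0.
have mg k : measurable_fun D (g k).
  apply/measurable_EFinP; apply: measurable_funM; first exact: measurable_cst.
  by apply: measurable_funX; exact: measurable_funB.
pose S x := (\sum_(0 <= k <oo) g k x)%E.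
have mS : measurable_fun D S.
  by apply: ge0_emeasurable_sum => // k x _ _.
have S0 x : (0 <= S x)%E by apply: nneseries_ge0 => k _ _.
have iS : mu.-integrable D S.
  apply/integrableP; split=> //.
  rewrite (eq_integral S); last by move=> x _; rewrite gee0_abs.
  rewrite integral_nneseries//.
  apply: (@le_lt_trans _ _ (\sum_(0 <= k <oo) (2 / (2 ^ k.+1)%:R)%:E)%E); last first.
    by apply: le_lt_trans (epsilon_trick0 xpredT _) _ => //; exact: ltry.
  apply: lee_nneseries => [k _ _|k _]; first by apply: integral_ge0 => x _; exact: g0.
  rewrite /g; under eq_integral do rewrite EFinM.
  rewrite ge0_integralZl_EFin ?exprn_ge0//; last 2 first.
    by pos.
    by apply/measurable_EFinP/measurable_funX; exact: measurable_funB.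
  apply: (@le_trans _ _ ((4 ^+ k)%:E * (8^-1 ^+ k)%:E)%E).
    by rewrite lee_pmul2l// lte_fin exprn_gt0.
  rewrite -EFinM lee_fin -exprMn (_ : 4 * 8^-1 = 2^-1 :> R); last by lra.
  by rewrite natrX exprS invfM mulrA divff// mul1r exprVn.
have := integrable_ae mD iS; apply: filterS => x Sx Dx.
apply: (@cvg_of_geometric_steps _ (fine (S x))) => k.
rewrite -lee_fin fineK; last exact: Sx.
apply: le_trans (nneseries_lim_ge k.+1 (fun n _ _ => g0 n x)).
rewrite big_nat_recr//= leeDr//.
by pos.
Qed.

(* The limsup makes this measurable, also where [u] does not converge. *)
Definition limit_fun (U : Type) (u : nat -> U -> R) (x : U) : R :=
  fine (limn_esup (fun k => (u k x)%:E)).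

Lemma limit_funE (U : Type) (u : nat -> U -> R) x : cvgn (u^~ x) ->
  u k x @[k --> \oo] --> limit_fun u x.
Proof.
move=> /cvg_ex[l ul]; suff -> : limit_fun u x = l by [].
rewrite /limit_fun (_ : limn_esup _ = l%:E)//.
have h : (u k x)%:E @[k --> \oo] --> l%:E by apply: cvg_EFin => //; exact: nearW.
by rewrite (cvg_limn_einf_sup h).
Qed.

Lemma measurable_limit_fun (u : nat -> T -> R) :
  (forall k, measurable_fun D (u k)) -> measurable_fun D (limit_fun u).
Proof.
move=> mu_; apply: measurableT_comp => //.
by apply: measurable_fun_limn_esup => k; exact/measurable_EFinP.
Qed.

End square_summable.

Lemma fast_subsequence (P : nat -> nat -> Prop) :
  (forall j, exists N, forall m, (N <= m)%N -> P j m) ->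
  exists phi : nat -> nat, [/\ {homo phi : m n / (m <= n)%N},
    forall j, (j <= phi j)%N & forall j m, (phi j <= m)%N -> P j m].
Proof.
move=> /choice[N NP].
pose phi j := (j + \sum_(i < j.+1) N i)%N.
exists phi; split=> [m n mn|j|j m jm]; rewrite /phi.
- rewrite leq_add//.
  rewrite -(big_mkord xpredT) -(big_mkord xpredT N) (@big_cat_nat _ _ _ m.+1 0 n.+1)//=.
  by rewrite leq_addr.
- exact: leq_addr.
- apply: NP; apply: leq_trans jm; rewrite /phi big_ord_recr/=.
  by rewrite addnA leq_addl.
Qed.

Section L2_real.
Context {d} {T : measurableType d} {R : realType}.
Variables (mu : {measure set T -> \bar R}) (D : set T).
Hypothesis mD : measurable D.
Implicit Types f g : T -> R.

Definition rL2sq f : \bar R := (\int[mu]_(x in D) ((f x) ^+ 2)%:E)%E.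

Definition rL2 f := measurable_fun D f /\ (rL2sq f < +oo)%E.

Lemma rL2sq_ge0 f : (0 <= rL2sq f)%E.
Proof. by apply: integral_ge0 => x _; rewrite lee_fin sqr_ge0. Qed.

Lemma measurable_sqr f : measurable_fun D f ->
  measurable_fun D (fun x => ((f x) ^+ 2)%:E).
Proof. by meas. Qed.

Lemma rL2sq_le f g : measurable_fun D f -> measurable_fun D g ->
  (forall x, D x -> `|f x| <= `|g x|) -> (rL2sq f <= rL2sq g)%E.
Proof.
move=> mf mg fg; apply: ge0_le_integral => //.
- by pos.
- by meas.
- by meas.
- by move=> x Dx; rewrite lee_fin -(real_normK (num_real (f x))) -(real_normK (num_real (g x))) lerXn2r ?nnegrE// fg.
Qed.

Lemma rL2sqZ a f : measurable_fun D f ->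
  rL2sq (fun x => a * f x) = ((a ^+ 2)%:E * rL2sq f)%E.
Proof.
move=> mf; rewrite /rL2sq -ge0_integralZl_EFin ?sqr_ge0//.
- by apply: eq_integral => x _; rewrite exprMn EFinM.
- by pos.
- by meas.
Qed.

Lemma rL2sqD f g : measurable_fun D f -> measurable_fun D g ->
  (rL2sq (fun x => (f x + g x)%R) <= 2%:E * rL2sq f + 2%:E * rL2sq g)%E.
Proof.
move=> mf mg; rewrite /rL2sq -!ge0_integralZl_EFin//; first last.
- by meas.
- by pos.
- by meas.
- by pos.
have p0 (h : T -> R) x : D x -> (0 <= 2%:E * (h x ^+ 2)%:E)%E by pos.
have mp (h : T -> R) : measurable_fun D h -> measurable_fun D (fun x => 2%:E * (h x ^+ 2)%:E)%E by meas.
rewrite -ge0_integralD//; try exact: p0; try exact: mp.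
apply: ge0_le_integral => //.
- by pos.
- by meas.
- by apply: emeasurable_funD; exact: mp.
- move=> x _; rewrite -!EFinM -EFinD lee_fin.
  by have := sqr_ge0 (f x - g x); lra.
Qed.

Lemma rL2Z a f : rL2 f -> rL2 (fun x => a * f x).
Proof.
move=> [mf ff]; split; first by apply: measurable_funM.
by rewrite rL2sqZ// lte_mul_pinfty// lee_fin sqr_ge0.
Qed.

Lemma rL2D f g : rL2 f -> rL2 g -> rL2 (fun x => f x + g x).
Proof.
move=> [mf ff] [mg fg]; split; first exact: measurable_funD.
apply: le_lt_trans (rL2sqD mf mg) _.
by rewrite lte_add_pinfty// lte_mul_pinfty.
Qed.

Lemma rL2N f : rL2 f -> rL2 (fun x => - f x).
Proof. by move=> /(rL2Z (-1)); under eq_fun do rewrite mulN1r. Qed.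

Lemma rL2B f g : rL2 f -> rL2 g -> rL2 (fun x => f x - g x).
Proof. by move=> hf /rL2N; exact: rL2D. Qed.

Lemma rL2_mul_integrable f g : rL2 f -> rL2 g ->
  mu.-integrable D (fun x => (f x * g x)%:E).
Proof.
move=> [mf ff] [mg fg]; apply/integrableP; split.
  by meas.
apply: (@le_lt_trans _ _ (rL2sq f + rL2sq g)%E); last exact: lte_add_pinfty.
rewrite /rL2sq -ge0_integralD//; first last.
- by meas.
- by pos.
- by meas.
- by pos.
apply: ge0_le_integral => //.
- apply: measurableT_comp => //.
  by meas.
- by apply: emeasurable_funD; exact: measurable_sqr.
- move=> x _; rewrite /= lee_fin ler_norml.
  have := sqr_ge0 (f x + g x); have := sqr_ge0 (f x - g x).
  by have := sqr_ge0 (f x); have := sqr_ge0 (g x); move=> *; apply/andP; split; lra.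
Qed.

Lemma rL2_fin f : rL2 f -> rL2sq f \is a fin_num.
Proof. by move=> [_ ff]; rewrite ge0_fin_numE// rL2sq_ge0. Qed.

(** Riesz-Fischer. A subsequence with rate [8^-j] converges almost everywhere, and Fatou's lemma
    bounds the distance from every late term of the whole sequence to the pointwise limit. *)
Theorem rL2_complete (f_ : nat -> T -> R) : (forall k, rL2 (f_ k)) ->
  (forall e : R, 0 < e -> exists N, forall m k, (N <= m)%N -> (N <= k)%N ->
    (rL2sq (fun x => (f_ m x - f_ k x)%R) <= e%:E)%E) ->
  exists2 f, rL2 f & forall e : R, 0 < e -> exists N, forall m, (N <= m)%N ->
    (rL2sq (fun x => (f_ m x - f x)%R) <= e%:E)%E.
Proof.
move=> f2 cf; have mf k := (f2 k).1.
have [|phi [phi_homo phi_ge phiP]] := @fast_subsequence (fun j m => forall k,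
    (m <= k)%N -> (rL2sq (fun x => (f_ k x - f_ m x)%R) <= (8^-1 ^+ j)%:E)%E).
  move=> j; have [|N hN] := cf (8^-1 ^+ j); first by rewrite exprn_gt0.
  by exists N => m Nm k mk; apply: hN => //; exact: leq_trans mk.
pose u j := f_ (phi j).
have aeu : {ae mu, forall x, D x -> cvgn (u^~ x)}.
  apply: ae_cvg_of_geometric_steps => // [k|k]; first exact: mf.
  by apply: phiP; rewrite ?phi_homo.
pose f := limit_fun u.
have mlf : measurable_fun D f by apply: measurable_limit_fun => k; exact: mf.
have lim (e : R) : 0 < e -> exists N, forall m, (N <= m)%N ->
    (rL2sq (fun x => (f_ m x - f x)%R) <= e%:E)%E.
  move=> e0; have [N hN] := cf e e0; exists N => m Nm.
  apply: (@fatou_le _ _ _ _ _ mD (fun j x => ((f_ m x - u j x) ^+ 2)%:E) _ _ N).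
  - by move=> k; apply: measurable_sqr; apply: measurable_funB; exact: mf.
  - by apply: measurable_sqr; apply: measurable_funB => //.
  - by pos.
  - by pos.
  - apply: filterS aeu => x ux Dx; have h := limit_funE (ux Dx).
    apply: cvg_EFin; first exact: nearW.
    by under eq_fun do rewrite /= expr2; apply: cvgM; apply: cvgB => //; exact: cvg_cst.
  - by move=> k Nk; apply: hN => //; apply: leq_trans Nk _.
exists f => //.
have [N /(_ N (leqnn N)) hN] := lim 1 ltr01.
have hd : rL2 (fun x => f_ N x - f x).
  split; first exact: measurable_funB.
  by apply: le_lt_trans hN _; exact: ltry.
rewrite (_ : f = fun x => f_ N x - (f_ N x - f x)); first exact: rL2B.
by apply/funext => x; rewrite opprB addrC subrK.
Qed.

End L2_real.

(** * Lebesgue measure on row vectors *)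

Section lebesgue_affine.
Context {R : realType}.
Local Notation leb := (@lebesgue_measure R).
Local Open Scope ereal_scope.

Definition affine1 (c a : R) (x : measurableTypeR R) : measurableTypeR R := (c * x + a)%R.

Lemma measurable_affine1 (c a : R) : mfunT (affine1 c a).
Proof. by apply: measurable_funD => //. Qed.

Local Notation pushm := measure_function_pushforward__canonical__measure_function_Measure.

(** By uniqueness of Lebesgue measure it is enough to compare lengths of half-open intervals. *)
Lemma lebesgue_affine (c a : R) (c0 : (0 < c)%R) (A : set (measurableTypeR R)) :
  measurable A -> leb A = mscale (NngNum (ltW c0)) (pushm leb (measurable_affine1 c a)) A.
Proof.
move=> mA; apply: lebesgue_measure_unique => // _ [[x y] _ <-] /=.
rewrite /mscale /= /pushforward.
rewrite (_ : affine1 c a @^-1` _ = `]((x - a) / c)%R, ((y - a) / c)%R]%classic); last first.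
  apply/seteqP; split=> z; rewrite /affine1 /= !in_itv/=.
    by rewrite ltr_pdivrMr// ler_pdivlMr// ltrBlDr lerBrDr mulrC.
  by rewrite ltr_pdivrMr// ler_pdivlMr// ltrBlDr lerBrDr mulrC.
rewrite !lebesgue_measure_itv/= !lte_fin ltr_pM2r ?invr_gt0// ltrD2r.
case: ifPn => _; last by rewrite mule0.
by rewrite -!EFinB -EFinM; congr (_%:E); field; rewrite gt_eqF.
Qed.

Lemma ge0_integral_affine (c a : R) (f : R -> \bar R) : (0 < c)%R ->
  mfunT f -> (forall x, 0 <= f x) ->
  \int[leb]_x f x = c%:E * \int[leb]_x f (c * x + a)%R.
Proof.
move=> c0 mf f0.
rewrite (eq_measure_integral (mscale (NngNum (ltW c0)) (pushm leb (measurable_affine1 c a)))); last first.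
  by move=> A mA _; exact: lebesgue_affine.
rewrite ge0_integral_mscale//=; congr (_ * _).
by rewrite (ge0_integral_pushforward (measurable_affine1 c a)).
Qed.

End lebesgue_affine.

Section rV_integral.
Context {R : realType}.
Local Notation leb := (@lebesgue_measure R).
Local Notation lebn n := (rV_lebesgue R n).
Local Open Scope ereal_scope.

Lemma integral_indic_itv (i : interval R) :
  \int[leb]_x (\1_[set` i] x)%:E = leb [set` i].
Proof. by rewrite integral_indic//= setIT. Qed.

Lemma measurable_rV_curry n (f : 'rV[R]_n.+1 -> \bar R) : mfunT f ->
  mfunT (fun p : measurableTypeR R * 'rV[R]_n => f (rV_cons p)).
Proof. by move=> mf; apply: measurableT_comp mf _; exact: measurable_rV_cons. Qed.

Lemma ge0_integral_rV_cons n (f : 'rV[R]_n.+1 -> \bar R) :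
  mfunT f -> (forall x, 0 <= f x) ->
  \int[lebn n.+1]_x f x = \int[leb]_t \int[lebn n]_v f (rV_cons (t, v)).
Proof.
move=> mf f0; rewrite [LHS](ge0_integral_pushforward (@measurable_rV_cons R n))//.
rewrite preimage_setT.
exact: (fubini_tonelli1 (m1 := leb) (m2 := lebn n) _ (measurable_rV_curry mf) (fun p => f0 _)).
Qed.

Lemma measurable_integral_rV_cons n (f : 'rV[R]_n.+1 -> \bar R) :
  mfunT f -> (forall x, 0 <= f x) ->
  mfunT (fun t : measurableTypeR R => \int[lebn n]_v f (rV_cons (t, v))).
Proof.
move=> mf f0; have := @measurable_fun_fubini_tonelli_F _ _ _ _ _ (lebn n) (fun p => f (rV_cons p)).
by apply => //; exact: measurable_rV_curry.
Qed.

Lemma rV_consD n (t s : R) (v w : 'rV[R]_n) :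
  (rV_cons (t, v) + rV_cons (s, w))%R = rV_cons (t + s, v + w)%R.
Proof.
rewrite /rV_cons /=; apply: (etrans (@add_row_mx _ 1 1 n _ _ _ _)).
by rewrite -[(t + s)%:M]/(scalar_mx _) raddfD.
Qed.

Lemma rV_consP n (x : 'rV[R]_n.+1) : exists t v, x = rV_cons (t, v).
Proof.
exists (x 0%R 0%R), (rsubmx (x : 'rV_(1 + n))); rewrite /rV_cons /=.
apply: (etrans (esym (@hsubmxK _ 1 1 n x))); congr (row_mx _ _).
apply/matrixP => i j; rewrite !ord1 !mxE/=; congr (x _ _).
exact/val_inj.
Qed.

Lemma measurable_rV_add n (a : 'rV[R]_n) : mfunT (fun x : 'rV[R]_n => (x + a)%R).
Proof.
apply: measurable_fun_matrix => i j.
under eq_fun do rewrite mxE; apply: measurable_funD => //.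
exact: measurable_entry.
Qed.

Lemma rV0_eq (x y : 'rV[R]_0) : x = y.
Proof. by apply/matrixP => i []. Qed.

Lemma ge0_integral_rV_translation n (a : 'rV[R]_n) (f : 'rV[R]_n -> \bar R) :
  mfunT f -> (forall x, 0 <= f x) ->
  \int[lebn n]_x f (x + a)%R = \int[lebn n]_x f x.
Proof.
elim: n a f => [|n ih] a f mf f0.
  by apply: eq_integral => x _; congr f; exact: rV0_eq.
have [s [w ->]] := rV_consP a.
have mfa (b : 'rV[R]_n.+1) : mfunT (fun x : 'rV[R]_n.+1 => f (x + b)%R).
  by apply: measurableT_comp mf _; exact: measurable_rV_add.
rewrite (ge0_integral_rV_cons (mfa _) (fun x => f0 _)) (ge0_integral_rV_cons mf f0).
rewrite [RHS](@ge0_integral_affine _ 1 s)//; last 2 first.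
- exact: measurable_integral_rV_cons.
- by pos.
rewrite mul1e; apply: eq_integral => t _; rewrite mul1r.
under eq_integral do rewrite rV_consD.
apply: (ih w (fun v => f (rV_cons ((t + s)%R, v)))) => //.
by apply: (measurableT_comp (measurable_rV_curry mf)).
Qed.

(** Row vectors carry the maximum norm: balls are cubes, and their volume is computed one coordinate
    at a time. *)
Lemma norm_rV_cons n (t : R) (v : 'rV[R]_n) : `|rV_cons (t, v)|%R = Num.max `|t|%R `|v|%R.
Proof.
rewrite /Num.norm/= !mx_normrE; apply/le_anti/andP; split.
  apply: bigmax_le => [|[i j] _]; first by rewrite le_max normr_ge0.
  rewrite /= /rV_cons le_max !ord1.
  have [k ->|k ->] := split_ordP (j : 'I_(1 + n)).
    by rewrite (row_mxEl (t%:M) v) mxE !ord1 eqxx mulr1n lexx.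
  rewrite (row_mxEr (t%:M) v); apply/orP; right.
  exact: (le_bigmax _ (fun ij : 'I_1 * 'I_n => `|v ij.1 ij.2|%R) (0%R, k)).
rewrite ge_max; apply/andP; split.
  have := @le_bigmax _ _ _ 0%R (fun ij : 'I_1 * 'I_n.+1 => `|rV_cons (t, v) ij.1 ij.2|%R) (0%R, 0%R).
  congr (_ <= _)%R; rewrite /= /rV_cons.
  have -> : (0%R : 'I_n.+1) = lshift n (0%R : 'I_1) by exact/val_inj.
  by rewrite (row_mxEl (t%:M) v) mxE.
apply: bigmax_le => [|[i j] _]; first by apply: bigmax_ge_id.
have := @le_bigmax _ _ _ 0%R (fun ij : 'I_1 * 'I_n.+1 => `|rV_cons (t, v) ij.1 ij.2|%R) (0%R, rshift 1 j).
by rewrite /= /rV_cons (row_mxEr (t%:M) v) !ord1.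
Qed.

Lemma continuous_norm_rV n : continuous (fun x : 'rV[R]_n => `|x|%R).
Proof. exact: norm_continuous. Qed.

Lemma measurable_norm_rV n : mfunT (fun x : 'rV[R]_n => `|x|%R : R).
Proof. by apply: continuous_measurable_rV; exact: continuous_norm_rV. Qed.

Lemma measurable_cube n (r : R) : measurable [set x : 'rV[R]_n | (`|x| <= r)%R].
Proof.
rewrite -[X in measurable X]setTI.
rewrite (_ : [set x | _] = (fun x : 'rV[R]_n => `|x|%R : R) @^-1` `]-oo, r]); last first.
  by [].
exact: measurable_norm_rV.
Qed.

Lemma rV_lebesgue_cube n (r : R) : (0 <= r)%R ->
  lebn n [set x : 'rV[R]_n | (`|x| <= r)%R] = ((2 * r) ^+ n)%:E.
Proof.
move=> r0; elim: n => [|n ih].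
  by rewrite expr0 /= diracE mem_set//= normr0.
rewrite -(setIT [set _ | _]) -integral_indic//; last exact: measurable_cube.
rewrite ge0_integral_rV_cons//; last first.
  by apply/measurable_EFinP/measurable_indicP; exact: measurable_cube.
transitivity (\int[leb]_t (((2 * r) ^+ n)%:E * (\1_(`[(- r)%R, r]%classic) t)%:E)).
  have ih' : \int[lebn n]_v (\1_[set v : 'rV[R]_n | (`|v| <= r)%R] v)%:E = ((2 * r) ^+ n)%:E.
    by rewrite integral_indic ?setIT//; exact: measurable_cube.
  apply: eq_integral => t _; rewrite -ih'.
  rewrite muleC -ge0_integralZl_EFin//; last first.
    by apply/measurable_EFinP/measurable_indicP; exact: measurable_cube.
  apply: eq_integral => v _; rewrite -EFinM !indicE; congr (_%:E).
  rewrite -natrM mulnb; congr (_%:R); congr nat_of_bool.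
  apply/idP/andP.
    rewrite inE /= norm_rV_cons ge_max => /andP[h1 h2].
    by split; rewrite inE //= in_itv/= -ler_norml.
  move=> []; rewrite !inE/= in_itv/= -ler_norml => h1 h2.
  by rewrite norm_rV_cons ge_max h1.
rewrite ge0_integralZl_EFin//; last 2 first.
- by meas.
- by pos.
rewrite integral_indic_itv [X in _ * X]lebesgue_measure_itv/= lte_fin.
have [rN|] := ltP (- r)%R r.
  by rewrite -EFinB -EFinM opprK exprS mulrC; congr (_ * _)%:E; lra.
move=> h; have -> : r = 0%R by lra.
by rewrite mule0 mulr0 exprS mul0r.
Qed.

(* Tonelli applied to [f (x - y) g x], using the invariance of [nu], then of
   [lebn n]. *)
Lemma translation_invariant_le n (nu : {sigma_finite_measure set 'rV[R]_n -> \bar R}) (C : R) :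
  (forall (a : 'rV[R]_n) (f : 'rV[R]_n -> \bar R), mfunT f ->
    (forall x, 0 <= f x) -> \int[nu]_x f (x + a)%R = \int[nu]_x f x) ->
  nu [set x | (`|x| <= 1)%R] <= C%:E ->
  exists2 C' : R, (0 <= C')%R & forall g : 'rV[R]_n -> \bar R, mfunT g ->
    (forall x, 0 <= g x) -> \int[nu]_x g x <= C'%:E * \int[lebn n]_x g x.
Proof.
move=> nuT nuC.
pose Q := [set x : 'rV[R]_n | (`|x| <= 1)%R].
have mQ : measurable Q by exact: measurable_cube.
pose f (x : 'rV[R]_n) : \bar R := (\1_Q x)%:E.
have f0 x : 0 <= f x by rewrite lee_fin.
have mf : mfunT f by apply/measurable_EFinP/measurable_indicP.
have fN (x : 'rV[R]_n) : f (- x)%R = f x.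
  by rewrite /f !indicE (_ : ((- x)%R \in Q) = (x \in Q))//; apply/idP/idP; rewrite !inE /Q/= normrN.
have C0 : (0 <= C)%R by rewrite -lee_fin; apply: le_trans nuC.
exists (C / 2 ^+ n)%R; first by rewrite divr_ge0// exprn_ge0.
move=> g mg g0.
have lebQ : \int[lebn n]_x f x = (2 ^+ n)%:E.
  transitivity (lebn n Q); first by rewrite integral_indic// setIT.
  by rewrite [LHS]rV_lebesgue_cube// mulr1.
have nuQ : \int[nu]_x f x <= C%:E by rewrite integral_indic// setIT.
have msub : mfunT (fun p : 'rV[R]_n * 'rV[R]_n => (p.1 - p.2)%R).
  apply: measurable_fun_matrix => i j; under eq_fun do rewrite !mxE.
  apply: measurable_funB.
    by apply: (measurableT_comp (measurable_entry i j)).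
  by apply: (measurableT_comp (measurable_entry i j)).
have madd : mfunT (fun p : 'rV[R]_n * 'rV[R]_n => (p.2 + p.1)%R).
  apply: measurable_fun_matrix => i j; under eq_fun do rewrite !mxE.
  apply: measurable_funD.
    by apply: (measurableT_comp (measurable_entry i j)).
  by apply: (measurableT_comp (measurable_entry i j)).
have key : (2 ^+ n)%:E * \int[nu]_x g x = \int[lebn n]_x g x * \int[nu]_x f x.
  transitivity (\int[lebn n]_x \int[nu]_y (f x * g (y + x)%R)).
    rewrite -lebQ muleC -ge0_integralZl//; last exact: integral_ge0.
    apply: eq_integral => x _; rewrite muleC.
    rewrite ge0_integralZl//; first by rewrite nuT.
    by apply: (measurableT_comp mg); exact: measurable_rV_add.
  rewrite (fubini_tonelli (m1 := lebn n) (m2 := nu) (fun p => f p.1 * g (p.2 + p.1)%R)); last 2 first.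
  - by meas.
  - by pos.
  transitivity (\int[nu]_y \int[lebn n]_x (f (x - y)%R * g x)).
    apply: eq_integral => y _.
    rewrite -(@ge0_integral_rV_translation n y (fun x => f (x - y)%R * g x))//; last 2 first.
    - apply: emeasurable_funM => //; apply: (measurableT_comp mf).
      exact: measurable_rV_add.
    - by pos.
    by apply: eq_integral => x _; rewrite addrK addrC.
  rewrite -(fubini_tonelli (m1 := lebn n) (m2 := nu) (fun p => f (p.1 - p.2)%R * g p.1)); last 2 first.
  - by meas.
  - by pos.
  rewrite muleC -ge0_integralZl//; last exact: integral_ge0.
  apply: eq_integral => x _ /=; under eq_integral do rewrite muleC.
  rewrite ge0_integralZl//; last first.
    apply: (measurableT_comp mf).
    apply: measurable_fun_matrix => i j; under eq_fun do rewrite !mxE.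
    by apply: measurable_funB => //; exact: measurable_entry.
  rewrite muleC; congr (_ * _); rewrite -[RHS](nuT (- x)%R f mf f0).
  by apply: eq_integral => y _; rewrite -fN opprB.
rewrite -(@lee_pmul2l _ (2 ^+ n)%:E) ?lte_fin ?exprn_gt0// key.
rewrite muleA -EFinM mulrCA divff ?gt_eqF ?exprn_gt0// mulr1 muleC.
by rewrite lee_wpmul2r// integral_ge0.
Qed.

End rV_integral.

Section radial.
Context {R : realType}.
Local Notation leb := (@lebesgue_measure R).
Local Notation lebn n := (rV_lebesgue R n).
Local Open Scope ereal_scope.

Local Notation pushm := measure_function_pushforward__canonical__measure_function_Measure.

Definition opp1 (x : measurableTypeR R) : measurableTypeR R := (- (x : R))%R.

Lemma measurable_opp1 : mfunT opp1.
Proof. exact: oppr_measurable. Qed.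

Lemma lebesgue_opp (A : set (measurableTypeR R)) :
  measurable A -> leb A = pushm leb measurable_opp1 A.
Proof.
move=> mA; apply: lebesgue_measure_unique => // _ [[x y] _ <-] /=.
rewrite /pushforward.
rewrite (_ : opp1 @^-1` _ = `[(- y)%R, (- x)%R[%classic); last first.
  apply/seteqP; split=> z; rewrite /opp1 /= !in_itv/=.
    by rewrite lerNl ltrNr andbC.
  by rewrite lerNl ltrNr andbC.
rewrite !lebesgue_measure_itv/= !lte_fin ltrN2.
by case: ifPn => // _; rewrite -!EFinB opprK addrC.
Qed.

Lemma ge0_integral_opp (f : R -> \bar R) :
  mfunT f -> (forall x, 0 <= f x) ->
  \int[leb]_x f x = \int[leb]_x f (- x)%R.
Proof.
move=> mf f0.
rewrite [LHS](eq_measure_integral (pushm leb measurable_opp1)); last first.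
  by move=> A mA _; exact: lebesgue_opp.
by rewrite (ge0_integral_pushforward measurable_opp1).
Qed.

Lemma ge0_integral_even_le (F : R -> \bar R) : mfunT F ->
  (forall x, 0 <= F x) ->
  \int[leb]_t F `|t|%R <= 2%:E * \int[leb]_(t in `[0%R, +oo[) F t.
Proof.
move=> mF F0; pose G t := F t * (\1_(`[0%R, +oo[%classic) t)%:E.
have G0 t : 0 <= G t by rewrite mule_ge0// lee_fin.
have mG : mfunT G.
  by apply: emeasurable_funM => //; exact/measurable_EFinP/measurable_indicP.
have -> : \int[leb]_(t in `[0%R, +oo[) F t = \int[leb]_t G t.
  by rewrite integral_mkcond epatch_indic.
rewrite mule_natl mule2n {2}(ge0_integral_opp mG G0).
have mGN : mfunT (fun t : R => G (- t)%R) by meas.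
rewrite -ge0_integralD//; apply: ge0_le_integral => //.
- by meas.
- exact: emeasurable_funD.
- move=> t _; rewrite /G !indicE !mem_setE !in_itv/= !andbT oppr_ge0.
  have [t0|t0] := leP 0%R t.
    by rewrite ger0_norm// mule1 leeDl// mule_ge0// lee_fin.
  by rewrite (ltW t0) ltr0_norm// mule1 mule0 add0e.
Qed.

(* Induction on the dimension through [max (|t|, |v|)]: the set where the maximum
   is attained by [|t|] contributes a factor [(2 |t|)^n]. *)
Lemma ge0_integral_radial_le n : exists2 C : R, (0 <= C)%R &
  forall F : R -> \bar R, mfunT F -> (forall r, 0 <= F r) ->
  \int[lebn n.+1]_z F `|z|%R <=
    C%:E * \int[leb]_(r in `[0%R, +oo[) (F r * (r ^+ n)%:E).
Proof.
elim: n => [|n [C C0 ih]].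
  exists 2%R => // F mF F0.
  have mFn : mfunT (fun z : 'rV[R]_1 => F `|z|%R).
    by apply: (measurableT_comp mF); exact: measurable_norm_rV.
  rewrite (ge0_integral_rV_cons mFn (fun z => F0 _)).
  rewrite (_ : \int[leb]_t \int[lebn 0]_v _ = \int[leb]_t F `|t|%R); last first.
    apply: eq_integral => t _; rewrite integral_dirac//; last first.
      apply: (measurableT_comp mF); apply: continuous_measurable_rV => v.
      have -> : (fun v : 'rV[R]_0 => `|rV_cons (t, v)|%R) = cst `|t|%R.
        apply/funext => w; rewrite norm_rV_cons (rV0_eq w 0%R) normr0.
        by apply/max_idPl.
      exact: cst_continuous.
    rewrite diracT mul1e norm_rV_cons normr0.
    by congr F; apply/max_idPl.
  under [X in _ <= _ * X]eq_integral do rewrite expr0 mule1.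
  exact: ge0_integral_even_le.
exists (2 * 2 ^+ n.+1 + 2 * C)%R; first by rewrite addr_ge0// ?mulr_ge0// exprn_ge0.
move=> F mF F0.
have mFn : mfunT (fun z : 'rV[R]_n.+2 => F `|z|%R).
  by apply: (measurableT_comp mF); exact: measurable_norm_rV.
rewrite (ge0_integral_rV_cons mFn (fun z => F0 _)).
pose G (p : measurableTypeR R * 'rV[R]_n.+1) :=
  F `|p.1|%R * (\1_[set v : 'rV[R]_n.+1 | (`|v| <= `|p.1|)%R] p.2)%:E.
pose K (p : measurableTypeR R * 'rV[R]_n.+1) :=
  F `|p.2|%R * (\1_(`[(- `|p.2|)%R, `|p.2|%R]%classic) (p.1 : R))%:E.
have mn1 : mfunT (fun p : measurableTypeR R * 'rV[R]_n.+1 => `|p.1 : R|%R : R).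
  by apply: (measurableT_comp (@measurable_realfun.normr_measurable R setT)).
have mn2 : mfunT (fun p : measurableTypeR R * 'rV[R]_n.+1 => `|p.2|%R : R).
  by apply: (measurableT_comp (@measurable_norm_rV R n.+1)).
have mind (h k : measurableTypeR R * 'rV[R]_n.+1 -> R) : mfunT h -> mfunT k ->
    mfunT (fun p => (((h p <= k p)%R : bool)%:R : R)%:E).
  move=> mh mk; apply/measurable_EFinP.
  rewrite (_ : (fun p => _) = \1_[set p | (h p <= k p)%R]); last first.
    by apply/funext => p; rewrite indicE; congr (_%:R); congr nat_of_bool; apply/idP/idP; rewrite inE.
  apply/measurable_indicP; rewrite -[X in measurable X]setTI.
  by apply: measurable_fun_le.
have GE p : G p = F `|p.1|%R * (((`|p.2| <= `|p.1 : R|)%R : bool)%:R : R)%:E.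
  by rewrite /G indicE; congr (_ * (_%:R)%:E); congr nat_of_bool; apply/idP/idP; rewrite inE.
have KE p : K p = F `|p.2|%R * (((`|p.1 : R| <= `|p.2|)%R : bool)%:R : R)%:E.
  by rewrite /K indicE; congr (_ * (_%:R)%:E); congr nat_of_bool; apply/idP/idP; rewrite inE/= in_itv/= ler_norml.
have mG : mfunT G.
  rewrite (_ : G = fun p => F `|p.1 : R|%R * (((`|p.2| <= `|p.1 : R|)%R : bool)%:R : R)%:E); last first.
    by apply/funext => p.
  by apply: emeasurable_funM; [exact: (measurableT_comp mF)|exact: mind].
have mK : mfunT K.
  rewrite (_ : K = fun p => F `|p.2|%R * (((`|p.1 : R| <= `|p.2|)%R : bool)%:R : R)%:E); last first.
    by apply/funext => p.
  by apply: emeasurable_funM; [exact: (measurableT_comp mF)|exact: mind].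
have G0 p : 0 <= G p by rewrite mule_ge0// lee_fin.
have K0 p : 0 <= K p by rewrite mule_ge0// lee_fin.
have step : \int[leb]_t \int[lebn n.+1]_v F `|rV_cons (t, v)|%R <=
    \int[leb]_t \int[lebn n.+1]_v G (t, v) + \int[lebn n.+1]_v \int[leb]_t K (t, v).
  rewrite -(fubini_tonelli (m1 := leb) (m2 := lebn n.+1) K mK K0).
  rewrite -[X in X + _](fubini_tonelli1 (m1 := leb) (m2 := lebn n.+1) G mG G0).
  rewrite -[X in _ + X](fubini_tonelli1 (m1 := leb) (m2 := lebn n.+1) K mK K0).
  rewrite -(fubini_tonelli1 (m1 := leb) (m2 := lebn n.+1) _ (measurable_rV_curry mFn) (fun p => F0 _)).
  rewrite -ge0_integralD//; apply: ge0_le_integral => //.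
  - exact: (measurable_rV_curry mFn).
  - exact: emeasurable_funD.
  - move=> [t v] _; rewrite norm_rV_cons GE KE/=.
    case: (leP `|t|%R `|v|%R) => h.
      by rewrite mule1 leeDr// mule_ge0// lee_fin.
    by rewrite (ltW h) mule1 mule0 adde0.
apply: (le_trans step).
have mFr k (c : R) : mfunT (fun r : R => F r * (c * `|r| ^+ k)%:E) by meas.
have Fr0 k (c r : R) : (0 <= c)%R -> 0 <= F r * (c * `|r| ^+ k)%:E by pos.
have swap k (c : R) : (0 <= c)%R ->
    \int[leb]_(r in `[0%R, +oo[) (F r * (c * `|r| ^+ k)%:E) =
    c%:E * \int[leb]_(r in `[0%R, +oo[) (F r * (r ^+ k)%:E).
  move=> c0; rewrite -ge0_integralZl_EFin//.
  - apply: eq_integral => r; rewrite inE/= in_itv/= andbT => r0.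
    by rewrite ger0_norm// EFinM muleCA.
  - by move=> r; rewrite /= in_itv/= andbT => r0; rewrite mule_ge0// lee_fin exprn_ge0.
  - by meas.
rewrite EFinD ge0_muleDl ?lee_fin ?mulr_ge0 ?exprn_ge0//.
apply: leeD.
  rewrite (_ : \int[leb]_t \int[lebn n.+1]_v G (t, v) = \int[leb]_t (F `|t|%R * (2 ^+ n.+1 * `| `|t| | ^+ n.+1)%:E)).
    have c0 : (0 <= 2 ^+ n.+1 :> R)%R by pos.
    have h := ge0_integral_even_le (mFr n.+1 (2 ^+ n.+1)%R) (fun r => Fr0 n.+1 _ r c0).
    apply: (le_trans h).
    by rewrite swap ?exprn_ge0// muleA -EFinM.
  apply: eq_integral => t _; rewrite /G/= ge0_integralZl//.
  - rewrite integral_indic//; last exact: measurable_cube.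
    by rewrite setIT [X in _ * X](rV_lebesgue_cube n.+1 (normr_ge0 t)) exprMn normr_id.
  - by apply/measurable_EFinP/measurable_indicP; exact: measurable_cube.
(* Integrating [t] over [|t| <= |v|] leaves the weight [2 |v|], and the induction hypothesis is
   applied to [r -> F r * 2 r]. *)
rewrite (_ : \int[lebn n.+1]_v \int[leb]_t K (t, v) = \int[lebn n.+1]_v (F `|v|%R * (2 * `| `|v| | ^+ 1)%:E)).
  have h := ih (fun r => F r * (2 * `|r| ^+ 1)%:E) (mFr 1%N 2%R) (fun r => Fr0 1%N _ r (ler0n _ 2)).
  apply: (le_trans h).
  rewrite [(2 * C)%R]mulrC EFinM -muleA lee_wpmul2l ?lee_fin// -swap//.
  apply: ge0_le_integral => //.
  - by move=> r; rewrite /= in_itv/= andbT => r0; rewrite mule_ge0 ?Fr0// lee_fin exprn_ge0.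
  - by meas.
  - by meas.
  - move=> r; rewrite /= in_itv/= andbT => r0.
    by rewrite -muleA -EFinM expr1 ger0_norm// -mulrA -exprS.
apply: eq_integral => v _; rewrite /K/= ge0_integralZl//.
- rewrite (integral_indic_itv `[_, _]) [X in _ * X]lebesgue_measure_itv/= lte_fin normr_id expr1.
  have [v0|] := ltP (- `|v|)%R `|v|%R.
    by rewrite -EFinB opprK; congr (_ * _%:E); rewrite mulr_natl mulr2n.
  move=> h; have -> : (`|v| = 0)%R by apply/le_anti; rewrite normr_ge0 andbT; lra.
  by rewrite mulr0.
- by meas.
Qed.

End radial.

(** * Smooth functions *)

Section smooth_theory.
Context {R : realType} {n : nat}.
Local Notation V := 'rV[R]_n.
Implicit Types (f g : V -> R).
Local Notation e j := (delta_mx 0 j : V).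

Lemma smooth_continuous f : smooth f -> continuous f.
Proof. by move=> /(_ [::])[]. Qed.

Lemma smooth_derivable f : smooth f -> forall j x, derivable f x (e j).
Proof. by move=> /(_ [::])[]. Qed.

Lemma smooth_partial f j : smooth f -> smooth (partial j f).
Proof.
move=> sf s; have := sf (rcons s j).
by rewrite foldr_rcons.
Qed.

(** A coinduction principle: smoothness quantifies over all iterated partial derivatives, and a
    class closed under differentiation replaces an induction over them. *)
Lemma smooth_coind (C : set (V -> R)) :
  (forall f, C f -> continuous f /\ forall j,
    (forall x, derivable f x (e j)) /\ C (partial j f)) ->
  forall f, C f -> smooth f.
Proof.
move=> CC f Cf s; suff : C (foldr partial f s).
  by move=> /CC[cf df]; split=> // j; have [] := df j.
by elim: s => //= j s /CC[_ /(_ j)[]].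
Qed.

(** The derivative of a product is a sum of products, so neither sums nor products alone are stable.
    The generated algebra is closed under differentiation. *)
Inductive smooth_expr : (V -> R) -> Prop :=
| SmoothBase f : smooth f -> smooth_expr f
| SmoothConst c : smooth_expr (fun=> c)
| SmoothAdd f g : smooth_expr f -> smooth_expr g -> smooth_expr (fun x => f x + g x)
| SmoothMul f g : smooth_expr f -> smooth_expr g -> smooth_expr (fun x => f x * g x).

Lemma smooth_expr_smooth f : smooth_expr f -> smooth f.
Proof.
move: f; apply: (@smooth_coind smooth_expr) => f0; elim=> {f0}f.
- move=> sf; split; first exact: smooth_continuous.
  by move=> j; split; [exact: smooth_derivable|exact/SmoothBase/smooth_partial].
- split=> [|j]; first by move=> x; exact: cst_continuous.
  split=> [x|]; first exact: derivable_cst.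
  rewrite (_ : partial j _ = fun=> 0); first exact: SmoothConst.
  by apply/funext => x; rewrite /partial derive_cst.
- move=> g hf [cf df] hg [cg dg]; split=> [x|j].
    by apply: (@cvgD _ _ _ (nbhs x)); [exact: cf|exact: cg].
  have [df1 df2] := df j; have [dg1 dg2] := dg j; split=> [x|].
    exact: derivableD.
  rewrite (_ : partial j _ = fun x => partial j f x + partial j g x).
    exact: SmoothAdd.
  by apply/funext => x; rewrite /partial -deriveD.
- move=> g hf [cf df] hg [cg dg]; split=> [x|j].
    by apply: (@cvgM _ _ (nbhs x)); [exact: cf|exact: cg].
  have [df1 df2] := df j; have [dg1 dg2] := dg j; split=> [x|].
    exact: derivableM.
  rewrite (_ : partial j _ = fun x => f x * partial j g x + g x * partial j f x).
    by apply: SmoothAdd; exact: SmoothMul.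
  by apply/funext => x; rewrite /partial -[RHS]/(_ *: _ + _ *: _) -deriveM.
Qed.

Lemma smooth_cst (c : R) : smooth (fun _ : V => c).
Proof. exact/smooth_expr_smooth/SmoothConst. Qed.

Lemma smoothD f g : smooth f -> smooth g -> smooth (fun x => f x + g x).
Proof. by move=> sf sg; apply/smooth_expr_smooth/SmoothAdd; exact: SmoothBase. Qed.

Lemma smoothM f g : smooth f -> smooth g -> smooth (fun x => f x * g x).
Proof. by move=> sf sg; apply/smooth_expr_smooth/SmoothMul; exact: SmoothBase. Qed.

Lemma smoothZ c f : smooth f -> smooth (fun x => c * f x).
Proof. by move=> sf; apply: smoothM; [exact: smooth_cst|exact: sf]. Qed.

Lemma smoothB f g : smooth f -> smooth g -> smooth (fun x => f x - g x).
Proof.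
move=> sf sg; under eq_fun do rewrite -mulN1r.
by apply: smoothD; [exact: sf|exact: smoothZ].
Qed.

Lemma smooth_prod (I : Type) (r : seq I) (F : I -> V -> R) :
  (forall i, smooth (F i)) -> smooth (fun x => \prod_(i <- r) F i x).
Proof.
move=> sF; elim: r => [|i r ih].
  by under eq_fun do rewrite big_nil; exact: smooth_cst.
by under eq_fun do rewrite big_cons; apply: smoothM; [exact: sF|exact: ih].
Qed.

Lemma smooth_sum (I : Type) (r : seq I) (F : I -> V -> R) :
  (forall i, smooth (F i)) -> smooth (fun x => \sum_(i <- r) F i x).
Proof.
move=> sF; elim: r => [|i r ih].
  by under eq_fun do rewrite big_nil; exact: smooth_cst.
by under eq_fun do rewrite big_cons; apply: smoothD; [exact: sF|exact: ih].
Qed.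

Lemma partialD f g j x : smooth f -> smooth g ->
  partial j (fun x => f x + g x) x = partial j f x + partial j g x.
Proof. by move=> sf sg; rewrite /partial -deriveD//; exact: smooth_derivable. Qed.

Lemma partialM f g j x : smooth f -> smooth g ->
  partial j (fun x => f x * g x) x = f x * partial j g x + g x * partial j f x.
Proof.
move=> sf sg; rewrite /partial -[RHS]/(_ *: _ + _ *: _) -deriveM//;
exact: smooth_derivable.
Qed.

Lemma partialZ c f j x : smooth f ->
  partial j (fun x => c * f x) x = c * partial j f x.
Proof.
move=> sf; rewrite (partialM _ _ (smooth_cst c) sf).
by rewrite {2}/partial derive_cst mulr0 addr0.
Qed.

Lemma partial_sum (I : Type) (r : seq I) (F : I -> V -> R) j x :
  (forall i, smooth (F i)) ->
  partial j (fun x => \sum_(i <- r) F i x) x = \sum_(i <- r) partial j (F i) x.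
Proof.
move=> sF; elim: r => [|i r ih].
  rewrite big_nil (_ : (fun _ => _) = cst 0); first by rewrite /partial derive_cst.
  by apply/funext => y; rewrite big_nil.
rewrite big_cons -ih -partialD//; last exact: smooth_sum.
by congr partial; apply/funext => y; rewrite big_cons.
Qed.

Lemma measurable_smooth f : smooth f -> mfunT f.
Proof. by move=> /smooth_continuous; exact: continuous_measurable_rV. Qed.

Lemma is_derive_line f (x v : V) t : derivable f (x + t *: v) v ->
  is_derive t (1 : R) (fun s : R => f (x + s *: v)) ('D_v f (x + t *: v)).
Proof.
move=> dfx.
have E : (fun h : R => h^-1 *: (((fun s : R => f (x + s *: v)) \o shift t) (h *: 1) - f (x + t *: v)))
    = (fun h : R => h^-1 *: ((f \o shift (x + t *: v)) (h *: v) - f (x + t *: v))).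
  apply/funext => h /=; congr (_ *: (f _ - _)).
  by rewrite -[h%:A]/(h * 1) mulr1 scalerDl addrCA.
by split; rewrite ?/derivable ?/derive E.
Qed.

(** The vertices of a path from [p] to [q] along the coordinate axes; it stays in the cube around
    [p] with radius [|q - p|]. *)
Definition mix (k : nat) (p q : V) : V := \row_j (if (j < k)%N then q 0 j else p 0 j).

Lemma norm_rV_le (x : V) (c : R) : 0 <= c -> (forall j, `|x 0 j| <= c) -> `|x| <= c.
Proof.
move=> c0 xc; rewrite [leLHS]/Num.norm/= mx_normrE.
by apply: bigmax_le => //= -[i j] _; rewrite ord1.
Qed.

Lemma coord_norm_le (x : V) j : `|x 0 j| <= `|x|.
Proof.
rewrite [leRHS]/Num.norm/= mx_normrE.
exact: (le_bigmax _ (fun ij : 'I_1 * 'I_n => `|x ij.1 ij.2|) (0, j)).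
Qed.

(* Change the coordinates one at a time and apply the one-dimensional mean value
   theorem. *)
Lemma mean_value_box f (p q : V) (K : R) :
  (forall j x, derivable f x (e j)) ->
  (forall z, `|z - p| <= `|q - p| -> forall j, `|partial j f z| <= K) ->
  `|f q - f p| <= n%:R * K * `|q - p|.
Proof.
move=> df fK.
have step k : (k <= n)%N -> `|f (mix k p q) - f p| <= k%:R * K * `|q - p|.
  elim: k => [|k ih] kn.
    rewrite (_ : mix 0 p q = p) ?subrr ?normr0 ?mul0r//.
    by apply/rowP => j; rewrite mxE.
  have {}ih := ih (ltnW kn); pose j := Ordinal kn.
  pose d := q 0 j - p 0 j.
  have mixS s : `|mix k p q + (s * d) *: e j - p| <= `|q - p| \/ ~ (0 <= s <= 1).
    have [/andP[s0 s1]|] := pselect (0 <= s <= 1); last by right.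
    left; apply: norm_rV_le => // i; rewrite !mxE eqxx/=.
    have [ij|ij] := eqVneq i j.
      rewrite ij ltnn mulr1 addrAC subrr add0r /d.
      apply: le_trans (coord_norm_le (q - p) j); rewrite !mxE normrM ger0_norm//.
      by rewrite ler_piMl.
    rewrite mulr0 addr0; case: ifP => _; last by rewrite subrr normr0.
    by apply: le_trans (coord_norm_le (q - p) i); rewrite !mxE.
  have mixE : mix k.+1 p q = mix k p q + (1 * d) *: e j.
    apply/rowP => i; rewrite !mxE eqxx/= ltnS leq_eqVlt mul1r.
    have [ij|ij] := eqVneq i j.
      by rewrite ij eqxx/= ltnn mulr1 addrC subrK.
    have -> : (nat_of_ord i == k) = false.
      by apply/negbTE.
    by rewrite mulr0 addr0.
  pose g (s : R) := f (mix k p q + s *: (d *: e j)).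
  have dg (s : R) : is_derive s 1 g (d * partial j f (mix k p q + (s * d) *: e j)).
    have h : derivable f (mix k p q + (s * d) *: e j) (e j) by [].
    have {}h := is_derive_line h.
    have h2 : is_derive s (1 : R) (fun s : R => s * d) d.
      have := @is_deriveM _ _ id (cst d) s 1 1 0 (is_derive_id _ _) (is_derive_cst _ _ _).
      by rewrite scaler0 add0r -[d *: 1]/(d * 1) mulr1.
    have := is_derive1_comp (f := fun t => f (mix k p q + t *: e j)) (g := fun s => s * d) h h2.
    rewrite mulrC; congr is_derive.
    by apply/funext => t; rewrite /g /= scalerA.
  have [c /[!in_itv]/= c01 gc] := @MVT_segment _ g
      (fun s => d * partial j f (mix k p q + (s * d) *: e j)) 0 1 ler01 (fun x _ => dg x)
      (@derivable_within_continuous _ _ _ _ (fun x _ => @ex_derive _ _ _ _ _ _ _ (dg x))).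
  have g1 : g 1 = f (mix k.+1 p q) by rewrite mixE /g scalerA.
  have g0 : g 0 = f (mix k p q) by rewrite /g scale0r addr0.
  rewrite g1 g0 subr0 mulr1 in gc.
  rewrite -(subrK (f (mix k p q)) (f (mix k.+1 p q))) -addrA.
  apply: le_trans (ler_normD _ _) _.
  have b1 : `|f (mix k.+1 p q) - f (mix k p q)| <= K * `|q - p|.
    rewrite gc normrM mulrC; apply: ler_pM => //.
      by apply: fK; case: (mixS c) => // h.
    by apply: le_trans (coord_norm_le (q - p) j); rewrite !mxE.
  rewrite -natr1 mulrDl mul1r mulrDl [leRHS]addrC.
  exact: lerD b1 ih.
have := step n (leqnn n); rewrite (_ : mix n p q = q)//.
by apply/rowP => j; rewrite mxE ltn_ord.
Qed.

Lemma is_derive_coord (g : R -> R) (dg : R) i j (z : V) :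
  is_derive (z 0 i) 1 g dg ->
  is_derive z (e j) (fun z : V => g (z 0 i)) ((i == j)%:R * dg).
Proof.
move=> dgz.
have E : (fun h : R => h^-1 *: (((fun z : V => g (z 0 i)) \o shift z) (h *: e j) - g (z 0 i)))
    = (fun h : R => (i == j)%:R *: (h^-1 *: ((g \o shift (z 0 i)) (h *: 1) - g (z 0 i)))).
  apply/funext => h /=; rewrite !mxE eqxx/=.
  case: (i == j); first by rewrite !scale1r -[h%:A]/(h * 1).
  by rewrite mulr0 add0r subrr scaler0 scale0r.
have c : (fun h : R => h^-1 *: ((g \o shift (z 0 i)) (h *: 1) - g (z 0 i))) @ 0^' --> 'D_1 g (z 0 i).
  exact: (@ex_derive _ _ _ _ _ _ _ dgz).
have c' : (fun h : R => (i == j)%:R *: (h^-1 *: ((g \o shift (z 0 i)) (h *: 1) - g (z 0 i))))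
    @ 0^' --> (i == j)%:R * dg.
  by rewrite -(@derive_val _ _ _ _ _ _ _ dgz); apply: (cvgZl_tmp (k := (i == j)%:R)).
split; first by rewrite /derivable E; apply/cvg_ex; exists ((i == j)%:R * dg).
by rewrite /derive E; exact/cvg_lim.
Qed.

(** The multiples of the functions [F k (z 0 i)] form a class closed under partial derivatives. *)
Lemma smooth_coord (F : nat -> R -> R) i :
  (forall k (x : R), is_derive x (1 : R) (F k) (F k.+1 x)) ->
  smooth (fun z : V => F 0%N (z 0 i)).
Proof.
move=> dF; apply: (@smooth_coind [set f | exists c k, f = fun z : V => c * F k (z 0 i)]); last first.
  by exists 1, 0%N; apply/funext => z; rewrite mul1r.
move=> _ [c [k ->]].
have dz j (z : V) : is_derive z (e j) (fun z : V => c * F k (z 0 i)) (c * ((i == j)%:R * F k.+1 (z 0 i))).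
  have := @is_deriveZ _ _ _ (fun z : V => F k (z 0 i)) c z (e j) _ (is_derive_coord j (dF k (z 0 i))).
  by [].
split=> [z|j].
  apply: (@cvgM _ _ (nbhs z)); first exact: cvg_cst.
  apply: (@continuous_comp _ _ _ (fun z : V => z 0 i) (F k)); first exact: coord_continuous.
  by apply: differentiable_continuous; apply/derivable1_diffP.
split=> [z|]; first exact: (@ex_derive _ _ _ _ _ _ _ (dz j z)).
exists (c * (i == j)%:R), k.+1; apply/funext => z.
by rewrite /partial (@derive_val _ _ _ _ _ _ _ (dz j z)) mulrA.
Qed.

Lemma coord_deriv_seq : forall k (x : R), is_derive x 1
  (nth (fun=> 0) [:: id; fun=> 1] k) (nth (fun=> 0 : R) [:: id; fun=> 1] k.+1 x).
Proof.
case=> [|[|k]] x /=; first exact: is_derive_id.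
  exact: is_derive_cst.
by rewrite nth_nil; exact: is_derive_cst.
Qed.

Lemma smooth_proj i : smooth (fun z : V => z 0 i).
Proof. exact: (smooth_coord i coord_deriv_seq). Qed.

Lemma partial_proj i j (z : V) : partial j (fun z : V => z 0 i) z = (i == j)%:R.
Proof.
have := is_derive_coord j (is_derive_id (z 0 i) (1 : R)).
by move=> /(@derive_val _ _ _ _ _ _ _); rewrite mulr1.
Qed.

(** Directional derivatives along arbitrary vectors. After subtracting the linear part of [f] at
    [x], all partial derivatives are small near [x], and [mean_value_box] makes the remainder small
    compared with [h]. *)
Lemma smooth_is_derive f x v : smooth f ->
  is_derive x v f (\sum_j v 0 j * partial j f x).
Proof.
move=> sf; set l := \sum_j _.
suff c : (fun h : R => h^-1 *: ((f \o shift x) (h *: v) - f x)) @ 0^' --> l.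
  by split; [apply/cvg_ex; exists l|exact/cvg_lim].
pose g z := f z - \sum_j partial j f x * z 0 j.
have sl : smooth (fun z : V => \sum_j partial j f x * z 0 j).
  by apply: smooth_sum => j; apply: smoothZ; exact: smooth_proj.
have sg : smooth g by exact: smoothB.
have pg j z : partial j g z = partial j f z - partial j f x.
  rewrite /g; under [X in partial j X]eq_fun do rewrite -mulN1r.
  rewrite (partialD _ _ sf (smoothZ (-1) sl)) (partialZ _ _ _ sl) mulN1r; congr (_ - _).
  rewrite partial_sum; last by move=> i; apply: smoothZ; exact: smooth_proj.
  under eq_bigr => i _ do rewrite (partialZ _ _ _ (smooth_proj i)) partial_proj.
  rewrite (bigD1 j)//= big1 ?addr0; first by rewrite eqxx mulr1.
  by move=> i ij; rewrite (negbTE ij) mulr0.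
apply/cvgrPdist_le => eps eps0.
pose K := eps / (n%:R * `|v| + 1).
have K0 : 0 < K by rewrite divr_gt0.
have [del /= del0 delP] : exists2 del, 0 < del & forall z, `|z - x| < del ->
    forall j, `|partial j f z - partial j f x| <= K.
  have : \forall z \near x, forall j, `|partial j f x - partial j f z| <= K.
    apply: (@filter_forall _ _ _ (nbhs x)) => j.
    have c : partial j f @ x --> partial j f x.
      exact: (@smooth_continuous _ (smooth_partial j sf) x).
    by move/cvgrPdist_le : c => /(_ _ K0).
  move=> /nbhs_ballP[del /= del0 delP]; exists del => // z zx j.
  by rewrite distrC; apply: delP; rewrite -ball_normE /= distrC.
near=> h.
have h0 : h != 0 by near: h; exact: nbhs_dnbhs_neq.
have hv : `|h| * `|v| < del.
  have h1 : `|h| < del / (`|v| + 1).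
    near: h; apply: dnbhs0_lt; rewrite divr_gt0// ltr_wpDl//.
  rewrite ltr_pdivlMr ?ltr_wpDl// in h1.
  by apply: le_lt_trans h1; rewrite ler_wpM2l// lerDl.
have := @mean_value_box g x (x + h *: v) K (smooth_derivable sg).
rewrite (addrC x) addrK normrZ => /(_ _)/wrap[|mv].
  by move=> z zx j; rewrite pg; apply: delP; exact: le_lt_trans hv.
have E : l - h^-1 *: ((f \o shift x) (h *: v) - f x) = - (h^-1 * (g (h *: v + x) - g x)).
  have S : \sum_j partial j f x * (h *: v + x) 0 j =
      \sum_j partial j f x * x 0 j + h * l.
    rewrite mulr_sumr -big_split/=; apply: eq_bigr => j _.
    by rewrite !mxE; ring.
  rewrite /g S /= -[_ *: _]/(_ * _).
  by field.
rewrite E normrN normrM normfV.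
rewrite ler_pdivrMl ?normr_gt0//.
apply: le_trans mv _.
rewrite mulrAC [n%:R * _]mulrCA -mulrA ler_wpM2l//.
have -> : eps = (n%:R * `|v| + 1) * K by rewrite /K mulrC divfK// gt_eqF.
by rewrite ler_wpM2r ?(ltW K0)// lerDl.
Unshelve. all: end_near. Qed.

End smooth_theory.

(** * Test functions *)

Section semi_density.
Context {R : realType} {V : lmodType R}.
Variables (D : set V) (q : V -> V -> R).
Hypothesis Q : semi_ip D q.

Lemma semi_ip_sqD x y : D x -> D y -> q (x + y) (x + y) <= 2 * q x x + 2 * q y y.
Proof.
move=> Dx Dy; have Ds := semi_ipDD Q Dx Dy; have Dd := semi_ipDB Q Dx Dy.
have := semi_ip_ge0 Q Dd.
rewrite (semi_ipBl Q Dx Dy Dd) (semi_ipDl Q Dx Dy Ds).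
rewrite !(semi_ipBr Q Dx Dy)// !(semi_ipDr Q Dx Dy)// (semi_ip_sym Q Dy Dx).
by move=> h; lra.
Qed.

Lemma semi_ipBC x y : D x -> D y -> q (x - y) (x - y) = q (y - x) (y - x).
Proof.
move=> Dx Dy; have Dd := semi_ipDB Q Dx Dy; have Dd' := semi_ipDB Q Dy Dx.
rewrite (semi_ipBl Q Dx Dy Dd) (semi_ipBl Q Dy Dx Dd').
by rewrite !(semi_ipBr Q Dx Dy)// !(semi_ipBr Q Dy Dx)//; ring.
Qed.

(** The projection theorem: the closure [D'] of [M] in [D] is complete, so Riesz yields the
    projection [p] of [u] onto it. The difference [u - p] is orthogonal to [M], hence null by
    hypothesis. *)
Theorem semi_dense (M : set V) : semi_complete D q -> M `<=` D -> M 0 ->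
  (forall a x y, M x -> M y -> M (a *: x + y)) ->
  (forall u, D u -> (forall m, M m -> q u m = 0) -> q u u = 0) ->
  forall u (e : R), D u -> 0 < e -> exists2 m, M m & q (u - m) (u - m) < e.
Proof.
move=> cpl MD M0 ML Mperp.
pose D' := [set u | D u /\ forall e : R, 0 < e -> exists2 m, M m & q (u - m) (u - m) < e].
have D'D u : D' u -> D u by case.
have MD' m : M m -> D' m.
  move=> Mm; split; first exact: MD.
  by move=> e e0; exists m => //; rewrite subrr (semi_ip0l Q)//; exact: (semi_ip_dom0 Q).
have Q' : semi_ip D' q.
  split=> [|a x y [Dx Mx] [Dy My]|a x y z /D'D ? /D'D ? /D'D ?|x y /D'D ? /D'D ?|x /D'D ?].
  - exact: MD'.
  - split=> [|e e0]; first exact: (semi_ip_dom Q).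
    have a1 : 0 < a ^+ 2 + 1 by nra.
    have [|x' Mx' xx'] := Mx (e / (a ^+ 2 + 1) / 4); first by rewrite !divr_gt0.
    have [|y' My' yy'] := My (e / 4); first by rewrite divr_gt0.
    exists (a *: x' + y'); first exact: ML.
    have Dxx := semi_ipDB Q Dx (MD _ Mx'); have Dyy := semi_ipDB Q Dy (MD _ My').
    rewrite opprD addrACA -scalerBr.
    apply: le_lt_trans (semi_ip_sqD (semi_ipDZ Q a Dxx) Dyy) _.
    rewrite (semi_ipZl Q) ?(semi_ipZr Q)//; last exact: (semi_ipDZ Q).
    rewrite mulrA -expr2.
    have h : a ^+ 2 * q (x - x') (x - x') <= (a ^+ 2 + 1) * q (x - x') (x - x').
      by rewrite ler_wpM2r ?(semi_ip_ge0 Q)// lerDl.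
    have : (a ^+ 2 + 1) * q (x - x') (x - x') < e / 4.
      by rewrite mulrC -ltr_pdivlMr// mulrAC.
    by move: h yy'; lra.
  - exact: (semi_ip_linear Q).
  - exact: (semi_ip_sym Q).
  - exact: (semi_ip_ge0 Q).
have cpl' : semi_complete D' q.
  move=> u_ Du cu; have [k|u Du' uu] := cpl u_ _ cu; first exact: D'D.
  exists u => //; split=> // e e0.
  have e4 : 0 < e / 4 by pos.
  have [N /(_ N (leqnn N)) hN] := uu _ e4.
  have [DN /(_ _ e4)[m Mm um]] := Du N; exists m => //.
  have -> : u - m = (u - u_ N) + (u_ N - m) by rewrite addrA subrK.
  apply: le_lt_trans (semi_ip_sqD (semi_ipDB Q Du' DN) (semi_ipDB Q DN (MD _ Mm))) _.
  by rewrite (semi_ipBC Du' DN); move: hN um; lra.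
move=> u e Du e0.
have [p [Dp pM] pP] : exists2 p, D' p & forall v, D' v -> q p v = q u v.
  apply: (semi_riesz Q' (semi_ip_ge0 Q Du) cpl').
    move=> a x y /D'D Dx /D'D Dy.
    by rewrite (semi_ipDr Q) ?(semi_ipZr Q)//; exact: (semi_ipDZ Q).
  by move=> x /D'D Dx; exact: (semi_ip_CS Q).
have Dup := semi_ipDB Q Du Dp.
have up0 : q (u - p) (u - p) = 0.
  apply: Mperp => // m Mm; rewrite (semi_ipBl Q)//; last exact: MD.
  by rewrite pP ?subrr//; exact: MD'.
have [|m Mm pm] := pM (e / 2); first by rewrite divr_gt0.
exists m => //.
have -> : u - m = (u - p) + (p - m) by rewrite addrA subrK.
apply: le_lt_trans (semi_ip_sqD Dup (semi_ipDB Q Dp (MD _ Mm))) _.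
by rewrite up0; move: pm; lra.
Qed.

End semi_density.

Section real_integrals.
Context d (T : measurableType d) (R : realType) (mu : {measure set T -> \bar R}).
Variables (D : set T) (mD : measurable D).

Lemma Rintegral_dominated (f_ : nat -> T -> R) (f g : T -> R) :
  (forall k, measurable_fun D (f_ k)) ->
  (forall x, D x -> f_ k x @[k --> \oo] --> f x) ->
  mu.-integrable D (EFin \o g) -> (forall k x, D x -> `|f_ k x| <= g x) ->
  mu.-integrable D (EFin \o f) /\
  (\int[mu]_(x in D) f_ k x)%R @[k --> \oo] --> (\int[mu]_(x in D) f x)%R.
Proof.
move=> mf_ f_f ig fg.
have mf : measurable_fun D f.
  exact: (measurable_fun_cvg mf_).
have [|||||] := @dominated_convergence _ _ _ mu D mD (fun k => EFin \o f_ k) (EFin \o f) (EFin \o g).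
- by move=> k; exact/measurable_EFinP.
- exact/measurable_EFinP.
- by apply: aeW => x Dx; apply: cvg_EFin; [exact: nearW|exact: f_f].
- by [].
- by apply: aeW => x k Dx; rewrite /= lee_fin fg.
move=> i _ c; split=> //.
have h := fine_cvg (f := fun k => (\int[mu]_(x in D) (f_ k x)%:E)%E) (a := (\int[mu]_(x in D) f x)%R).
by apply: h; rewrite /Rintegral fineK//; exact: integrable_fin_num.
Qed.

Definition rip (f g : T -> R) : R := (\int[mu]_(x in D) (f x * g x))%R.

Lemma rip_sq f : rip f f = fine (rL2sq mu D f).
Proof. by []. Qed.

Lemma rL2_semi_ip : semi_ip (rL2 mu D) rip.
Proof.
have h0 : rL2 mu D (0 : T -> R).
  split; first exact: measurable_cst.
  by rewrite /rL2sq (eq_integral (cst 0%E)) ?integral0// => x _; rewrite /= expr0n.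
have hL a f g : rL2 mu D f -> rL2 mu D g -> rL2 mu D (a *: f + g).
  by move=> hf hg; apply: (rL2D mD (rL2Z mD a hf) hg).
split=> //.
- move=> a f g h hf hg hh; rewrite /rip.
  have i1 := rL2_mul_integrable mD hf hh; have i2 := rL2_mul_integrable mD hg hh.
  rewrite -RintegralZl// -RintegralD//; last first.
    exact: (@integrableZl _ _ _ mu D mD a (fun x => (f x * h x)%:E) i1).
  by apply: eq_Rintegral => x _; rewrite fctE mulrDl -mulrA.
- by move=> f g *; apply: eq_Rintegral => x _; rewrite mulrC.
- by move=> f hf; apply: Rintegral_ge0 => x _; rewrite -expr2 sqr_ge0.
Qed.

Lemma rL2_semi_complete : semi_complete (rL2 mu D) rip.
Proof.
have fin f : rL2 mu D f -> (rL2sq mu D f = (rip f f)%:E).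
  by move=> hf; rewrite rip_sq fineK// rL2_fin.
move=> f_ hf cf.
have [|f f2 fc] := rL2_complete mD hf.
  move=> e e0; have [N hN] := cf _ e0; exists N => m k Nm Nk.
  have := ltW (hN _ _ Nm Nk); rewrite -lee_fin -fin//.
  exact: (rL2B mD).
exists f => // e e0; have e2 : 0 < e / 2 by rewrite divr_gt0.
have [N hN] := fc _ e2; exists N => m Nm.
have := hN _ Nm; rewrite fin ?lee_fin; last exact: (rL2B mD).
by lra.
Qed.

End real_integrals.

(** * Smooth cutoffs built from the function exp (- 1 / x) *)

Section flat_function.
Variable R : realType.

(* [flat k] is the k-th derivative of [exp (- 1 / x)], extended by 0. *)
Fixpoint flat_poly (k : nat) : {poly R} :=
  if k is k'.+1 then 'X^2 * (flat_poly k' - (flat_poly k')^`()) else 1.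

Definition flat (k : nat) (x : R) : R :=
  if 0 < x then (flat_poly k).[x^-1] * expR (- x^-1) else 0.

Lemma horner_le (p : {poly R}) : exists2 C : R, 0 <= C &
  forall y, 1 <= y -> `|p.[y]| <= C * y ^+ size p.
Proof.
exists (\sum_(i < size p) `|p`_i|); first exact: sumr_ge0.
move=> y y1; rewrite horner_coef mulr_suml.
apply: le_trans (ler_norm_sum _ _ _) _; apply: ler_sum => i _.
have y0 : 0 <= y by apply: le_trans y1.
rewrite normrM ler_wpM2l// ger0_norm ?exprn_ge0//.
by rewrite ler_weXn2l// ltnW.
Qed.

(** The exponential of [1 / x] dominates every power of [1 / x]. The exponent 2 is chosen because it
    makes the difference quotient at 0 of size [O(h)], so that every derivative extends by 0. *)
Lemma flat_le k : exists2 C : R, 0 <= C & forall x, `|x| <= 1 -> `|flat k x| <= C * x ^+ 2.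
Proof.
have [C C0 hC] := horner_le (flat_poly k).
set m := size _ in hC.
exists (C * (m.+2)`!%:R) => [|x x1]; first by rewrite mulr_ge0.
rewrite /flat; case: ifPn => [x0|_]; last first.
  by rewrite normr0 mulr_ge0 ?sqr_ge0// mulr_ge0.
have y0 : 0 < x^-1 by pos.
have y1 : 1 <= x^-1 by rewrite invf_ge1//; move: x1; rewrite gtr0_norm.
have e0 : 0 < expR x^-1 by exact: expR_gt0.
rewrite normrM (ger0_norm (expR_ge0 _)) expRN ler_pdivrMr//.
apply: le_trans (hC _ y1) _; rewrite -!mulrA ler_wpM2l//.
have h := @expR_ge1Dxn R x^-1 m.+1 (ltW y0).
have h2 : x^-1 ^+ m.+2 <= (m.+2)`!%:R * expR x^-1.
  rewrite mulrC -ler_pdivrMr//; apply: le_trans h; by rewrite lerDr.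
have h3 : x ^+ 2 * x^-1 ^+ m.+2 = x^-1 ^+ m.
  by rewrite -[m.+2]/(2 + m)%N exprD mulrA -exprMn divff ?gt_eqF// expr1n mul1r.
by nra.
Qed.

Lemma flat_ge0 x : 0 <= flat 0 x.
Proof. by rewrite /flat; case: ifP => // _; rewrite /= hornerC//. Qed.

Lemma flat_le1 x : flat 0 x <= 1.
Proof.
rewrite /flat; case: ifP => // x0; rewrite /= hornerC mul1r -expR0 ler_expR.
by rewrite oppr_le0 invr_ge0 ltW.
Qed.

Lemma flat_eq0 k x : x <= 0 -> flat k x = 0.
Proof. by move=> x0; rewrite /flat ltNge x0. Qed.

Lemma is_derive_flat k (x : R) : is_derive x (1 : R) (flat k) (flat k.+1 x).
Proof.
have [x0|x0|->] := ltgtP x 0.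
- rewrite (flat_eq0 _ (ltW x0)).
  have h : is_derive x (1 : R) (cst (0 : R)) 0 by exact: is_derive_cst.
  apply: (near_eq_is_derive _ h).
  by near=> y; rewrite flat_eq0//; apply: ltW; near: y; exact: lt_nbhsl.
- have xN : x != 0 by rewrite gt_eqF.
  have di : is_derive x (1 : R) (fun y : R => y^-1) (- x ^- 2).
    have := @is_deriveV _ id x 1 1 xN (is_derive_id _ _).
    by rewrite -[_ *: _]/(_ * _) mulr1.
  have dp : is_derive x^-1 (1 : R) (horner (flat_poly k)) ((flat_poly k)^`().[x^-1]).
    have := @derivable_horner R (flat_poly k) x^-1.
    by move=> h; split=> //; rewrite derivE derive1E.
  have d1 := is_derive1_comp (f := horner (flat_poly k)) (g := fun y => y^-1) dp di.
  have d2 := is_derive1_comp (f := expR) (g := fun y => - y^-1) (is_derive_expR _)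
     (@is_deriveN _ _ _ (fun y : R => y^-1) x 1 _ di).
  have := @is_deriveM _ _ _ _ x 1 _ _ d1 d2.
  move=> h; apply: is_derive_eq.
    apply: (near_eq_is_derive _ h).
    by near=> y; rewrite /flat ifT//; near: y; exact: lt_nbhsr.
  rewrite /flat x0 /= !hornerE -![_ *: _]/(_ * _) /=.
  by field.
- suff c : (fun h : R => h^-1 *: ((flat k \o shift 0) (h *: 1) - flat k 0)) @ 0^' --> (0 : R).
    rewrite (flat_eq0 k.+1 (lexx 0)); split; first by apply/cvg_ex; exists 0.
    exact/cvg_lim.
  have [C C0 hC] := flat_le k.
  apply/cvgrPdist_le => e e0; near=> h.
  have h0 : h != 0 by near: h; exact: nbhs_dnbhs_neq.
  have h1 : `|h| <= 1 by near: h; apply: dnbhs0_le.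
  have h2 : `|h| <= e / (C + 1) by near: h; apply: dnbhs0_le; rewrite divr_gt0// ltr_wpDl.
  rewrite sub0r normrN /= addr0 (flat_eq0 k (lexx 0)) subr0.
  rewrite -[h%:A]/(h * 1) mulr1 -[_ *: _]/(_ * _) normrM normfV ler_pdivrMl ?normr_gt0//.
  apply: le_trans (hC _ h1) _; rewrite -(real_normK (num_real h)) expr2.
  rewrite mulrCA ler_wpM2l//.
  rewrite ler_pdivlMr ?ltr_wpDl// in h2.
  by apply: le_trans h2; rewrite mulrC ler_wpM2l// lerDl.
Unshelve. all: end_near. Qed.

Lemma is_derive_flat_affine (c b : R) k (x : R) :
  is_derive x (1 : R) (fun y => c ^+ k * flat k (c * y + b)) (c ^+ k.+1 * flat k.+1 (c * x + b)).
Proof.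
have d1 : is_derive x (1 : R) (fun y : R => c * y + b) c.
  have h1 := @is_deriveZ _ _ _ id c x 1 1 (is_derive_id _ _).
  have h2 := @is_deriveD _ _ _ _ (cst b) x 1 _ _ h1 (is_derive_cst _ _ _).
  by apply: is_derive_eq h2 _; rewrite addr0 -[_ *: _]/(_ * _) mulr1.
have d2 := is_derive1_comp (f := flat k) (g := fun y => c * y + b) (is_derive_flat k _) d1.
have d3 := @is_deriveZ _ _ _ _ (c ^+ k) x 1 _ d2.
by apply: is_derive_eq d3 _; rewrite -[_ *: _]/(_ * _) exprS; ring.
Qed.

(** For [t > 0] the value is [exp (- 1 / (k t))]. Products of such factors approximate indicators of
    boxes. *)
Lemma flat_scale_cvg (t : R) : flat 0 (k%:R * t) @[k --> \oo] --> ((0 < t)%R%:R : R).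
Proof.
have [t0|t0] := ltP 0 t; last first.
  under eq_fun do rewrite flat_eq0 ?mulr_ge0_le0//.
  exact: cvg_cst.
rewrite -(cvg_shiftS (fun k => flat 0 (k%:R * t))).
have E k : flat 0 (k.+1%:R * t) = expR (- (k.+1%:R^-1 * t^-1)).
  by rewrite /flat mulr_gt0//= hornerC mul1r invfM.
under eq_fun do rewrite E.
have c : (fun k => - (k.+1%:R^-1 * t^-1)) @ \oo --> - (0 * t^-1 : R).
  by apply: cvgN; apply: cvgM; [exact: cvg_harmonic|exact: cvg_cst].
have := @continuous_cvg _ _ _ _ _ _ expR _ (@continuous_expR R _) c.
by rewrite mul0r oppr0 expR0; apply.
Qed.

End flat_function.

Section test_functions.
Context {R : realType} {n : nat}.
Local Notation V := 'rV[R]_n.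
Local Notation leb := (rV_lebesgue R n).
Implicit Types (f g phi : V -> R) (D : set V).

Lemma test_supp D phi x : test_function D phi -> phi x != 0 -> D x.
Proof. by move=> [_ _ sD] px; apply/sD/subset_closure. Qed.

Lemma test_box D phi : test_function D phi ->
  exists2 M : R, 0 <= M & forall x, phi x != 0 -> `|x| <= M.
Proof.
move=> [_ /compact_bounded[M [Mr hM]] _]; exists (`|M| + 1); first by rewrite addr_ge0.
move=> x px; apply: (hM (`|M| + 1)); last exact/subset_closure.
by apply: le_lt_trans (ler_norm M) _; rewrite ltrDl.
Qed.

(** It suffices to exhibit a closed set that contains the points where [phi] is not zero, and a
    bound for these points; the closure itself need not be computed. *)
Lemma test_functionP D phi (K : set V) (M : R) : smooth phi -> closed K -> K `<=` D ->
  (forall x, phi x != 0 -> K x) -> (forall x, phi x != 0 -> `|x| <= M) -> test_function D phi.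
Proof.
move=> sphi cK KD phiK phiM.
have sK : tsupport phi `<=` K.
  by apply: (subset_trans (closure_subset phiK)).
split=> //; last exact: subset_trans KD.
apply: bounded_closed_compact; last exact: closed_closure.
have cM : closed [set x : V | `|x| <= M].
  by apply: (@preimage_closed _ _ (fun x : V => `|x|) [set y : R | y <= M]);
    [move=> x _; exact: norm_continuous|exact: closed_le].
have sM : tsupport phi `<=` [set x | `|x| <= M].
  by apply: (subset_trans (closure_subset phiM)).
exists M; split; first exact: num_real.
by move=> y My x /sM /le_trans; apply; exact: ltW.
Qed.

Lemma test_functionS D D' phi : D `<=` D' -> test_function D phi -> test_function D' phi.
Proof. by move=> DD' [? ? pD]; split=> //; exact: subset_trans DD'. Qed.

Lemma test_function_le D phi g : test_function D phi -> smooth g ->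
  (forall x, g x != 0 -> phi x != 0) -> test_function D g.
Proof.
move=> tphi sg gphi; have [M M0 hM] := test_box tphi; have [_ _ pD] := tphi.
apply: (test_functionP sg (@closed_closure _ _) pD) => x /gphi px.
  exact: subset_closure.
exact: hM.
Qed.

Lemma test_functionM D phi g : test_function D phi -> smooth g ->
  test_function D (fun x => phi x * g x).
Proof.
move=> tphi sg; apply: (test_function_le tphi); first by apply: smoothM => //; case: tphi.
by move=> x; rewrite mulf_eq0 negb_or => /andP[].
Qed.

Lemma partial_near0 f j (x : V) : (\near x, f x = 0) -> partial j f x = 0.
Proof.
move=> fx; rewrite /partial (@near_eq_derive _ _ _ _ (cst (0 : R)))//; exact: derive_cst.
Qed.

Lemma test_partial D phi j : test_function D phi -> test_function D (partial j phi).
Proof.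
move=> tphi; have [M M0 hM] := test_box tphi; have [sphi _ pD] := tphi.
have h x : partial j phi x != 0 -> tsupport phi x.
  apply: contraPP => nx; apply/negP; rewrite negbK; apply/eqP; apply: partial_near0.
  have : nbhs x (~` tsupport phi).
    by apply: open_nbhs_nbhs; split=> //; apply: closed_openC; exact: closed_closure.
  apply: filterS => y ny; apply/eqP; apply: contrapT => /negP py.
  by apply: ny; exact: subset_closure.
apply: (test_functionP (smooth_partial j sphi) (@closed_closure _ _) pD h (M := M)).
have cM : closed [set x : V | `|x| <= M].
  by apply: (@preimage_closed _ _ (fun x : V => `|x|) [set y : R | y <= M]);
    [move=> x _; exact: norm_continuous|exact: closed_le].
have sM : tsupport phi `<=` [set x | `|x| <= M].
  by apply: (subset_trans (closure_subset hM)).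
by move=> x /h/sM.
Qed.

Lemma test_functionZ D phi c : test_function D phi -> test_function D (fun x => c * phi x).
Proof.
move=> tphi; apply: (test_function_le tphi); first by apply: smoothZ; case: tphi.
by move=> x; rewrite mulf_eq0 negb_or => /andP[].
Qed.

Lemma test_functionD D phi g : test_function D phi -> test_function D g ->
  test_function D (fun x => phi x + g x).
Proof.
move=> tp tg; have [M M0 hM] := test_box tp; have [N N0 hN] := test_box tg.
have [sp _ pD] := tp; have [sg _ gD] := tg.
have cU : closed (tsupport phi `|` tsupport g) by apply: closedU; exact: closed_closure.
have pg x : phi x + g x != 0 -> phi x != 0 \/ g x != 0.
  by lra.
apply: (test_functionP (smoothD sp sg) cU (M := M + N)).
- by move=> x [/pD|/gD].
- by move=> x /pg[] h; [left|right]; exact: subset_closure.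
- by move=> x /pg[/hM|/hN] h; apply: le_trans h _; rewrite (lerDl, lerDr).
Qed.

Lemma test_function0 D : test_function D (fun _ : V => 0).
Proof.
apply: (test_functionP (smooth_cst 0) closed0 (sub0set _) (M := 0)) => x;
by rewrite eqxx.
Qed.

Lemma test_bounded D phi : test_function D phi ->
  exists2 M : R, 0 <= M & forall x, `|phi x| <= M.
Proof.
move=> [sphi cphi _].
have /compact_bounded[M [Mr hM]] : compact (phi @` tsupport phi).
  by apply: continuous_compact => //; apply: continuous_subspaceT; exact: smooth_continuous.
exists (`|M| + 1); first by rewrite addr_ge0.
move=> x; have [->|px] := eqVneq (phi x) 0; first by rewrite normr0 addr_ge0.
apply: (hM (`|M| + 1)); first by apply: le_lt_trans (ler_norm M) _; rewrite ltrDl.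
by exists x => //; exact: subset_closure.
Qed.

Lemma test_lipschitz D phi : test_function D phi ->
  exists2 K : R, 0 <= K & forall x y, `|phi x - phi y| <= K * `|x - y|.
Proof.
move=> tphi.
have /choice[M_ hM] j : exists M : R, 0 <= M /\ forall x, `|partial j phi x| <= M.
  by have [M M0 hM] := test_bounded (test_partial j tphi); exists M.
pose K := \sum_j M_ j.
have K0 : 0 <= K by apply: sumr_ge0 => j _; case: (hM j).
exists (n%:R * K) => [|x y]; first by rewrite mulr_ge0.
apply: mean_value_box => [j z|z _ j]; first by case: tphi => sphi _ _; exact: smooth_derivable.
apply: le_trans ((hM j).2 z) _; rewrite /K (bigD1 j)//= lerDl sumr_ge0// => i _.
by case: (hM i).
Qed.

Lemma cube_integrable (M r : R) : 0 <= r ->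
  leb.-integrable setT (EFin \o (fun x : V => M * \1_[set x : V | `|x| <= r] x)).
Proof.
move=> r0; rewrite (_ : _ \o _ = fun x : V => (M%:E * (\1_[set x : V | (`|x| <= r)%R] x)%:E)%E); last first.
  by [].
apply: (@integrableZl _ _ _ leb setT measurableT M (fun x : V => (\1_[set x : V | (`|x| <= r)%R] x)%:E)).
have mc : measurable [set x : V | `|x| <= r] by exact: measurable_cube.
apply/integrableP; split; first exact/measurable_EFinP.
rewrite (eq_integral (fun x : V => (\1_[set x : V | (`|x| <= r)%R] x)%:E)); last first.
  by move=> x _; rewrite /= ger0_norm.
rewrite integral_indic// setIT; have E := @rV_lebesgue_cube R n r r0.
by apply: le_lt_trans (ltry ((2 * r) ^+ n)); exact: le_of_eq.
Qed.

Lemma bounded_cube_integrable f (M r : R) : 0 <= r -> mfunT f ->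
  (forall x, `|f x| <= M) -> (forall x, f x != 0 -> `|x| <= r) ->
  leb.-integrable setT (EFin \o f).
Proof.
move=> r0 mf fM fr; have M0 : 0 <= M by apply: le_trans (fM 0).
apply: (le_integrable measurableT _ _ (cube_integrable M r0)).
  exact/measurable_EFinP.
move=> x _; rewrite /= lee_fin [leRHS]ger0_norm; last by rewrite mulr_ge0.
have [->|px] := eqVneq (f x) 0; first by rewrite normr0 mulr_ge0.
by rewrite indicE mem_set /= ?mulr1//; exact: fr.
Qed.

Lemma test_integrable D phi : test_function D phi -> leb.-integrable setT (EFin \o phi).
Proof.
move=> tphi; have [r r0 hr] := test_box tphi; have [M M0 hM] := test_bounded tphi.
apply: (bounded_cube_integrable r0 _ hM hr).
by apply: measurable_smooth; case: tphi.
Qed.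

Lemma test_rL2 D phi E : measurable E -> test_function D phi -> rL2 leb E phi.
Proof.
move=> mE tphi; have sphi : smooth phi by case: tphi.
have := test_integrable (test_functionM tphi sphi).
move=> /integrableP[_ h]; have mphi := measurable_smooth sphi.
split; first exact: measurable_funTS.
apply: le_lt_trans h.
apply: (@le_trans _ _ (\int[leb]_x (phi x ^+ 2)%:E)%E).
  apply: ge0_subset_integral => //; last by move=> x _; rewrite lee_fin sqr_ge0.
  by meas.
by apply/le_of_eq/eq_integral => x _; rewrite /= -expr2 ger0_norm ?sqr_ge0.
Qed.

End test_functions.

(** * The fundamental lemma of the calculus of variations *)

Section boxes.
Context {R : realType} {n : nat}.
Local Notation V := 'rV[R]_n.
Local Notation leb := (rV_lebesgue R n).

Definition box (a b : V) : set V := [set x | forall i, a 0 i < x 0 i < b 0 i].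

Definition boxes : set (set V) := [set B | exists a b, B = box a b].

Lemma measurable_box a b : measurable (box a b).
Proof.
rewrite (_ : box a b = \bigcap_(i in [set: 'I_n]) [set x : V | a 0 i < x 0 i < b 0 i]); last first.
  by apply/seteqP; split => y //= h i; [move=> _; exact: h|exact: h].
apply: fin_bigcap_measurable => // i _.
rewrite (_ : [set _ | _] = (fun y : V => y 0 i) @^-1` `]a 0 i, b 0 i[%classic); last first.
  by [].
by rewrite -[X in measurable X]setTI; apply: measurable_entry.
Qed.

Lemma box_setIE (a b a' b' : V) : box a b `&` box a' b' =
  box (\row_i Num.max (a 0 i) (a' 0 i)) (\row_i Num.min (b 0 i) (b' 0 i)).
Proof.
apply/seteqP; split=> x /=.
  by move=> [h h'] i; rewrite !mxE gt_max lt_min; case/andP: (h i) => -> ->; case/andP: (h' i) => -> ->.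
by move=> h; split=> i; have := h i; rewrite !mxE gt_max lt_min; move=> /andP[/andP[h1 h2]] /andP[h3 h4]; rewrite ?h1 ?h2//.
Qed.

Lemma box_setI : setI_closed boxes.
Proof. by move=> _ _ [a [b ->]] [a' [b' ->]]; rewrite box_setIE; eexists; eexists. Qed.

Lemma rV_measurable_boxes : @measurable _ V = <<s boxes >>.
Proof.
apply/seteqP; split; last first.
  apply: smallest_sub; first exact: sigma_algebra_measurable.
  by move=> _ [a [b ->]]; exact: measurable_box.
apply: (@smallest_sub _ _ _ _ (smallest_sigma_algebra _ _)).
move=> _ [i [j [A mA ->]]]; rewrite (ord1 i).
suff h : measurable_fun (setT : set (g_sigma_algebraType boxes)) (fun M : V => M 0 j).
  by have := h measurableT A mA; rewrite setTI.
apply: (measurability _ (RGenOpens.measurableE R)).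
move=> _ [_ [a [b ->] <-]]; rewrite setTI.
pose B (k : nat) := box (\row_i if i == j then a else - k%:R) (\row_i if i == j then b else k%:R).
rewrite (_ : _ @^-1` _ = \bigcup_k B k); last first.
  apply/seteqP; split=> x /=; rewrite in_itv/=.
    move=> xab; pose k := Num.bound `|x|; exists k => // l; rewrite !mxE.
    have [->//|lj] := eqVneq l j.
    rewrite -ltr_norml; apply: le_lt_trans (coord_norm_le x l) _.
    have := archi_boundP (normr_ge0 (`|x|)).
    by rewrite normr_id.
  by move=> [k _ /(_ j)]; rewrite !mxE eqxx.
apply: bigcupT_measurable => k; apply: sub_sigma_algebra.
by eexists; eexists.
Qed.

(** Boxes are stable under intersection and generate the sigma-algebra, so Dynkin's theorem extends
    the vanishing to all measurable sets. The step to complements uses that the integral over the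
    whole space vanishes, which is obtained by exhausting it with boxes. *)
Lemma ae_eq0_of_boxes (g : V -> R) : leb.-integrable setT (EFin \o g) ->
  (forall a b, (\int[leb]_(x in box a b) (g x)%:E = 0)%E) ->
  {ae leb, forall x, g x = 0}.
Proof.
move=> ig gB; have mg : mfunT g.
  by apply/measurable_EFinP; case/integrableP : ig.
have igA A : measurable A -> leb.-integrable A (EFin \o g).
  by move=> mA; apply: integrableS ig.
have gT : (\int[leb]_x (g x)%:E = 0)%E.
  pose B (k : nat) := box (const_mx (- k%:R)) (const_mx k%:R).
  have := @Rintegral_dominated _ _ _ leb setT measurableT
     (fun k => g \_ (B k)) g (fun x => `|g x|).
  case.
  - move=> k; apply/(measurable_restrictT _ _).1; first exact: measurable_box.
    by meas.
  - move=> x _; apply: cvg_near_cst; exists (Num.bound `|x|) => // k /= xk.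
    rewrite patchE mem_set// => i; rewrite !mxE -ltr_norml.
    apply: le_lt_trans (coord_norm_le x i) _.
    have := archi_boundP (normr_ge0 x) => h; apply: lt_le_trans h _.
    by rewrite ler_nat.
  - exact: (integrable_abse ig).
  - by move=> k x _; rewrite patchE; case: ifP => // _; rewrite normr0.
  move=> _ c; have c0 : (fun k => \int[leb]_x (g \_ (B k)) x) @ \oo --> (0 : R).
    rewrite (_ : (fun k => _) = fun=> 0); first exact: cvg_cst.
    by apply/funext => k; rewrite -Rintegral_mkcond /Rintegral gB.
  have := cvg_unique (@norm_hausdorff _ _) c c0 => h.
  by rewrite -(fineK (integrable_fin_num measurableT ig)) -[fine _]/(Rintegral _ _ _) h.
have gA A : measurable A -> (\int[leb]_(x in A) (g x)%:E = 0)%E.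
  rewrite {1}rV_measurable_boxes.
  apply: (@dynkin_induction _ V boxes (fun A => (\int[leb]_(x in A) (g x)%:E = 0)%E)
    rV_measurable_boxes box_setI) => //.
  - by move=> _ [a [b ->]].
  - move=> S mS S0; move: gT; rewrite -(setUv S) integral_setU ?S0 ?add0e//.
    + exact: measurableC.
    + by meas.
    + by apply/disj_setPS; rewrite setICr.
  - move=> F mF tF F0; rewrite integral_bigcup//; last first.
      by apply: igA; exact: bigcupT_measurable.
    by apply: eseries0 => i _ _.
have := @integral_ae_eq _ _ _ leb setT measurableT (cst 0%E) (EFin \o g) ig.
case=> [|E _ mE|N [mN N0 sN]]; first exact: measurable_cst.
  by rewrite integral_cst// mul0e; exact: gA.
exists N; split=> // x /= gx; apply: sN => /= h; apply: gx.
by have := h I; case.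
Qed.

(* A product of one-dimensional bumps; it tends to the indicator of the box. *)
Definition box_bump (a b : V) (k : nat) (x : V) : R :=
  \prod_i (flat 0 (k%:R * (x 0 i - a 0 i)) * flat 0 (k%:R * (b 0 i - x 0 i))).

Lemma smooth_flat_affine (c d : R) i : smooth (fun x : V => flat 0 (c * x 0 i + d)).
Proof.
have := @smooth_coord R n (fun k x => c ^+ k * flat k (c * x + d)) i (is_derive_flat_affine c d).
by under eq_fun do rewrite expr0 mul1r.
Qed.

Lemma smooth_box_bump a b k : smooth (box_bump a b k).
Proof.
apply: smooth_prod => i; apply: smoothM.
  under eq_fun do rewrite mulrBr; exact: smooth_flat_affine.
under eq_fun do rewrite mulrBr addrC -mulNr; exact: smooth_flat_affine.
Qed.

Lemma box_bump_le a b k x : 0 <= box_bump a b k x <= 1.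
Proof.
apply/andP; split; first by apply: prodr_ge0 => i _; rewrite mulr_ge0 ?flat_ge0.
apply: prodr_ile1 => i _.
by rewrite mulr_ge0 ?flat_ge0//= mulr_ile1 ?flat_ge0 ?flat_le1.
Qed.

Lemma box_bump_supp a b k x : box_bump a b k x != 0 -> box a b x.
Proof.
move=> /prodf_neq0 h i; have := h i isT; rewrite mulf_eq0 negb_or => /andP[h1 h2].
apply/andP; split; rewrite ltNge; apply/negP => h3.
  by move/negP : h1; apply; rewrite flat_eq0// mulr_ge0_le0// subr_le0.
by move/negP : h2; apply; rewrite flat_eq0// mulr_ge0_le0// subr_le0.
Qed.

Lemma box_bump_cvg a b x : box_bump a b k x @[k --> \oo] --> (\1_(box a b) x : R).
Proof.
have -> : (\1_(box a b) x : R) = \prod_i ((0 < x 0 i - a 0 i)%R%:R * (0 < b 0 i - x 0 i)%R%:R).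
  rewrite indicE; have [h|h] := boolP (x \in _).
    rewrite big1// => i _; move: h; rewrite inE => /(_ i).
    by rewrite !subr_gt0 => /andP[-> ->]; rewrite mulr1.
  have [i hi] : exists i, ~~ (a 0 i < x 0 i < b 0 i).
    apply: contrapT => /forallNP h2; move/negP: h; apply; rewrite inE => i.
    by have := h2 i; move/negP; rewrite negbK.
  rewrite (bigD1 i)//= !subr_gt0; move: hi; rewrite negb_and => /orP[]/negbTE ->;
  by rewrite ?(mulr0, mul0r).
rewrite /box_bump.
elim: (index_enum _) => [|i s ih].
  by under eq_fun do rewrite big_nil; rewrite big_nil; exact: cvg_cst.
under eq_fun do rewrite big_cons; rewrite big_cons.
by apply: cvgM; [apply: cvgM; exact: flat_scale_cvg|exact: ih].
Qed.

Lemma test_box_bump D (a b : V) k : [set x : V | forall i, a 0 i <= x 0 i <= b 0 i] `<=` D ->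
  test_function D (box_bump a b k).
Proof.
move=> cD.
apply: (@test_functionP _ _ _ _ _ (\sum_i (`|a 0 i| + `|b 0 i|)) (smooth_box_bump a b k) _ cD).
- rewrite (_ : [set _ | _] = \bigcap_(i in [set: 'I_n]) ((fun x : V => x 0 i) @^-1` `[a 0 i, b 0 i]%classic)).
    apply: closed_bigI => i _; apply: preimage_closed; last exact: itv_closed.
    by move=> x _; exact: coord_continuous.
  by apply/seteqP; split => y /= h i; [move=> _ /=; rewrite in_itv/= h|have /= := h i I; rewrite in_itv].
- by move=> x /box_bump_supp h i; case/andP: (h i) => /ltW -> /ltW ->.
- move=> x /box_bump_supp h; apply: norm_rV_le; first by apply: sumr_ge0 => i _; rewrite addr_ge0.
  move=> j; rewrite (bigD1 j)//=.
  apply: (@le_trans _ _ (`|a 0 j| + `|b 0 j|)); last first.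
    by rewrite lerDl sumr_ge0//.
  have /andP[h1 h2] := h j; rewrite ler_norml.
  have := ler_norm (b 0 j); have := ler_norm (- a 0 j); rewrite normrN.
  have := normr_ge0 (b 0 j); have := normr_ge0 (a 0 j).
  by move: h1 h2 => *; apply/andP; split; lra.
Qed.

Lemma box_cube a b : exists2 r : R, 0 <= r & box a b `<=` [set x | `|x| <= r].
Proof.
exists (\sum_i (`|a 0 i| + `|b 0 i|)); first by apply: sumr_ge0 => i _; rewrite addr_ge0.
move=> x h /=; apply: norm_rV_le; first by apply: sumr_ge0 => i _; rewrite addr_ge0.
move=> j; rewrite (bigD1 j)//=.
apply: (@le_trans _ _ (`|a 0 j| + `|b 0 j|)); last first.
  by rewrite lerDl sumr_ge0//.
have /andP[h1 h2] := h j; rewrite ler_norml.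
have := ler_norm (b 0 j); have := ler_norm (- a 0 j); rewrite normrN.
have := normr_ge0 (b 0 j); have := normr_ge0 (a 0 j).
by move: h1 h2 => *; apply/andP; split; lra.
Qed.

End boxes.

Section fundamental_lemma.
Context {R : realType} {n : nat}.
Local Notation V := 'rV[R]_n.
Local Notation leb := (rV_lebesgue R n).

Let cbox (a b : V) : set V := [set x | forall i, a 0 i <= x 0 i <= b 0 i].

Lemma box_sub_cbox (a b : V) : box a b `<=` cbox a b.
Proof. by move=> x h i; case/andP: (h i) => /ltW -> /ltW ->. Qed.

(** Cubes with rational center and radius [1 / (k + 1)] are enumerated by decoding natural numbers.
    An index without a cube, or with one whose closure leaves [U], gives [None]. *)
Lemma open_box_cover (U : set V) : open U -> exists F : nat -> option (V * V),
  (forall k a b, F k = Some (a, b) -> cbox a b `<=` U) /\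
  (forall x, U x -> exists k a b, F k = Some (a, b) /\ box a b x).
Proof.
move=> oU.
pose bx (p : 'rV[rat]_n * nat) : V * V :=
  (\row_i (ratr (p.1 0 i) - p.2.+1%:R^-1), \row_i (ratr (p.1 0 i) + p.2.+1%:R^-1)).
exists (fun k => if unpickle k is Some p then
  (if `[< cbox (bx p).1 (bx p).2 `<=` U >] then Some (bx p) else None) else None).
split=> [k a b|x Ux].
  by case: unpickle => // p; case: asboolP => // pU [aE bE]; move: pU; rewrite /= -aE -bE.
have /nbhs_ballP[e /= e0 eU] : nbhs x U by exact: open_nbhs_nbhs.
have [k ke] : exists k : nat, k.+1%:R^-1 < e / 2.
  have e20 : 0 < e / 2 by pos.
  by have [k] := ltr_add_invr e20; rewrite add0r => h; exists k.
have xq i : exists q : rat, `|x 0 i - ratr q| < k.+1%:R^-1 :> R.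
  have : x 0 i - k.+1%:R^-1 < x 0 i + k.+1%:R^-1 :> R.
    by rewrite ltrBlDr -addrA ltrDl//.
  move=> /rat_in_itvoo[q]; rewrite in_itv /= => /andP[h1 h2]; exists q.
  by rewrite distrC ltr_distl h1.
have /choice[q_ hq] := xq.
pose q : 'rV[rat]_n := \row_i q_ i.
exists (pickle (q, k)), (bx (q, k)).1, (bx (q, k)).2; rewrite pickleK.
split; last first.
  move=> i; rewrite !mxE; have := hq i.
  rewrite ltr_distl => /andP[/= h1 h2].
  by move: h1 h2; move: (k.+1%:R^-1) => z *; apply/andP.
case: asboolP => [_|]; first by case: (bx _).
case=> y yb; apply: eU; rewrite -ball_normE /=.
apply: (@le_lt_trans _ _ (k.+1%:R^-1 + k.+1%:R^-1)); last first.
  by rewrite [ltRHS]splitr ltrD.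
apply: norm_rV_le => [|i]; first by rewrite addr_ge0.
have := yb i; rewrite !mxE => /andP[h1 h2]; have := hq i; rewrite ltr_distl => /andP[h3 h4].
by rewrite ler_norml; move: h1 h2 h3 h4; move: (k.+1%:R^-1) => c *; apply/andP; split; lra.
Qed.

(** Countably many boxes with closure in [U] cover [U], so one such box is enough. The function
    restricted to it is integrable, and its integral over any other box is a limit of integrals
    against bumps. *)
Theorem fundamental_lemma (U : set V) (f : V -> R) : open U -> rL2 leb U f ->
  (forall phi, test_function U phi -> (\int[leb]_(x in U) (f x * phi x))%R = 0) ->
  {ae leb, forall x, U x -> f x = 0}.
Proof.
move=> oU f2 fphi; have mU := open_measurable_rV oU.
have [F [FU UF]] := open_box_cover oU.
suff h k : {ae leb, forall x a b, F k = Some (a, b) -> box a b x -> f x = 0}.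
  move/ae_foralln : h; apply: filterS => x h /UF[k [a [b [Fk]]]].
  exact: h Fk.
case Fk : (F k) => [[a b]|]; last by apply: aeW.
suff h : {ae leb, forall x, (f \_ (box a b)) x = 0}.
  by apply: filterS h => x h _ _ [<- <-] xab; rewrite -h patchE mem_set.
have cU := FU _ _ _ Fk.
have mb (c d : V) := measurable_box c d.
have bU : box a b `<=` U := subset_trans (@box_sub_cbox a b) cU.
have ib : leb.-integrable (box a b) (EFin \o f).
  have h1 : rL2 leb (box a b) f.
    split; first exact: measurable_funS f2.1.
    apply: le_lt_trans f2.2; apply: ge0_subset_integral => //; last by move=> *; rewrite lee_fin sqr_ge0.
    exact: measurable_sqr f2.1.
  have h2 : rL2 leb (box a b) (fun=> 1).
    split; first exact: measurable_cst.
    have [r r0 br] := box_cube a b.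
    rewrite /rL2sq (eq_integral (cst 1%E)); last by move=> x _; rewrite expr1n.
    rewrite integral_cst// mul1e.
    apply: le_lt_trans (le_measure _ _ _ br) _; rewrite ?inE//; first exact: measurable_cube.
    have E := @rV_lebesgue_cube R n r r0.
    by apply: le_lt_trans (ltry ((2 * r) ^+ n)); exact: le_of_eq.
  have := rL2_mul_integrable (mb a b) h1 h2.
  by under eq_fun do rewrite mulr1.
have ifb : leb.-integrable setT (EFin \o (f \_ (box a b))).
  rewrite -restrict_EFin; apply/(integrable_restrict _ (mb a b) measurableT).
  by rewrite setTI.
apply: (ae_eq0_of_boxes ifb) => c d.
(* The intersection of the two boxes is again a box with closure in [U], so its bumps are test
   functions of [U]. *)
have E := box_setIE a b c d; set a' := \row_i _ in E; set b' := \row_i _ in E.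
have mfU : measurable_fun U f := f2.1.
have := @Rintegral_dominated _ _ _ leb U mU (fun k x => f x * box_bump a' b' k x)
  (fun x => f x * \1_(box a' b') x) (fun x => `|(f \_ (box a b)) x|).
case.
- move=> m; apply: measurable_funM => //; apply: measurable_funTS.
  by apply: measurable_smooth; exact: smooth_box_bump.
- by move=> x Ux; apply: cvgM; [exact: cvg_cst|exact: box_bump_cvg].
- by apply: (integrableS measurableT) => //; exact: (integrable_abse ifb).
- move=> m x Ux; have [->|nz] := eqVneq (box_bump a' b' m x) 0; first by rewrite mulr0 normr0.
  have := box_bump_supp nz; rewrite -E => -[xab _].
  rewrite patchE mem_set// normrM; have /andP[h1 h2] := box_bump_le a' b' m x.
  by rewrite ler_piMr// ger0_norm.
move=> i cv.
have cv0 : (fun m => \int[leb]_(x in U) (f x * box_bump a' b' m x)) @ \oo --> (0 : R).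
  rewrite (_ : (fun m => _) = fun=> 0); first exact: cvg_cst.
  apply/funext => m; apply: fphi; apply: test_box_bump.
  move=> x h; apply: cU => l; have := h l; rewrite !mxE ge_max le_min.
  by lra.
have := cvg_unique (@norm_hausdorff _ _) cv cv0 => h.
rewrite -(fineK (integrable_fin_num _ (integrableS measurableT _ _ ifb)))//.
rewrite -[fine _]/(Rintegral _ _ _).
rewrite -[RHS]/((0 : R)%:E) -h Rintegral_mkcond [in RHS]Rintegral_mkcond; congr (_%:E).
apply: eq_Rintegral => x _; rewrite !patchE indicE -E in_setI.
case: (boolP (x \in box c d)) => xcd; case: (boolP (x \in box a b)) => xab;
  rewrite /= ?mulr0 ?mulr1 ?if_same//.
by rewrite mem_set//; apply: bU; rewrite inE in xab.
Qed.

Theorem test_functions_dense (U : set V) (f : V -> R) (e : R) : open U -> rL2 leb U f ->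
  0 < e -> exists2 phi, test_function U phi & (rL2sq leb U (fun x => (f x - phi x)%R) < e%:E)%E.
Proof.
move=> oU f2 e0; have mU := open_measurable_rV oU.
have [||||phi tphi h] := @semi_dense _ _ _ _ (@rL2_semi_ip _ _ _ leb U mU)
    (test_function U) (@rL2_semi_complete _ _ _ leb U mU) _ _ _ _ f e f2 e0.
- by move=> phi; exact: test_rL2.
- exact: test_function0.
- by move=> a f1 f2' t1 t2; apply: test_functionD => //; exact: test_functionZ.
- move=> u u2 up; rewrite rip_sq /rL2sq.
  rewrite (ae_eq_integral (cst 0%E))//.
  + by rewrite integral0.
  + exact: measurable_sqr u2.1.
  + have := fundamental_lemma oU u2 up.
    by apply: filterS => x h Ux; rewrite h// expr0n.
exists phi => //; move: h; rewrite rip_sq -lte_fin fineK//; apply: rL2_fin.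
by apply: (rL2B mU f2); exact: test_rL2 mU tphi.
Qed.

End fundamental_lemma.

(** * Mollification *)

Section translations.
Context {R : realType} {n : nat}.
Local Notation V := 'rV[R]_n.
Local Notation leb := (rV_lebesgue R n).

Lemma integral_rV_translation (a : V) (f : V -> \bar R) : mfunT f ->
  (\int[leb]_x f (x + a)%R = \int[leb]_x f x)%E.
Proof.
move=> mf; rewrite integralE [RHS]integralE; congr (_ - _)%E.
  have m1 : mfunT f^\+%E by exact: measurable_funepos.
  rewrite -(@ge0_integral_rV_translation R n a f^\+%E m1 (fun x => funepos_ge0 _ _)).
  by apply: eq_integral => x _; rewrite !unlock.
have m1 : mfunT f^\-%E by exact: measurable_funeneg.
rewrite -(@ge0_integral_rV_translation R n a f^\-%E m1 (fun x => funeneg_ge0 _ _)).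
by apply: eq_integral => x _; rewrite !unlock.
Qed.

Lemma Rintegral_rV_translation (a : V) (f : V -> R) : mfunT f ->
  (\int[leb]_x f (x + a) = \int[leb]_x f x)%R.
Proof.
move=> mf; congr fine; apply: (@integral_rV_translation a (EFin \o f)).
exact/measurable_EFinP.
Qed.

Lemma integrable_rV_translation (a : V) (f : V -> R) :
  leb.-integrable setT (EFin \o f) -> leb.-integrable setT (EFin \o (fun x : V => f (x + a))).
Proof.
move=> /integrableP[mf fi]; apply/integrableP; split.
  by apply: (measurableT_comp mf); exact: measurable_rV_add.
rewrite (integral_rV_translation a (f := fun x => `|(EFin \o f) x|%E)) //.
exact: measurableT_comp.
Qed.

Lemma measurable_rV_translation (a : V) (f : V -> R) :
  mfunT f -> mfunT (fun x : V => f (x + a)).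
Proof. by move=> mf; apply: (measurableT_comp mf); exact: measurable_rV_add. Qed.

Lemma rL2sq_translation (a : V) (f : V -> R) : mfunT f ->
  rL2sq leb setT (fun x => f (x + a)) = rL2sq leb setT f.
Proof.
move=> mf; apply: (integral_rV_translation a (f := fun x => (f x ^+ 2)%:E)).
by meas.
Qed.

Lemma partial_seq_cvg (f : V -> R) (x : V) j : derivable f x (delta_mx 0 j) ->
  (k.+1%:R * (f (x + k.+1%:R^-1 *: delta_mx 0 j) - f x)) @[k --> \oo] --> partial j f x.
Proof.
move=> /cvgr_dnbhsP; move=> /(_ (fun k => k.+1%:R^-1)).
have h : (forall k : nat, k.+1%:R^-1 != 0 :> R) /\ (k.+1%:R^-1 : R) @[k --> \oo] --> (0 : R).
  by split; [move=> k; rewrite invr_eq0 pnatr_eq0|exact: cvg_harmonic].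
move=> /(_ h); rewrite /partial /derive.
move=> c; rewrite (_ : (fun k => _) = (fun k : nat => k.+1%:R^-1^-1 *:
  ((f \o shift x) (k.+1%:R^-1 *: delta_mx 0 j) - f x)))//.
by apply/funext => k; rewrite invrK /= (addrC x).
Qed.

(** The difference quotients have integral 0 by translation invariance. They are dominated by the
    Lipschitz constant on a cube that exceeds the support by the maximal shift 1. *)
Lemma integral_partial_eq0 D (phi : V -> R) j : test_function D phi ->
  (\int[leb]_x partial j phi x)%R = 0.
Proof.
move=> tphi; have sphi : smooth phi by case: tphi.
have [K K0 hK] := test_lipschitz tphi; have [M M0 hM] := test_box tphi.
have iphi := test_integrable tphi; have mphi := measurable_smooth sphi.
pose e : V := delta_mx 0 j.
pose q (k : nat) x := k.+1%:R * (phi (x + k.+1%:R^-1 *: e) - phi x).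
have e1 : `|e| <= 1.
  apply: norm_rV_le => // i; rewrite mxE eqxx /=.
  by case: (_ == _); rewrite ?normr1 ?normr0.
have k1 k : `|k.+1%:R^-1 *: e| <= 1.
  rewrite normrZ ger0_norm// -[leRHS]mulr1 ler_pM// invf_le1//.
  by rewrite ler1n.
have iT k : leb.-integrable setT (EFin \o (fun x => phi (x + k.+1%:R^-1 *: e))).
  exact: integrable_rV_translation.
have := @Rintegral_dominated _ _ _ leb setT measurableT q (partial j phi)
  (fun x => K * \1_[set x : V | `|x| <= M + 1] x).
case.
- move=> k; apply: measurable_funM => //; apply: measurable_funB => //.
  exact: measurable_rV_translation.
- by move=> x _; apply: partial_seq_cvg; exact: smooth_derivable.
- by apply: cube_integrable; rewrite addr_ge0.
- move=> k x _.
  have [xM|xM] := leP `|x| (M + 1).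
    rewrite indicE mem_set//= mulr1.
    rewrite normrM ger0_norm//.
    have := hK (x + k.+1%:R^-1 *: e) x; rewrite addrAC subrr add0r => h.
    rewrite -ler_pdivlMl//; apply: le_trans h _.
    rewrite [leRHS]mulrC ler_wpM2l// normrZ ger0_norm//.
    by rewrite ler_piMr.
  have p0 : phi x = 0.
    apply/eqP; apply: contraTT xM => /hM h; rewrite -leNgt.
    by apply: le_trans h _; rewrite lerDl.
  have p1 : phi (x + k.+1%:R^-1 *: e) = 0.
    apply/eqP; apply: contraTT xM => /hM h; rewrite -leNgt.
    rewrite -(addrK (k.+1%:R^-1 *: e) x); apply: le_trans (ler_normB _ _) _.
    exact: lerD.
  rewrite /q p0 p1 subrr mulr0 normr0; exact: mulr_ge0.
move=> _ cv; have cv0 : (fun k => \int[leb]_x q k x)%R @ \oo --> (0 : R).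
  rewrite (_ : (fun k => _) = fun=> 0); first exact: cvg_cst.
  apply/funext => k; rewrite RintegralZl//; last exact: (integrableB measurableT (iT k) iphi).
  by rewrite RintegralB// Rintegral_rV_translation// subrr mulr0.
exact: (cvg_unique (@norm_hausdorff _ _) cv cv0).
Qed.

Lemma integral_by_parts D (phi v : V -> R) j : test_function D phi -> smooth v ->
  (\int[leb]_x (phi x * partial j v x) = - \int[leb]_x (partial j phi x * v x))%R.
Proof.
move=> tphi sv; have sphi : smooth phi by case: tphi.
have := integral_partial_eq0 j (test_functionM tphi sv).
under eq_Rintegral => x _ do rewrite (partialM _ _ sphi sv).
rewrite RintegralD//; first last.
- have := test_integrable (test_functionM (test_partial j tphi) sv).
  by apply: eq_integrable => // x _ /=; rewrite mulrC.
- exact: (test_integrable (test_functionM tphi (smooth_partial j sv))).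
move=> /eqP; rewrite addr_eq0 => /eqP ->; congr (- _).
by apply: eq_Rintegral => x _; rewrite mulrC.
Qed.

(** A test function replaces [f] at the cost [e / 12], once translated and once not. Its own
    increment is at most [e / 8] by the Lipschitz bound on a cube of volume [vol]. The factors 2 of
    the two splittings give [2 (e/12) + 2 (2 (e/8) + 2 (e/12)) = e]. *)
Lemma translation_continuous (f : V -> R) (e : R) : rL2 leb setT f -> 0 < e ->
  exists2 delta : R, 0 < delta & forall w, `|w| <= delta ->
    (rL2sq leb setT (fun y => (f (y + w) - f y)%R) <= e%:E)%E.
Proof.
move=> f2 e0; have e12 : 0 < e / 12 by rewrite divr_gt0.
have [phi tphi fphi] := test_functions_dense (@openT _) f2 e12.
have sphi : smooth phi by case: tphi.
have [K K0 hK] := test_lipschitz tphi; have [M M0 hM] := test_box tphi.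
have mphi := measurable_smooth sphi; have mf := f2.1.
pose vol := (2 * (M + 1)) ^+ n; have vol0 : 0 <= vol by rewrite exprn_ge0// mulr_ge0// addr_ge0.
pose S := K ^+ 2 * vol * 8 + 1.
have S0 : 0 < S by rewrite ltr_wpDl// !mulr_ge0 ?sqr_ge0.
pose delta := Num.min 1 (e / S).
have d0 : 0 < delta by rewrite lt_min ltr01 divr_gt0.
exists delta => // w; rewrite le_min => /andP[w1 we].
pose a := fun y => f y - phi y.
have ma : mfunT a by exact: measurable_funB.
pose b := fun y => phi (y + w) - phi y.
have mb : mfunT b by apply: measurable_funB => //; exact: measurable_rV_translation.
have mT : mfunT (fun y : V => a (y + w)) by exact: measurable_rV_translation.
have mN : mfunT (fun y => - a y) by exact: measurableT_comp.
have -> : (fun y => f (y + w) - f y) = (fun y => a (y + w) + (b y + - a y)).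
  by apply/funext => y; rewrite /a /b; ring.
have h3 := @rL2sqD _ _ _ leb setT measurableT _ _ mT (measurable_funD mb mN).
apply: le_trans h3 _.
rewrite rL2sq_translation//.
have hN : rL2sq leb setT (fun y => - a y) = rL2sq leb setT a.
  by apply: eq_integral => y _; rewrite sqrrN.
have hb : (rL2sq leb setT b <= (K ^+ 2 * `|w| ^+ 2 * vol)%:E)%E.
  pose g y : R := (K * `|w|) * \1_[set x : V | `|x| <= M + 1] y.
  have mc : measurable [set x : V | `|x| <= M + 1] by exact: measurable_cube.
  have mg : mfunT g by exact: measurable_funM.
  apply: (@le_trans _ _ (rL2sq leb setT g)).
    apply: rL2sq_le => // y _; rewrite /g [leRHS]ger0_norm; last by rewrite !mulr_ge0.
    have [xM|xM] := leP `|y| (M + 1).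
      rewrite indicE mem_set//= mulr1; apply: le_trans (hK _ _) _.
      by rewrite addrAC subrr add0r.
    have p0 : phi y = 0.
      apply/eqP; apply: contraTT xM => /hM h; rewrite -leNgt.
      by apply: le_trans h _; rewrite lerDl.
    have p1 : phi (y + w) = 0.
      apply/eqP; apply: contraTT xM => /hM h; rewrite -leNgt.
      rewrite -(addrK w y); apply: le_trans (ler_normB _ _) _.
      exact: lerD.
    by rewrite /b p0 p1 subrr normr0; apply: mulr_ge0 => //; exact: mulr_ge0.
  rewrite /g rL2sqZ// exprMn [leRHS]EFinM; apply: lee_wpmul2l.
    by pos.
  rewrite /rL2sq (eq_integral (fun x => (\1_[set x : V | (`|x| <= M + 1)%R] x)%:E)); last first.
    by move=> x _; rewrite indicE; case: (_ \in _); rewrite ?expr1n ?expr0n.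
  rewrite integral_indic// setIT.
  have E := @rV_lebesgue_cube R n (M + 1) (addr_ge0 M0 ler01).
  by apply: le_of_eq.
have hb2 : (rL2sq leb setT b <= (e / 8)%:E)%E.
  apply: le_trans hb _; rewrite lee_fin.
  have h1 : `|w| * S <= e by rewrite -ler_pdivlMr.
  have h2 : `|w| ^+ 2 <= `|w| by rewrite expr2 ler_piMl.
  have h3 : K ^+ 2 * vol * `|w| ^+ 2 <= K ^+ 2 * vol * `|w|.
    by rewrite ler_wpM2l// mulr_ge0// sqr_ge0.
  have := normr_ge0 w; move: h1 h3; rewrite /S; lra.
have ha : (rL2sq leb setT a <= (e / 12)%:E)%E by exact: ltW.
apply: (@le_trans _ _ (2%:E * (e / 12)%:E + 2%:E * (2%:E * (e / 8)%:E + 2%:E * (e / 12)%:E))%E).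
  apply: leeD; first by rewrite lee_pmul2l.
  have h4 := @rL2sqD _ _ _ leb setT measurableT _ _ mb mN.
  rewrite lee_pmul2l//; apply: le_trans h4 _.
  by rewrite hN; apply: leeD; rewrite lee_pmul2l.
rewrite -[leLHS]/((2 * (e / 12) + 2 * (2 * (e / 8) + 2 * (e / 12)))%:E) lee_fin.
lra.
Qed.

End translations.

Section mollification.
Context {R : realType} {n : nat}.
Local Notation V := 'rV[R]_n.
Local Notation leb := (rV_lebesgue R n).

Lemma measurable_sub_rV (y : V) (f : V -> R) :
  mfunT f -> mfunT (fun z : V => f (z - y)).
Proof. exact: measurable_rV_translation. Qed.

(* The correlation with a kernel rather than the convolution, so that only
   translation invariance is needed. *)
Definition mollify (rho f : V -> R) (y : V) : R := (\int[leb]_z (rho (z - y) * f z))%R.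

Lemma mollify_integrable D rho f y : test_function D rho -> leb.-integrable setT (EFin \o f) ->
  leb.-integrable setT (EFin \o (fun z : V => rho (z - y) * f z)).
Proof.
move=> trho fi; have [M M0 hM] := test_bounded trho.
have mf : mfunT f by apply/measurable_EFinP; case/integrableP : fi.
have mr : mfunT rho by apply: measurable_smooth; case: trho.
have fiM : leb.-integrable setT (fun z : V => (M%:E * (f z)%:E)%E) by exact: integrableZl.
apply: (le_integrable measurableT _ _ fiM).
  by apply/measurable_EFinP; apply: measurable_funM => //; exact: measurable_sub_rV.
move=> z _; rewrite /= lee_fin !normrM.
by rewrite ler_wpM2r// (le_trans (hM _))// ler_norm.
Qed.

Lemma mollify_continuous D rho f : test_function D rho -> leb.-integrable setT (EFin \o f) ->
  continuous (mollify rho f).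
Proof.
move=> trho fi y; have [K K0 hK] := test_lipschitz trho.
have fia : leb.-integrable setT (EFin \o (fun z => `|f z|)) by exact: (integrable_abse fi).
pose S := \int[leb]_z `|f z|.
have S0 : 0 <= S by apply: Rintegral_ge0.
have L y' : `|mollify rho f y - mollify rho f y'| <= K * `|y - y'| * S.
  have i1 := mollify_integrable y trho fi; have i2 := mollify_integrable y' trho fi.
  rewrite /mollify -RintegralB//.
  apply: le_trans (le_normr_Rintegral measurableT (integrableB measurableT i1 i2)) _.
  rewrite /S -RintegralZl//; apply: le_Rintegral => //.
  - exact: (integrable_abse (integrableB measurableT i1 i2)).
  - exact: (@integrableZl _ _ _ leb setT measurableT _ (fun z => (`|f z|)%:E)).
  - move=> z _; rewrite -mulrBl normrM ler_wpM2r//.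
    apply: le_trans (hK _ _) _; rewrite opprB addrC addrA addrNK.
    by rewrite distrC.
apply/(@cvgrPdist_le _ _ _ (nbhs y)) => e e0.
have KS0 : 0 < K * S + 1 by rewrite ltr_wpDl// mulr_ge0.
near=> y'; apply: le_trans (L y') _.
have : `|y - y'| <= e / (K * S + 1).
  near: y'; apply/nbhs_ballP; exists (e / (K * S + 1)); first by rewrite /= divr_gt0.
  by move=> z; rewrite -ball_normE /= => /ltW.
rewrite ler_pdivlMr// => h; apply: le_trans h.
by rewrite mulrC mulrA mulrC ler_wpM2l// mulrC lerDl.
Unshelve. all: end_near. Qed.

Lemma test_functionN D (rho : V -> R) : test_function D rho -> test_function D (fun x => - rho x).
Proof. by move=> /(test_functionZ (-1)); under eq_fun do rewrite mulN1r. Qed.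

Lemma mollify_is_derive D rho f y j : test_function D rho -> leb.-integrable setT (EFin \o f) ->
  is_derive y (delta_mx 0 j) (mollify rho f) (mollify (fun x => - partial j rho x) f y).
Proof.
move=> trho fi; have [K K0 hK] := test_lipschitz trho; have srho : smooth rho by case: trho.
have mf : mfunT f by apply/measurable_EFinP; case/integrableP : fi.
have mr := measurable_smooth srho.
pose e : V := delta_mx 0 j.
have e1 : `|e| <= 1.
  apply: norm_rV_le => // i; rewrite mxE eqxx /=.
  by case: (_ == _); rewrite ?normr1 ?normr0.
suff c : (fun h : R => h^-1 *: ((mollify rho f \o shift y) (h *: e) - mollify rho f y)) @ 0^' -->
    mollify (fun x => - partial j rho x) f y.
  split; first by apply/cvg_ex; eexists; exact: c.
  exact/cvg_lim.
apply/cvgr_dnbhsP => u [u0 uc].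
have i1 := mollify_integrable y trho fi.
have i2 k := mollify_integrable (u k *: e + y) trho fi.
have iB k := integrableB measurableT (i2 k) i1.
pose q k (z : V) := (u k)^-1 * (rho (z - (u k *: e + y)) * f z - rho (z - y) * f z).
have qE k : (u k)^-1 *: ((mollify rho f \o shift y) (u k *: e) - mollify rho f y) =
    \int[leb]_z q k z.
  rewrite -[LHS]/(_ * _) /= /mollify -RintegralB// /q RintegralZl//.
  exact: (iB k).
under eq_fun do rewrite qE.
have := @Rintegral_dominated _ _ _ leb setT measurableT q (fun z => - partial j rho (z - y) * f z)
  (fun z => K * `|f z|).
case=> //.
- move=> k; apply: measurable_funM => //; apply: measurable_funB;
    by apply: measurable_funM => //; exact: measurable_sub_rV.
- move=> z _; rewrite /q.
  under eq_fun do rewrite -mulrBl mulrA.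
  apply: cvgM; last exact: cvg_cst.
  have h1 := @smooth_derivable _ _ _ srho j (z - y).
  have /cvgr_dnbhsP/(_ (fun k => - u k)) := h1.
  have h2 : (forall k, - u k != 0) /\ - u k @[k --> \oo] --> (0 : R).
    by split; [move=> k; rewrite oppr_eq0|rewrite -oppr0; exact: cvgN].
  move=> /(_ h2) /cvgN; rewrite /partial /derive.
  move=> c; rewrite (_ : (fun k => _) = (fun k => - ((- u k)^-1 *:
    ((rho \o shift (z - y)) (- u k *: e) - rho (z - y)))))//.
  apply/funext => k; rewrite -[(- u k)^-1 *: _]/((- u k)^-1 * _) /= invrN mulNr opprK.
  by congr (_ * (rho _ - _)); rewrite scaleNr opprD addrCA.
- exact: (@integrableZl _ _ _ leb setT measurableT _ (fun z => (`|f z|)%:E) (integrable_abse fi)).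
- move=> k z _; rewrite /q -mulrBl mulrA normrM ler_wpM2r//.
  rewrite normrM normfV ler_pdivrMl ?normr_gt0//.
  apply: le_trans (hK _ _) _; rewrite mulrC ler_wpM2r//.
  rewrite opprD addrA addrAC opprB [X in `|X|](_ : _ = - (u k *: e)); last first.
    by apply/rowP => i; rewrite !mxE; ring.
  by rewrite normrN normrZ ler_piMr.
Qed.

Lemma smooth_mollify D rho f : test_function D rho -> leb.-integrable setT (EFin \o f) ->
  smooth (mollify rho f).
Proof.
move=> trho fi; apply: (@smooth_coind _ _ [set g | exists2 r, test_function D r & g = mollify r f]); last by exists rho.
move=> _ [r tr ->]; split; first exact: mollify_continuous tr fi.
move=> j; split=> [x|]; first exact: (@ex_derive _ _ _ _ _ _ _ (mollify_is_derive x j tr fi)).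
exists (fun x => - partial j r x); first exact/test_functionN/test_partial.
by apply/funext => x; rewrite /partial (@derive_val _ _ _ _ _ _ _ (mollify_is_derive x j tr fi)).
Qed.

Lemma partial_mollify D rho f y j : test_function D rho -> leb.-integrable setT (EFin \o f) ->
  partial j (mollify rho f) y = mollify (fun x => - partial j rho x) f y.
Proof. by move=> tr fi; rewrite /partial (@derive_val _ _ _ _ _ _ _ (mollify_is_derive y j tr fi)). Qed.

Lemma mollifyE rho f y : mfunT rho -> mfunT f ->
  mollify rho f y = (\int[leb]_w (rho w * f (w + y)))%R.
Proof.
move=> mr mf; rewrite /mollify -(Rintegral_rV_translation y).
  by apply: eq_Rintegral => w _; rewrite addrK.
by apply: measurable_funM => //; exact: measurable_sub_rV.
Qed.

(** The support is centered at [c] instead of 0. As [mollify] integrates [f] near [y + c], a center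
    on the axis of an interior cone keeps the average inside the domain. *)
Record mollifier (c : V) (r : R) (rho : V -> R) : Prop := Mollifier {
  mollifier_test : test_function setT rho ;
  mollifier_ge0 : forall x, 0 <= rho x ;
  mollifier_int : (\int[leb]_x rho x)%R = 1 ;
  mollifier_supp : forall x, rho x != 0 -> `|x - c| <= r }.

Lemma mollifier_exists (c : V) (r : R) : 0 < r -> exists rho, mollifier c r rho.
Proof.
move=> r0.
pose a := c - const_mx r; pose b := c + const_mx r.
pose B := box_bump a b 1.
have tB : test_function setT B by apply: test_box_bump.
have B0 x : 0 <= B x by case/andP: (box_bump_le a b 1 x).
have iB := test_integrable tB.
have mB : mfunT B by apply: measurable_smooth; case: tB.
have bE x : B x != 0 -> `|x - c| <= r.
  move=> /box_bump_supp h; apply: norm_rV_le; first exact: ltW.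
  move=> i; have := h i; rewrite !mxE ler_norml => /andP[h1 h2].
  by apply/andP; split; lra.
have Bpos x : box a b x -> 0 < B x.
  move=> h; apply: prodr_gt0 => i _; have /andP[h1 h2] := h i.
  by rewrite mulr_gt0// /flat mul1r subr_gt0 ?h1 ?h2/= hornerC mul1r expR_gt0.
pose I := (\int[leb]_x B x)%R.
(* Otherwise [B] would vanish almost everywhere, whereas it is positive on a cube of positive
   volume. *)
have I0 : 0 < I.
  rewrite lt_neqAle Rintegral_ge0// andbT; apply/eqP => I0.
  have : (\int[leb]_x (B x)%:E = 0)%E.
    by rewrite -(fineK (integrable_fin_num measurableT iB)) -[fine _]/I -I0.
  rewrite (eq_integral (fun x => `|(EFin \o B) x|%E)); last first.
    by move=> x _; rewrite /= ger0_norm.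
  move/(@ae_eq_integral_abs _ _ _ leb setT measurableT (EFin \o B)); case.
    exact/measurable_EFinP.
  move=> N [mN N0 sN].
  have {}sN x : B x != 0 -> N x.
    by move=> Bx; apply: sN => /= /(_ Logic.I)[h]; rewrite h eqxx in Bx.
  pose Q : V -> R := \1_[set x : V | `|x| <= r / 2].
  have r2 : 0 <= r / 2 by pos.
  have mc : measurable [set x : V | `|x| <= r / 2] by exact: measurable_cube.
  have mQ : mfunT Q by exact/measurable_indicP.
  have : (\int[leb]_x (Q (x - c))%:E = 0)%E.
    rewrite (ae_eq_integral (cst 0%E))//.
    + by rewrite integral0.
    + by apply/measurable_EFinP; exact: measurable_sub_rV.
    exists N; split=> // x /= h; apply: sN; rewrite gt_eqF//; apply: Bpos.
    have xc : `|x - c| <= r / 2.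
      apply: contrapT => xc; apply: h => _; rewrite /Q indicE memNset//.
    move=> i; have := le_trans (coord_norm_le (x - c) i) xc; rewrite !mxE ler_norml.
    by move=> /andP[h3 h4]; apply/andP; split; lra.
  rewrite (integral_rV_translation (- c) (f := fun x => (Q x)%:E)); last exact/measurable_EFinP.
  rewrite integral_indic// setIT.
  move=> h; have := @rV_lebesgue_cube R n (r / 2) r2; rewrite [X in X = _]h.
  rewrite mulrC divfK// => /esym/eqP; rewrite eqe expf_eq0 => /andP[_ /eqP r00].
  by rewrite r00 ltxx in r0.
exists (fun x => I^-1 * B x); split.
- exact: test_functionZ.
- by pos.
- by rewrite RintegralZl// mulVf// gt_eqF.
- by move=> x; rewrite mulf_eq0 negb_or => /andP[_ /bE].
Qed.

(** Jensen's inequality as Cauchy-Schwarz for [sqrt rho] and [sqrt rho * g], the first of which has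
    norm 1. *)
Lemma mollifier_jensen c r rho (g : V -> R) : mollifier c r rho -> mfunT g ->
  (((\int[leb]_w (rho w * g w))%R ^+ 2)%:E <= \int[leb]_w (rho w * g w ^+ 2)%:E)%E.
Proof.
move=> [trho r0 rint _] mg.
have mr : mfunT rho by apply: measurable_smooth; case: trho.
pose s w := Num.sqrt (rho w).
have ms : mfunT s.
  by apply: (measurableT_comp (continuous_measurable_fun (@sqrt_continuous R))).
have s2 w : s w * s w = rho w by rewrite -expr2 sqr_sqrtr.
have sg2 : rL2sq leb setT (fun w : V => s w * g w) = (\int[leb]_w (rho w * g w ^+ 2)%:E)%E.
  by apply: eq_integral => w _; rewrite exprMn expr2 s2.
have ss2 : rL2sq leb setT s = 1%E.
  rewrite /rL2sq (eq_integral (EFin \o rho)); last by move=> w _; rewrite /= expr2 s2.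
  rewrite -(fineK (integrable_fin_num measurableT (test_integrable trho))).
  by rewrite -[fine _]/(Rintegral _ _ _) rint.
have [loo|] := ltP (\int[leb]_w (rho w * g w ^+ 2)%:E)%E +oo%E; last first.
  by move=> h; apply: le_trans h; exact: leey.
have h1 : rL2 leb setT s by split=> //; rewrite ss2 ltry.
have h2 : rL2 leb setT (fun w : V => s w * g w).
  by split; [exact: measurable_funM|rewrite sg2].
have := semi_ip_CS (@rL2_semi_ip _ _ _ leb setT measurableT) h1 h2.
rewrite !rip_sq ss2 mul1r sg2 -lee_fin fineK; last first.
  by rewrite ge0_fin_numE// integral_ge0// => w _; rewrite lee_fin mulr_ge0 ?sqr_ge0.
have -> : rip leb setT s (fun w : V => s w * g w) = (\int[leb]_w (rho w * g w))%R.
  by apply: eq_Rintegral => w _; rewrite mulrA s2.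
by [].
Qed.

(** By Jensen and Tonelli the error is at most the average of [|f (. + w) - f|^2] over [w] with
    weight [rho], and [|w| <= |c| + r] on the support. The radius [delta] is the one of
    [translation_continuous]. *)
Theorem mollify_approx (f : V -> R) (e : R) : leb.-integrable setT (EFin \o f) ->
  rL2 leb setT f -> 0 < e ->
  exists2 delta : R, 0 < delta & forall c r rho, mollifier c r rho -> `|c| + r <= delta ->
    (rL2sq leb setT (fun y => (mollify rho f y - f y)%R) <= e%:E)%E.
Proof.
move=> fi f2 e0; have [delta d0 hd] := translation_continuous f2 e0.
exists delta => // c r rho K cr; have mf := f2.1.
have [trho r0 rint rsupp] := K.
have mr : mfunT rho by apply: measurable_smooth; case: trho.
have irho := test_integrable trho.
pose G (p : V * V) : \bar R := (rho p.1 * (f (p.1 + p.2) - f p.2) ^+ 2)%:E.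
have madd : mfunT (fun p : V * V => p.1 + p.2).
  apply: measurable_fun_matrix => i j; under eq_fun do rewrite mxE.
  apply: measurable_funD.
    by apply: (measurableT_comp (measurable_entry i j)).
  by apply: (measurableT_comp (measurable_entry i j)).
have mG : mfunT G.
  apply/measurable_EFinP; apply: measurable_funM.
    by meas.
  by meas.
have G0 p : (0 <= G p)%E by rewrite lee_fin mulr_ge0// sqr_ge0.
apply: (@le_trans _ _ (\int[leb]_y \int[leb]_w G (w, y))%E).
  apply: ge0_le_integral => //.
  - by pos.
  - apply: measurable_sqr; apply: measurable_funB => //; apply: measurable_smooth.
    exact: smooth_mollify trho fi.
  - exact: (@measurable_fun_fubini_tonelli_G _ _ _ _ _ leb G mG G0).
  - move=> y _.
    have i1 : leb.-integrable setT (EFin \o (fun w : V => rho w * f (w + y))).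
      have := integrable_rV_translation y (mollify_integrable y trho fi).
      by under [X in EFin \o X]eq_fun do rewrite addrK.
    have i2 : leb.-integrable setT (EFin \o (fun w : V => rho w * f y)).
      by apply: (@integrableZr _ _ _ leb setT measurableT (f y) (EFin \o rho) irho).
    have mg : mfunT (fun w : V => f (w + y) - f y).
      by apply: measurable_funB => //; exact: measurable_rV_translation.
    apply: le_trans (mollifier_jensen K mg); rewrite lee_fin.
    apply: le_of_eq; congr (_ ^+ 2).
    rewrite mollifyE//.
    transitivity (\int[leb]_w (rho w * f (w + y) - rho w * f y)); last first.
      by apply: eq_Rintegral => w _; rewrite mulrBr.
    by rewrite RintegralB// RintegralZr// rint mul1r.
rewrite -(fubini_tonelli (m1 := leb) (m2 := leb) G mG G0).
rewrite (_ : e%:E = \int[leb]_w (e%:E * (rho w)%:E))%E; last first.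
  rewrite integralZl// -[X in (_ * X)%E](fineK (integrable_fin_num measurableT irho)).
  by rewrite -[fine _]/(Rintegral _ _ _) rint mule1.
apply: ge0_le_integral => //.
- by pos.
- exact: (@measurable_fun_fubini_tonelli_F _ _ _ _ _ leb G mG G0).

- by meas.
- move=> w _.
  have mD : mfunT (fun y : V => f (y + w) - f y).
    by apply: measurable_funB => //; exact: measurable_rV_translation.
  rewrite (eq_integral (fun y : V => ((rho w)%:E * ((f (y + w) - f y)%R ^+ 2)%:E)%E)); last first.
    by move=> y _; rewrite /G /= (addrC w).
  rewrite ge0_integralZl_EFin//; last 2 first.
    by pos.
    by meas.
  have [->|rw] := eqVneq (rho w) 0; first by rewrite mul0e mule0.
  rewrite muleC lee_wpmul2r ?lee_fin//; apply: hd.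
  rewrite -(subrK c w); apply: le_trans (ler_normD _ _) _; apply: le_trans cr.
  by rewrite addrC lerD2l; exact: rsupp.
Qed.

End mollification.

(** * Density of smooth functions *)

Section real_sobolev.
Context {R : realType} {n : nat}.
Local Notation V := 'rV[R]_n.
Local Notation leb := (rV_lebesgue R n).

Lemma smooth_translation (f : V -> R) (y : V) : smooth f -> smooth (fun z => f (z - y)).
Proof.
move=> sf; apply: (@smooth_coind _ _ [set g | exists2 f, smooth f & g = fun z => f (z - y)]); last by exists f.
move=> _ [g sg ->].
have E j z : (fun h : R => h^-1 *: (((fun z : V => g (z - y)) \o shift z) (h *: delta_mx 0 j) - g (z - y))) =
   (fun h : R => h^-1 *: ((g \o shift (z - y)) (h *: delta_mx 0 j) - g (z - y))).
  by apply/funext => h; rewrite /= addrA.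
split=> [z|j].
  apply: (@continuous_comp _ _ _ (fun z : V => z - y) g); last exact: smooth_continuous.
  by apply: (@cvgB _ _ _ (nbhs z) _ id (fun=> y)); [exact: cvg_id|exact: cvg_cst].
split=> [z|]; first by rewrite /derivable E; exact: smooth_derivable.
exists (partial j g); first exact: smooth_partial.
by apply/funext => z; rewrite /partial /derive E.
Qed.

Lemma partial_translation (f : V -> R) (y z : V) j :
  partial j (fun z => f (z - y)) z = partial j f (z - y).
Proof.
have E : (fun h : R => h^-1 *: (((fun z : V => f (z - y)) \o shift z) (h *: delta_mx 0 j) - f (z - y))) =
   (fun h : R => h^-1 *: ((f \o shift (z - y)) (h *: delta_mx 0 j) - f (z - y))).
  by apply/funext => h; rewrite /= addrA.
by rewrite /partial /derive E.
Qed.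

Lemma partial_supp (f : V -> R) (K : set V) j x : closed K -> (forall x, f x != 0 -> K x) ->
  partial j f x != 0 -> K x.
Proof.
move=> cK fK; apply: contraPP => nx; apply/negP; rewrite negbK; apply/eqP; apply: partial_near0.
have : nbhs x (~` K) by apply: open_nbhs_nbhs; split=> //; exact: closed_openC.
by apply: filterS => y ny; apply/eqP; apply: contrapT => /negP /fK.
Qed.

Lemma closed_cube (c : V) (r : R) : closed [set x : V | `|x - c| <= r].
Proof.
apply: (@preimage_closed _ _ (fun x : V => `|x - c|) [set y : R | y <= r]); last exact: closed_le.
move=> x _; apply: (@continuous_comp _ _ _ (fun x : V => x - c) (fun x => `|x|)).
  by apply: (@cvgB _ _ _ (nbhs x) _ id (fun=> c)); [exact: cvg_id|exact: cvg_cst].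
exact: norm_continuous.
Qed.

Lemma smooth_bounded (U : set V) (f : V -> R) : bounded_set U -> smooth f ->
  exists2 M : R, 0 <= M & forall x, U x -> `|f x| <= M.
Proof.
move=> [B [Br hB]] sf.
pose K := [set x : V | `|x - 0| <= `|B| + 1].
have cK : compact K.
  apply: bounded_closed_compact; last exact: closed_cube.
  exists (`|B| + 1); split; first exact: num_real.
  by move=> z hz x; rewrite /K /= subr0 => /le_trans; apply; exact: ltW.
have /compact_bounded[M [Mr hM]] : compact (f @` K).
  by apply: continuous_compact => //; apply: continuous_subspaceT; exact: smooth_continuous.
exists (`|M| + 1); first by rewrite addr_ge0.
move=> x Ux; apply: (hM (`|M| + 1)); first by apply: le_lt_trans (ler_norm M) _; rewrite ltrDl.
exists x => //; rewrite /K /= subr0; apply: (hB (`|B| + 1)) => //.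
by apply: le_lt_trans (ler_norm B) _; rewrite ltrDl.
Qed.

Lemma rL2_bounded_mul (U : set V) (b f : V -> R) (M : R) : measurable U ->
  measurable_fun U b -> (forall x, U x -> `|b x| <= M) -> rL2 leb U f ->
  rL2 leb U (fun x => b x * f x).
Proof.
move=> mU mb bM [mf f2]; split; first exact: measurable_funM.
have := (rL2Z mU M (conj mf f2)).2; apply: le_lt_trans; apply: rL2sq_le => //.
- by meas.
- by meas.
move=> x Ux; rewrite !normrM ler_wpM2r//.
by apply: le_trans (bM _ Ux) _; exact: ler_norm.
Qed.

Lemma bounded_measure (U : set V) : measurable U -> bounded_set U -> (leb U < +oo)%E.
Proof.
move=> mU [B [Br hB]].
have B0 : 0 <= `|B| + 1 by pos.
have h : U `<=` [set x | `|x| <= `|B| + 1].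
  move=> x Ux; apply: (hB (`|B| + 1)) => //.
  by apply: le_lt_trans (ler_norm B) _; rewrite ltrDl.
apply: le_lt_trans (le_measure _ _ _ h) _; rewrite ?inE//; first exact: measurable_cube.
have E := @rV_lebesgue_cube R n _ B0.
by apply: le_lt_trans (ltry ((2 * (`|B| + 1)) ^+ n)); exact: le_of_eq.
Qed.

Lemma rL2_cst (U : set V) (c : R) : measurable U -> bounded_set U -> rL2 leb U (fun=> c).
Proof.
move=> mU bU; split; first exact: measurable_cst.
rewrite /rL2sq integral_cst//; apply: lte_mul_pinfty => //; first by rewrite lee_fin sqr_ge0.
exact: bounded_measure.
Qed.

Lemma rL2_smooth (U : set V) (f : V -> R) : measurable U -> bounded_set U -> smooth f ->
  rL2 leb U f.
Proof.
move=> mU bU sf; have [M M0 hM] := smooth_bounded bU sf.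
have mf : measurable_fun U f by apply: measurable_funTS; exact: measurable_smooth.
have := rL2_bounded_mul mU mf hM (rL2_cst 1 mU bU).
by under eq_fun do rewrite mulr1.
Qed.

Variable U : set V.
Hypotheses (oU : open U) (bU : bounded_set U).
Let mU : measurable U. Proof. exact: open_measurable_rV. Qed.

Definition rweak (j : 'I_n) (u g : V -> R) := rL2 leb U g /\
  forall phi, test_function U phi ->
    (\int[leb]_(x in U) (phi x * g x))%R = - (\int[leb]_(x in U) (partial j phi x * u x))%R.

Definition rgrad (u : V -> R) (G : 'I_n -> V -> R) :=
  rL2 leb U u /\ forall j, rweak j u (G j).

Lemma test_integrable_mul phi f : test_function U phi -> rL2 leb U f ->
  leb.-integrable U (EFin \o (fun x => phi x * f x)).
Proof. by move=> tp f2; apply: rL2_mul_integrable => //; exact: test_rL2 tp. Qed.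

Lemma rweak_unique j u g g' : rweak j u g -> rweak j u g' ->
  g = g' %[ae leb in U].
Proof.
move=> [g2 hg] [g2' hg'].
have := fundamental_lemma oU (rL2B mU g2 g2').
have h phi : test_function U phi -> (\int[leb]_(x in U) ((g x - g' x) * phi x))%R = 0.
  move=> tp; transitivity (\int[leb]_(x in U) (phi x * g x - phi x * g' x))%R.
    by apply: eq_Rintegral => x _; rewrite mulrC mulrBr.
  rewrite RintegralB//; [|exact: test_integrable_mul..].
  by rewrite hg// hg'// subrr.
move=> /(_ h); apply: filterS => x hx Ux.
by apply/eqP; rewrite -subr_eq0 hx.
Qed.

Lemma rweak_linear a j u g u' g' : rL2 leb U u -> rL2 leb U u' ->
  rweak j u g -> rweak j u' g' ->
  rweak j (fun x => a * u x + u' x) (fun x => a * g x + g' x).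
Proof.
move=> u2 u2' [g2 hg] [g2' hg']; split; first by apply: rL2D => //; exact: rL2Z.
move=> phi tp; have tp' := test_partial j tp.
have L f f' psi : rL2 leb U f -> rL2 leb U f' -> test_function U psi ->
    (\int[leb]_(x in U) (psi x * (a * f x + f' x)))%R =
    a * (\int[leb]_(x in U) (psi x * f x))%R + (\int[leb]_(x in U) (psi x * f' x))%R.
  move=> f2 f2' tpsi; have i1 := @test_integrable_mul psi f tpsi f2.
  have i2 := @test_integrable_mul psi f' tpsi f2'.
  have i3 : leb.-integrable U (EFin \o (fun x => a * (psi x * f x))).
    exact: (@integrableZl _ _ _ leb U mU a (EFin \o (fun x => psi x * f x)) i1).
  rewrite -RintegralZl// -RintegralD//; apply: eq_Rintegral => x _.
  by rewrite mulrDr mulrCA.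
by rewrite !L// hg// hg'//; ring.
Qed.

Lemma rweak_mul j chi u g : rL2 leb U u -> smooth chi -> rweak j u g ->
  rweak j (fun x => chi x * u x) (fun x => chi x * g x + partial j chi x * u x).
Proof.
move=> u2 schi [g2 hg].
have [M M0 hM] := smooth_bounded bU schi.
have spchi := smooth_partial j schi.
have [M' M0' hM'] := smooth_bounded bU spchi.
have mchi : measurable_fun U chi by apply: measurable_funTS; exact: measurable_smooth.
have mpchi : measurable_fun U (partial j chi) by apply: measurable_funTS; exact: measurable_smooth.
have g2' := rL2_bounded_mul mU mchi hM g2.
have u2' := rL2_bounded_mul mU mpchi hM' u2.
split; first exact: rL2D.
move=> phi tp; have sphi : smooth phi by case: tp.
have tpc := test_functionM tp schi.
have := hg _ tpc.
have -> : (\int[leb]_(x in U) (partial j (fun x => phi x * chi x) x * u x))%R =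
    (\int[leb]_(x in U) (phi x * (partial j chi x * u x)))%R +
    (\int[leb]_(x in U) (partial j phi x * (chi x * u x)))%R.
  rewrite -RintegralD//.
  - by apply: eq_Rintegral => x _; rewrite (partialM _ _ sphi schi); ring.
  - exact: test_integrable_mul.
  - apply: test_integrable_mul; first exact: test_partial.
    exact: rL2_bounded_mul hM u2.
move=> h; transitivity ((\int[leb]_(x in U) (phi x * chi x * g x))%R +
    (\int[leb]_(x in U) (phi x * (partial j chi x * u x)))%R); last by rewrite h; ring.
rewrite -RintegralD//.
- by apply: eq_Rintegral => x _; ring.
- exact: test_integrable_mul.
- exact: test_integrable_mul.
Qed.

Lemma rweak_smooth j v : smooth v -> rweak j v (partial j v).
Proof.
move=> sv; split; first exact/rL2_smooth/smooth_partial.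
move=> phi tp; have := integral_by_parts j tp sv.
have h psi f : test_function U psi -> (\int[leb]_(x in U) (psi x * f x))%R = (\int[leb]_x (psi x * f x))%R.
  move=> tpsi; rewrite Rintegral_mkcond; apply: eq_Rintegral => x _; rewrite patchE.
  case: ifPn => // xU; have [->|/(test_supp tpsi) Ux] := eqVneq (psi x) 0; first by rewrite mul0r.
  by rewrite mem_set in xU.
by rewrite (h _ _ tp) (h _ _ (test_partial j tp)).
Qed.

Definition smooth_approx (u : V -> R) (G : 'I_n -> V -> R) := forall e : R, 0 < e ->
  exists v, [/\ smooth v, (rL2sq leb U (fun x => (v x - u x)%R) <= e%:E)%E &
    forall j, (rL2sq leb U (fun x => (partial j v x - G j x)%R) <= e%:E)%E].

Lemma smooth_approxD u G u' G' : rgrad u G -> rgrad u' G' ->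
  smooth_approx u G -> smooth_approx u' G' ->
  smooth_approx (fun x => u x + u' x) (fun j x => G j x + G' j x).
Proof.
move=> [[mu _] hG] [[mu' _] hG'] aG aG' e e0.
have e4 : 0 < e / 4 by pos.
have [v [sv vu vG]] := aG _ e4; have [v' [sv' vu' vG']] := aG' _ e4.
have mv f : smooth f -> measurable_fun U f.
  by move=> sf; apply: measurable_funTS; exact: measurable_smooth.
have key (f f' h h' : V -> R) : measurable_fun U f -> measurable_fun U f' ->
    measurable_fun U h -> measurable_fun U h' ->
    (rL2sq leb U (fun x => (f x - h x)%R) <= (e / 4)%:E)%E ->
    (rL2sq leb U (fun x => (f' x - h' x)%R) <= (e / 4)%:E)%E ->
    (rL2sq leb U (fun x => (f x + f' x - (h x + h' x))%R) <= e%:E)%E.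
  move=> mf mf' mh mh' h1 h2.
  have -> : (fun x => f x + f' x - (h x + h' x)) = (fun x => (f x - h x) + (f' x - h' x)).
    by apply/funext => x; ring.
  have h3 := @rL2sqD _ _ _ leb U mU _ _ (measurable_funB mf mh) (measurable_funB mf' mh').
  apply: le_trans h3 _.
  rewrite (_ : e%:E = 2%:E * (e / 4)%:E + 2%:E * (e / 4)%:E)%E; last first.
    by rewrite -[RHS]/((2 * (e / 4) + 2 * (e / 4))%:E); congr (_%:E); lra.
  by apply: leeD; rewrite lee_pmul2l.
exists (fun x => v x + v' x); split; first exact: smoothD.
  by apply: key => //; exact: mv.
move=> j; have [[mG _] _] := hG j; have [[mG' _] _] := hG' j.
under [X in rL2sq _ _ X]eq_fun do rewrite partialD//.
have spv := smooth_partial j sv; have spv' := smooth_partial j sv'.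
by apply: key; [exact: mv|exact: mv|exact: mG|exact: mG'|exact: vG|exact: vG'].
Qed.

(** The inverse of [1] plus the sum of the [1 / d_j] lies below every [d_j]; the summand 1 keeps it
    meaningful for an empty index set. *)
Lemma min_delta (P : 'I_n -> R -> Prop) :
  (forall j d d', 0 < d' -> d' <= d -> P j d -> P j d') ->
  (forall j, exists2 d : R, 0 < d & P j d) -> exists2 d : R, 0 < d & forall j, P j d.
Proof.
move=> Pm hP; have /choice[d_ hd] j : exists d : R, 0 < d /\ P j d.
  by have [d d0 Pd] := hP j; exists d.
pose s := \sum_j (d_ j)^-1 + 1.
have s0 j : (d_ j)^-1 <= s.
  rewrite /s (bigD1 j)//= -addrA lerDl addr_ge0// sumr_ge0// => i _.
  by rewrite invr_ge0 ltW//; case: (hd i).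
have sp : 0 < s by rewrite ltr_wpDl// sumr_ge0// => i _; rewrite invr_ge0 ltW//; case: (hd i).
exists s^-1; first by rewrite invr_gt0.
move=> j; have [dj0 Pj] := hd j; apply: Pm Pj; first by rewrite invr_gt0.
by rewrite -[leRHS]invrK lef_pV2// posrE// invr_gt0.
Qed.

(* The uniform interior cone property near [p], for a cone with axis [a]. *)
Definition cone_at (p : V) (r : R) := 0 < r /\ exists (a : V) (kappa e0 : R), [/\ 0 < kappa, 0 < e0 &
  forall (y w : V) (e : R), U y -> `|y - p| <= 2 * r -> 0 < e <= e0 -> `|w - a| <= kappa -> U (y + e *: w)].

Lemma patch_integrable (f : V -> R) : rL2 leb U f ->
  rL2 leb setT (f \_ U) /\ leb.-integrable setT (EFin \o (f \_ U)).
Proof.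
move=> f2; have mf : mfunT (f \_ U).
  by apply/(measurable_restrictT f mU); exact: (proj1 f2).
split.
  split=> //; apply: le_lt_trans f2.2; apply: le_of_eq.
  rewrite /rL2sq [RHS]integral_mkcond; apply: eq_integral => x _.
  by rewrite !patchE; case: ifP => // _; rewrite expr0n.
rewrite -restrict_EFin; apply/(integrable_restrict _ mU measurableT).
rewrite setTI; have := rL2_mul_integrable mU f2 (rL2_cst 1 mU bU).
by under eq_fun do rewrite mulr1.
Qed.

(* Translation along the axis moves the support of the mollifier into [U]. *)
Lemma smooth_approx_local p r u G : cone_at p r -> rgrad u G ->
  (forall x, r < `|x - p| -> u x = 0 /\ forall j, G j x = 0) -> smooth_approx u G.
Proof.
move=> [r0 [a [kappa [e0 [k0 e00 cone]]]]] [u2 hG] uG0 e epos.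
have [f2 fi] := patch_integrable u2.
have [d1 d10 h1] := mollify_approx fi f2 epos.
have [d2 d20 h2] := @min_delta (fun j d => forall (c : V) (r : R) (rho : V -> R), mollifier c r rho -> `|c| + r <= d ->
    (rL2sq leb setT (fun y => (mollify rho (G j \_ U) y - (G j \_ U) y)%R) <= e%:E)%E)
  (fun j d d' _ dd' h c r rho K cr => h c r rho K (le_trans cr dd'))
  (fun j => let: conj g2 gi := patch_integrable (hG j).1 in mollify_approx gi g2 epos).
pose L := `|a| + kappa; have L0 : 0 < L by rewrite ltr_wpDl.
pose m := Num.min (Num.min d1 d2) r; have m0 : 0 < m by rewrite !lt_min d10 d20 r0.
pose ee := Num.min e0 (m / L).
have ee0 : 0 < ee by rewrite lt_min e00 divr_gt0.
have eeL : ee * L <= m by rewrite -ler_pdivlMr// ge_min lexx orbT.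
have [rho K] := @mollifier_exists R n (ee *: a) (ee * kappa) (mulr_gt0 ee0 k0).
have [trho rho0 rint rsupp] := K.
have srho : smooth rho by case: trho.
have rK : `|ee *: a| + ee * kappa <= m by rewrite normrZ gtr0_norm// -mulrDr.
have rsmall x : `|x - ee *: a| <= ee * kappa -> `|x| <= r.
  move=> h; rewrite -(subrK (ee *: a) x); apply: le_trans (ler_normD _ _) _.
  apply: (@le_trans _ _ m); last by rewrite ge_min lexx orbT.
  by rewrite addrC; apply: le_trans rK; rewrite lerD2l.
have md1 : m <= d1 by rewrite !ge_min lexx.
have md2 : m <= d2 by rewrite !ge_min lexx orbT.
pose v := mollify rho (u \_ U).
have sv : smooth v by exact: smooth_mollify trho fi.
have sub f g : mfunT f -> (forall x, U x -> g x = f x) ->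
    (rL2sq leb U g <= rL2sq leb setT f)%E.
  move=> mf gf; rewrite /rL2sq (eq_integral (fun x => (f x ^+ 2)%:E)); last first.
    by move=> x /[!inE] Ux; rewrite gf.
  apply: ge0_subset_integral => //; first exact: measurable_sqr.
  by pos.
exists v; split=> //.
  apply: le_trans (h1 _ _ _ K (le_trans rK md1)); apply: sub => //.
    apply: measurable_funB; [exact: measurable_smooth|exact: f2.1].
  by move=> x Ux; rewrite patchE mem_set.
move=> j; have [g2 gi] := patch_integrable (hG j).1.
apply: le_trans (h2 j _ _ _ K (le_trans rK md2)); apply: sub => //.
  apply: measurable_funB; [|exact: g2.1].
  by apply: measurable_smooth; exact: smooth_mollify trho gi.
move=> y Uy; rewrite [in RHS]patchE mem_set//; congr (_ - _).
rewrite (partial_mollify _ _ trho fi) /mollify.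
(* Far from [p] both sides vanish, since [u] and [G] are zero outside the ball of radius [r] and the
   kernel reaches no further than [r]. Near [p] the cone property makes [z -> rho (z - y)] a test
   function of [U], and the definition of the weak derivative applies. *)
have [yp|yp] := leP `|y - p| (2 * r); last first.
  have far (z : V) (psi : V -> R) : (psi (z - y) != 0 -> `|z - y - ee *: a| <= ee * kappa) ->
      psi (z - y) != 0 -> r < `|z - p|.
    move=> /[apply] /rsmall h; rewrite ltNge; apply/negP => zp.
    move: yp; rewrite ltNge => /negP; apply.
    rewrite (_ : y - p = (z - p) - (z - y)); last by apply/rowP => i; rewrite !mxE; ring.
    by apply: le_trans (ler_normB _ _) _; rewrite mulr_natl mulr2n lerD.
  transitivity (0 : R); last symmetry.
    rewrite (_ : (fun z => _) = cst 0) ?Rintegral_cst ?mul0r//; apply/funext => z /=.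
    have [->|pz] := eqVneq (partial j rho (z - y)) 0; first by rewrite oppr0 mul0r.
    have h : partial j rho (z - y) != 0 -> `|z - y - ee *: a| <= ee * kappa.
      by move=> h; apply: (partial_supp (@closed_cube (ee *: a) (ee * kappa)) rsupp h).
    have [u0 _] := uG0 z (far z _ h pz).
    by rewrite patchE u0 if_same mulr0.
  rewrite (_ : (fun z => _) = cst 0) ?Rintegral_cst ?mul0r//; apply/funext => z /=.
  have [->|pz] := eqVneq (rho (z - y)) 0; first by rewrite mul0r.
  have [_ /(_ j) G0] := uG0 z (far z _ (rsupp (z - y)) pz).
  by rewrite patchE G0 if_same mulr0.
have tphi : test_function U (fun z => rho (z - y)).
  apply: (@test_functionP _ _ _ _ [set z | `|z - (y + ee *: a)| <= ee * kappa] (`|y| + r)).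
  - exact: smooth_translation.
  - exact: closed_cube.
  - move=> z /= h; rewrite -(subrK y z) addrC.
    have : `|ee^-1 *: (z - y) - a| <= kappa.
      rewrite (_ : _ - a = ee^-1 *: (z - (y + ee *: a))); last first.
        by rewrite opprD addrA [in RHS]scalerBr [in RHS]scalerA mulVf ?gt_eqF// scale1r.
      by rewrite normrZ gtr0_norm ?invr_gt0// ler_pdivrMl.
    move=> /(cone y _ ee Uy yp); rewrite ee0 ge_min lexx => /(_ isT).
    by rewrite scalerA mulfV ?gt_eqF// scale1r.
  - by move=> z /rsupp; rewrite /= opprD addrA.
  - move=> z /rsupp/rsmall h; rewrite -(subrK y z) addrC.
    by apply: le_trans (ler_normD _ _) _; rewrite lerD2l.
have [_ /(_ _ tphi)] := hG j.
under [X in _ = - X -> _]eq_Rintegral => z _ do rewrite partial_translation.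
move=> hh; transitivity (- (\int[leb]_(x in U) (partial j rho (x - y) * u x))%R).
  have h3 := mollify_integrable y (test_partial j trho) fi.
  transitivity (- (\int[leb]_z (partial j rho (z - y) * (u \_ U) z))).
    by rewrite -mulN1r -RintegralZl//; apply: eq_Rintegral => z _; rewrite mulN1r mulNr.
  congr (- _); rewrite [in RHS]Rintegral_mkcond.
  by apply: eq_Rintegral => z _; rewrite !patchE; case: ifP; rewrite ?mulr0.
rewrite -hh Rintegral_mkcond; apply: eq_Rintegral => z _.
by rewrite !patchE; case: ifP; rewrite ?mulr0.
Qed.

(** The indicator of the cube of radius [3 r / 4] is mollified by a kernel of radius [r / 4], so it
    stays 1 within [r / 2] and reaches 0 beyond [r]. *)
Lemma plateau_bump (p : V) (r : R) : 0 < r -> exists b, [/\ test_function setT b,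
  forall x, `|x - p| < r / 2 -> b x = 1 & forall x, b x != 0 -> `|x - p| <= r].
Proof.
move=> r0; have r4 : 0 < r / 4 by rewrite divr_gt0.
have [rho [trho rho0 rint rsupp]] := @mollifier_exists R n 0 (r / 4) r4.
pose Q : V -> R := \1_[set x : V | `|x - p| <= 3 * (r / 4)].
have mQ : mfunT Q.
  apply/measurable_indicP; rewrite -[X in measurable X]setCK; apply: measurableC.
  apply: open_measurable_rV; apply: closed_openC; exact: closed_cube.
have Q1 x : `|x - p| <= 3 * (r / 4) -> Q x = 1 by move=> h; rewrite /Q indicE mem_set.
have Q0 x : 3 * (r / 4) < `|x - p| -> Q x = 0.
  by move=> h; rewrite /Q indicE memNset//= leNgt h.
have iQ : leb.-integrable setT (EFin \o Q).
  apply: (@bounded_cube_integrable R n Q 1 (3 * (r / 4) + `|p|)) => //.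
  - by pos.
  - by move=> x; rewrite /Q indicE; case: (_ \in _); rewrite ?normr1 ?normr0.
  - move=> x; apply: contraNle => h; apply/eqP/Q0.
    rewrite -(subrK p x) in h; have := lt_le_trans h (ler_normD _ _).
    by rewrite ltrD2r.
have mr : mfunT rho by apply: measurable_smooth; case: trho.
exists (mollify rho Q).
have supp x : mollify rho Q x != 0 -> `|x - p| <= r.
  apply: contraNle => h; apply/eqP; rewrite mollifyE//.
  rewrite (_ : (fun w => _) = cst 0) ?Rintegral_cst ?mul0r//; apply/funext => w /=.
  have [->|/rsupp] := eqVneq (rho w) 0; first by rewrite mul0r.
  rewrite subr0 => hw; rewrite Q0 ?mulr0//.
  have : `|x - p| <= `|w + x - p| + `|w|.
    rewrite (_ : x - p = (w + x - p) - w); last by apply/rowP => i; rewrite !mxE; ring.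
    exact: ler_normB.
  by move: h hw; move: `|x - p| `|w + x - p| `|w| => A B C *; lra.
split=> //.
- apply: (@test_functionP _ _ _ _ [set x | `|x - p| <= r] (r + `|p|)) => //.
  + exact: smooth_mollify trho iQ.
  + exact: closed_cube.
  + move=> x /supp h; rewrite -(subrK p x); apply: le_trans (ler_normD _ _) _.
    by rewrite lerD2r.
- move=> x h; rewrite mollifyE// -rint; apply: eq_Rintegral => w _.
  have [->|/rsupp] := eqVneq (rho w) 0; first by rewrite mul0r.
  rewrite subr0 => hw; rewrite Q1 ?mulr1//.
  rewrite -addrA; apply: le_trans (ler_normD _ _) _.
  by move: h hw; move: `|x - p| `|w| => A C *; lra.
Qed.

Lemma rgrad_mul chi u G : smooth chi -> rgrad u G ->
  rgrad (fun x => chi x * u x) (fun j x => chi x * G j x + partial j chi x * u x).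
Proof.
move=> schi [u2 hG]; split; last by move=> j; exact: rweak_mul.
have [M M0 hM] := smooth_bounded bU schi.
by apply: rL2_bounded_mul hM u2 => //; apply: measurable_funTS; exact: measurable_smooth.
Qed.

Lemma smooth_approx_ext u G u' G' : (forall x, U x -> u x = u' x) ->
  (forall j x, U x -> G j x = G' j x) -> smooth_approx u G -> smooth_approx u' G'.
Proof.
move=> uu GG aG e e0; have [v [sv vu vG]] := aG e e0.
have E f g g' : (forall x, U x -> g x = g' x) ->
    rL2sq leb U (fun x : V => (f x - g x)) = rL2sq leb U (fun x : V => (f x - g' x)).
  by move=> gg; apply: eq_integral => x /[!inE] Ux; rewrite gg.
exists v; split=> //; first by rewrite -(E _ _ _ uu).
by move=> j; rewrite -(E _ _ _ (GG j)).
Qed.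

(** Induction in place of a partition of unity. The part [b u] is supported near the first center,
    where the local result applies; [(1 - b) u] vanishes on the first half-size ball, so the
    remaining balls take care of it. *)
Lemma smooth_approx_cover (s : seq (V * R)) u G : (forall pr, pr \in s -> cone_at pr.1 pr.2) ->
  rgrad u G ->
  (forall x, U x -> (forall pr, pr \in s -> pr.2 / 2 <= `|x - pr.1|) ->
    u x = 0 /\ forall j, G j x = 0) -> smooth_approx u G.
Proof.
elim: s u G => [|[p r] s ih] u G cs hu u0.
  move=> e e0; exists (fun=> 0); split; first exact: smooth_cst.
    rewrite /rL2sq (eq_integral (cst 0%E)) ?integral0 ?lee_fin ?ltW//.
    by move=> x /[!inE] Ux; have [//|-> _] := u0 x Ux; rewrite subrr expr0n.
  move=> j; rewrite /rL2sq (eq_integral (cst 0%E)) ?integral0 ?lee_fin ?ltW//.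
  move=> x /[!inE] Ux; have [//|_ ->] := u0 x Ux.
  by rewrite /partial derive_cst subrr expr0n.
have c := cs (p, r) (mem_head _ _); have [/= r0 _] := c.
have [b [tb b1 bsupp]] := plateau_bump p r0.
have sb : smooth b by case: tb.
have sb1 : smooth (fun x => 1 - b x) by apply: smoothB => //; exact: smooth_cst.
have pb1 j x : partial j (fun x => 1 - b x) x = - partial j b x.
  under [X in partial j X]eq_fun do rewrite -mulN1r.
  rewrite (partialD _ _ (smooth_cst 1) (smoothZ (-1) sb)) (partialZ _ _ _ sb) mulN1r.
  by rewrite {1}/partial derive_cst add0r.
have h1 := rgrad_mul sb hu; have h2 := rgrad_mul sb1 hu.
have a1 : smooth_approx (fun x => b x * u x) (fun j x => b x * G j x + partial j b x * u x).
  apply: (smooth_approx_local c h1) => /= x xr.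
  have b0 : b x = 0 by apply/eqP; apply: contraTT xr => /bsupp; rewrite -leNgt.
  split=> [|j]; first by rewrite b0 mul0r.
  have -> : partial j b x = 0; last by rewrite b0 !mul0r addr0.
  apply/eqP; apply: contraTT xr => /(partial_supp (@closed_cube p r) bsupp) /=.
  by rewrite -leNgt.
have a2 := ih _ _ (fun pr prs => cs pr (mem_behead (s := _ :: _) prs)) h2.
have {}a2 := a2 _.
have := smooth_approxD h1 h2 a1 (a2 _); move=> hh.
apply: (smooth_approx_ext _ _ (hh _)).
- by move=> x _; ring.
- by move=> j x _; rewrite pb1; ring.
move=> x Ux xs; have [xp|xp] := ltP `|x - p| (r / 2); last first.
  have [|-> G0] := u0 x Ux.
    by move=> pr; rewrite inE => /orP[/eqP ->//|]; exact: xs.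
  by split=> [|j]; rewrite ?G0 !mulr0 ?addr0.
have pb0 j : partial j b x = 0.
  suff : partial j (fun x => 1 - b x) x = 0 by rewrite pb1 => /eqP; rewrite oppr_eq0 => /eqP.
  apply: partial_near0; apply/nbhs_ballP.
  exists (r / 2 - `|x - p|); first by rewrite /= subr_gt0.
  move=> y; rewrite -ball_normE /= => xy; rewrite b1 ?subrr//.
  rewrite (_ : y - p = (x - p) - (x - y)); last by apply/rowP => i; rewrite !mxE; ring.
  apply: le_lt_trans (ler_normB _ _) _; by rewrite addrC -ltrBrDr.
by rewrite (b1 _ xp) subrr; split=> [|j]; rewrite ?pb1 ?pb0 ?oppr0 !mul0r ?addr0.
Qed.

Theorem smooth_dense u G : (forall p, closure U p -> exists r, cone_at p r) -> rgrad u G ->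
  smooth_approx u G.
Proof.
move=> cU hu; have cpt : compact (closure U).
  apply: bounded_closed_compact; last exact: closed_closure.
  have [B [Br hB]] := bU; exists (`|B| + 1); split; first exact: num_real.
  move=> y yB x xU.
  have h : U `<=` [set x | `|x - 0| <= `|B| + 1].
    move=> z Uz; rewrite /= subr0; apply: (hB (`|B| + 1)) => //.
    by apply: le_lt_trans (ler_norm B) _; rewrite ltrDl.
  have := closure_subset h xU; rewrite -(closure_id _).1; last exact: closed_cube.
  by rewrite /= subr0 => /le_trans; apply; exact: ltW.
have /choice[r_ hr] p : exists r, closure U p -> cone_at p r.
  have [/cU[r c]|] := pselect (closure U p); first by exists r.
  by exists 0.
move: cpt; rewrite compact_cover => /(_ V (closure U) (fun p => ball p (r_ p / 2))).
case=> [p pU|x xU|D DU UD].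
- by apply: ball_open.
- exists x => //; apply: ballxx; have [r0 _] := hr _ xU; by rewrite divr_gt0.
refine (@smooth_approx_cover [seq ((p : V), r_ p) | p <- finmap.enum_fset D] u G _ hu _).
  move=> _ /mapP[p pD ->] /=; apply: hr; have := DU p pD; by rewrite inE.
move=> x Ux xs; exfalso; have [p /= pD] := UD x (subset_closure Ux).
rewrite -ball_normE /= distrC ltNge => /negP; apply.
by apply: (xs (p, r_ p)); apply: map_f.
Qed.

End real_sobolev.

(** * Lipschitz graphs *)

Section graph_geometry.
Context {R : realType} {m : nat}.
Local Notation n := m.+2.
Local Notation V := 'rV[R]_n.
Local Notation V' := 'rV[R]_m.+1.
Local Notation leb := (@lebesgue_measure R).
Local Notation lebn := (rV_lebesgue R).
Variable G : lipschitz_graph R n.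
Local Notation h := (height G).
Local Notation T := (tangent G).
Local Notation ax := (axis G).

Let TT : T *m T^T = 1%:M := tangent_orthonormal G.
Let Ta : T *m ax^T = 0 := tangent_axis G.
Let aa : ax *m ax^T = 1%:M := axis_unit G.
Let aT : ax *m T^T = 0.
Proof. by apply: trmx_inj; rewrite trmx_mul trmxK Ta trmx0. Qed.

Lemma tangent_le1 i j : `|T i j| <= 1.
Proof.
have : (T *m T^T) i i = 1 by rewrite TT mxE eqxx.
rewrite mxE (bigD1 j)//= mxE -expr2 => E.
have s0 : 0 <= \sum_(k | k != j) T i k * T^T k i.
  by apply: sumr_ge0 => k _; rewrite mxE -expr2 sqr_ge0.
rewrite -(@ler_pXn2r _ 2) ?nnegrE// expr1n real_normK ?num_real//.
by rewrite -E lerDl.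
Qed.

Lemma axis_le1 j : `|ax 0 j| <= 1.
Proof.
have : (ax *m ax^T) 0 0 = 1 by rewrite aa mxE.
rewrite mxE (bigD1 j)//= mxE -expr2 => E.
have s0 : 0 <= \sum_(k | k != j) ax 0 k * ax^T k 0.
  by apply: sumr_ge0 => k _; rewrite mxE -expr2 sqr_ge0.
rewrite -(@ler_pXn2r _ 2) ?nnegrE// expr1n real_normK ?num_real//.
by rewrite -E lerDl.
Qed.

Definition xcoord (w : V) : V' := w *m T^T.
Definition tcoord (w : V) : R := (w *m ax^T) 0 0.

Lemma xcoordE (x : V') t : xcoord (x *m T + t *: ax) = x.
Proof. by rewrite /xcoord mulmxDl -mulmxA TT mulmx1 -scalemxAl aT scaler0 addr0. Qed.

Lemma tcoordE (x : V') t : tcoord (x *m T + t *: ax) = t.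
Proof.
by rewrite /tcoord mulmxDl -mulmxA Ta mulmx0 add0r -scalemxAl aa !mxE eqxx mulr1.
Qed.

(** The tangent rows and the axis form an [n] by [n] matrix [M] with [M M^T = 1], which therefore
    has full rank. *)
Lemma frame_surj (w : V) : w = xcoord w *m T + tcoord w *: ax.
Proof.
suff [x [t ->]] : exists x t, w = x *m T + t *: ax by rewrite xcoordE tcoordE.
pose M := col_mx T ax.
have MM : M *m M^T = 1%:M.
  by rewrite tr_col_mx mul_col_row TT Ta aT aa -scalar_mx_block.
have fM : row_full M.
  rewrite /row_full eqn_leq rank_leq_col /=.
  have : (\rank (M *m M^T) <= \rank M)%N by exact: mxrankM_maxl.
  rewrite MM mxrank1; apply: leq_trans.
  by rewrite addn1.
have /submxP[D ->] : (w <= M)%MS by exact: submx_full.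
exists (lsubmx D), (rsubmx D 0 0).
rewrite -{1}(hsubmxK D) mul_row_col; congr (_ + _).
by rewrite {1}(mx11_scalar (rsubmx D)) mul_scalar_mx.
Qed.

Lemma placeD x t y s : place G (x + y) (t + s) = place G x t + (y *m T + s *: ax).
Proof. by rewrite /place mulmxDl scalerDl; apply/rowP => i; rewrite !mxE; ring. Qed.

Lemma place_inj x t y s : place G x t = place G y s -> x = y /\ t = s.
Proof.
rewrite /place -!addrA => /addrI E.
by split; [rewrite -(xcoordE x t) E xcoordE|rewrite -(tcoordE x t) E tcoordE].
Qed.

Lemma place_surj y : exists x t, y = place G x t.
Proof.
exists (xcoord (y - base G)), (tcoord (y - base G)).
by rewrite /place -addrA -frame_surj addrC subrK.
Qed.

Lemma epigraph_place x t : epigraph G (place G x t) <-> h x < t.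
Proof.
split=> [[x' [t' [ht /place_inj[-> ->]]]]//|ht].
by exists x, t.
Qed.

Lemma norm_frame (x : V') t : `|x *m T + t *: ax| <= m.+1%:R * `|x| + `|t|.
Proof.
apply: norm_rV_le => [|j]; first by rewrite addr_ge0// mulr_ge0.
rewrite !mxE; apply: le_trans (ler_normD _ _) _; apply: lerD; last first.
  by rewrite normrM ler_piMr// axis_le1.
apply: le_trans (ler_norm_sum _ _ _) _.
apply: (@le_trans _ _ (\sum_(k < m.+1) `|x|)).
  apply: ler_sum => k _; rewrite normrM -[leRHS]mulr1 ler_pM// ?tangent_le1//.
  exact: coord_norm_le.
by rewrite sumr_const card_ord mulr_natl.
Qed.

Lemma norm_xcoord (w : V) : `|xcoord w| <= n%:R * `|w|.
Proof.
apply: norm_rV_le => [|j]; first by rewrite mulr_ge0.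
rewrite !mxE; apply: le_trans (ler_norm_sum _ _ _) _.
apply: (@le_trans _ _ (\sum_(k < n) `|w|)).
  apply: ler_sum => k _; rewrite normrM -[leRHS]mulr1 ler_pM// ?coord_norm_le//.
  by rewrite mxE tangent_le1.
by rewrite sumr_const card_ord mulr_natl.
Qed.

Lemma norm_tcoord (w : V) : `|tcoord w| <= n%:R * `|w|.
Proof.
rewrite /tcoord !mxE; apply: le_trans (ler_norm_sum _ _ _) _.
apply: (@le_trans _ _ (\sum_(k < n) `|w|)).
  apply: ler_sum => k _; rewrite normrM -[leRHS]mulr1 ler_pM// ?coord_norm_le//.
  by rewrite mxE axis_le1.
by rewrite sumr_const card_ord mulr_natl.
Qed.

Lemma height_lip : exists2 L : R, 0 < L & forall x y, `|h x - h y| <= L * `|x - y|.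
Proof.
have /pinfty_ex_gt0[M M0 hM] := height_lipschitz G.
by exists M => // x y; have := hM (x, y) (conj I I).
Qed.

Lemma place_bounded (B : R) x t : `|place G x t| <= B ->
  `|x| <= n%:R * (B + `|base G|) /\ `|t| <= n%:R * (B + `|base G|).
Proof.
move=> hB; have hw : `|x *m T + t *: ax| <= B + `|base G|.
  rewrite (_ : _ + _ = place G x t - base G).
    by apply: le_trans (ler_normB _ _) _; rewrite lerD2r.
  by rewrite /place; apply/rowP => i; rewrite !mxE; ring.
split.
  by rewrite -{1}(xcoordE x t); apply: le_trans (norm_xcoord _) _; rewrite ler_wpM2l.
by rewrite -{1}(tcoordE x t); apply: le_trans (norm_tcoord _) _; rewrite ler_wpM2l.
Qed.

Lemma measurable_place_comp d (U : measurableType d) (D : set U) (f : U -> V') (g : U -> R) :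
  measurable_fun D f -> measurable_fun D g ->
  measurable_fun D (fun u => place G (f u) (g u)).
Proof.
move=> mf mg; apply: measurable_fun_matrix => i j.
rewrite (_ : (fun _ => _) = (fun u => base G i j +
   (\sum_k f u i k * T k j) + g u * ax i j)); last first.
  by apply/funext => u; rewrite /place !mxE.
apply: measurable_funD; last by apply: measurable_funM; [exact: mg|exact: measurable_cst].
apply: measurable_funD; first exact: measurable_cst.
apply: measurable_sum => k; apply: measurable_funM; last exact: measurable_cst.
exact: (measurableT_comp (measurable_entry i k) mf).
Qed.

Lemma measurable_height : mfunT h.
Proof. by apply: continuous_measurable_rV; exact: height_continuous. Qed.

Definition place_pair (p : V' * measurableTypeR R) : V := place G p.1 p.2.

Lemma measurable_place_pair : mfunT place_pair.
Proof. by apply: measurable_place_comp. Qed.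

Definition place_measure : set V -> \bar R := pushforward (lebn m.+1 \x leb)%E place_pair.

HB.instance Definition _ := isMeasure.Build _ _ _ place_measure
  (@measure0 _ _ _ (measure_function_pushforward__canonical__measure_function_Measure
     (lebn m.+1 \x leb)%E measurable_place_pair))
  (@measure_ge0 _ _ _ (measure_function_pushforward__canonical__measure_function_Measure
     (lebn m.+1 \x leb)%E measurable_place_pair))
  (@measure_semi_sigma_additive _ _ _ (measure_function_pushforward__canonical__measure_function_Measure
     (lebn m.+1 \x leb)%E measurable_place_pair)).

Lemma place_measure_cube (r : R) : (place_measure [set x : V | (`|x| <= r)%R] < +oo)%E.
Proof.
rewrite /place_measure /pushforward.
pose r' := n%:R * (Num.max r 0 + `|base G|).
have r'0 : 0 <= r' by rewrite mulr_ge0// addr_ge0// le_max lexx orbT.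
apply: (@le_lt_trans _ _ ((lebn m.+1 \x leb)%E ([set x : V' | (`|x| <= r')%R] `*` `[(- r')%R, r']%classic))).
  apply: le_measure; rewrite ?inE.
  - rewrite -[X in measurable X]setTI; apply: measurable_place_pair => //.
    exact: measurable_cube.
  - by apply: measurableX; [exact: measurable_cube|exact: measurable_itv].
  move=> [x t] /= h1.
  have [h2 h3] : `|x| <= r' /\ `|t| <= r'.
    by apply: place_bounded; apply: le_trans h1 _; rewrite le_max lexx.
  by split=> //=; rewrite in_itv/= -ler_norml.
rewrite product_measure1E//; last exact: measurable_cube.
have E := @rV_lebesgue_cube R m.+1 r' r'0.
have EL : (leb `[(- r')%R, r']%classic <= (r' - - r')%:E)%E.
  rewrite lebesgue_measure_itv/=; case: ifP => _; first by rewrite -EFinB.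
  by rewrite lee_fin opprK addr_ge0.
apply: (@le_lt_trans _ _ (((2 * r') ^+ m.+1)%:E * (r' - - r')%:E)%E); last by rewrite -EFinM ltry.
by apply: lee_pmul => //; exact: le_of_eq.
Qed.

Let place_sigma_finite : sigma_finite setT place_measure.
Proof.
exists (fun k : nat => [set x : V | `|x| <= k%:R]).
  apply/seteqP; split=> // x _; exists (Num.bound `|x|) => //=.
  by have := archi_boundP (normr_ge0 x) => /ltW.
by move=> k; split; [exact: measurable_cube|exact: place_measure_cube].
Qed.

HB.instance Definition _ := Measure_isSigmaFinite.Build _ _ _
  place_measure place_sigma_finite.

Lemma integral_place (g : V -> \bar R) : mfunT g -> (forall y, (0 <= g y)%E) ->
  (\int[place_measure]_y g y = \int[lebn m.+1]_x \int[leb]_t g (place G x t))%E.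
Proof.
move=> mg g0.
rewrite [LHS](ge0_integral_pushforward measurable_place_pair)// preimage_setT.
apply: (fubini_tonelli1 (m1 := lebn m.+1) (m2 := leb) (g \o place_pair)).
  by apply: (measurableT_comp mg); exact: measurable_place_pair.
by move=> p; exact: g0.
Qed.

(** Lebesgue measure transported by the rigid motion is translation invariant and finite on the unit
    cube, so [translation_invariant_le] compares it with Lebesgue measure without computing a
    determinant. *)
Lemma place_integral_le : exists2 C : R, 0 <= C & forall g : V -> \bar R,
  mfunT g -> (forall x, (0 <= g x)%E) ->
  (\int[lebn m.+1]_x \int[leb]_t g (place G x t) <= C%:E * \int[lebn n]_y g y)%E.
Proof.
have [||C C0 hC] := @translation_invariant_le R n place_measure
  (fine (place_measure [set x : V | `|x| <= 1])).
- move=> a f mf f0; have mfa : mfunT (fun x : V => f (x + a)).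
    by apply: (measurableT_comp mf); exact: measurable_rV_add.
  rewrite (integral_place mf f0) (integral_place mfa (fun x => f0 _)).
  rewrite {1}(frame_surj a).
  transitivity (\int[lebn m.+1]_x (fun x => \int[leb]_t f (place G x t)) (x + xcoord a)%R)%E.
    apply: eq_integral => x _ /=.
    have mfx (y : V') : mfunT (fun t : R => f (place G y t)).
      by apply: (measurableT_comp mf); apply: measurable_place_comp; last exact: measurable_id.
    rewrite [RHS](@ge0_integral_affine R 1 (tcoord a) (fun t => f (place G (x + xcoord a) t)))//.
    rewrite mul1e; apply: eq_integral => t _.
    by rewrite mul1r -placeD.
  apply: ge0_integral_rV_translation.
    apply: (@measurable_fun_fubini_tonelli_F _ _ _ _ _ leb (f \o place_pair)) => //.
      by apply: (measurableT_comp mf); exact: measurable_place_pair.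
    by move=> p; exact: f0.
  by pos.
- by rewrite fineK// ge0_fin_numE//; exact: place_measure_cube.
by exists C => // g mg g0; rewrite -integral_place//; exact: hC.
Qed.

Lemma epigraph_cone p (P : set V) : open P -> P p -> exists r, 0 < r /\
  exists (a : V) (kappa e0 : R), [/\ 0 < kappa, 0 < e0 &
  forall (y w : V) (e : R), epigraph G y -> `|y - p| <= 2 * r -> 0 < e <= e0 ->
    `|w - a| <= kappa -> epigraph G (y + e *: w) /\ P (y + e *: w)].
Proof.
move=> oP Pp; have /nbhs_ballP[s /= s0 sP] : nbhs p P by exact: open_nbhs_nbhs.
have [L L0 hL] := height_lip.
pose r := s / 4; have r0 : 0 < r by rewrite divr_gt0.
(* A direction within [kappa] of the axis has tangential part at most [n kappa] and vertical part at
   least [1 - n kappa]. As [(L + 1) n kappa = 1/2], it is steeper than the slope [L] of the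
   graph. *)
pose kappa := (2 * n%:R * (L + 1))^-1.
have L1 : 0 < L + 1 by rewrite addr_gt0.
have k0 : 0 < kappa by rewrite invr_gt0 !mulr_gt0.
pose e0 := r / (`|ax| + kappa); have e00 : 0 < e0 by rewrite divr_gt0// ltr_wpDl.
exists r; split=> //; exists ax, kappa, e0; split=> // y w e [x [t [ht ->]]] yp /andP[ee0 ee] wa.
set x' := xcoord w; set t' := tcoord w.
have hx : `|x'| <= n%:R * kappa.
  have -> : x' = xcoord (w - ax) by rewrite /xcoord mulmxBl aT subr0.
  by apply: le_trans (norm_xcoord _) _; rewrite ler_wpM2l.
have ht' : `|t' - 1| <= n%:R * kappa.
  have -> : t' - 1 = tcoord (w - ax) by rewrite /t' /tcoord mulmxBl aa !mxE eqxx.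
  by apply: le_trans (norm_tcoord _) _; rewrite ler_wpM2l.
have nk : (L + 1) * (n%:R * kappa) = 2^-1.
  rewrite /kappa !invfM; have : L + 1 != 0 by rewrite gt_eqF.
  have : n%:R != 0 :> R by [].
  by move=> *; field; apply/andP.
have E : place G x t + e *: w = place G (x + e *: x') (t + e * t').
  by rewrite placeD -scalemxAl -scalerA -scalerDr -frame_surj.
split.
  rewrite E; apply/epigraph_place.
  have := hL (x + e *: x') x; rewrite addrAC subrr add0r normrZ gtr0_norm// => h1.
  have h2 : h (x + e *: x') <= h x + L * (e * `|x'|).
    by rewrite -lerBlDl; apply: le_trans h1; exact: ler_norm.
  have h3 : 1 - n%:R * kappa <= t'.
    by move: ht'; rewrite ler_norml => /andP[+ _]; lra.
  have h4 : L * `|x'| < t'.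
    apply: (@lt_le_trans _ _ (1 - n%:R * kappa)) => //.
    have : L * `|x'| <= L * (n%:R * kappa) by nra.
    by move: nk; lra.
  have : e * (L * `|x'|) < e * t' by rewrite ltr_pM2l.
  by move: h2 ht; rewrite [L * (e * _)]mulrCA; lra.
apply: sP; rewrite -ball_normE /=.
rewrite (_ : p - _ = - (place G x t - p) - e *: w); last by apply/rowP => i; rewrite !mxE; ring.
apply: le_lt_trans (ler_normB _ _) _; rewrite normrN normrZ gtr0_norm//.
have hw : `|w| <= `|ax| + kappa.
  by rewrite -(subrK ax w) addrC; apply: le_trans (ler_normD _ _) _; rewrite lerD2l.
have : e * `|w| <= r.
  apply: (@le_trans _ _ (e0 * (`|ax| + kappa))); first by rewrite ler_pM// ltW.
  by rewrite /e0 divfK// gt_eqF// ltr_wpDl.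
by move: yp; rewrite /r => *; lra.
Qed.

Lemma graph_point_closure x : closure (epigraph G) (graph_point G x).
Proof.
move=> B /nbhs_ballP[e /= e0 eB].
exists (place G x (h x + e / 2)); split.
  by apply/epigraph_place; rewrite ltrDl divr_gt0.
apply: eB; rewrite -ball_normE /= /graph_point.
have -> : place G x (h x) - place G x (h x + e / 2) = - (e / 2 *: ax).
  by rewrite /place scalerDl; apply/rowP => i; rewrite !mxE; ring.
rewrite normrN normrZ gtr0_norm ?divr_gt0//.
apply: (@le_lt_trans _ _ (e / 2)); last by rewrite ltr_pdivrMr// ltr_pMr// ltr1n.
have n1 : `|ax| <= 1 by apply: norm_rV_le => // j; exact: axis_le1.
by nra.
Qed.

End graph_geometry.

Section lipschitz_domain.
Context {R : realType} {m : nat} (Omega : set 'rV[R]_m.+2).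
Hypothesis oO : open Omega.
Variable A : lipschitz_atlas Omega.

Lemma closure_open_boundary p : closure Omega p -> Omega p \/ boundary Omega p.
Proof.
move=> cp; have [|nO] := pselect (Omega p); [by left|right; split=> //].
by move=> /interior_subset.
Qed.

Lemma lipschitz_cone p : closure Omega p -> exists r, cone_at Omega p r.
Proof.
move=> /closure_open_boundary[Op|/patch_cover -/(_ A)[k _ pk]].
  have /nbhs_ballP[s /= s0 sO] : nbhs p Omega by exact: open_nbhs_nbhs.
  exists (s / 4); split; first by rewrite divr_gt0.
  (* At an interior point every direction is admissible, so the axis is 0. *)
  exists 0, 1, (s / 4); split=> //; first by rewrite divr_gt0.
  move=> y w e _ yp /andP[e0 es]; rewrite subr0 => w1; apply: sO; rewrite -ball_normE /=.
  rewrite (_ : p - _ = - (y - p) - e *: w); last by apply/rowP => i; rewrite !mxE; ring.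
  apply: le_lt_trans (ler_normB _ _) _; rewrite normrN normrZ gtr0_norm//.
  have : e * `|w| <= s / 4 by nra.
  by move: yp; lra.
have [r [r0 [a [kappa [e0 [k0 e00 H]]]]]] := epigraph_cone (coords k) (@patch_open _ _ _ A k) pk.

have /nbhs_ballP[s /= s0 sP] : nbhs p (Defs.patch k) by apply: open_nbhs_nbhs; split=> //; exact: patch_open.
pose r' := Num.min r (s / 4).
have r'r : r' <= r by rewrite ge_min lexx.
have r's : r' <= s / 4 by rewrite ge_min lexx orbT.
have r'0 : 0 < r' by rewrite lt_min r0 divr_gt0.
exists r'; split=> //; exists a, kappa, e0; split=> // y w e Oy yp ee wa.
have Py : Defs.patch k y.
  apply: sP; rewrite -ball_normE /= distrC; move: yp r's; lra.
have Ey : epigraph (coords k) y.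
  have : (Omega `&` Defs.patch k) y by [].
  by rewrite patch_epigraph => -[].
have [|E1 E2] := H y w e Ey _ ee wa; first by move: yp r'r; lra.
have : (epigraph (coords k) `&` Defs.patch k) (y + e *: w) by [].
by rewrite -patch_epigraph => -[].
Qed.

Lemma graph_point_boundary (k : 'I_(npatch A)) x : Defs.patch k (graph_point (coords k) x) ->
  boundary Omega (graph_point (coords k) x).
Proof.
move=> pk; split.
  move=> B Bn; have Bp : nbhs (graph_point (coords k) x) (B `&` Defs.patch k).
    by apply: filterI => //; apply: open_nbhs_nbhs; split=> //; exact: patch_open.
  have [y [Ey [By Py]]] := @graph_point_closure R m (coords k) x _ Bp.
  have : (epigraph (coords k) `&` Defs.patch k) y by [].
  by rewrite -(patch_epigraph (l := A)) => -[Oy _]; exists y.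
move=> /interior_subset Op.
have : (Omega `&` Defs.patch k) (graph_point (coords k) x) by [].
by rewrite patch_epigraph => -[/epigraph_place]; rewrite ltxx.
Qed.

End lipschitz_domain.

(** * Trace estimates over a Lipschitz graph *)

Section increments.
Context {R : realType}.
Local Notation leb := (@lebesgue_measure R).

Lemma integral_mul_indic d (T : measurableType d) (mu : {measure set T -> \bar R})
    (D : set T) (f : T -> \bar R) :
  (\int[mu]_(x in D) f x = \int[mu]_x (f x * (\1_D x)%:E))%E.
Proof.
rewrite integral_mkcond; apply: eq_integral => x _; rewrite patchE indicE.
by case: ifP => xD; rewrite ?mule1 ?mule0.
Qed.

Lemma continuous_mul (f g : R -> R) :
  continuous f -> continuous g -> continuous (fun x => f x * g x).
Proof. by move=> cf cg x; exact: (cvgM (cf x) (cg x)). Qed.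

Lemma derivative_integral (phi dphi : R -> R) (a b : R) : a < b ->
  (forall x : R, is_derive x (1 : R) phi (dphi x)) -> continuous dphi ->
  leb.-integrable `[a, b] (EFin \o dphi) /\
  (\int[leb]_(x in `[a, b]) dphi x)%R = phi b - phi a.
Proof.
move=> ab dp cd.
have cw : {within `[a, b], continuous dphi} by exact: continuous_subspaceT.
split; first by apply: continuous_compact_integrable => //; exact: segment_compact.
have cp (x : R) : {for x, continuous phi}.
  by apply: differentiable_continuous; apply/derivable1_diffP.
rewrite /Rintegral (@continuous_FTC2 R dphi phi a b)//.
- split; first by move=> x _; exact: (@ex_derive _ _ _ _ _ _ _ (dp x)).
  + by apply: cvg_at_right_filter; exact: cp.
  + by apply: cvg_at_left_filter; exact: cp.
- by move=> x _; rewrite derive1E (@derive_val _ _ _ _ _ _ _ (dp x)).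
Qed.

Lemma abs_increment_le (phi dphi : R -> R) (a b : R) : a < b ->
  (forall x : R, is_derive x (1 : R) phi (dphi x)) -> continuous dphi ->
  ((`|phi b - phi a|)%:E <= \int[leb]_(x in `[a, b]) (`|dphi x|)%:E)%E.
Proof.
move=> ab dp cd; have [i <-] := derivative_integral ab dp cd.
by rewrite EFin_normr_Rintegral//; apply: le_abse_integral => //; case/integrableP : i.
Qed.

Lemma sqr_increment_le (phi dphi : R -> R) :
  (forall x : R, is_derive x (1 : R) phi (dphi x)) -> continuous dphi ->
  (((phi 1 - phi 0) ^+ 2)%:E <= \int[leb]_(x in `[0%R, 1%R]) (dphi x ^+ 2)%:E)%E.
Proof.
move=> dp cd; have [i <-] := derivative_integral ltr01 dp cd.
pose D : set R := `[0, 1]%classic.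
have mD : measurable D by meas.
have md : measurable_fun D dphi by apply/measurable_EFinP; case/integrableP : i.
have lD : leb D = 1%E by rewrite lebesgue_measure_itv/= lte_fin ltr01 oppr0 adde0.
have i1 : (\int[leb]_(x in D) cst 1 x = 1)%E by rewrite integral_cst// mul1e.
have h2 : rL2 leb D (fun=> 1).
  split; first exact: measurable_cst.
  rewrite /rL2sq (eq_integral (cst 1%E)); last by move=> x _; rewrite expr1n.
  by rewrite i1 ltry.
have h1 : rL2 leb D dphi.
  split=> //; have : leb.-integrable D (EFin \o (fun x => dphi x ^+ 2)).
    apply: continuous_compact_integrable => //; first exact: segment_compact.
    apply: continuous_subspaceT => x; under eq_fun do rewrite expr2.
    by apply: cvgM; exact: cd.
  move=> /integrableP[_]; apply: le_lt_trans; apply: le_of_eq.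
  by apply: eq_integral => x _; rewrite /= ger0_norm ?sqr_ge0.
have := semi_ip_CS (@rL2_semi_ip _ _ _ leb D mD) h1 h2.
rewrite (_ : rip leb D _ (fun=> 1) = \int[leb]_(x in D) dphi x)%R; last first.
  by apply: eq_Rintegral => x _; rewrite mulr1.
rewrite (_ : rip leb D (fun=> 1) (fun=> 1) = 1) ?mulr1; last first.
  rewrite rip_sq /rL2sq (eq_integral (cst 1%E)); last by move=> x _; rewrite expr1n.
  by rewrite i1.
by rewrite -lee_fin rip_sq fineK//; exact: rL2_fin.
Qed.

End increments.

Section trace_estimate.
Context {R : realType} {m : nat}.
Local Notation n := m.+2.
Local Notation V := 'rV[R]_n.
Local Notation V' := 'rV[R]_m.+1.
Local Notation leb := (@lebesgue_measure R).
Local Notation lebn := (rV_lebesgue R).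
Variable G : lipschitz_graph R n.
Local Notation h := (height G).
Local Notation T := (tangent G).
Local Notation ax := (axis G).

Lemma place_subbase x t : place G x t - base G = x *m T + t *: ax.
Proof. by rewrite /place; apply/rowP => i; rewrite !mxE; ring. Qed.

Lemma measurable_epigraph : measurable (epigraph G).
Proof.
pose f (y : V) := tcoord G (y - base G) - h (xcoord G (y - base G)).
have -> : epigraph G = f @^-1` `]0, +oo[%classic.
  apply/seteqP; split=> y; rewrite /f /= in_itv/= andbT subr_gt0.
    move=> [x [t [ht ->]]].
    by rewrite place_subbase xcoordE tcoordE.
  have [x [t ->]] := place_surj G y.
  by rewrite place_subbase xcoordE tcoordE => /epigraph_place.
rewrite -[X in measurable X]setTI.
have ms : mfunT (fun y : V => y - base G) by exact: measurable_rV_add.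
have mf : mfunT f.
  apply: measurable_funB.
    rewrite (_ : (fun _ => _) = (fun y => \sum_k (y - base G) 0 k * ax^T k 0)); last first.
      by apply/funext => y; rewrite /tcoord mxE.
    apply: measurable_sum => k; apply: measurable_funM; last exact: measurable_cst.
    exact: (measurableT_comp (measurable_entry 0 k) ms).
  apply: (measurableT_comp (measurable_height G)).
  apply: measurable_fun_matrix => i j.
  rewrite (_ : (fun _ => _) = (fun y => \sum_k (y - base G) i k * T^T k j)); last first.
    by apply/funext => y; rewrite /xcoord mxE.
  apply: measurable_sum => k; apply: measurable_funM; last exact: measurable_cst.
  exact: (measurableT_comp (measurable_entry i k) ms).
by meas.
Qed.

(** Coordinates that flatten the graph: the epigraph becomes [t > 0]. *)
Definition above (x : V') (t : R) : V := place G x (h x + t).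

Lemma measurable_above_comp d (U : measurableType d) (f : U -> V') (g : U -> R) :
  mfunT f -> mfunT g ->
  mfunT (fun u => above (f u) (g u)).
Proof.
move=> mf mg; apply: measurable_place_comp => //; apply: measurable_funD => //.
exact: (measurableT_comp (measurable_height G) mf).
Qed.

Lemma above_line x t : above x t = above x 0 + t *: ax.
Proof. by rewrite /above addr0 /place scalerDl addrA. Qed.

Lemma above_norm_le (B : R) x t : 0 <= B -> `|above x t| <= B ->
  `|x| <= n%:R * (B + `|base G|).
Proof. by move=> B0 /place_bounded[]. Qed.

Lemma above_lip : exists2 L : R, 0 < L & forall x y t, `|above x t - above y t| <= L * `|x - y|.
Proof.
have [L L0 hL] := height_lip G.
exists (m.+1%:R + L); first by rewrite addr_gt0.
move=> x y t; rewrite (_ : _ - _ = (x - y) *m T + (h x - h y) *: ax); last first.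
  by rewrite /above /place mulmxBl; apply/rowP => i; rewrite !mxE; ring.
by apply: le_trans (norm_frame _ _ _) _; rewrite mulrDl lerD2l.
Qed.

(** On each vertical line the shear [t -> h x + t] is a translation, which preserves the integral;
    the rest is [place_integral_le]. *)
Lemma above_integral_le : exists2 C : R, 0 <= C & forall g : V -> \bar R,
  mfunT g -> (forall x, (0 <= g x)%E) ->
  (\int[leb]_(t in `[0%R, +oo[) \int[lebn m.+1]_x g (above x t) <=
   C%:E * \int[lebn n]_(y in epigraph G) g y)%E.
Proof.
have [C C0 hC] := place_integral_le G; exists C => // g mg g0.
have mE := measurable_epigraph.
pose g1 y := (g y * (\1_(epigraph G) y)%:E)%E.
have mg1 : mfunT g1.
  by apply: emeasurable_funM => //; apply/measurable_EFinP.
have g10 y : (0 <= g1 y)%E by rewrite mule_ge0//.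
have mab : mfunT (fun p : V' * measurableTypeR R => above p.1 p.2).
  by apply: measurable_above_comp.
rewrite [X in (_ <= _ * X)%E]integral_mul_indic.
apply: le_trans (hC g1 mg1 g10).
rewrite -(@integral_itv_obnd_cbnd R 0 +oo%O); last first.
  apply: measurable_funTS.
  apply: (@measurable_fun_fubini_tonelli_G _ _ _ _ _ (lebn m.+1) (fun p : V' * measurableTypeR R => g (above p.1 p.2))) => //.
  by meas.
rewrite integral_mul_indic.
pose H (p : V' * measurableTypeR R) := (g (above p.1 p.2) * (\1_(`]0%R, +oo[%classic) (p.2 : R))%:E)%E.
have mI : mfunT (fun t : R => (\1_(`]0%R, +oo[%classic) t)%:E : \bar R) by meas.
have mH : mfunT H.
  apply: emeasurable_funM; first exact: (measurableT_comp mg mab).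
  exact: (measurableT_comp mI measurable_snd).
have H0 p : (0 <= H p)%E by rewrite mule_ge0//.
have mgt t : mfunT (fun x : V' => g (above x t)).
  by apply: (measurableT_comp mg); apply: measurable_above_comp.
rewrite (eq_integral (fun t => \int[lebn m.+1]_x H (x, t))%E); last first.
  by move=> t _; rewrite /H -ge0_integralZr//.
rewrite -(fubini_tonelli (m1 := lebn m.+1) (m2 := leb) H mH H0).
apply: le_of_eq; apply: eq_integral => x _.
have mgx : mfunT (fun t : R => g1 (place G x t)).
  by apply: (measurableT_comp mg1); apply: measurable_place_comp; last exact: measurable_id.
rewrite [RHS](@ge0_integral_affine R 1 (h x))// mul1e; apply: eq_integral => t _.
rewrite /H /g1 /= mul1r /above (addrC t); congr (_ * _%:E)%E.
rewrite !indicE (_ : (t \in _) = (place G x (h x + t) \in epigraph G))//.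
apply/idP/idP; rewrite !inE /= in_itv/= andbT.
  by move=> t0; apply/epigraph_place; rewrite ltrDl.
by move=> /epigraph_place; rewrite ltrDl.
Qed.

Definition gradsum (f : V -> R) y := \sum_j `|partial j f y|.

Lemma gradsum_ge0 f y : 0 <= gradsum f y.
Proof. exact: sumr_ge0. Qed.

Lemma measurable_gradsum f : smooth f -> mfunT (gradsum f).
Proof.
move=> sf; apply: measurable_sum => j; apply: measurableT_comp => //.
by apply: measurable_smooth; exact: smooth_partial.
Qed.

Lemma smooth_line_continuous (f : V -> R) (y : V) (c : R -> R) : smooth f -> continuous c ->
  continuous (fun s : R => f (y + c s *: ax)).
Proof.
move=> sf cc s.
have c1 : (fun s : R => y + c s *: ax) @ s --> y + c s *: ax.
  apply: (@cvgD _ _ _ (nbhs s)); first exact: cvg_cst.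
  by apply: (@cvgZr_tmp _ _ _ (nbhs s)); exact: cc.
exact: (@continuous_comp _ _ _ (fun s : R => y + c s *: ax) f s c1 (@smooth_continuous _ _ _ sf _)).
Qed.

Definition axis_derive (f : V -> R) (y : V) := \sum_j ax 0 j * partial j f y.

Lemma axis_derive_le f y : `|axis_derive f y| <= gradsum f y.
Proof.
apply: le_trans (ler_norm_sum _ _ _) _; apply: ler_sum => j _.
by rewrite normrM ler_piMl// axis_le1.
Qed.

Lemma smooth_axis_derive f : smooth f -> smooth (axis_derive f).
Proof. by move=> sf; apply: smooth_sum => j; apply: smoothZ; exact: smooth_partial. Qed.

Lemma is_derive_axis_path (f : V -> R) (y : V) (c dc : R -> R) (s : R) : smooth f ->
  is_derive s (1 : R) c (dc s) ->
  is_derive s (1 : R) (fun s : R => f (y + c s *: ax)) (dc s * axis_derive f (y + c s *: ax)).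
Proof.
move=> sf dcs.
have d1 := smooth_is_derive (y + c s *: ax) ax sf.
have d2 := @is_derive_line R n f y ax (c s) (@ex_derive _ _ _ _ _ _ _ d1).
rewrite (@derive_val _ _ _ _ _ _ _ d1) in d2.
have := is_derive1_comp (f := fun s => f (y + s *: ax)) (g := c) d2 dcs.
by rewrite mulrC.
Qed.

(** The vertical segment is run through as [s -> r s^2], with speed [2 r s]. At constant speed,
    integration over [r] would leave the divergent integral of [1 / s]; here the factor [s^2]
    compensates the rescaling of [r]. *)
Lemma vertical_le f x (r : R) : smooth f ->
  (((f (above x r) - f (above x 0)) ^+ 2)%:E <=
   \int[leb]_(s in `[0%R, 1%R]) (4 * r ^+ 2 * s ^+ 2 * gradsum f (above x (r * s ^+ 2)) ^+ 2)%:E)%E.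
Proof.
move=> sf; pose c (s : R) := r * s ^+ 2; pose dc (s : R) := 2 * r * s.
have dcP (s : R) : is_derive s (1 : R) c (dc s).
  have h1 := @is_deriveM _ _ id id s 1 1 1 (is_derive_id _ _) (is_derive_id _ _).
  have h2 := @is_deriveZ _ _ _ _ r s 1 _ h1.
  apply: is_derive_eq h2 _; rewrite /dc -![_ *: _]/(_ * _) /=; ring.
have cc : continuous c.
  by move=> s; apply: differentiable_continuous.
have cdc : continuous dc.
  by move=> s; apply: cvgM; [exact: cvg_cst|exact: cvg_id].
have := @sqr_increment_le R (fun s => f (above x 0 + c s *: ax))
   (fun s => dc s * axis_derive f (above x 0 + c s *: ax)).
move=> /(_ (fun s => is_derive_axis_path (above x 0) sf (dcP s))).
have cph : continuous (fun s => dc s * axis_derive f (above x 0 + c s *: ax)).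
  apply: continuous_mul; first exact: cdc.
  have H := @smooth_line_continuous (axis_derive f) (above x 0) c (smooth_axis_derive sf) cc.
  exact H.
move=> /(_ cph); rewrite {2}/c expr0n mulr0 scale0r addr0 {1}/c expr1n mulr1 -above_line.
move=> /le_trans; apply; apply: ge0_le_integral => //.
- by pos.
- apply/measurable_EFinP; apply: measurable_funX; apply: measurable_funTS.
  exact: continuous_measurable_fun.
- apply/measurable_EFinP; apply: measurable_funTS; apply: measurable_funM.
    by meas.
  apply: measurable_funX; apply: (measurableT_comp (measurable_gradsum sf)).
  apply: measurable_above_comp; first exact: measurable_cst.
  by meas.
- move=> s _; rewrite lee_fin -above_line exprMn /dc.
  rewrite (_ : 4 * r ^+ 2 * s ^+ 2 = (2 * r * s) ^+ 2); last by ring.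
  rewrite ler_wpM2l ?sqr_ge0//.
  by rewrite -[leLHS]real_normK ?num_real// ler_pXn2r ?nnegrE ?gradsum_ge0// axis_derive_le.
Qed.

Lemma above_abs_le f x : test_function setT f ->
  ((`|f (above x 0)|)%:E <= \int[leb]_(t in `[0%R, +oo[) (gradsum f (above x t))%:E)%E.
Proof.
move=> tf; have sf : smooth f by case: tf.
have [B B0 hB] := test_box tf.
(* At this height the vertical line has left the support of [f], wherever it started. *)
pose T0 := n%:R * (B + `|base G|) + `|h x| + 1.
have T00 : 0 < T0 by rewrite ltr_wpDl// addr_ge0// mulr_ge0// addr_ge0.
have fT : f (above x T0) = 0.
  apply/eqP; apply: contraT => /hB /place_bounded[_].
  have := ler_norm (h x + T0); have := ler_norm (- h x); rewrite normrN /T0.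
  by move=> *; exfalso; lra.
have := @abs_increment_le R (fun s => f (above x 0 + s *: ax))
   (fun s => 1 * axis_derive f (above x 0 + s *: ax)) 0 T0 T00.
have dP (s : R) : is_derive s (1 : R) (fun s : R => f (above x 0 + s *: ax)) (1 * axis_derive f (above x 0 + s *: ax)).
  exact: (@is_derive_axis_path f (above x 0) id (fun=> 1) s sf (is_derive_id _ _)).
move=> /(_ dP).
have cph : continuous (fun s : R => 1 * axis_derive f (above x 0 + s *: ax)).
  apply: continuous_mul; first by move=> s; exact: cvg_cst.
  have ci : continuous (fun s : R => s) by move=> z.
  have H := @smooth_line_continuous (axis_derive f) (above x 0) (fun s => s) (smooth_axis_derive sf) ci.
  exact H.
move=> /(_ cph); rewrite -above_line fT scale0r addr0 sub0r normrN.
have mg : mfunT (fun t : R => (gradsum f (above x t))%:E).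
  apply/measurable_EFinP; apply: (measurableT_comp (measurable_gradsum sf)).
  by apply: measurable_above_comp.
move=> /le_trans; apply.
apply: (@le_trans _ _ (\int[leb]_(t in `[0%R, T0]) (gradsum f (above x t))%:E)%E).
  apply: ge0_le_integral => //.
  - apply/measurable_EFinP; apply: measurableT_comp => //; apply: measurable_funTS.
    exact: continuous_measurable_fun.
  - exact: measurable_funTS.
  - by move=> s _; rewrite lee_fin mul1r -above_line axis_derive_le.
apply: ge0_subset_integral => //.
- exact: measurable_funTS.
- by move=> t _; rewrite lee_fin gradsum_ge0.
- by move=> t; rewrite /= !in_itv/= => /andP[-> _].
Qed.

Local Notation "|| x ||" := (`|x|%R : R) (only parsing).

Lemma measurable_rV_addf d (U : measurableType d) (k : nat) (f g : U -> 'rV[R]_k) :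
  mfunT f -> mfunT g -> mfunT (fun u => f u + g u).
Proof.
move=> mf mg; apply: measurable_fun_matrix => i j; under eq_fun do rewrite mxE.
apply: measurable_funD; first exact: (measurableT_comp (measurable_entry i j) mf).
exact: (measurableT_comp (measurable_entry i j) mg).
Qed.

Lemma measurable_smooth_above d (U : measurableType d) (f : V -> R) (a : U -> V') (b : U -> R) :
  mfunT f -> mfunT a -> mfunT b ->
  mfunT (fun u => f (above (a u) (b u))).
Proof. by move=> mf ma mb; apply: (measurableT_comp mf); exact: measurable_above_comp. Qed.

Definition slice_energy f (t : R) : \bar R :=
  (\int[lebn m.+1]_x (gradsum f (above x t) ^+ 2)%:E)%E.

Definition graph_energy f : \bar R := (\int[leb]_(t in `[0%R, +oo[) slice_energy f t)%E.

Lemma slice_energy_ge0 f t : (0 <= slice_energy f t)%E.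
Proof. by apply: integral_ge0 => x _; rewrite lee_fin sqr_ge0. Qed.

Lemma measurable_slice_energy f : smooth f -> mfunT (slice_energy f).
Proof.
move=> sf; apply: (@measurable_fun_fubini_tonelli_G _ _ _ _ _ (lebn m.+1)
  (fun p : V' * measurableTypeR R => (gradsum f (above p.1 p.2) ^+ 2)%:E)).
  apply/measurable_EFinP; apply: measurable_funX.
  apply: measurable_smooth_above; [exact: measurable_gradsum|exact: measurable_fst|exact: measurable_snd].
by pos.
Qed.

Definition vertical f (r : R) : \bar R :=
  (\int[lebn m.+1]_x ((f (above x r) - f (above x 0)) ^+ 2)%:E)%E.

Lemma measurable_vertical f : smooth f -> mfunT (vertical f).
Proof.
move=> sf; have mf := measurable_smooth sf.
apply: (@measurable_fun_fubini_tonelli_G _ _ _ _ _ (lebn m.+1)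
  (fun p : V' * measurableTypeR R => ((f (above p.1 p.2) - f (above p.1 0)) ^+ 2)%:E)).
  apply/measurable_EFinP; apply: measurable_funX; apply: measurable_funB.
    by apply: measurable_smooth_above.
  by apply: measurable_smooth_above.
by pos.
Qed.

Let ind01 (s : R) : R := \1_(`[0, 1]%classic) s.
Let mind01 : mfunT ind01.
Proof. by apply/measurable_indicP. Qed.

Lemma vertical_slice_le f (r : R) : smooth f ->
  (vertical f r <= \int[leb]_s ((4 * r ^+ 2 * s ^+ 2 * ind01 s)%:E * slice_energy f (r * s ^+ 2)%R))%E.
Proof.
move=> sf; have mg := measurable_gradsum sf; have mf := measurable_smooth sf.
pose H (p : V' * measurableTypeR R) : \bar R :=
  ((4 * r ^+ 2 * (p.2 : R) ^+ 2 * ind01 p.2) * gradsum f (above p.1 (r * (p.2 : R) ^+ 2)) ^+ 2)%:E.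
have m2 : mfunT (fun p : V' * measurableTypeR R => (p.2 : R)) by meas.
have mH : mfunT H.
  apply/measurable_EFinP; apply: measurable_funM.
    by meas.
  apply: measurable_funX; apply: measurable_smooth_above => //.
  by meas.
have c0 s : 0 <= 4 * r ^+ 2 * s ^+ 2 * ind01 s by pos.
have H0 p : (0 <= H p)%E by rewrite lee_fin mulr_ge0 ?sqr_ge0.
apply: (@le_trans _ _ (\int[lebn m.+1]_x \int[leb]_s H (x, s))%E).
  apply: ge0_le_integral => //.
  - by pos.
  - by apply/measurable_EFinP; apply: measurable_funX; apply: measurable_funB; by apply: measurable_smooth_above => //.
  - exact: (@measurable_fun_fubini_tonelli_F _ _ _ _ _ leb H mH H0).
  - move=> x _; apply: le_trans (vertical_le x r sf) _.
    rewrite integral_mul_indic; apply: le_of_eq; apply: eq_integral => s _.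
    by rewrite /H -EFinM; congr (_%:E); rewrite mulrAC.
rewrite (fubini_tonelli (m1 := lebn m.+1) (m2 := leb) H mH H0).
apply: le_of_eq; apply: eq_integral => s _.
rewrite /slice_energy -ge0_integralZl_EFin//.
- by pos.
- by apply/measurable_EFinP; apply: measurable_funX; apply: measurable_smooth_above.
Qed.

Let indp (s : R) : R := \1_(`[0, +oo[%classic) s.
Let mindp : mfunT indp.
Proof. by apply/measurable_indicP. Qed.

(* Hardy's inequality with a constant obtained from the substitution s -> s ^ 2,
   which replaces the weight s ^ (-1/2). *)
Lemma hardy_le f : smooth f ->
  (\int[leb]_r ((indp r)%:E * \int[leb]_s ((4 * s ^+ 2 * ind01 s)%:E * slice_energy f (r * s ^+ 2)%R))
    <= 4%:E * graph_energy f)%E.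
Proof.
move=> sf; have mS := measurable_slice_energy sf; have S0 := slice_energy_ge0 f.
have p0 s : 0 <= indp s by [].
have c0 s : 0 <= 4 * s ^+ 2 * ind01 s by pos.
pose H (p : measurableTypeR R * measurableTypeR R) : \bar R :=
  ((indp p.1 * (4 * (p.2 : R) ^+ 2 * ind01 p.2))%:E * slice_energy f ((p.1 : R) * (p.2 : R) ^+ 2)%R)%E.
have m1 : mfunT (fun p : measurableTypeR R * measurableTypeR R => (p.1 : R)) by meas.
have m2 : mfunT (fun p : measurableTypeR R * measurableTypeR R => (p.2 : R)) by meas.
have mH : mfunT H.
  apply: emeasurable_funM.
    by meas.
  apply: (measurableT_comp mS); apply: measurable_funM => //; exact: measurable_funX.
have H0 p : (0 <= H p)%E by rewrite mule_ge0// lee_fin mulr_ge0.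
rewrite (eq_integral (fun r => \int[leb]_s H (r, s))%E); last first.
  move=> r _.
  have mm : mfunT (fun s : R => (4 * s ^+ 2 * ind01 s)%:E * slice_energy f (r * s ^+ 2)%R)%E.
    apply: emeasurable_funM.
      by meas.
    by apply: (measurableT_comp mS); apply: measurable_funM.
  have mm0 (s : R) : setT s -> (0 <= (4 * s ^+ 2 * ind01 s)%:E * slice_energy f (r * s ^+ 2)%R)%E by pos.

  rewrite -(ge0_integralZl_EFin leb measurableT mm0 mm (p0 r)).
  by apply: eq_integral => s _; rewrite /H muleA//.
rewrite (fubini_tonelli (m1 := leb) (m2 := leb) H mH H0).
have EE : graph_energy f = (\int[leb]_u (slice_energy f u * (indp u)%:E))%E.
  by rewrite /graph_energy integral_mul_indic.
have E0 : (0 <= graph_energy f)%E by apply: integral_ge0 => t _.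
apply: (@le_trans _ _ (\int[leb]_s ((4%:E * graph_energy f) * (ind01 s)%:E)))%E; last first.
  rewrite ge0_integralZl//.
  - have I1 : (\int[leb]_s (ind01 s)%:E = 1)%E.
      by rewrite [LHS]integral_indic_itv lebesgue_measure_itv/= lte_fin ltr01 oppr0 adde0.
    by rewrite [X in (_ * X)%E]I1 mule1.
  - by meas.
  - by pos.
  - by pos.
apply: ge0_le_integral => //.
- by pos.
- exact: (@measurable_fun_fubini_tonelli_G _ _ _ _ _ leb H mH H0).
- by meas.
move=> s _.
have [->|s0] := eqVneq s 0.
  rewrite (eq_integral (cst 0%E)) ?integral0; first by rewrite !mule_ge0 ?lee_fin.
  by move=> r _; rewrite /H /= expr0n/= mulr0 mul0r mulr0 mul0e.
have s2 : 0 < s ^+ 2 by nra.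
rewrite EE (@ge0_integral_affine R (s ^+ 2) 0)//; last 2 first.
- by meas.
- by pos.
pose K (r : R) : \bar R := (slice_energy f (s ^+ 2 * r + 0)%R * (indp (s ^+ 2 * r + 0)%R)%:E)%E.
have ma : mfunT (fun r : R => s ^+ 2 * r + 0) by meas.
have mK : mfunT K.
  apply: emeasurable_funM; first exact: (measurableT_comp mS ma).
  by meas.
have K0 (r : R) : setT r -> (0 <= K r)%E by move=> _; rewrite mule_ge0// lee_fin.
have EH : (\int[leb]_r H (r, s) = (4 * s ^+ 2 * ind01 s)%:E * \int[leb]_r K r)%E.
  rewrite -(ge0_integralZl_EFin leb measurableT K0 mK (c0 s)); apply: eq_integral => r _.
  rewrite /H /K /= addr0 (mulrC (s ^+ 2) r).
  have -> : indp (r * s ^+ 2) = indp r.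
    rewrite /indp !indicE; congr ((nat_of_bool _)%:R).
    by rewrite !mem_setE !in_itv/= !andbT pmulr_lge0.
  by rewrite (mulrC (indp r)) EFinM -muleA (muleC (indp r)%:E).
rewrite EH -/(K _) [X in (_ <= X)%E](_ : _ = (4 * s ^+ 2 * ind01 s)%:E * \int[leb]_r K r)%E//.
by rewrite muleA -EFinM muleAC//.
Qed.

Definition horizontal f (r : R) (zeta : V') : \bar R :=
  (\int[lebn m.+1]_x ((f (above (x + zeta) r) - f (above x r)) ^+ 2)%:E)%E.

Lemma measurable_horizontal_int f r (zeta : V') : smooth f ->
  mfunT (fun x : V' => ((f (above (x + zeta) r) - f (above x r)) ^+ 2)%:E).
Proof.
move=> sf; have mf := measurable_smooth sf.
apply/measurable_EFinP; apply: measurable_funX; apply: measurable_funB.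
  by apply: measurable_smooth_above => //; exact: measurable_rV_add.
by apply: measurable_smooth_above.
Qed.

(** A long step is a sum of [k + 1] translates of a short one, which all have the same norm. The
    induction uses [(a + b)^2 <= (1 + c) a^2 + (1 + 1/c) b^2] and
    [(1 + c) + (1 + 1/c) c^2 = (c + 1)^2]. *)
Lemma horizontal_subdivide f r (eta : V') (k : nat) : smooth f ->
  (horizontal f r (k.+1%:R *: eta) <= (k.+1%:R ^+ 2)%:E * horizontal f r eta)%E.
Proof.
move=> sf; have mf := measurable_smooth sf.
elim: k => [|k ih]; first by rewrite scale1r expr1n mul1e.
set c : R := k.+1%:R; have c0 : 0 < c by rewrite ltr0n.
pose u (x : V') := f (above (x + c *: eta) r) - f (above x r).
pose v (x : V') := f (above (x + eta) r) - f (above x r).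
have mu : mfunT u.
  by apply: measurable_funB; apply: measurable_smooth_above => //; exact: measurable_rV_add.
have mv : mfunT v.
  by apply: measurable_funB; apply: measurable_smooth_above => //; exact: measurable_rV_add.
have mvs : mfunT (fun x : V' => v (x + c *: eta)) by exact: measurable_rV_translation.
have cS : k.+2%:R = c + 1 :> R by rewrite /c -natr1.
have E (x : V') : f (above (x + k.+2%:R *: eta) r) - f (above x r) = v (x + c *: eta) + u x.
  by rewrite cS scalerDl scale1r /u /v addrA addrA subrK.
apply: (@le_trans _ _ ((1 + c)%:E * \int[lebn m.+1]_x (v (x + c *: eta)%R ^+ 2)%:E +
    (1 + c^-1)%:E * \int[lebn m.+1]_x (u x ^+ 2)%:E)%E).
  rewrite -!ge0_integralZl_EFin ?addr_ge0 ?invr_ge0 ?(ltW c0)//; last 4 first.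
  - by pos.
  - by meas.
  - by pos.
  - by meas.
  rewrite -ge0_integralD//; last 4 first.
  - by pos.
  - by meas.
  - by pos.
  - by meas.
  apply: ge0_le_integral => //.
  - by pos.
  - exact: measurable_horizontal_int.
  - by apply: emeasurable_funD; apply: measurable_funeM; exact: measurable_sqr.
  move=> x _; rewrite E -!EFinM -EFinD lee_fin; move: (v _) (u x) => a b.
  rewrite -subr_ge0 (_ : _ - _ = c^-1 * (c * a - b) ^+ 2); first by rewrite mulr_ge0 ?sqr_ge0// invr_ge0 ltW.
  by field.
have -> : (\int[lebn m.+1]_x (v (x + c *: eta)%R ^+ 2)%:E = horizontal f r eta)%E.
  by rewrite [LHS](integral_rV_translation (c *: eta) (f := fun x => (v x ^+ 2)%:E))//; exact: measurable_sqr.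
apply: (@le_trans _ _ ((1 + c)%:E * horizontal f r eta + (1 + c^-1)%:E * ((c ^+ 2)%:E * horizontal f r eta))%E).
  by rewrite leeD2l// lee_wpmul2l// lee_fin addr_ge0// invr_ge0 ltW.
rewrite muleA -EFinM -ge0_muleDl; last 2 first.
- by pos.
- by pos.
rewrite -EFinD cS (_ : 1 + c + _ = (c + 1) ^+ 2)//.
by field.
Qed.

(* The remainder of order [|eta|^4] disappears in [horizontal_le], where a step
   [zeta] is split into many small steps [eta]. *)
Lemma horizontal_small L f r : (forall x y t, `|above x t - above y t| <= L * `|x - y|) ->
  0 < L -> test_function setT f -> exists2 K : R, 0 <= K & forall eta : V', `|eta| <= 1 ->
  (horizontal f r eta <= (2 * n%:R ^+ 2 * L ^+ 2 * `|eta| ^+ 2)%:E * slice_energy f r +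
     (K * `|eta| ^+ 4)%:E)%E.
Proof.
move=> hL L0 tf; have sf : smooth f by case: tf.
have mf := measurable_smooth sf; have mg := measurable_gradsum sf.
have /choice[K_ hK] j : exists K : R, 0 <= K /\ forall x y, `|partial j f x - partial j f y| <= K * `|x - y|.
  by have [K K0 hK] := test_lipschitz (test_partial j tf); exists K.
pose K' := \sum_j K_ j.
have K'0 : 0 <= K' by apply: sumr_ge0 => j _; case: (hK j).
have KK' j : K_ j <= K'.
  by rewrite /K' (bigD1 j)//= lerDl sumr_ge0// => i _; case: (hK i).
have [B B0 hB] := test_box tf.
(* The summand 1 allows for the shift by [eta], whose norm is at most 1. *)
pose R0 := n%:R * (B + `|base G|) + 1.
have R00 : 0 <= R0 by rewrite addr_ge0// mulr_ge0// addr_ge0.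
pose vol := (2 * R0) ^+ m.+1.
have vol0 : 0 <= vol by rewrite exprn_ge0// mulr_ge0.
pose c1 := 2 * n%:R ^+ 2 * L ^+ 2 : R.
have c10 : 0 <= c1 by rewrite !mulr_ge0// ltW.
exists (c1 * (K' ^+ 2 * L ^+ 2) * vol) => [|eta eta1].
  by pos.
pose Q : V' -> R := \1_[set x : V' | `|x| <= R0].
have mQ : mfunT Q by apply/measurable_indicP; exact: measurable_cube.
have mgx : mfunT (fun x : V' => gradsum f (above x r) ^+ 2).
  by apply: measurable_funX; exact: measurable_smooth_above.
pose e2 := `|eta| ^+ 2 : R; have e20 : 0 <= e2 by rewrite sqr_ge0.
have a0 : 0 <= c1 * e2 by pos.
pose b0 := c1 * (K' ^+ 2 * L ^+ 2) * e2 * e2.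
have b00 : 0 <= b0 by rewrite /b0 !mulr_ge0// ltW.
have pt x : (f (above (x + eta) r) - f (above x r)) ^+ 2 <=
    c1 * e2 * gradsum f (above x r) ^+ 2 + b0 * Q x.
  have [xR|xR] := leP `|x| R0; last first.
    have z1 : f (above x r) = 0.
      apply/eqP; apply: contraTT xR => /hB /(above_norm_le B0) h; rewrite -leNgt.
      by apply: le_trans h _; rewrite lerDl.
    have z2 : f (above (x + eta) r) = 0.
      apply/eqP; apply: contraTT xR => /hB /(above_norm_le B0) h; rewrite -leNgt.
      rewrite -(addrK eta x); apply: le_trans (ler_normB _ _) _.
      exact: lerD.
    rewrite z1 z2 subrr expr0n /=; apply: addr_ge0; first by apply: mulr_ge0 => //; exact: sqr_ge0.
    by pos.
  rewrite (_ : Q x = 1) ?mulr1; last by rewrite /Q indicE mem_set.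
  set p := above x r; set q := above (x + eta) r.
  have pq : `|q - p| <= L * `|eta|     by have := hL (x + eta) x r; rewrite -/p -/q [x + eta - x]addrAC subrr add0r.
  have g0 := gradsum_ge0 f p.
  have Kd : 0 <= K' * `|q - p| by pos.
  have := @mean_value_box _ _ f p q (gradsum f p + K' * `|q - p|) (smooth_derivable sf).
  have H z : `|z - p| <= `|q - p| -> forall j, `|partial j f z| <= gradsum f p + K' * `|q - p|.
    move=> zq j; rewrite -(subrK (partial j f p) (partial j f z)) addrC.
    apply: le_trans (ler_normD _ _) _; apply: lerD.
      by rewrite /gradsum (bigD1 j)//= lerDl; apply: sumr_ge0 => i _.
    apply: le_trans ((hK j).2 z p) _; apply: ler_pM => //; by case: (hK j).
  move=> /(_ H) mv.
  have g1 : gradsum f p + K' * `|q - p| <= gradsum f p + K' * (L * `|eta|).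
    by nra.
  have Le : 0 <= L * `|eta| by pos.
  have mv2 : `|f q - f p| <= n%:R * (gradsum f p + K' * (L * `|eta|)) * (L * `|eta|).
    apply: le_trans mv _; apply: ler_pM => //; first by rewrite mulr_ge0// addr_ge0.
    by rewrite ler_wpM2l.
  rewrite -real_normK ?num_real//.
  apply: (@le_trans _ _ ((n%:R * (gradsum f p + K' * (L * `|eta|)) * (L * `|eta|)) ^+ 2)).
    rewrite ler_pXn2r ?nnegrE//; apply: mulr_ge0 => //; apply: mulr_ge0 => //.
    by pos.
  rewrite /b0 /c1 /e2; move: (gradsum f p) (`|eta|) (n%:R : R) => a s N.
  rewrite -subr_ge0 (_ : _ - _ = N ^+ 2 * L ^+ 2 * s ^+ 2 * (a - K' * (L * s)) ^+ 2); last by ring.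
  by pos.
apply: (@le_trans _ _ ((c1 * e2)%:E * slice_energy f r + b0%:E * (\int[lebn m.+1]_x (Q x)%:E))%E); last first.
  rewrite leeD2l//.
  have -> : (\int[lebn m.+1]_x (Q x)%:E = vol%:E)%E.
    rewrite integral_indic ?setIT//; last exact: measurable_cube.
    exact: (@rV_lebesgue_cube R m.+1 R0 R00).
  by rewrite -EFinM lee_fin /b0 /e2; apply: le_of_eq; ring.
have I1 : ((c1 * e2)%:E * slice_energy f r =
    \int[lebn m.+1]_x ((c1 * e2)%:E * (gradsum f (above x r) ^+ 2)%:E))%E.
  rewrite ge0_integralZl_EFin//; last exact/measurable_EFinP.
  by pos.
have I2 : (b0%:E * (\int[lebn m.+1]_x (Q x)%:E) = \int[lebn m.+1]_x (b0%:E * (Q x)%:E))%E.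
  rewrite ge0_integralZl_EFin//; first by move=> x _; rewrite lee_fin.
  by meas.
rewrite I1 I2 -ge0_integralD//; last 4 first.
- by pos.
- by meas.
- by pos.
- by meas.
apply: ge0_le_integral => //.
- by pos.
- exact: measurable_horizontal_int.
- by apply: emeasurable_funD; apply: measurable_funeM; exact/measurable_EFinP.
- by move=> x _; rewrite -!EFinM -EFinD lee_fin.
Qed.

Lemma horizontal_le : exists2 C : R, 0 <= C & forall f, test_function setT f ->
  forall r (zeta : V'), (horizontal f r zeta <= (C * `|zeta| ^+ 2)%:E * slice_energy f r)%E.
Proof.
have [L L0 hL] := above_lip.
exists (2 * n%:R ^+ 2 * L ^+ 2) => [|f tf r zeta]; first by rewrite !mulr_ge0// ltW.
have sf : smooth f by case: tf.
have [K K0 hK] := horizontal_small r hL L0 tf.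
set C := 2 * n%:R ^+ 2 * L ^+ 2 in hK *.
have C0 : 0 <= C by rewrite !mulr_ge0// ltW.
apply/lee_addgt0Pr => e e0.
(* The first summand makes the short steps have norm at most 1; the second makes the accumulated
   remainder [K |zeta|^4 / c^2] at most [e]. *)
pose k := Num.bound (`|zeta| + K * `|zeta| ^+ 4 / e).
have w0 : 0 <= K * `|zeta| ^+ 4 / e by pos.
have z0 : 0 <= `|zeta| + K * `|zeta| ^+ 4 / e by pos.
have kb : `|zeta| + K * `|zeta| ^+ 4 / e < k.+1%:R.
  by apply: lt_trans (archi_boundP z0) _; rewrite ltr_nat.
set c : R := k.+1%:R in kb; have c0 : 0 < c by rewrite ltr0n.
have c1 : 1 <= c by rewrite ler1n.
pose eta := c^-1 *: zeta.
have eE : `|eta| = `|zeta| / c by rewrite normrZ gtr0_norm ?invr_gt0// mulrC.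
have eta1 : `|eta| <= 1.
  rewrite eE ler_pdivrMr// mul1r; apply: le_trans (ltW kb).
  by rewrite lerDl.
have -> : zeta = c *: eta by rewrite scalerA mulfV ?gt_eqF// scale1r.
apply: le_trans (horizontal_subdivide _ _ _ sf) _.
apply: le_trans (lee_wpmul2l _ (hK _ eta1)) _; first by rewrite lee_fin sqr_ge0.
have cz : `|c *: eta| = `|zeta| by rewrite scalerA mulfV ?gt_eqF// scale1r.
rewrite ge0_muleDr; last 2 first.
- by rewrite mule_ge0 ?slice_energy_ge0// lee_fin mulr_ge0//.
- by pos.
rewrite muleA -!EFinM cz.
have -> : c ^+ 2 * (C * `|eta| ^+ 2) = C * `|zeta| ^+ 2.
  by rewrite eE; field.
rewrite leeD2l// lee_fin.
have -> : c ^+ 2 * (K * `|eta| ^+ 4) = K * `|zeta| ^+ 4 / c ^+ 2.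
  by rewrite eE; field.
rewrite ler_pdivrMr ?exprn_gt0//.
have h1 : K * `|zeta| ^+ 4 <= e * c.
  rewrite -ler_pdivrMl// mulrC; apply: le_trans (ltW kb).
  by rewrite lerDr.
by nra.
Qed.

Definition real_gagliardo (g : V' -> R) : \bar R :=
  (\int[lebn m.+1]_x \int[lebn m.+1]_y ((g x - g y) ^+ 2 / enorm (x - y) ^+ n)%:E)%E.

Lemma norm_le_enorm k (x : 'rV[R]_k) : `|x| <= enorm x.
Proof.
apply: norm_rV_le => [|j]; first exact: sqrtr_ge0.
rewrite -(@ler_pXn2r _ 2) ?nnegrE ?sqrtr_ge0//.
rewrite sqr_sqrtr ?sumr_ge0// => [|i _]; last exact: sqr_ge0.
by rewrite real_normK ?num_real// (bigD1 j)//= lerDl sumr_ge0// => i _; exact: sqr_ge0.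
Qed.

Lemma measurable_inv : mfunT (fun x : R => x^-1 : R).
Proof.
rewrite -(setUv [set 0 : R]); apply/measurable_funU; [exact: measurable_set1| |split].
- by apply: measurableC.
- exact: measurable_fun_set1.
- apply: open_continuous_measurable_fun => [|x]; first by rewrite openC; exact: closed_eq.
  by rewrite inE /= => /eqP x0; exact: inv_continuous.
Qed.

(** The density [r^m] of polar coordinates in dimension [m + 1] turns the kernel [r^-(m + 2)] into
    [r^-2]. *)
Lemma integral_radial_weight_le : exists2 C : R, 0 <= C & forall F : R -> \bar R,
  mfunT F -> (forall r, (0 <= F r)%E) ->
  (\int[lebn m.+1]_z (F `|z|%R * (`|z|^-1%R ^+ n)%:E) <=
   C%:E * \int[leb]_(r in `[0%R, +oo[) (F r * (r ^- 2)%:E))%E.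
Proof.
have [C C0 hC] := @ge0_integral_radial_le R m; exists C => // F mF F0.
pose F1 (r : R) : \bar R := (F r * (`|r|^-1 ^+ n)%:E)%E.
have mi : mfunT (fun r : R => `|r|^-1 : R).
  apply: (measurableT_comp (f := fun x : R => x^-1)); last exact: normr_measurable.
  exact: measurable_inv.
have mF1 : mfunT F1.
  by apply: emeasurable_funM => //; apply/measurable_EFinP; exact: measurable_funX.
have F10 r : (0 <= F1 r)%E by rewrite mule_ge0//.
have := hC F1 mF1 F10; rewrite /F1.
under eq_integral => z _ do rewrite normr_id.
move=> /le_trans; apply; rewrite lee_wpmul2l//; apply: ge0_le_integral => //.
- move=> r; rewrite /= in_itv/= andbT => r0; apply: mule_ge0; last by rewrite lee_fin; exact: exprn_ge0.
  by pos.
- by meas.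
- apply: measurable_funTS; apply: emeasurable_funM => //; apply/measurable_EFinP.
  by apply: (measurableT_comp (f := fun x : R => x^-1)); [exact: measurable_inv|exact: measurable_funX].
move=> r; rewrite /= in_itv/= andbT => r0; rewrite -muleA -EFinM lee_wpmul2l// lee_fin.
rewrite ger0_norm//; have [->|rN] := eqVneq r 0.
  by rewrite invr0 expr0n mul0r//.
rewrite exprVn (_ : r ^+ n = r ^+ 2 * r ^+ m); last by rewrite -exprD.
rewrite invfM -mulrA mulVf ?mulr1// expf_neq0//.
Qed.

(* The boundary points over [x] and [x + z] are joined through the points at height
   [|z|] above them, by two vertical increments and a horizontal one. *)
Theorem real_gagliardo_le : exists2 C : R, 0 <= C & forall f, test_function setT f ->
  (real_gagliardo (fun x => f (graph_point G x)) <=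
   C%:E * \int[lebn n]_(y in epigraph G) (gradsum f y ^+ 2)%:E)%E.
Proof.
have [C1 C10 hC1] := integral_radial_weight_le.
have [C2 C20 hC2] := horizontal_le.
have [C3 C30 hC3] := above_integral_le.
exists ((6 * C1 * 4 + 3 * C1 * C2) * C3) => [|f tf]; first by rewrite !mulr_ge0// addr_ge0// !mulr_ge0.
have sf : smooth f by case: tf.
have mf := measurable_smooth sf; have mg := measurable_gradsum sf.
pose W r (x : V') := f (above x r).
have W0 x : f (graph_point G x) = W 0 x by rewrite /W /above addr0.
pose w (z : V') : R := `|z|^-1 ^+ n; have w0 z : 0 <= w z by rewrite exprn_ge0.
have mi : mfunT (fun r : R => r^-1 : R) by exact: measurable_inv.
have mw : mfunT w.
  by apply: measurable_funX; apply: (measurableT_comp mi); exact: measurable_norm_rV.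
pose a (p : V' * V') := (W `|p.2| p.1 - W 0 p.1) ^+ 2.
pose b (p : V' * V') := (W `|p.2| (p.1 + p.2) - W `|p.2| p.1) ^+ 2.
pose c (p : V' * V') := (W `|p.2| (p.1 + p.2) - W 0 (p.1 + p.2)) ^+ 2.
have mn : mfunT (fun p : V' * V' => `|p.2| : R).
  by apply: (measurableT_comp (@measurable_norm_rV R m.+1)).
have m1 : mfunT (fun p : V' * V' => p.1) by meas.
have mp : mfunT (fun p : V' * V' => p.1 + p.2).
  by apply: measurable_rV_addf.
have mW (x : V' * V' -> V') (r : V' * V' -> R) : mfunT x -> mfunT r ->
    mfunT (fun p => W (r p) (x p)).
  by move=> mx mr; exact: measurable_smooth_above.
have ma : mfunT a by apply: measurable_funX; apply: measurable_funB; exact: mW.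
have mb : mfunT b by apply: measurable_funX; apply: measurable_funB; exact: mW.
have mc : mfunT c by apply: measurable_funX; apply: measurable_funB; exact: mW.
pose H (p : V' * V') : \bar R := (3 * (a p + b p + c p) * w p.2)%:E.
have a0 p : 0 <= a p by exact: sqr_ge0.
have b0 p : 0 <= b p by exact: sqr_ge0.
have c0 p : 0 <= c p by exact: sqr_ge0.
have H0 p : (0 <= H p)%E by rewrite lee_fin mulr_ge0// mulr_ge0// !addr_ge0.
have mH : mfunT H.
  apply/measurable_EFinP; apply: measurable_funM; last first.
    by meas.
  by meas.
have mGp : mfunT (fun x : V' => f (graph_point G x)).
  by rewrite (funext W0); apply: measurable_smooth_above.
apply: (@le_trans _ _ (\int[lebn m.+1]_x \int[lebn m.+1]_z H (x, z))%E).
  have men : mfunT (@enorm R m.+1).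
    apply: (@measurableT_comp _ _ _ _ _ _ (@Num.sqrt R)).
      by apply: continuous_measurable_fun; exact: sqrt_continuous.
    by apply: measurable_sum => j; apply: measurable_funX; exact: measurable_entry.
  pose Hg (p : V' * V') : \bar R :=
    ((f (graph_point G p.1) - f (graph_point G p.2)) ^+ 2 / enorm (p.1 - p.2) ^+ n)%:E.
  have Hg0 p : (0 <= Hg p)%E by rewrite lee_fin divr_ge0 ?sqr_ge0// exprn_ge0// sqrtr_ge0.
  have mHg : mfunT Hg.
    apply/measurable_EFinP; apply: measurable_funM.
      by apply: measurable_funX; apply: measurable_funB; apply: (measurableT_comp mGp).
    apply: (measurableT_comp mi); apply: measurable_funX; apply: (measurableT_comp men).
    apply: measurable_fun_matrix => i j.
    rewrite (_ : (fun _ => _) = (fun p : V' * V' => p.1 i j - p.2 i j)); last first.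
      by apply/funext => p; rewrite !mxE.
    by apply: measurable_funB; apply: (measurableT_comp (@measurable_entry _ _ _ _ i j)).
  have mgx (x : V') : mfunT (fun y : V' => Hg (x, y)) by meas.
  apply: ge0_le_integral => //.
  - by move=> x _; apply: integral_ge0 => y _; exact: (Hg0 (x, y)).
  - exact: (@measurable_fun_fubini_tonelli_F _ _ _ _ _ (lebn m.+1) Hg mHg Hg0).
  - exact: (@measurable_fun_fubini_tonelli_F _ _ _ _ _ (lebn m.+1) H mH H0).
  move=> x _; have := integral_rV_translation x (mgx x); rewrite {2}/Hg /= => <-.
  apply: ge0_le_integral => //.
  - exact: (measurableT_comp (mgx x) (measurable_rV_add x)).
  - by meas.
  move=> z _; rewrite lee_fin /= !W0 (addrC z) opprD addrA subrr sub0r.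
  set A0 := W 0 x; set B0 := W 0 (x + z).
  have e1 : (A0 - B0) ^+ 2 <= 3 * (a (x, z) + b (x, z) + c (x, z)).
    rewrite /a /b /c /= -/A0 -/B0; move: (W _ x) (W _ (x + z)) => s t.
    rewrite -subr_ge0 (_ : _ - _ = ((s - A0) - (t - s)) ^+ 2 + ((s - A0) + (t - B0)) ^+ 2 + ((t - s) + (t - B0)) ^+ 2); last by ring.
    by pos.
  have [z0|z0] := eqVneq z 0.
    rewrite /A0 /B0 z0 addr0 subrr expr0n /= mul0r; apply: mulr_ge0 => //.
    by pos.
  apply: ler_pM => //; [exact: sqr_ge0|by rewrite invr_ge0 exprn_ge0// sqrtr_ge0|].
  have zp : 0 < `|z| by rewrite normr_gt0.
  (* The maximum norm is below the Euclidean norm, so the weight [w] dominates the kernel of the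
     seminorm. *)
  have ez : `|z| <= enorm (- z) by rewrite -normrN; exact: norm_le_enorm.
  rewrite /w exprVn lef_pV2 ?posrE ?exprn_gt0//; last exact: lt_le_trans ez.
  by rewrite ler_pXn2r// nnegrE//; apply: le_trans ez.
rewrite (fubini_tonelli (m1 := lebn m.+1) (m2 := lebn m.+1) H mH H0).
have mv := measurable_vertical sf; have v0 r : (0 <= vertical f r)%E by apply: integral_ge0 => x _; rewrite lee_fin sqr_ge0.
have mS := measurable_slice_energy sf; have S0 := slice_energy_ge0 f.
(* The vertical increments over [x] and over [x + z] have the same integral in [x]; with the 3 from
   squaring a sum of three terms this gives 6. *)
pose F1 (r : R) : \bar R := (6%:E * vertical f r)%E.
pose F2 (r : R) : \bar R := (3%:E * ((C2 * r ^+ 2)%:E * slice_energy f r))%E.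
have mF1 : mfunT F1 by apply: measurable_funeM.
have mF2 : mfunT F2.
  apply: measurable_funeM; apply: emeasurable_funM => //; apply/measurable_EFinP.
  by meas.
have F10 r : (0 <= F1 r)%E by apply: mule_ge0.
have F20 r : (0 <= F2 r)%E.
  by rewrite mule_ge0// mule_ge0// lee_fin mulr_ge0// sqr_ge0.
have mnz := @measurable_norm_rV R m.+1.
have mFw (F : R -> \bar R) : mfunT F ->
    mfunT (fun z : V' => (F `|z|%R * (w z)%:E)%E).
  by meas.
have Fw0 (F : R -> \bar R) (z : V') : (forall r, 0 <= F r)%E -> (0 <= F `|z|%R * (w z)%:E)%E by pos.
apply: (@le_trans _ _ (\int[lebn m.+1]_z ((F1 `|z|%R * (w z)%:E) + (F2 `|z|%R * (w z)%:E)))%E).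
  apply: ge0_le_integral => //.
  - by pos.
  - exact: (@measurable_fun_fubini_tonelli_G _ _ _ _ _ (lebn m.+1) H mH H0).
  - by apply: emeasurable_funD; exact: mFw.
  move=> z _.
  have m1z (k : V' * V' -> R) : mfunT k ->
      mfunT (fun x : V' => (k (x, z))%:E).
    by meas.
  have -> : (\int[lebn m.+1]_x H (x, z) = (3 * w z)%:E * (\int[lebn m.+1]_x (a (x, z))%:E +
      \int[lebn m.+1]_x (b (x, z))%:E + \int[lebn m.+1]_x (c (x, z))%:E))%E.
    have z1 (x : V') : setT x -> (0 <= (a (x, z))%:E)%E by pos.
    have z2 (x : V') : setT x -> (0 <= (b (x, z))%:E)%E by pos.
    have z3 (x : V') : setT x -> (0 <= (c (x, z))%:E)%E by pos.
    have z4 (x : V') : setT x -> (0 <= (a (x, z))%:E + (b (x, z))%:E)%E by pos.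
    have z5 (x : V') : setT x -> (0 <= (a (x, z))%:E + (b (x, z))%:E + (c (x, z))%:E)%E by pos.
    have q4 : mfunT (fun x : V' => (a (x, z))%:E + (b (x, z))%:E)%E.
      by apply: emeasurable_funD; exact: m1z.
    rewrite -(ge0_integralD (lebn m.+1) measurableT z1 (m1z _ ma) z2 (m1z _ mb)).
    rewrite -(ge0_integralD (lebn m.+1) measurableT z4 q4 z3 (m1z _ mc)).
    have k0 : 0 <= 3 * w z by pos.
    rewrite -(ge0_integralZl_EFin (lebn m.+1) measurableT z5 _ k0); last first.
      by apply: emeasurable_funD => //; exact: m1z.
    by apply: eq_integral => x _; rewrite /H /= -!EFinD -EFinM; congr EFin; ring.
  have -> : (\int[lebn m.+1]_x (c (x, z))%:E = vertical f `|z|%R)%E.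
    exact: (integral_rV_translation z (m1z _ ma)).
  have Eb : (\int[lebn m.+1]_x (b (x, z))%:E <= (C2 * `|z| ^+ 2)%:E * slice_energy f `|z|%R)%E := hC2 f tf `|z| z.
  rewrite -[(\int[lebn m.+1]_x (a (x, z))%:E)%E]/(vertical f `|z|%R) /F1 /F2.
  have w30 : (0 <= (3 * w z)%:E)%E by pos.
  apply: (le_trans (lee_wpmul2l w30 (leeD2r _ (leeD2l _ Eb)))).
  have Q0 : (0 <= (C2 * `|z| ^+ 2)%:E * slice_energy f `|z|%R)%E by pos.
  move: (v0 `|z|) Q0; move: (vertical f _) (_ * slice_energy f _)%E => x y x0 y0.
  rewrite (addeAC x y x) ge0_muleDr ?adde_ge0// ge0_muleDr//; apply: le_of_eq.
  rewrite -ge0_muleDl// -EFinD; congr (_ + _)%E.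
    by rewrite [RHS]muleAC -EFinM; congr ((_%:E) * _)%E; ring.
  by rewrite [RHS]muleAC -EFinM.
rewrite ge0_integralD//; last 4 first.
- by move=> z _; exact: Fw0.
- exact: mFw.
- by move=> z _; exact: Fw0.
- exact: mFw.
have D1 := hC1 F1 mF1 F10; have D2 := hC1 F2 mF2 F20.
have mg0 : mfunT (fun y : V => (gradsum f y ^+ 2)%:E) by meas.
have D3 : (graph_energy f <= C3%:E * \int[lebn n]_(y in epigraph G) (gradsum f y ^+ 2)%:E)%E.
  by apply: hC3 => // y; rewrite lee_fin sqr_ge0.
(* The bound [vertical f r <= r^2 Q r] absorbs the weight [r^-2], and the integral of [Q] is
   controlled by [hardy_le]. *)
have D4 : (\int[leb]_(r in `[0%R, +oo[) (F1 r * (r ^- 2)%:E) <= 6%:E * (4%:E * graph_energy f))%E.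
  rewrite integral_mul_indic.
  apply: le_trans (lee_wpmul2l _ (hardy_le sf)); last by rewrite lee_fin.
  pose Q (r : R) := (\int[leb]_s ((4 * s ^+ 2 * ind01 s)%:E * slice_energy f (r * s ^+ 2)%R))%E.
  have c40 (s : R) : 0 <= 4 * s ^+ 2 * ind01 s by pos.
  have Q0 r : (0 <= Q r)%E by apply: integral_ge0 => s _; rewrite mule_ge0// lee_fin.
  have mQ : mfunT Q.
    apply: (@measurable_fun_fubini_tonelli_F _ _ _ _ _ leb
      (fun p : measurableTypeR R * measurableTypeR R => ((4 * (p.2 : R) ^+ 2 * ind01 p.2)%:E * slice_energy f ((p.1 : R) * (p.2 : R) ^+ 2)%R)%E)).
      apply: emeasurable_funM.
        by meas.
      by apply: (measurableT_comp mS); apply: measurable_funM => //; exact: measurable_funX.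
    by pos.
  rewrite -ge0_integralZl_EFin//; last 2 first.
  - by pos.
  - by meas.
  apply: ge0_le_integral => //.
  - by pos.
  - by meas.
  - by meas.
  move=> r _; rewrite -/(indp r) -/(Q r) (muleC _ (indp r)%:E) (muleCA 6%:E).
  apply: lee_wpmul2l; first by rewrite lee_fin.
  rewrite /F1 -muleA; apply: lee_wpmul2l; first by rewrite lee_fin.
  have [->|r0] := eqVneq r 0; first by rewrite expr0n/= invr0 mule0.
  have vQ : (vertical f r <= (r ^+ 2)%:E * Q r)%E.
    apply: (le_trans (vertical_slice_le r sf)); rewrite -ge0_integralZl_EFin ?sqr_ge0//.
    - apply: le_of_eq; apply: eq_integral => s _.
      by rewrite muleA -EFinM; congr (_%:E * _)%E; ring.
    - by pos.
    - apply: emeasurable_funM; last by apply: (measurableT_comp mS); apply: measurable_funM => //; exact: measurable_funX.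
      by meas.
  have r2 : (0 <= (r ^- 2)%:E)%E by pos.
  apply: (le_trans (lee_wpmul2r r2 vQ)); rewrite muleAC -EFinM mulfV ?mul1e//.
  by rewrite sqrf_eq0.
(* The weight [r^-2] cancels the factor [r^2] of a horizontal step of length [r]. This is why the
   horizontal path is taken at height [|z|]: the layers are then integrated over [r]. *)
have D5 : (\int[leb]_(r in `[0%R, +oo[) (F2 r * (r ^- 2)%:E) <= (3 * C2)%:E * graph_energy f)%E.
  rewrite /graph_energy -ge0_integralZl_EFin//; last 2 first.
  - by meas.
  - by pos.
  apply: ge0_le_integral => //.
  - by pos.
  - by meas.
  - by meas.
  move=> r _; rewrite /F2 muleA -EFinM muleAC -EFinM lee_wpmul2r// lee_fin.
  have [->|r0] := eqVneq r 0; first by rewrite expr0n/= !mulr0 mul0r mulr_ge0.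
  by rewrite mulrA mulfK// sqrf_eq0.
apply: (le_trans (leeD (le_trans D1 (lee_wpmul2l _ D4)) (le_trans D2 (lee_wpmul2l _ D5)))); rewrite ?lee_fin//.
have E0 : (0 <= graph_energy f)%E by apply: integral_ge0 => t _.
rewrite !muleA -!EFinM -ge0_muleDl; try by rewrite lee_fin !mulr_ge0.
have k0 : (0 <= ((6 * C1 * 4 + 3 * C1 * C2))%:E)%E by pos.
rewrite (EFinM (6 * C1 * 4 + 3 * C1 * C2) C3) -muleA; apply: le_trans (lee_wpmul2l k0 D3).
apply: le_of_eq; congr (_ * _)%E; rewrite -EFinD; congr EFin; ring.
Qed.

Lemma trace_abs_le : exists2 C : R, 0 <= C & forall f, test_function setT f ->
  (\int[lebn m.+1]_x (`|f (graph_point G x)|)%:E <=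
   C%:E * \int[lebn n]_(y in epigraph G) (gradsum f y)%:E)%E.
Proof.
have [C C0 hC] := above_integral_le; exists C => // f tf.
have sf : smooth f by case: tf.
have mf := measurable_smooth sf; have mg := measurable_gradsum sf.
pose K (p : V' * measurableTypeR R) : \bar R := ((gradsum f (above p.1 p.2))%:E * (indp p.2)%:E)%E.
have K0 p : (0 <= K p)%E by rewrite mule_ge0 ?lee_fin ?gradsum_ge0.
have mK : mfunT K.
  apply: emeasurable_funM; apply/measurable_EFinP.
    exact: measurable_smooth_above.
  by meas.
apply: (@le_trans _ _ (\int[lebn m.+1]_x \int[leb]_t K (x, t))%E).
  apply: ge0_le_integral => //.
  - apply/measurable_EFinP; apply: measurableT_comp; first exact: normr_measurable.
    rewrite (_ : (fun x => _) = (fun x => f (above x 0))); first exact: measurable_smooth_above.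
    by apply/funext => x; rewrite /above addr0.
  - exact: (@measurable_fun_fubini_tonelli_F _ _ _ _ _ leb K mK K0).
  move=> x _; have := above_abs_le x tf; rewrite integral_mul_indic /above addr0.
  by [].
rewrite (fubini_tonelli (m1 := lebn m.+1) (m2 := leb) K mK K0).
apply: le_trans (hC (fun y => (gradsum f y)%:E) _ _); last 2 first.
- by meas.
- by move=> x; rewrite lee_fin gradsum_ge0.
rewrite [leRHS]integral_mul_indic; apply: ge0_le_integral => //.
- by pos.
- exact: (@measurable_fun_fubini_tonelli_G _ _ _ _ _ (lebn m.+1) K mK K0).
- apply: emeasurable_funM; last by apply/measurable_EFinP; exact/measurable_indicP.
  apply: (@measurable_fun_fubini_tonelli_G _ _ _ _ _ (lebn m.+1)
    (fun p : V' * measurableTypeR R => (gradsum f (above p.1 p.2))%:E)).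
    by apply/measurable_EFinP; exact: measurable_smooth_above.
  by move=> p; rewrite lee_fin gradsum_ge0.
move=> t _; rewrite muleC -ge0_integralZl_EFin//; last 2 first.
- by move=> x _; rewrite lee_fin gradsum_ge0.
- by apply/measurable_EFinP; apply: measurable_smooth_above.
by apply: le_of_eq; apply: eq_integral => x _; rewrite /K muleC.
Qed.

End trace_estimate.

(** * Integration over the boundary *)

Import HBNNSimple.

Section surface_integral.
Context {R : realType} {n : nat} {Omega : set 'rV[R]_n} {A : lipschitz_atlas Omega}.
Variable P : partition_of_unity A.
Local Notation V' := 'rV[R]_n.-1.
Local Notation leb := (rV_lebesgue R n.-1).

Lemma measurable_cutoff k : mfunT (cutoff P k).
Proof. by have [sc _ _] := cutoff_test P k; exact: measurable_smooth. Qed.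

Lemma measurable_surface_density k : mfunT (surface_density P k).
Proof.
apply: measurable_funM; last exact: measurable_area_density.
exact: (measurableT_comp (measurable_cutoff k) (measurable_graph_point _)).
Qed.

Lemma surface_density_ge0 k x : 0 <= surface_density P k x.
Proof. by rewrite mulr_ge0 ?cutoff_ge0 ?area_density_ge0. Qed.

(** The surface measure is a sum of weighted push-forwards, so the formula is verified on simple
    functions below [f], whose integrals have the left side as supremum. *)
Lemma surface_integral_le (f : 'rV[R]_n -> \bar R) : (forall y, (0 <= f y)%E) ->
  mfunT f ->
  (\int[surface_measure P]_y f y <=
   \sum_k \int[leb]_x (f (graph_point (coords k) x) * (surface_density P k x)%:E))%E.
Proof.
move=> f0 mf; rewrite ge0_integralTE//; apply: ge_ereal_sup => _ [phi phif <-].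
pose s := finmap.enum_fset (fset_set (range phi)).
rewrite sintegralE fsbig_finite//= -/s.
have s0 r : r \in s -> 0 <= r.
  by rewrite /s in_fset_set// inE => -[y _ <-].
have mD k r : measurable (graph_point (coords k) @^-1` (phi @^-1` [set r])).
  by rewrite -[X in measurable X]setTI; apply: measurable_graph_point.
have md k : mfunT (fun x => (surface_density P k x)%:E).
  by apply/measurable_EFinP; exact: measurable_surface_density.
have d0 k x : (0 <= (surface_density P k x)%:E)%E by rewrite lee_fin surface_density_ge0.
have I0 k r : (0 <= \int[leb]_(x in graph_point (coords k) @^-1` (phi @^-1` [set r]))
    (surface_density P k x)%:E)%E by exact: integral_ge0.
rewrite [leLHS](_ : _ = \sum_(r <- s | r \in s) \sum_k r%:E *
    \int[leb]_(x in graph_point (coords k) @^-1` (phi @^-1` [set r])) (surface_density P k x)%:E)%E; last first.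
  rewrite [LHS]big_seq; apply: eq_bigr => r rs.
  by rewrite ge0_sume_distrr.
rewrite exchange_big; apply: lee_sum => k _ /=.
pose F (r : R) (x : V') : \bar R :=
  (`|r| * \1_(graph_point (coords k) @^-1` (phi @^-1` [set r])) x * surface_density P k x)%:E.
have mF r : mfunT (F r).
  apply/measurable_EFinP; apply: measurable_funM; last exact: measurable_surface_density.
  by meas.
have F0 r x : (0 <= F r x)%E.
  by rewrite lee_fin mulr_ge0 ?surface_density_ge0// mulr_ge0.
rewrite [leLHS](_ : _ = \int[leb]_x (\sum_(r <- s) F r x))%E; last first.
  rewrite [RHS]ge0_integral_sum// [RHS]big_seq.
  apply: eq_bigr => r rs; rewrite [in LHS]integral_mul_indic.
  rewrite -ge0_integralZl_EFin ?s0//; last 2 first.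
  - by move=> x _; rewrite mule_ge0// lee_fin.
  - by apply: emeasurable_funM => //; apply/measurable_EFinP/measurable_indicP.
  by apply: eq_integral => x _; rewrite -!EFinM /F ger0_norm ?s0//; congr EFin; ring.
apply: ge0_le_integral => //.
- by pos.
- by apply: emeasurable_sum.
- apply: emeasurable_funM => //; exact: (measurableT_comp mf (measurable_graph_point _)).
move=> x _; set y := graph_point (coords k) x.
rewrite (_ : \sum_(r <- s) F r x = (phi y)%:E * (surface_density P k x)%:E)%E.
  by rewrite lee_wpmul2r//.
rewrite (bigD1_seq (phi y))//=; last first.
- by rewrite /s; exact: finmap.fset_uniq.
- by rewrite /s in_fset_set// inE.
rewrite big1 ?adde0 => [|r ry].
  by rewrite /F indicE mem_set// mulr1 ger0_norm.
rewrite /F indicE memNset ?mulr0 ?mul0r// => /= E; move: ry.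
by rewrite -E eqxx.
Qed.

End surface_integral.

(** * Trace estimates on a Lipschitz domain *)

Section gagliardo_kernel.
Context {R : realType} {m : nat}.
Local Notation n := m.+2.
Local Notation V' := 'rV[R]_m.+1.
Local Notation leb' := (rV_lebesgue R m.+1).
Implicit Types f g : V' -> R.

Definition increment_kernel f (p : V' * V') : \bar R :=
  ((f p.1 - f p.2) ^+ 2 / enorm (p.1 - p.2) ^+ n)%:E.

Lemma increment_kernel_ge0 f p : (0 <= increment_kernel f p)%E.
Proof. by rewrite lee_fin divr_ge0 ?sqr_ge0// exprn_ge0// sqrtr_ge0. Qed.

Lemma measurable_increment_kernel f : mfunT f ->
  mfunT (increment_kernel f).
Proof.
move=> mf; apply/measurable_EFinP; apply: measurable_funM.
  by meas.
apply: (measurableT_comp (@measurable_inv R)); apply: measurable_funX.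
apply: (@measurableT_comp _ _ _ _ _ _ (@Num.sqrt R)).
  by apply: continuous_measurable_fun; exact: sqrt_continuous.
apply: measurable_sum => j; apply: measurable_funX.
rewrite (_ : (fun _ => _) = (fun p : V' * V' => p.1 0 j - p.2 0 j)); last first.
  by apply/funext => p; rewrite !mxE.
by apply: measurable_funB; apply: (measurableT_comp (@measurable_entry _ _ _ _ 0 j)).
Qed.

Lemma real_gagliardo_prod f : mfunT f ->
  real_gagliardo f = (\int[leb' \x leb']_p increment_kernel f p)%E.
Proof.
move=> mf; rewrite (fubini_tonelli1 _ (measurable_increment_kernel mf) (increment_kernel_ge0 f)).
by [].
Qed.

Lemma real_gagliardo_ge0 f : (0 <= real_gagliardo f)%E.
Proof.
apply: integral_ge0 => x _; apply: integral_ge0 => y _.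
exact: (increment_kernel_ge0 f (x, y)).
Qed.

Lemma ae_prod (Q : set V') : {ae leb', forall x, Q x} ->
  {ae (leb' \x leb')%E, forall p : V' * V', Q p.1 /\ Q p.2}.
Proof.
move=> [N [mN N0 QN]]; exists (N `*` setT `|` setT `*` N); split.
- by apply: measurableU; apply: measurableX.
- apply/eqP; rewrite -measure_le0; apply: (le_trans (measureU2 _ _ _)); try exact: measurableX.
  have E1 : (leb' \x leb')%E (N `*` setT) = 0%E by rewrite product_measure1E// [X in (X * _)%E]N0 mul0e.
  have E2 : (leb' \x leb')%E (setT `*` N) = 0%E by rewrite product_measure1E// [X in (_ * X)%E]N0 mule0.
  by rewrite [X in (X + _)%E]E1 [X in (_ + X)%E]E2 adde0.
- move=> p /= /not_andP[Qp|Qp]; [left|right]; split=> //; exact: QN.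
Qed.

Lemma real_gagliardo_fatou (f_ : nat -> V' -> R) f (c : \bar R) N :
  (forall l, mfunT (f_ l)) -> mfunT f ->
  {ae leb', forall x, f_ l x @[l --> \oo] --> f x} ->
  (forall l, (N <= l)%N -> (real_gagliardo (f_ l) <= c)%E) -> (real_gagliardo f <= c)%E.
Proof.
move=> mf_ mf /ae_prod cf hc; rewrite real_gagliardo_prod//.
apply: (@fatou_le _ _ _ _ setT measurableT (fun l => increment_kernel (f_ l)) _ c N).
- by move=> l; exact: measurable_increment_kernel.
- exact: measurable_increment_kernel.
- by move=> l p _; exact: increment_kernel_ge0.
- by move=> p _; exact: increment_kernel_ge0.
- apply: filterS cf => p [c1 c2] _; apply/cvg_EFin; first by near=> l.
  rewrite /increment_kernel /comp /=.
  have c3 : (f_ l p.1 - f_ l p.2) @[l --> \oo] --> f p.1 - f p.2 by exact: cvgB.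
  rewrite expr2; under eq_fun => l do rewrite expr2.
  exact: (cvgM (cvgM c3 c3) (cvg_cst _)).
- by move=> l Nl; rewrite -real_gagliardo_prod//; exact: hc.
Unshelve. all: by end_near. Qed.

End gagliardo_kernel.

(** The terms of even index are interleaved with zeros. The resulting sequence has geometric steps,
    hence converges almost everywhere, and the zeros identify the limit. *)
Lemma ae_cvg0_of_geometric d (T : measurableType d) (R : realType)
    (mu : {measure set T -> \bar R}) (w : nat -> T -> R) :
  (forall l, mfunT (w l)) ->
  (forall l, (rL2sq mu setT (w l) <= (8^-1 ^+ l)%:E)%E) ->
  {ae mu, forall x, w (2 * l)%N x @[l --> \oo] --> 0}.
Proof.
move=> mw hw; pose u (k : nat) := if odd k then fun=> 0 else w k.
have mu_ k : mfunT (u k) by rewrite /u; case: odd.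
have st k : (\int[mu]_x ((u k.+1 x - u k x) ^+ 2)%:E <= (8^-1 ^+ k)%:E)%E.
  rewrite /u /=; case: (odd k) => /=.
    under eq_integral => x _ do rewrite subr0.
    apply: (le_trans (hw k.+1)); rewrite lee_fin exprS ler_piMl ?exprn_ge0//.
    by rewrite invf_le1// ler1n.
  by under eq_integral => x _ do rewrite sub0r sqrrN; exact: hw.
have := ae_cvg_of_geometric_steps measurableT mu_ st.
apply: filterS => x /(_ Logic.I) /cvg_ex[l ul].
have sub (phi : nat -> nat) : (forall k, (k <= phi k)%N) -> u (phi k) x @[k --> \oo] --> l.
  move=> phik; apply: (cvg_comp phi _ _ ul) => B [N _ NB]; exists N => // k Nk.
  by apply: NB; exact: (leq_trans Nk (phik k)).
have l0 : l = 0.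
  have h : u (2 * k).+1 x @[k --> \oo] --> l.
    by apply: sub => k; rewrite mul2n -addnn -addSn leq_addl.
  have E : (fun k => u (2 * k).+1 x) = fun=> 0 by apply/funext => k; rewrite /u oddS oddM.
  by move: h; rewrite E => h; exact: (cvg_unique _ h (cvg_cst 0)).
have : u (2 * k)%N x @[k --> \oo] --> l by apply: sub => k; rewrite mul2n -addnn leq_addl.
by rewrite /u l0; under eq_fun => k do rewrite oddM /=.
Qed.

Lemma partialB {R : realType} {n : nat} (f g : 'rV[R]_n -> R) j x : smooth f -> smooth g ->
  partial j (fun x => f x - g x) x = partial j f x - partial j g x.
Proof.
by move=> sf sg; apply: deriveB; exact: smooth_derivable.
Qed.

Section boundary_estimates.
Context {R : realType} {m : nat} {Omega : set 'rV[R]_m.+2} {A : lipschitz_atlas Omega}.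
Hypotheses (oO : open Omega) (bO : bounded_set Omega).
Variable P : partition_of_unity A.
Local Notation n := m.+2.
Local Notation V := 'rV[R]_n.
Local Notation V' := 'rV[R]_m.+1.
Local Notation leb := (rV_lebesgue R n).
Local Notation leb' := (rV_lebesgue R m.+1).
Local Notation omega := (surface_measure P).
Local Notation dO := (boundary Omega).
Implicit Types (u v f g : V -> R) (k : 'I_(npatch A)).
Local Notation Gam := (fun k => graph_point (coords k)).

Let mO : measurable Omega := open_measurable_rV oO.

Definition rloc k v (x : V') : R :=
  cutoff P k (graph_point (coords k) x) * v (graph_point (coords k) x).

Definition gradsq v (y : V) : R := \sum_j partial j v y ^+ 2.

Lemma gradsq_ge0 v y : 0 <= gradsq v y.
Proof. by apply: sumr_ge0 => j _; exact: sqr_ge0. Qed.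

Lemma measurable_gradsq v : smooth v -> mfunT (gradsq v).
Proof.
move=> sv; apply: measurable_sum => j; apply: measurable_funX.
by apply: measurable_smooth; exact: smooth_partial.
Qed.

Definition dirichlet v : \bar R := (\sum_j rL2sq leb Omega (partial j v))%E.

Lemma dirichletE v : smooth v -> dirichlet v = (\int[leb]_(y in Omega) (gradsq v y)%:E)%E.
Proof.
move=> sv; rewrite /dirichlet /gradsq.
under [RHS]eq_integral => y _ do rewrite -sumEFin.
rewrite ge0_integral_sum//; last by move=> j y _; rewrite lee_fin sqr_ge0.
move=> j; apply: measurable_funTS; apply/measurable_EFinP; apply: measurable_funX.
by apply: measurable_smooth; exact: smooth_partial.
Qed.

(** Inside the patch, where [g] lives, the epigraph and the domain coincide. *)
Lemma epigraph_integral_le k (g : V -> R) : mfunT g -> (forall y, 0 <= g y) ->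
  (forall y, g y != 0 -> Defs.patch k y) ->
  (\int[leb]_(y in epigraph (coords k)) (g y)%:E <= \int[leb]_(y in Omega) (g y)%:E)%E.
Proof.
move=> mg g0 gp; rewrite integral_mul_indic [leRHS]integral_mul_indic.
have mE : measurable (epigraph (coords k)) by exact: measurable_epigraph.
apply: ge0_le_integral => //.
- by pos.
- by meas.
- by meas.
move=> y _; rewrite -!EFinM lee_fin; have [->|/gp py] := eqVneq (g y) 0; first by rewrite !mul0r.
rewrite ler_wpM2l// !indicE ler_nat; case: (boolP (y \in epigraph _)) => //.
rewrite inE => Ey; rewrite mem_set//.
have : (epigraph (coords k) `&` Defs.patch k) y by [].
by rewrite -patch_epigraph => -[].
Qed.

Lemma gradsum_le_gradsq v y : (gradsum v y) <= n%:R * Num.sqrt (gradsq v y).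
Proof.
rewrite /gradsum; apply: (@le_trans _ _ (\sum_(j < n) Num.sqrt (gradsq v y))).
  apply: ler_sum => j _; rewrite -(@ler_pXn2r _ 2) ?nnegrE ?sqrtr_ge0//.
  rewrite sqr_sqrtr ?gradsq_ge0// real_normK ?num_real//.
  by rewrite /gradsq (bigD1 j)//= lerDl sumr_ge0// => i _; exact: sqr_ge0.
by rewrite sumr_const card_ord mulr_natl.
Qed.

Lemma cutoff_bound k : exists2 B : R, 0 <= B &
  (forall y, cutoff P k y <= B) /\ (forall j y, `|partial j (cutoff P k) y| <= B).
Proof.
have tc := cutoff_test P k; have [B B0 hB] := test_bounded tc.
have /choice[B_ hB_] j : exists b : R, 0 <= b /\ forall y, `|partial j (cutoff P k) y| <= b.
  by have [b b0 hb] := test_bounded (test_partial j tc); exists b.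
exists (B + \sum_j B_ j); first by rewrite addr_ge0// sumr_ge0// => j _; case: (hB_ j).
split=> [y|j y].
  apply: (le_trans (ler_norm _)); apply: (le_trans (hB y)); rewrite lerDl.
  by apply: sumr_ge0 => j _; case: (hB_ j).
apply: (le_trans ((hB_ j).2 y)); rewrite (bigD1 j)//= addrCA lerDl addr_ge0//.
by apply: sumr_ge0 => i _; case: (hB_ i).
Qed.

Lemma gradsum_cutoffM k B v y : 0 <= B -> (forall y, cutoff P k y <= B) ->
  (forall j y, `|partial j (cutoff P k) y| <= B) -> smooth v ->
  gradsum (fun y => cutoff P k y * v y) y <= n%:R * B * `|v y| + B * gradsum v y.
Proof.
move=> B0 hB hdB sv; have [sc _ _] := cutoff_test P k.
rewrite /gradsum [B * _]mulr_sumr [n%:R * B * _](_ : _ = \sum_(j < n) B * `|v y|); last first.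
  by rewrite sumr_const card_ord -mulrA mulr_natl.
rewrite -big_split; apply: ler_sum => j _ /=; rewrite partialM// addrC.
apply: le_trans (ler_normD _ _) _; rewrite !normrM (mulrC `|v y|); apply: lerD.
  by rewrite ler_wpM2r// ger0_norm ?cutoff_ge0.
by rewrite ler_wpM2r.
Qed.

Lemma cutoffM_test k v : smooth v -> test_function (Defs.patch k) (fun y => cutoff P k y * v y).
Proof. by move=> sv; apply: test_functionM => //; exact: cutoff_test. Qed.

Lemma gradsum_patch k f y : test_function (Defs.patch k) f -> gradsum f y != 0 -> Defs.patch k y.
Proof.
move=> tf gy; have [j] : exists j, partial j f y != 0.
  apply: contrapT => /forallNP h; move: gy; rewrite /gradsum big1 ?eqxx// => j _.
  by have /negP := h j; rewrite negbK => /eqP ->; rewrite normr0.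
exact: test_supp (test_partial j tf).
Qed.

Let integral_combination (a b : R) v : smooth v -> 0 <= a -> 0 <= b ->
  (\int[leb]_(y in Omega) (a * gradsq v y + b * v y ^+ 2)%:E =
   a%:E * dirichlet v + b%:E * rL2sq leb Omega v)%E.
Proof.
move=> sv a0 b0; have mv := measurable_smooth sv; have mg := measurable_gradsq sv.
have m1 : measurable_fun Omega (fun y => (gradsq v y)%:E) by meas.
have m2 : measurable_fun Omega (fun y => (v y ^+ 2)%:E) by meas.
rewrite dirichletE// /rL2sq -!ge0_integralZl_EFin//; last 2 first.
- by pos.
- by move=> y _; rewrite lee_fin gradsq_ge0.
rewrite -ge0_integralD//.
- by move=> y _; rewrite -EFinM lee_fin mulr_ge0// gradsq_ge0.
- by meas.
- by pos.
- by meas.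
Qed.

Lemma loc_gagliardo_le k : exists2 C : R, 0 <= C & forall v, smooth v ->
  (real_gagliardo (rloc k v) <= C%:E * (dirichlet v + rL2sq leb Omega v))%E.
Proof.
have [C C0 hC] := real_gagliardo_le (coords k).
have [B B0 [hB hdB]] := cutoff_bound k.
pose K := 2 * (n%:R * B) ^+ 2; have K0 : 0 <= K by rewrite mulr_ge0// sqr_ge0.
exists (C * K) => [|v sv]; first by rewrite mulr_ge0.
have tf := cutoffM_test k sv.
have tfT : test_function setT (fun y => cutoff P k y * v y) by apply: test_functionS tf.
have sf : smooth (fun y => cutoff P k y * v y) by case: tf.
apply: (le_trans (hC _ tfT)); rewrite EFinM -muleA lee_wpmul2l ?lee_fin//.
apply: (@le_trans _ _ (\int[leb]_(y in Omega) (K * gradsq v y + K * v y ^+ 2)%:E)%E); last first.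
  have D0 : (0 <= dirichlet v)%E by apply: sume_ge0 => j _; exact: rL2sq_ge0.
  by rewrite integral_combination// (ge0_muleDr _ D0 (rL2sq_ge0 leb Omega v)).
have mg := measurable_gradsum sf.
apply: le_trans (epigraph_integral_le (k := k) (g := fun y => gradsum _ y ^+ 2) (measurable_funX 2 mg) _ _) _.
- by pos.
- by move=> y; rewrite sqrf_eq0; exact: gradsum_patch.
apply: ge0_le_integral => //.
- by pos.
- by meas.
- apply/measurable_EFinP; apply: measurable_funTS; apply: measurable_funD; apply: measurable_funM => //.
    exact: measurable_gradsq.
  by apply: measurable_funX; exact: measurable_smooth.
move=> y _; rewrite lee_fin.
have h := gradsum_cutoffM y B0 hB hdB sv.
have h2 := gradsum_le_gradsq v y.
set S := Num.sqrt _ in h2; have S2 : S ^+ 2 = gradsq v y by rewrite sqr_sqrtr// gradsq_ge0.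
have S0 : 0 <= S by exact: sqrtr_ge0.
have h3 : gradsum (fun y => cutoff P k y * v y) y <= n%:R * B * (`|v y| + S).
  by apply: (le_trans h); rewrite mulrDr lerD2l [n%:R * B]mulrC -mulrA ler_wpM2l.
apply: (@le_trans _ _ ((n%:R * B * (`|v y| + S)) ^+ 2)).
  by rewrite ler_pXn2r ?nnegrE ?gradsum_ge0// !mulr_ge0// addr_ge0.
rewrite -S2 -(real_normK (num_real (v y))) /K exprMn.
move: (`|v y|) S {h2 S2 S0 h3} => a b; rewrite -subr_ge0.
rewrite (_ : _ - _ = (n%:R * B) ^+ 2 * (a - b) ^+ 2); last by ring.
by pos.
Qed.

(** The [L^1] trace estimate is applied to the cutoff times [v^2], whose gradient contains
    [|v| |grad v|]. Young's inequality with weight [d] sends an arbitrarily small part to the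
    gradient; the division by [C + 1] anticipates the constant of the trace estimate. *)
Lemma loc_trace_le k (eta : R) : 0 < eta -> exists2 C : R, 0 <= C & forall v, smooth v ->
  (\int[leb']_x (cutoff P k (graph_point (coords k) x) * v (graph_point (coords k) x) ^+ 2)%:E <=
   eta%:E * dirichlet v + C%:E * rL2sq leb Omega v)%E.
Proof.
move=> eta0; have [C C0 hC] := trace_abs_le (coords k).
have [B B0 [hB hdB]] := cutoff_bound k.
pose d := eta / (C + 1); have d0 : 0 < d by rewrite divr_gt0// ltr_wpDl.
pose K := n%:R * B + (n%:R * B) ^+ 2 / d.
have K0 : 0 <= K by rewrite addr_ge0 ?mulr_ge0// ?sqr_ge0// invr_ge0 ltW.
exists (C * K) => [|v sv]; first by rewrite mulr_ge0.
have sv2 : smooth (fun y => v y * v y) by exact: smoothM.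
have tf := cutoffM_test k sv2.
have tfT : test_function setT (fun y => cutoff P k y * (v y * v y)) by apply: test_functionS tf.
have sf : smooth (fun y => cutoff P k y * (v y * v y)) by case: tf.
have mg := measurable_gradsum sf.
have D0 : (0 <= dirichlet v)%E by apply: sume_ge0 => j _; exact: rL2sq_ge0.
apply: (@le_trans _ _ (C%:E * \int[leb]_(y in epigraph (coords k))
    (gradsum (fun y => cutoff P k y * (v y * v y)) y)%:E)%E).
  apply: le_trans (hC _ tfT); apply: le_of_eq.
  apply: eq_integral => x _; rewrite expr2 ger0_norm// mulr_ge0 ?cutoff_ge0//.
  by rewrite -expr2 sqr_ge0.
apply: (@le_trans _ _ (C%:E * (d%:E * dirichlet v + K%:E * rL2sq leb Omega v))%E); last first.
  rewrite ge0_muleDr; last 2 first.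
  - by pos.
  - by rewrite mule_ge0 ?rL2sq_ge0// lee_fin.
  rewrite !muleA -!EFinM leeD2r// lee_wpmul2r// lee_fin /d mulrA ler_pdivrMr ?ltr_wpDl//.
  by rewrite mulrC ler_pM2l// lerDl.
rewrite lee_wpmul2l ?lee_fin// -integral_combination//; last exact: ltW.
apply: le_trans (epigraph_integral_le (k := k) mg _ _) _.
- exact: gradsum_ge0.
- by move=> y; exact: gradsum_patch.
apply: ge0_le_integral => //.
- by move=> y _; rewrite lee_fin gradsum_ge0.
- by meas.
- apply/measurable_EFinP; apply: measurable_funTS; apply: measurable_funD; apply: measurable_funM => //.
    exact: measurable_gradsq.
  by apply: measurable_funX; exact: measurable_smooth.
move=> y _; rewrite lee_fin.
have h := gradsum_cutoffM y B0 hB hdB sv2.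
have h2 := gradsum_le_gradsq v y.
set S := Num.sqrt _ in h2; have S2 : S ^+ 2 = gradsq v y by rewrite sqr_sqrtr// gradsq_ge0.
have g2 : gradsum (fun y => v y * v y) y = 2 * `|v y| * gradsum v y.
  rewrite /gradsum mulr_sumr; apply: eq_bigr => j _; rewrite partialM//.
  rewrite (_ : _ + _ = 2 * v y * partial j v y); last by ring.
  by rewrite !normrM normr_nat.
apply: (le_trans h); rewrite g2 normrM -S2 -(real_normK (num_real (v y))).
move: h2; set a := `|v y|; set s := gradsum v y => h2.
have a0 : 0 <= a by exact: normr_ge0.
apply: (@le_trans _ _ (n%:R * B * (a * a) + B * (2 * a * (n%:R * S)))).
  by rewrite lerD2l ler_wpM2l// ler_wpM2l// mulr_ge0.
rewrite -subr_ge0 (_ : _ - _ = d^-1 * (d * S - n%:R * B * a) ^+ 2).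
  by pos.
by rewrite /K; field; rewrite gt_eqF.
Qed.

Lemma loc_sq_le k : exists2 C : R, 0 <= C & forall v, smooth v ->
  (rL2sq leb' setT (rloc k v) <= C%:E * (dirichlet v + rL2sq leb Omega v))%E.
Proof.
have [C C0 hC] := loc_trace_le k ltr01.
have [B B0 [hB _]] := cutoff_bound k.
exists (B * (1 + C)) => [|v sv]; first by rewrite mulr_ge0// addr_ge0.
have mv := measurable_smooth sv.
have D0 : (0 <= dirichlet v)%E by apply: sume_ge0 => j _; exact: rL2sq_ge0.
have mGk := measurable_graph_point (coords k).
have mcG := measurableT_comp (measurable_cutoff P k) mGk.
have mvG := measurableT_comp mv mGk.
apply: (@le_trans _ _ (B%:E * \int[leb']_x (cutoff P k (graph_point (coords k) x) * v (graph_point (coords k) x) ^+ 2)%:E)%E).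
  rewrite -ge0_integralZl_EFin//; last 2 first.
  - by move=> x _; rewrite lee_fin mulr_ge0 ?cutoff_ge0// sqr_ge0.
  - by meas.
  apply: ge0_le_integral => //.
  - by pos.
  - by apply: measurable_sqr; exact: measurable_funM.
  - by meas.
  move=> x _; rewrite -EFinM lee_fin /rloc exprMn (mulrA B) ler_wpM2r ?sqr_ge0// expr2.
  by rewrite ler_wpM2r// cutoff_ge0.
rewrite EFinM -muleA lee_wpmul2l ?lee_fin//; apply: (le_trans (hC _ sv)).
rewrite (ge0_muleDr _ D0 (rL2sq_ge0 leb Omega v)); apply: leeD.
  by apply: lee_wpmul2r => //; rewrite lee_fin lerDl.
by apply: lee_wpmul2r; rewrite ?rL2sq_ge0// lee_fin lerDr.
Qed.

(** Where the derivative does not exist, [partial] takes the default value [point], whose absolute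
    value is therefore added. The bound then holds everywhere, without recourse to Rademacher's
    theorem. *)
Lemma partial_lipschitz_le (h : V' -> R) (L : R) j x : 0 <= L ->
  (forall x y, `|h x - h y| <= L * `|x - y|) -> `|partial j h x| <= L + `|point : R|.
Proof.
move=> L0 hL; rewrite /partial.
have [dh|ndh] := pselect (derivable h x (delta_mx 0 j)); last first.
  by rewrite /derive dvgP// lerDr.
apply: (@le_trans _ _ L); last by rewrite lerDl.
have /cvg_norm c1 := @partial_seq_cvg R m.+1 h x j dh.
apply: (ler_cvg_to c1 (cvg_cst L)); near=> k.
rewrite normrM; apply: (@le_trans _ _ (`|k.+1%:R| * (L * `|k.+1%:R^-1 *: delta_mx 0 j : V'|))).
  apply: ler_wpM2l => //; apply: (le_trans (hL _ _)).
  by rewrite (addrC x) addrK.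
rewrite normrZ mulrCA (mulrA `|k.+1%:R|) -normrM mulfV ?pnatr_eq0// normr1 mul1r ler_piMr//.
by apply: norm_rV_le => // i; rewrite mxE /=; case: (i == j); rewrite ?normr1 ?normr0.
Unshelve. all: by end_near. Qed.

Lemma area_density_bounded k : exists2 B : R, 0 <= B & forall x, area_density (coords k) x <= B.
Proof.
have [L L0 hL] := height_lip (coords k).
pose b := L + `|point : R|; have b0 : 0 <= b by rewrite addr_ge0// ltW.
exists (1 + m.+1%:R * b ^+ 2) => [|x]; first by rewrite addr_ge0// mulr_ge0// sqr_ge0.
have s0 : 0 <= 1 + m.+1%:R * b ^+ 2 by pos.
rewrite /area_density -[leRHS](ger0_norm s0) -sqrtr_sqr ler_sqrt ?sqr_ge0//.
apply: (@le_trans _ _ (1 + m.+1%:R * b ^+ 2)); last first.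
  by rewrite expr2 ler_peMl// lerDl mulr_ge0// sqr_ge0.
rewrite lerD2l; apply: (@le_trans _ _ (\sum_(j < m.+1) b ^+ 2)).
  apply: ler_sum => j _; rewrite -(real_normK (num_real (partial _ _ _))).
  by rewrite ler_pXn2r ?nnegrE//; apply: partial_lipschitz_le => //; exact: ltW.
by rewrite sumr_const card_ord mulr_natl.
Qed.

Lemma measurable_boundary : measurable dO.
Proof.
apply: measurableD; last by apply: open_measurable_rV; exact: open_interior.
by rewrite -[closure _]setCK; apply: measurableC; apply: open_measurable_rV; apply: closed_openC; exact: closed_closure.
Qed.

Lemma cutoff_boundary k x : cutoff P k (graph_point (coords k) x) != 0 ->
  dO (graph_point (coords k) x).
Proof. by move=> /(test_supp (cutoff_test P k)); exact: graph_point_boundary. Qed.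

(** [f] is controlled only on the boundary, but wherever the cutoff is not zero the graph point lies
    on the boundary; elsewhere the product is 0. *)
Lemma measurable_rloc k f : measurable_fun dO f -> mfunT (rloc k f).
Proof.
move=> /(measurable_restrictT _ measurable_boundary) mf.
rewrite (_ : rloc k f = rloc k (f \_ dO)).
  apply: measurable_funM.
    exact: (measurableT_comp (measurable_cutoff P k) (measurable_graph_point _)).
  exact: (measurableT_comp mf (measurable_graph_point _)).
apply/funext => x; rewrite /rloc patchE.
have [->|/cutoff_boundary dx] := eqVneq (cutoff P k (graph_point (coords k) x)) 0.
  by rewrite !mul0r.
by rewrite mem_set.
Qed.

Lemma rlocB k f g x : rloc k (fun y => f y - g y) x = rloc k f x - rloc k g x.
Proof. by rewrite /rloc mulrBr. Qed.

(* Weighted by the cutoff instead of its square, which is what controls the norm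
   of L^2(d omega). *)
Definition patch_sq k f : \bar R := (\int[leb']_x
  (cutoff P k (graph_point (coords k) x) * f (graph_point (coords k) x) ^+ 2)%:E)%E.

Lemma measurable_patch_sq k f : measurable_fun dO f ->
  mfunT (fun x => (cutoff P k (graph_point (coords k) x) * f (graph_point (coords k) x) ^+ 2)%:E).
Proof.
move=> /(measurable_restrictT _ measurable_boundary) mf.
rewrite (_ : (fun _ => _) = (fun x => (cutoff P k (graph_point (coords k) x) * (f \_ dO) (graph_point (coords k) x) ^+ 2)%:E)).
  apply/measurable_EFinP; apply: measurable_funM.
    exact: (measurableT_comp (measurable_cutoff P k) (measurable_graph_point _)).
  exact: (measurable_funX 2 (measurableT_comp mf (measurable_graph_point _))).
apply/funext => x; rewrite patchE.
have [->|/cutoff_boundary dx] := eqVneq (cutoff P k (graph_point (coords k) x)) 0.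
  by rewrite !mul0r.
by rewrite mem_set.
Qed.

Lemma patch_sq_ge0 k f : (0 <= patch_sq k f)%E.
Proof. by apply: integral_ge0 => x _; rewrite lee_fin mulr_ge0 ?cutoff_ge0// sqr_ge0. Qed.

Lemma surface_sq_le_patch : exists2 B : R, 0 <= B & forall f, measurable_fun dO f ->
  (rL2sq omega dO f <= B%:E * \sum_k patch_sq k f)%E.
Proof.
have /choice[B_ hB_] k : exists b : R, 0 <= b /\ forall x, area_density (coords k) x <= b.
  by have [b b0 hb] := area_density_bounded k; exists b.
pose B := \sum_k B_ k; have B0 : 0 <= B by apply: sumr_ge0 => k _; case: (hB_ k).
have hB k x : area_density (coords k) x <= B.
  apply: (le_trans ((hB_ k).2 x)); rewrite /B (bigD1 k)//= lerDl.
  by apply: sumr_ge0 => i _; case: (hB_ i).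
exists B => // f mf.
have mf' : mfunT (f \_ dO) by apply/(measurable_restrictT _ measurable_boundary).
pose q y := (((f \_ dO) y) ^+ 2)%:E.
have q0 y : (0 <= q y)%E by rewrite lee_fin sqr_ge0.
have mq : mfunT q by exact: measurable_sqr.
apply: (@le_trans _ _ (\int[omega]_y q y)%E).
  rewrite /rL2sq integral_mkcond; apply: le_of_eq; apply: eq_integral => y _.
  by rewrite /q !patchE; case: ifP => // _; rewrite expr0n.
apply: (le_trans (surface_integral_le P q0 mq)); rewrite ge0_sume_distrr; last first.
  by move=> k _; exact: patch_sq_ge0.
apply: lee_sum => k _; rewrite /patch_sq.
have mp := measurable_patch_sq k mf.
rewrite -ge0_integralZl_EFin//; last by move=> x _; rewrite lee_fin mulr_ge0 ?cutoff_ge0// sqr_ge0.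
apply: ge0_le_integral => //.
- by move=> x _; apply: mule_ge0 => //; rewrite lee_fin surface_density_ge0.
- apply: emeasurable_funM; first exact: (measurableT_comp mq (measurable_graph_point _)).
  by apply/measurable_EFinP; exact: measurable_surface_density.
- by meas.
move=> x _; rewrite -!EFinM lee_fin /surface_density patchE.
have [->|c0] := eqVneq (cutoff P k (graph_point (coords k) x)) 0; first by rewrite !(mul0r, mulr0).
rewrite mem_set; last exact: cutoff_boundary c0.
rewrite mulrA (mulrC _ (area_density _ _)) (mulrC (_ ^+ 2)); apply: ler_wpM2r => //.
by rewrite mulr_ge0 ?sqr_ge0// cutoff_ge0.
Qed.

Lemma patch_sq_fatou k (f_ : nat -> V -> R) f (c : \bar R) N :
  (forall l, measurable_fun dO (f_ l)) -> measurable_fun dO f ->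
  {ae leb', forall x, rloc k (f_ l) x @[l --> \oo] --> rloc k f x} ->
  (forall l, (N <= l)%N -> (patch_sq k (f_ l) <= c)%E) -> (patch_sq k f <= c)%E.
Proof.
move=> mf_ mf cf hc.
apply: (@fatou_le _ _ _ leb' setT measurableT (fun l x =>
  (cutoff P k (graph_point (coords k) x) * f_ l (graph_point (coords k) x) ^+ 2)%:E) _ c N) => //.
- by move=> l; exact: measurable_patch_sq.
- exact: measurable_patch_sq.
- by move=> l x _; rewrite lee_fin mulr_ge0 ?cutoff_ge0// sqr_ge0.
- by move=> x _; rewrite lee_fin mulr_ge0 ?cutoff_ge0// sqr_ge0.
apply: filterS cf => x + _; rewrite /rloc.
have [->|c0] := eqVneq (cutoff P k (graph_point (coords k) x)) 0.
  by move=> _; under eq_fun do rewrite mul0r; rewrite mul0r; exact: cvg_cst.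
move=> h; have : f_ l (graph_point (coords k) x) @[l --> \oo] --> f (graph_point (coords k) x).
  rewrite -(mulKf c0 (f _)); under eq_fun => l do rewrite -(mulKf c0 (f_ l _)).
  exact: (cvgM (cvg_cst _) h).
move=> h2; apply/cvg_EFin; first by near=> l.
rewrite expr2 /comp/=; under eq_fun => l do rewrite expr2.
exact: (cvgM (cvg_cst _) (cvgM h2 h2)).
Unshelve. all: by end_near. Qed.

Lemma dirichlet_ge0 v : (0 <= dirichlet v)%E.
Proof. by apply: sume_ge0 => j _; exact: rL2sq_ge0. Qed.

Lemma smooth_measurable (D : set V) v : smooth v -> measurable_fun D v.
Proof. by move=> /measurable_smooth; exact: measurable_funTS. Qed.

Lemma rL2sq_near (f g : V -> R) (e : R) : measurable_fun Omega f -> measurable_fun Omega g ->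
  (rL2sq leb Omega (fun x => (f x - g x)%R) <= e%:E)%E ->
  (rL2sq leb Omega f <= 2%:E * rL2sq leb Omega g + (2 * e)%:E)%E.
Proof.
move=> mf mg fe; have mfg : measurable_fun Omega (fun x => f x - g x) by exact: measurable_funB.
have := @rL2sqD _ _ _ leb Omega mO _ _ mg mfg.
rewrite (_ : (fun x => _) = f); last by apply/funext => x; rewrite addrC subrK.
move/le_trans; apply; rewrite leeD2l// EFinM; apply: lee_wpmul2l fe.
by [].
Qed.

Definition trace_cvg k u (G : 'I_n -> V -> R) g (v_ : nat -> V -> R) :=
  forall e : R, 0 < e -> exists N, forall l, (N <= l)%N ->
    [/\ (rL2sq leb Omega (fun x => (v_ l x - u x)%R) <= e%:E)%E,
       forall j, (rL2sq leb Omega (fun x => (partial j (v_ l) x - G j x)%R) <= e%:E)%E &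
       (rL2sq leb' setT (rloc k (fun x => (v_ l x - g x)%R)) <= e%:E)%E].

Let patch_bound k (eta C : R) :=
  forall u (G : 'I_n -> V -> R) g (v_ : nat -> V -> R), (forall l, smooth (v_ l)) ->
  rL2 leb Omega u -> (forall j, rL2 leb Omega (G j)) -> measurable_fun dO g ->
  trace_cvg k u G g v_ ->
  (patch_sq k g <= eta%:E * \sum_j rL2sq leb Omega (G j) + C%:E * rL2sq leb Omega u)%E.

(** [trace_cvg] controls the square of the cutoff, while [patch_sq] carries its first power. The
    passage to the limit is therefore pointwise: a subsequence converges almost everywhere in the
    chart, and Fatou's lemma keeps the bound of the smooth functions. *)
Let trace_patch_sq_le k (eta : R) : 0 < eta -> exists2 C : R, 0 <= C & patch_bound k eta C.
Proof.
(* Half of [eta] is used, because replacing [v_] by its limit in [rL2sq_near] costs a factor 2. *)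
move=> eta0; have e20 : 0 < eta / 2 by rewrite divr_gt0.
have [C C0 hC] := loc_trace_le k e20.
exists (2 * C) => [|u G g v_ sv [mu lu] GL mg H]; first by rewrite mulr_ge0.
have mv l : measurable_fun dO (v_ l) by exact: smooth_measurable.
have m2 l : measurable_fun dO (fun x => v_ l x - g x) by exact: measurable_funB.
have pre l : exists N, forall i, (N <= i)%N ->
    (rL2sq leb' setT (rloc k (fun x => (v_ i x - g x)%R)) <= (8^-1 ^+ l)%:E)%E.
  have [|N hN] := H (8^-1 ^+ l); first by rewrite exprn_gt0// invr_gt0.
  by exists N => i /hN[].
have [phi [phim phige phiP]] := fast_subsequence pre.
have cv := @ae_cvg0_of_geometric _ _ _ leb' (fun l => rloc k (fun x => v_ (phi l) x - g x))
  (fun l => measurable_rloc k (m2 _)) (fun l => phiP l _ (leqnn _)).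
have cv' : {ae leb', forall x, rloc k (v_ (phi (2 * l)%N)) x @[l --> \oo] --> rloc k g x}.
  apply: filterS cv => x h; rewrite -(add0r (rloc k g x)).
  under eq_fun => l do rewrite -(subrK (rloc k g x) (rloc k (v_ _) x)) -rlocB.
  exact: (cvgD h (cvg_cst _)).
have key (e : R) : 0 < e -> (patch_sq k g <= eta%:E * (\sum_j rL2sq leb Omega (G j)) +
    (2 * C)%:E * rL2sq leb Omega u + ((eta * n%:R + 2 * C) * e)%:E)%E.
  move=> e0; have [N hN] := H e e0.
  apply: (@patch_sq_fatou k (fun l => v_ (phi (2 * l)%N)) g _ N) => // l Nl.
  set i := phi _; have Ni : (N <= i)%N.
    by apply: (leq_trans Nl); apply: (leq_trans _ (phige _)); rewrite mul2n -addnn leq_addl.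
  have [h1 h2 _] := hN _ Ni.
  apply: (le_trans (hC _ (sv i))).
  have n1 := rL2sq_near (@smooth_measurable Omega _ (sv i)) mu h1.
  have n2 : (dirichlet (v_ i) <= 2%:E * (\sum_j rL2sq leb Omega (G j)) + (2 * n%:R * e)%:E)%E.
    rewrite /dirichlet ge0_sume_distrr; last by move=> j _; exact: rL2sq_ge0.
    rewrite (_ : (2 * n%:R * e)%:E = \sum_(j < n) (2 * e)%:E)%E; last first.
      by rewrite sumEFin sumr_const card_ord -[in RHS]mulr_natl; congr EFin; ring.
    rewrite -big_split; apply: lee_sum => j _.
    apply: (rL2sq_near _ _ (h2 j)); last by case: (GL j).
    by apply: smooth_measurable; exact: smooth_partial.
  have p0 : (0 <= (eta / 2)%:E)%E by pos.
  have p1 : (0 <= C%:E)%E by pos.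
  apply: (le_trans (leeD (lee_wpmul2l p0 n2) (lee_wpmul2l p1 n1))).
  have S0 : (0 <= \sum_j rL2sq leb Omega (G j))%E by apply: sume_ge0 => j _; exact: rL2sq_ge0.
  move: S0 (rL2sq_ge0 leb Omega u); move: (\sum_j _)%E (rL2sq _ _ _) => X Y X0 Y0.
  rewrite !ge0_muleDr ?mule_ge0 ?lee_fin ?mulr_ge0 ?(ltW e0)//.
  rewrite !muleA -!EFinM addeACA -EFinD divfK// (mulrC C 2).
  apply: le_of_eq; congr (_ + _ + _)%E.
  by congr EFin; field.
apply/lee_addgt0Pr => e e0.
pose D := eta * n%:R + 2 * C; have D0 : 0 <= D by rewrite addr_ge0// mulr_ge0// ltW.
apply: (le_trans (key (e / (D + 1)) _)); first by rewrite divr_gt0// ltr_wpDl.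
rewrite leeD2l// lee_fin mulrA ler_pdivrMr ?ltr_wpDl// mulrC ler_pM2l//.
by rewrite lerDl.
Unshelve. all: by end_near. Qed.

Lemma trace_surface_sq_le (eta : R) : 0 < eta -> exists2 C : R, 0 <= C &
  forall u (G : 'I_n -> V -> R) g (v_ : nat -> V -> R), (forall l, smooth (v_ l)) ->
  rL2 leb Omega u -> (forall j, rL2 leb Omega (G j)) -> measurable_fun dO g ->
  (forall k, trace_cvg k u G g v_) ->
  (rL2sq omega dO g <= eta%:E * \sum_j rL2sq leb Omega (G j) + C%:E * rL2sq leb Omega u)%E.
Proof.
move=> eta0; have [B B0 hB] := surface_sq_le_patch.
pose N : R := (npatch A)%:R; have N0 : 0 <= N by exact: ler0n.
(* Summation over the patches and multiplication by [B] must leave at most [eta]; the added ones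
   keep the denominator positive. *)
pose e := eta / ((B + 1) * (N + 1)).
have e0 : 0 < e by rewrite divr_gt0// mulr_gt0// ltr_wpDl.
have /choice[C_ hC_] k : exists c, 0 <= c /\ patch_bound k e c.
  by have [c c0 hc] := trace_patch_sq_le k e0; exists c.
pose C := \sum_k C_ k; have C0 : 0 <= C by apply: sumr_ge0 => k _; case: (hC_ k).
exists (B * C) => [|u G g v_ sv uL GL mg H]; first by rewrite mulr_ge0.
apply: (le_trans (hB g mg)).
have S0 : (0 <= \sum_j rL2sq leb Omega (G j))%E by apply: sume_ge0 => j _; exact: rL2sq_ge0.
have Y0 := rL2sq_ge0 leb Omega u.
have le1 k : (patch_sq k g <= e%:E * (\sum_j rL2sq leb Omega (G j)) + (C_ k)%:E * rL2sq leb Omega u)%E.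
  exact: (hC_ k).2 (H k).
apply: (@le_trans _ _ (B%:E * \sum_k (e%:E * (\sum_j rL2sq leb Omega (G j)) + (C_ k)%:E * rL2sq leb Omega u))%E).
  by apply: lee_wpmul2l; [rewrite lee_fin|apply: lee_sum => k _; exact: le1].
move: S0 Y0; move: (\sum_j _)%E (rL2sq _ _ _) => X Y X0 Y0.
have scale (x_ : 'I_(npatch A) -> R) Z : (forall k, 0 <= x_ k) ->
    (\sum_k (x_ k)%:E * Z = (\sum_k x_ k)%:E * Z)%E.
  by move=> x0; rewrite -sumEFin ge0_sume_distrl// => k _; rewrite lee_fin.
rewrite big_split/= !scale => [|k|k]; last 2 first.
- by case: (hC_ k).
- exact: ltW.
rewrite ge0_muleDr ?mule_ge0 ?lee_fin ?sumr_ge0//; last 2 first.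
- by pos.
- by move=> k _; case: (hC_ k).
rewrite !muleA -!EFinM leeD2r//; apply: lee_wpmul2r => //; rewrite lee_fin.
rewrite sumr_const card_ord -[_ *+ npatch A]mulr_natl -/N /e.
rewrite !mulrA ler_pdivrMr ?mulr_gt0 ?ltr_wpDl// [leRHS]mulrC.
by apply: ler_wpM2r; [exact: ltW|apply: ler_pM => //; rewrite lerDl].
Qed.

Lemma smooth_bound : exists2 C : R, 0 <= C & forall k v, smooth v ->
  (rL2sq leb' setT (rloc k v) <= C%:E * (dirichlet v + rL2sq leb Omega v))%E /\
  (real_gagliardo (rloc k v) <= C%:E * (dirichlet v + rL2sq leb Omega v))%E.
Proof.
have /choice[C_ hC_] k : exists c : R, 0 <= c /\ forall v, smooth v ->
  (rL2sq leb' setT (rloc k v) <= c%:E * (dirichlet v + rL2sq leb Omega v))%E /\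
  (real_gagliardo (rloc k v) <= c%:E * (dirichlet v + rL2sq leb Omega v))%E.
  have [c1 c10 h1] := loc_sq_le k; have [c2 c20 h2] := loc_gagliardo_le k.
  exists (c1 + c2); split=> [|v sv]; first exact: addr_ge0.
  have E0 : (0 <= dirichlet v + rL2sq leb Omega v)%E.
    by rewrite adde_ge0 ?rL2sq_ge0// dirichlet_ge0.
  split; [apply: (le_trans (h1 v sv))|apply: (le_trans (h2 v sv))];
    by apply: lee_wpmul2r => //; rewrite lee_fin ?lerDl ?lerDr.
exists (\sum_k C_ k) => [|k v sv]; first by apply: sumr_ge0 => k _; case: (hC_ k).
have E0 : (0 <= dirichlet v + rL2sq leb Omega v)%E.
  by rewrite adde_ge0 ?rL2sq_ge0// dirichlet_ge0.
have le1 : ((C_ k)%:E * (dirichlet v + rL2sq leb Omega v) <=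
    (\sum_k C_ k)%:E * (dirichlet v + rL2sq leb Omega v))%E.
  apply: lee_wpmul2r => //; rewrite lee_fin (bigD1 k)//= lerDl.
  by apply: sumr_ge0 => i _; case: (hC_ i).
have [h1 h2] := (hC_ k).2 v sv.
by split; [exact: le_trans le1|exact: le_trans le1].
Qed.

(** Smooth approximants are chosen so fast that they converge almost everywhere in every chart.
    Their pointwise limit, taken on the whole space, is one function that represents the trace in
    all charts, so nothing has to be glued. *)
Theorem real_trace_exists u G : rgrad Omega u G -> exists (g : V -> R) (v_ : nat -> V -> R), [/\ forall l, smooth (v_ l),
  mfunT g, rL2 omega dO g, forall k, trace_cvg k u G g v_ &
  forall e : R, 0 < e -> exists N, forall l, (N <= l)%N ->
    [/\ (rL2sq leb Omega (fun x => (v_ l x - u x)%R) <= e%:E)%E,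
       forall j, (rL2sq leb Omega (fun x => (partial j (v_ l) x - G j x)%R) <= e%:E)%E &
       forall k, (real_gagliardo (rloc k (fun x => (v_ l x - g x)%R)) <= e%:E)%E]].
Proof.
move=> uG; have [uL wG] := uG; have GL j : rL2 leb Omega (G j) by case: (wG j).
have [C C0 hC] := smooth_bound.
(* For [l <= i], the difference of approximants and its [n] partial derivatives have squared norms
   at most [4 d l]. Dividing by [K] makes [C] times their sum at most [8^-l], the rate needed for
   convergence almost everywhere. *)
pose K := (C + 1) * (4 * n.+1%:R); have K0 : 0 < K by rewrite mulr_gt0// ltr_wpDl.
pose d l : R := 8^-1 ^+ l / K; have d0 l : 0 < d l by rewrite divr_gt0// exprn_gt0// invr_gt0.
have dle l i : (l <= i)%N -> d i <= d l.
  move=> li; rewrite /d ler_pM2r ?invr_gt0//; apply: ler_wiXn2l => //.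
  by rewrite invf_le1// ler1n.
have /choice[v_ hv_] l := smooth_dense oO bO (fun p => @lipschitz_cone _ _ _ oO A p) uG (d0 l).
have sv l : smooth (v_ l) by case: (hv_ l).
have near2 (f g h : V -> R) l i : measurable_fun Omega f -> measurable_fun Omega g ->
    measurable_fun Omega h -> (l <= i)%N ->
    (rL2sq leb Omega (fun x => (f x - h x)%R) <= (d l)%:E)%E ->
    (rL2sq leb Omega (fun x => (g x - h x)%R) <= (d i)%:E)%E ->
    (rL2sq leb Omega (fun x => (f x - g x)%R) <= (4 * d l)%:E)%E.
  move=> mf mg mh li h1 h2.
  have m1 : measurable_fun Omega (fun x => f x - h x) by meas.
  have m2 : measurable_fun Omega (fun x => (-1) * (g x - h x)) by meas.
  have := @rL2sqD _ _ _ leb Omega mO _ _ m1 m2.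
  rewrite (_ : (fun x => _ + _) = (fun x => f x - g x)); last by apply/funext => x; ring.
  move/le_trans; apply; rewrite rL2sqZ//; last exact: measurable_funB.
  rewrite sqrrN expr1n mul1e (_ : 4 * d l = 2 * d l + 2 * d l); last by ring.
  rewrite (EFinD (2 * d l)) !(EFinM 2 (d l)); apply: leeD; apply: lee_wpmul2l => //.
  by apply: (le_trans h2); rewrite lee_fin; exact: dle.
have steps k l i : (l <= i)%N ->
    (rL2sq leb' setT (rloc k (fun x => (v_ l x - v_ i x)%R)) <= (8^-1 ^+ l)%:E)%E /\
    (real_gagliardo (rloc k (fun x => (v_ l x - v_ i x)%R)) <= (8^-1 ^+ l)%:E)%E.
  move=> li; have sw := smoothB (sv l) (sv i).
  have [_ hl hgl] := hv_ l; have [_ hi hgi] := hv_ i.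
  have b1 := near2 _ _ _ _ _ (@smooth_measurable Omega _ (sv l)) (@smooth_measurable Omega _ (sv i)) uL.1 li hl hi.
  have b2 : (dirichlet (fun x => (v_ l x - v_ i x)%R) <= (n%:R * (4 * d l))%:E)%E.
    rewrite (_ : (n%:R * (4 * d l))%:E = \sum_(j < n) (4 * d l)%:E)%E; last first.
      by rewrite sumEFin sumr_const card_ord mulr_natl.
    apply: lee_sum => j _.
    rewrite (_ : partial j _ = (fun x => partial j (v_ l) x - partial j (v_ i) x)); last first.
      by apply/funext => x; rewrite (partialB j x (sv l) (sv i)).
    apply: near2 li (hgl j) (hgi j); last by case: (GL j).
      exact: smooth_measurable (smooth_partial _ (sv l)).
    exact: smooth_measurable (smooth_partial _ (sv i)).
  have b3 : (C%:E * (dirichlet (fun x => (v_ l x - v_ i x)%R) +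
      rL2sq leb Omega (fun x => (v_ l x - v_ i x)%R)) <= (8^-1 ^+ l)%:E)%E.
    apply: (le_trans (lee_wpmul2l _ (leeD b2 b1))); first by rewrite lee_fin.
    rewrite -EFinD -EFinM lee_fin (_ : _ + _ = 4 * n.+1%:R * d l); last by rewrite -[n.+1%:R]natr1; ring.
    rewrite mulrA /d mulrA ler_pdivrMr// mulrC ler_wpM2l ?exprn_ge0 ?invr_ge0// /K.
    by rewrite ler_wpM2r ?mulr_ge0// lerDl.
  have [h1 h2] := hC k _ sw.
  by split; [exact: le_trans b3|exact: le_trans b3].
have mv_ (D : set V) l : measurable_fun D (v_ l) by exact: smooth_measurable.
pose g := limit_fun v_.
have mg : mfunT g by apply: measurable_limit_fun.
have mgd : measurable_fun dO g by meas.
have mr k l : mfunT (rloc k (v_ l)) by apply: measurable_rloc.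
have cv k : {ae leb', forall x, rloc k (v_ l) x @[l --> \oo] --> rloc k g x}.
  have st l : (\int[leb']_x ((rloc k (v_ l.+1) x - rloc k (v_ l) x) ^+ 2)%:E <= (8^-1 ^+ l)%:E)%E.
    have [h _] := steps k l l.+1 (leqnSn _); apply: le_trans h.
    apply: le_of_eq; apply: eq_integral => x _.
    by rewrite rlocB -sqrrN opprB.
  have := ae_cvg_of_geometric_steps measurableT (mr k) st.
  apply: filterS => x /(_ Logic.I); rewrite /rloc => cx.
  have [->|c0] := eqVneq (cutoff P k (graph_point (coords k) x)) 0.
    by under eq_fun do rewrite mul0r; rewrite mul0r; exact: cvg_cst.
  apply: cvgM; first exact: cvg_cst.
  apply: limit_funE; have /cvg_ex[t ht] := cx; apply/cvg_ex; exists ((cutoff P k (graph_point (coords k) x))^-1 * t).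
  under eq_fun => l do rewrite -(mulKf c0 (v_ l _)).
  exact: (cvgM (cvg_cst _) ht).
have cvd k l : {ae leb', forall x, rloc k (fun x => v_ l x - v_ i x) x @[i --> \oo] --> rloc k (fun x => v_ l x - g x) x}.
  apply: filterS (cv k) => x h; rewrite rlocB; under eq_fun => i do rewrite rlocB.
  exact: (cvgB (cvg_cst _) h).
have mrd k l f : measurable_fun dO f -> mfunT (rloc k (fun x => v_ l x - f x)).
  by move=> mf; apply: measurable_rloc; exact: measurable_funB.
have geo (e : R) : 0 < e -> exists N, forall l, (N <= l)%N -> 8^-1 ^+ l <= e.
  move=> e0; have l8 : `|8^-1 : R| < 1 by rewrite ger0_norm ?invr_ge0// invf_lt1// ltr1n.
  have /cvgrPdist_le/(_ e e0)[N _ hN] := cvg_expr l8.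
  exists N => l Nl; have := hN l Nl; by rewrite /= sub0r normrN ger0_norm.
have d8 l : d l <= 8^-1 ^+ l.
  rewrite /d ler_pdivrMr// ler_peMr ?exprn_ge0 ?invr_ge0//.
  have k1 : 1 <= C + 1 by rewrite lerDr.
  have k2 : 1 <= 4 * n.+1%:R :> R by rewrite -natrM ler1n.
  by rewrite -[leLHS]mul1r; apply: ler_pM.
have tc k : trace_cvg k u G g v_.
  move=> e e0; have [N hN] := geo e e0; exists N => l Nl.
  have dle' : d l <= e := le_trans (d8 l) (hN l Nl).
  have [_ h1 h2] := hv_ l; split=> [|j|].
  - by apply: (le_trans h1).
  - by apply: (le_trans (h2 j)).
  - apply: (@le_trans _ _ ((8^-1 ^+ l)%:E)); last by rewrite lee_fin; exact: hN.
    apply: (@fatou_le _ _ _ leb' setT measurableT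
      (fun i x => (rloc k (fun x => v_ l x - v_ i x) x ^+ 2)%:E) _ _ l) => //.
    + by move=> i; apply: measurable_sqr; exact: mrd.
    + by apply: measurable_sqr; exact: mrd.
    + by pos.
    + by pos.
    + apply: filterS (cvd k l) => x h _; apply/cvg_EFin; first by near=> i.
      by rewrite expr2 /comp/=; under eq_fun => i do rewrite expr2; exact: (cvgM h h).
    + by move=> i li; exact: (steps k l i li).1.
exists g, v_; split => //.
- split=> //; have [B B0 hB] := trace_surface_sq_le ltr01.
  apply: (le_lt_trans (hB u G g v_ sv uL GL mgd tc)).
  rewrite lte_add_pinfty// lte_mul_pinfty ?lee_fin//; last by case: uL.
  by apply: lte_sum_pinfty => j _; case: (GL j).
move=> e /geo[N hN]; exists N => l Nl.
have dle' : d l <= e := le_trans (d8 l) (hN l Nl).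
have [_ h1 h2] := hv_ l; split=> [|j|k].
- by apply: (le_trans h1); rewrite lee_fin.
- by apply: (le_trans (h2 j)); rewrite lee_fin.
- apply: (@real_gagliardo_fatou _ _ _ _ _ l _ (mrd k l _ mgd) (cvd k l)).
    by move=> i; exact: mrd.
  by move=> i li; apply: (le_trans (steps k l i li).2); rewrite lee_fin; exact: hN.
Unshelve. all: by end_near. Qed.

End boundary_estimates.

(** * Complex-valued functions *)

Local Open Scope complex_scope.

Section complex_parts.
Context {R : realType} {T : Type}.
Implicit Types (f g : T -> R[i]) (z w : R[i]).

Definition rep f : T -> R := fun x => complex.Re (f x).
Definition imp f : T -> R := fun x => complex.Im (f x).
Definition cpx (a b : T -> R) : T -> R[i] := fun x => a x +i* b x.

Lemma rep_lin z f g : rep (fun x => z * f x + g x) =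
  (fun x => complex.Re z * rep f x + (- complex.Im z * imp f x + rep g x)).
Proof.
apply/funext => x; rewrite /rep /imp; case: z => a b; case: (f x) => c d; case: (g x) => c' d' /=.
by ring.
Qed.

Lemma imp_lin z f g : imp (fun x => z * f x + g x) =
  (fun x => complex.Re z * imp f x + (complex.Im z * rep f x + imp g x)).
Proof.
apply/funext => x; rewrite /rep /imp; case: z => a b; case: (f x) => c d; case: (g x) => c' d' /=.
by ring.
Qed.

Lemma repB f g : rep (f - g) = (fun x => rep f x - rep g x).
Proof. by apply/funext => x; rewrite /rep [(f - g) x]/(f x - g x); case: (f x) => a b; case: (g x). Qed.

Lemma impB f g : imp (f - g) = (fun x => imp f x - imp g x).
Proof. by apply/funext => x; rewrite /imp [(f - g) x]/(f x - g x); case: (f x) => a b; case: (g x). Qed.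

Lemma subE f g : f - g = (fun x => (-1) * g x + f x).
Proof. by apply/funext => x; rewrite [(f - g) x]/(f x - g x) mulN1r addrC. Qed.

Lemma csqr_ge0 z : 0 <= csqr z.
Proof. by rewrite /csqr addr_ge0// sqr_ge0. Qed.

Lemma complex_eq z w : complex.Re z = complex.Re w -> complex.Im z = complex.Im w -> z = w.
Proof. by case: z => a b; case: w => c d /= -> ->. Qed.

(** [N] stands for a squared seminorm of real functions, that of [L^2] or of [H^{1/2}], and [M] for
    the functions on which its rules hold. The real and imaginary parts of [z f + g] have three
    terms each, so the factor 2 occurs twice. *)
Lemma complex_quadratic (M : set (T -> R)) (N : (T -> R) -> \bar R) :
  (forall h, 0 <= N h)%E ->
  (forall a h k, M h -> M k -> M (fun x => a * h x + k x)) ->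
  (forall h k, M h -> M k -> N (fun x => h x + k x)%R <= 2%:E * N h + 2%:E * N k)%E ->
  (forall a h, M h -> N (fun x => a * h x)%R = (a ^+ 2)%:E * N h)%E -> M (fun=> 0) ->
  forall z f g, M (rep f) -> M (imp f) -> M (rep g) -> M (imp g) ->
  (N (rep (fun x => (z * f x + g x)%R)) + N (imp (fun x => (z * f x + g x)%R)) <=
    (4 * csqr z)%:E * (N (rep f) + N (imp f)) + 4%:E * (N (rep g) + N (imp g)))%E.
Proof.
move=> N0 ML ND NZ M0 z f g Mrf Mif Mrg Mig; rewrite rep_lin imp_lin.
have MZ a h : M h -> M (fun x => a * h x).
  by move=> Mh; have := ML a h _ Mh M0; congr M; apply/funext => x; rewrite addr0.
have step a b (h h' h'' : T -> R) : M h -> M h' -> M h'' ->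
    (N (fun x => a * h x + (b * h' x + h'' x))%R <=
     (2 * a ^+ 2)%:E * N h + ((4 * b ^+ 2)%:E * N h' + 4%:E * N h''))%E.
  move=> Mh Mh' Mh''; apply: (le_trans (ND _ _ (MZ a _ Mh) (ML b _ _ Mh' Mh''))).
  rewrite NZ// muleA -EFinM leeD2l//.
  apply: (le_trans (lee_wpmul2l _ (ND _ _ (MZ b _ Mh') Mh''))); first by rewrite lee_fin.
  rewrite NZ// ge0_muleDr ?mule_ge0// ?lee_fin ?sqr_ge0// !muleA -!EFinM.
  by rewrite (_ : 2 * 2 = 4 :> R)// -natrM.
apply: (le_trans (leeD (step _ _ _ _ _ Mrf Mif Mrg) (step _ _ _ _ _ Mif Mrf Mig))).
rewrite /csqr; case: z => a b /=; rewrite sqrrN.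
move: (N0 (rep f)) (N0 (imp f)) (N0 (rep g)) (N0 (imp g)).
move: (N (rep f)) (N (imp f)) (N (rep g)) (N (imp g)) => x y s t x0 y0 s0 t0.
have a2 : 0 <= a ^+ 2 by pos.
have le1 (c : R) (w : \bar R) : (0 <= w)%E -> 0 <= c -> ((2 * c)%:E * w <= (4 * c)%:E * w)%E.
  by move=> w0 c0; apply: lee_wpmul2r => //; rewrite lee_fin ler_wpM2r// ler_nat.
apply: (@le_trans _ _ ((4 * a ^+ 2)%:E * x + ((4 * b ^+ 2)%:E * y + 4%:E * s) +
  ((4 * a ^+ 2)%:E * y + ((4 * b ^+ 2)%:E * x + 4%:E * t)))%E).
  by apply: leeD; apply: leeD2r; exact: le1.
have A0 : (0 <= (4 * a ^+ 2)%:E)%E by pos.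
have B0 : (0 <= (4 * b ^+ 2)%:E)%E by pos.
rewrite (ge0_muleDr _ s0 t0) mulrDr (EFinD (4 * a ^+ 2)) (ge0_muleDl _ A0 B0) !(ge0_muleDr _ x0 y0).
move: (4 * a ^+ 2)%:E (4 * b ^+ 2)%:E => A B.
apply: le_of_eq.
by rewrite addeACA (addeACA (B * y)%E) (addeC (B * y)%E) -[RHS]addeA.
Qed.

End complex_parts.

Section complex_L2.
Context {d} {T : measurableType d} {R : realType}.
Variables (mu : {measure set T -> \bar R}) (D : set T).
Hypothesis mD : measurable D.
Implicit Types f g : T -> R[i].

Lemma L2sqE f : measurable_fun D (rep f) -> measurable_fun D (imp f) ->
  L2sq mu D f = (rL2sq mu D (rep f) + rL2sq mu D (imp f))%E.
Proof.
move=> mr mi; rewrite /L2sq /csqr; under eq_integral => x _ do rewrite EFinD.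
rewrite ge0_integralD//.
- by pos.
- by meas.
- by pos.
- by meas.
Qed.

Lemma L2P f : L2 mu D f <-> rL2 mu D (rep f) /\ rL2 mu D (imp f).
Proof.
split=> [[mr mi]|[[mr lr] [mi li]]].
  rewrite L2sqE// => h; split; split=> //; apply: le_lt_trans h.
    by apply: leeDl; exact: rL2sq_ge0.
  by apply: leeDr; exact: rL2sq_ge0.
by split=> //; rewrite L2sqE// lte_add_pinfty.
Qed.

Lemma L2sq_ge0 f : (0 <= L2sq mu D f)%E.
Proof. by apply: integral_ge0 => x _; rewrite lee_fin csqr_ge0. Qed.

Lemma measurable_combination (a : R) (f g : T -> R) : measurable_fun D f -> measurable_fun D g ->
  measurable_fun D (fun x => a * f x + g x).
Proof. by meas. Qed.

Lemma L2sq_lin z f g : L2 mu D f -> L2 mu D g ->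
  (L2sq mu D (fun x => z * f x + g x)%R <= (4 * csqr z)%:E * L2sq mu D f + 4%:E * L2sq mu D g)%E.
Proof.
move=> /L2P[[rf _] [jf _]] /L2P[[rg _] [jg _]]; rewrite !L2sqE//; last 2 first.
- by rewrite rep_lin; do 2 apply: measurable_combination => //.
- by rewrite imp_lin; do 2 apply: measurable_combination => //.
apply: (@complex_quadratic _ _ [set h | measurable_fun D h] (rL2sq mu D)) => //.
- exact: rL2sq_ge0.
- exact: measurable_combination.
- by move=> h k mh mk; exact: rL2sqD.
- by move=> a h mh; exact: rL2sqZ.
- by meas.
Qed.

Lemma L2_lin z f g : L2 mu D f -> L2 mu D g -> L2 mu D (fun x => z * f x + g x).
Proof.
move=> /L2P[rf jf] /L2P[rg jg]; apply/L2P; rewrite rep_lin imp_lin.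
by split; apply: rL2D => //; [exact: rL2Z|apply: rL2D => //; exact: rL2Z|exact: rL2Z|apply: rL2D => //; exact: rL2Z].
Qed.

Lemma L2sq_fin f : L2 mu D f -> L2sq mu D f \is a fin_num.
Proof. by case=> _ _ l; rewrite ge0_fin_numE// L2sq_ge0. Qed.

Lemma rL2sq_ae (f g : T -> R) : measurable_fun D f -> measurable_fun D g ->
  f = g %[ae mu in D] -> rL2sq mu D f = rL2sq mu D g.
Proof.
move=> mf mg fg; apply: ae_eq_integral => //; try exact: measurable_sqr.
by apply: filterS fg => x h Dx; rewrite h.
Qed.

End complex_L2.

Section complex_gagliardo.
Context {R : realType} {m : nat}.
Local Notation V' := 'rV[R]_m.+1.
Local Notation leb' := (rV_lebesgue R m.+1).

Lemma real_gagliardoD (f g : V' -> R) : mfunT f -> mfunT g ->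
  (real_gagliardo (fun x => f x + g x)%R <= 2%:E * real_gagliardo f + 2%:E * real_gagliardo g)%E.
Proof.
move=> mf mg; have mfg : mfunT (fun x => f x + g x) by exact: measurable_funD.
have mk (h : V' -> R) : mfunT h -> mfunT (fun p => 2%:E * increment_kernel h p)%E.
  by move=> mh; apply: measurable_funeM; exact: measurable_increment_kernel.
have k0 (h : V' -> R) p : (0 <= 2%:E * increment_kernel h p)%E.
  by rewrite mule_ge0// increment_kernel_ge0.
rewrite !real_gagliardo_prod// -!ge0_integralZl//; try exact: measurable_increment_kernel;
  try by move=> *; exact: increment_kernel_ge0.
rewrite -ge0_integralD//; try exact: mk; try by move=> *; exact: k0.
apply: ge0_le_integral => //.
- by move=> *; exact: increment_kernel_ge0.
- exact: measurable_increment_kernel.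
- by apply: emeasurable_funD; exact: mk.
move=> p _; rewrite /increment_kernel -!EFinM -EFinD lee_fin !mulrA -mulrDl.
apply: ler_wpM2r; first by rewrite invr_ge0 exprn_ge0// sqrtr_ge0.
move: (f p.1) (f p.2) (g p.1) (g p.2) => a b c e; rewrite -subr_ge0.
rewrite (_ : _ - _ = ((a - b) - (c - e)) ^+ 2); last by ring.
by pos.
Qed.

Lemma real_gagliardoZ (a : R) (f : V' -> R) : mfunT f ->
  real_gagliardo (fun x => a * f x) = ((a ^+ 2)%:E * real_gagliardo f)%E.
Proof.
move=> mf; have mk := measurable_increment_kernel mf.
rewrite !real_gagliardo_prod//; last exact: measurable_funM.
rewrite -ge0_integralZl_EFin ?sqr_ge0//; last by move=> *; exact: increment_kernel_ge0.
apply: eq_integral => p _; rewrite /increment_kernel -EFinM; congr EFin.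
by rewrite -mulrBr exprMn -mulrA.
Qed.

Lemma gagliardoE (f : V' -> R[i]) : mfunT (rep f) -> mfunT (imp f) ->
  gagliardo f = (real_gagliardo (rep f) + real_gagliardo (imp f))%E.
Proof.
move=> mr mi; rewrite !real_gagliardo_prod// -ge0_integralD//;
  try exact: measurable_increment_kernel; try by move=> *; exact: increment_kernel_ge0.
rewrite (@fubini_tonelli1 _ _ _ _ _ leb' leb'); last 2 first.
- by apply: emeasurable_funD; exact: measurable_increment_kernel.
- by move=> p; rewrite adde_ge0// increment_kernel_ge0.
apply: eq_integral => x _; apply: eq_integral => y _; rewrite /increment_kernel -EFinD; congr EFin.
rewrite -mulrDl; congr (_ / _); rewrite /csqr /rep /imp.
by case: (f x) => a b; case: (f y) => c e.
Qed.

End complex_gagliardo.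

Section complex_sobolev.
Context {R : realType} {n : nat} {Omega : set 'rV[R]_n}.
Hypotheses (oO : open Omega) (bO : bounded_set Omega).
Local Notation V := 'rV[R]_n.
Local Notation leb := (rV_lebesgue R n).
Implicit Types (u v f g : V -> R[i]).

Let mO : measurable Omega := open_measurable_rV oO.

Lemma weak_partialP j u g : weak_partial Omega j u g <->
  rweak Omega j (rep u) (rep g) /\ rweak Omega j (imp u) (imp g).
Proof.
have reE (phi : V -> R) f : (fun x => complex.Re ((phi x)%:C * f x)) = (fun x => phi x * rep f x).
  by apply/funext => x; rewrite /rep; case: (f x) => a b /=; rewrite mul0r subr0.
have imE (phi : V -> R) f : (fun x => complex.Im ((phi x)%:C * f x)) = (fun x => phi x * imp f x).
  by apply/funext => x; rewrite /imp; case: (f x) => a b /=; rewrite mul0r addr0.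
split=> [[/(L2P leb mO)[rg jg] H]|[[rg H1] [jg H2]]].
  by split; split=> // phi tphi; have := H phi tphi; rewrite /cintegral !reE !imE => -[].
split=> [|phi tphi]; first by apply/(L2P leb mO).
by rewrite /cintegral !reE !imE; apply: complex_eq; [exact: H1|exact: H2].
Qed.

Lemma H1_weak u j : H1 Omega u -> weak_partial Omega j u (wpartial Omega j u).
Proof. by move=> [_ /(_ j)[g wg]]; exact: (xgetPex 0 (ex_intro _ g wg)). Qed.

Lemma H1P u : H1 Omega u <-> exists G G', rgrad Omega (rep u) G /\ rgrad Omega (imp u) G'.
Proof.
split=> [Hu|[G [G' [[ru H] [ju H']]]]].
  exists (fun j => rep (wpartial Omega j u)), (fun j => imp (wpartial Omega j u)).
  have [/(L2P leb mO)[ru ju] _] := Hu.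
  by split; split=> // j; have /weak_partialP[] := H1_weak j Hu.
split=> [|j]; first by apply/(L2P leb mO).
by exists (cpx (G j) (G' j)); apply/weak_partialP.
Qed.

Lemma L2sq_ae f g : L2 leb Omega f -> L2 leb Omega g ->
  f = g %[ae leb in Omega] -> L2sq leb Omega f = L2sq leb Omega g.
Proof.
move=> /(L2P leb mO)[[rf _] [jf _]] /(L2P leb mO)[[rg _] [jg _]] fg.
rewrite !(L2sqE leb mO)//; congr (_ + _)%E; apply: (rL2sq_ae mO) => //.
  by apply: filterS fg => x h Ox; rewrite /rep h.
by apply: filterS fg => x h Ox; rewrite /imp h.
Qed.

Lemma weak_partial_unique j u g g' : weak_partial Omega j u g -> weak_partial Omega j u g' ->
  g = g' %[ae leb in Omega].
Proof.
move=> /weak_partialP[r1 i1] /weak_partialP[r2 i2].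
have h1 := rweak_unique oO r1 r2; have h2 := rweak_unique oO i1 i2.
by apply: filterS2 h1 h2 => x e1 e2 Ox; apply: complex_eq; [exact: e1|exact: e2].
Qed.

Lemma weak_partial_lin z j u g u' g' : L2 leb Omega u -> L2 leb Omega u' ->
  weak_partial Omega j u g -> weak_partial Omega j u' g' ->
  weak_partial Omega j (fun x => z * u x + u' x) (fun x => z * g x + g' x).
Proof.
move=> /(L2P leb mO)[ru ju] /(L2P leb mO)[ru' ju'] /weak_partialP[r1 i1] /weak_partialP[r2 i2].
apply/weak_partialP; rewrite !rep_lin !imp_lin.
split; apply: rweak_linear => //; try (apply: rL2D => //; exact: rL2Z); exact: rweak_linear.
Qed.

Lemma H1_lin z u u' : H1 Omega u -> H1 Omega u' -> H1 Omega (fun x => z * u x + u' x).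
Proof.
move=> Hu Hu'; have [Lu _] := Hu; have [Lu' _] := Hu'; split=> [|j]; first exact: L2_lin.
exists (fun x => z * wpartial Omega j u x + wpartial Omega j u' x).
by apply: weak_partial_lin => //; exact: H1_weak.
Qed.

Lemma wpartial_ae j u g : weak_partial Omega j u g ->
  {ae leb, forall x, Omega x -> wpartial Omega j u x = g x}.
Proof.
move=> wg; apply: (weak_partial_unique _ wg).
exact: (xgetPex 0 (ex_intro _ g wg)).
Qed.

Lemma L2sq_wpartial j u g : weak_partial Omega j u g ->
  L2sq leb Omega (wpartial Omega j u) = L2sq leb Omega g.
Proof.
move=> wg; apply: L2sq_ae (wpartial_ae wg); last by case: wg.
by have [] := xgetPex 0 (ex_intro _ g wg).
Qed.

Lemma wpartial_L2 j u : H1 Omega u -> L2 leb Omega (wpartial Omega j u).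
Proof. by move=> /(H1_weak j)[]. Qed.

Lemma H1sq_ge0 u : (0 <= H1sq Omega u)%E.
Proof. by rewrite adde_ge0 ?L2sq_ge0// sume_ge0// => j _; exact: L2sq_ge0. Qed.

Lemma H1sq_fin u : H1 Omega u -> H1sq Omega u \is a fin_num.
Proof.
move=> Hu; rewrite ge0_fin_numE ?H1sq_ge0// lte_add_pinfty//; first by case: Hu => -[].
by apply: lte_sum_pinfty => j _; have [[]] := H1_weak j Hu.
Qed.

Lemma H1sq_lin z u u' : H1 Omega u -> H1 Omega u' ->
  (H1sq Omega (fun x => z * u x + u' x)%R <= (4 * csqr z)%:E * H1sq Omega u + 4%:E * H1sq Omega u')%E.
Proof.
move=> Hu Hu'; have [Lu _] := Hu; have [Lu' _] := Hu'; rewrite /H1sq.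
have s0 v : (0 <= \sum_j L2sq leb Omega (wpartial Omega j v))%E by apply: sume_ge0 => j _; exact: L2sq_ge0.
rewrite !(ge0_muleDr _ (L2sq_ge0 _ _ _) (s0 _)) addeACA; apply: leeD; first exact: L2sq_lin.
rewrite !ge0_sume_distrr; try by move=> j _; exact: L2sq_ge0.
rewrite -big_split; apply: lee_sum => j _ /=.
rewrite (L2sq_wpartial (weak_partial_lin z Lu Lu' (H1_weak j Hu) (H1_weak j Hu'))).
by apply: L2sq_lin => //; exact: wpartial_L2.
Qed.

Lemma weak_partial_smooth j v : csmooth v ->
  weak_partial Omega j v (cpx (partial j (rep v)) (partial j (imp v))).
Proof. by move=> [sr si]; apply/weak_partialP; split; exact: rweak_smooth. Qed.

Lemma H1_smooth v : csmooth v -> H1 Omega v.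
Proof.
move=> sv; have [sr si] := sv; split=> [|j]; last first.
  by exists (cpx (partial j (rep v)) (partial j (imp v))); exact: weak_partial_smooth.
by apply/(L2P leb mO); split; exact: rL2_smooth.
Qed.

Lemma H1sqE u G G' : rgrad Omega (rep u) G -> rgrad Omega (imp u) G' ->
  H1sq Omega u = ((rL2sq leb Omega (rep u) + rL2sq leb Omega (imp u)) +
    \sum_j (rL2sq leb Omega (G j) + rL2sq leb Omega (G' j)))%E.
Proof.
move=> [[mr _] H] [[mi _] H']; rewrite /H1sq (L2sqE leb mO)//; congr (_ + _)%E.
apply: eq_bigr => j _.
have w : weak_partial Omega j u (cpx (G j) (G' j)) by apply/weak_partialP.
rewrite (L2sq_wpartial w) (L2sqE leb mO)//.
  by have [[]] := H j.
by have [[]] := H' j.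
Qed.

End complex_sobolev.

Lemma cvg0_ereal (R : realType) (f : nat -> \bar R) : (forall l, (0 <= f l)%E) ->
  (f l @[l --> \oo] --> 0%E <-> forall e : R, 0 < e -> exists N, forall l, (N <= l)%N -> (f l <= e%:E)%E).
Proof.
move=> f0; split=> [/fine_cvgP[[N1 _ h1] /cvgrPdist_le h2] e e0|H].
  have [N2 _ hN2] := h2 e e0; exists (maxn N1 N2) => l; rewrite geq_max => /andP[l1 l2].
  have := hN2 l l2; rewrite /= sub0r normrN ger0_norm ?fine_ge0// -lee_fin fineK//.
  exact: h1.
have fin l : (exists e : R, f l <= e%:E)%E -> f l \is a fin_num.
  by move=> [e le]; rewrite ge0_fin_numE//; apply: (le_lt_trans le); rewrite ltry.
apply/fine_cvgP; split.
  have [N hN] := H 1 ltr01; exists N => // l Nl; apply: fin; exists 1; exact: hN.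
apply/cvgrPdist_le => e e0; have [N hN] := H e e0; exists N => // l Nl.
rewrite /= sub0r normrN ger0_norm ?fine_ge0// -lee_fin fineK ?hN//.
by apply: fin; exists e; exact: hN.
Qed.

Section ereal_arithmetic.
Context {R : realType}.
Local Open Scope ereal_scope.
Implicit Types (x y : \bar R) (a b : R).

Lemma combination_lty a b x y : (0 <= a)%R -> (0 <= b)%R -> x < +oo -> y < +oo ->
  a%:E * x + b%:E * y < +oo.
Proof. by move=> a0 b0 xo yo; rewrite lte_add_pinfty// lte_mul_pinfty. Qed.

Lemma quadratic_add x y x1 y1 x2 y2 : 0 <= x1 -> 0 <= y1 -> 0 <= x2 -> 0 <= y2 ->
  x <= 2%:E * x1 + 2%:E * x2 -> y <= 2%:E * y1 + 2%:E * y2 ->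
  x + y <= 2%:E * (x1 + y1) + 2%:E * (x2 + y2).
Proof.
by move=> x10 y10 x20 y20 hx hy; rewrite !ge0_muleDr// addeACA; exact: leeD.
Qed.

Lemma sume_const_scale (N : nat) a x : (0 <= a)%R ->
  \sum_(k < N) a%:E * x = (N%:R * a)%:E * x.
Proof.
by move=> a0; rewrite -ge0_sume_distrl// sumEFin sumr_const card_ord mulr_natl.
Qed.

End ereal_arithmetic.

(** * The Dirichlet trace *)

Lemma uniform_rank (I : finType) (Q : I -> nat -> Prop) :
  (forall k, exists N, forall l, (N <= l)%N -> Q k l) ->
  exists N, forall k l, (N <= l)%N -> Q k l.
Proof.
move=> /choice[N_ hN]; exists (\max_k N_ k) => k l Nl; apply: hN.
by apply: leq_trans Nl; exact: leq_bigmax.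
Qed.

Lemma combination_add (R : realType) (a b : R) (x1 y1 x2 y2 : \bar R) :
  (0 <= x1)%E -> (0 <= x2)%E -> (0 <= y1)%E -> (0 <= y2)%E ->
  (a%:E * x1 + b%:E * y1 + (a%:E * x2 + b%:E * y2) = a%:E * (x1 + x2) + b%:E * (y1 + y2))%E.
Proof. by move=> x10 x20 y10 y20; rewrite !ge0_muleDr// addeACA. Qed.

Lemma rgradB {R : realType} {n : nat} {Omega : set 'rV[R]_n} v G' u G :
  open Omega -> rgrad Omega v G' -> rgrad Omega u G ->
  rgrad Omega (fun x => v x - u x) (fun j x => G' j x - G j x).
Proof.
move=> oO [vL wG'] [uL wG].
have E (f g : 'rV[R]_n -> R) : (fun x => f x - g x) = (fun x => (-1) * g x + f x).
  by apply/funext => x; rewrite mulN1r addrC.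
split=> [|j]; first by apply: rL2B => //; exact: open_measurable_rV.
by rewrite E (E (G' j)); exact: rweak_linear.
Qed.

Section complex_trace.
Context {R : realType} {m : nat} {Omega : set 'rV[R]_m.+2} {A : lipschitz_atlas Omega}.
Hypotheses (oO : open Omega) (bO : bounded_set Omega).
Variable P : partition_of_unity A.
Local Notation n := m.+2.
Local Notation V := 'rV[R]_n.
Local Notation V' := 'rV[R]_m.+1.
Local Notation leb := (rV_lebesgue R n).
Local Notation leb' := (rV_lebesgue R m.+1).
Local Notation omega := (surface_measure P).
Local Notation dO := (boundary Omega).
Implicit Types (u v f g : V -> R[i]) (k : 'I_(npatch A)).

Let mO : measurable Omega := open_measurable_rV oO.
Let mdO : measurable dO := measurable_boundary.

Definition cmeasurable f := measurable_fun dO (rep f) /\ measurable_fun dO (imp f).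

Lemma cmeasurable_lin z f g : cmeasurable f -> cmeasurable g -> cmeasurable (fun x => z * f x + g x).
Proof.
move=> [rf jf] [rg jg]; split; rewrite ?rep_lin ?imp_lin;
  by do 2 apply: measurable_combination => //.
Qed.

Lemma rep_localize k f : rep (localize P k f) = rloc P k (rep f).
Proof. by apply/funext => x; rewrite /rep /localize /rloc; case: (f _) => a b /=; rewrite mul0r subr0. Qed.

Lemma imp_localize k f : imp (localize P k f) = rloc P k (imp f).
Proof. by apply/funext => x; rewrite /imp /localize /rloc; case: (f _) => a b /=; rewrite mul0r addr0. Qed.

Definition real_Hhalf_sq (h : V -> R) : \bar R :=
  (\sum_k (rL2sq leb' setT (rloc P k h) + real_gagliardo (rloc P k h)))%E.

Lemma real_Hhalf_sq_ge0 h : (0 <= real_Hhalf_sq h)%E.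
Proof. by apply: sume_ge0 => k _; rewrite adde_ge0 ?rL2sq_ge0// real_gagliardo_ge0. Qed.

Lemma Hhalf_sqE f : cmeasurable f ->
  Hhalf_sq P f = (real_Hhalf_sq (rep f) + real_Hhalf_sq (imp f))%E.
Proof.
move=> [mr mi]; rewrite /Hhalf_sq /real_Hhalf_sq -big_split; apply: eq_bigr => k _.
have m1 : mfunT (rep (localize P k f)) by rewrite rep_localize; exact: measurable_rloc.
have m2 : mfunT (imp (localize P k f)) by rewrite imp_localize; exact: measurable_rloc.
have E : Hhalf_rV_sq (localize P k f) =
    ((rL2sq leb' setT (rep (localize P k f)) + rL2sq leb' setT (imp (localize P k f))) +
     (real_gagliardo (rep (localize P k f)) + real_gagliardo (imp (localize P k f))))%E.
  by congr (_ + _)%E; [exact: (@L2sqE _ _ _ leb' setT measurableT _ m1 m2)|exact: gagliardoE].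
by rewrite E rep_localize imp_localize; exact: addeACA.
Qed.

Lemma Hhalf_sq_ge0 f : (0 <= Hhalf_sq P f)%E.
Proof.
apply: sume_ge0 => k _; rewrite adde_ge0 ?L2sq_ge0//.
apply: integral_ge0 => x _; apply: integral_ge0 => y _.
by rewrite lee_fin divr_ge0 ?csqr_ge0// exprn_ge0// sqrtr_ge0.
Qed.

Lemma Hhalf_sq_lin z f g : cmeasurable f -> cmeasurable g ->
  (Hhalf_sq P (fun x => z * f x + g x)%R <= (4 * csqr z)%:E * Hhalf_sq P f + 4%:E * Hhalf_sq P g)%E.
Proof.
move=> mf mg; rewrite !Hhalf_sqE//; last exact: cmeasurable_lin.
have [rf jf] := mf; have [rg jg] := mg.
apply: (@complex_quadratic _ _ [set h | measurable_fun dO h] real_Hhalf_sq) => //.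
- exact: real_Hhalf_sq_ge0.
- exact: measurable_combination.
- move=> h k mh mk; rewrite /real_Hhalf_sq.
  rewrite !ge0_sume_distrr; try by move=> i _; rewrite adde_ge0 ?rL2sq_ge0// real_gagliardo_ge0.
  rewrite -big_split; apply: lee_sum => i _.
  rewrite (_ : rloc P i (fun x => h x + k x) = (fun x => rloc P i h x + rloc P i k x)); last first.
    by apply/funext => x; rewrite /rloc mulrDr.
  have mh' := measurable_rloc P i mh; have mk' := measurable_rloc P i mk.
  by apply: quadratic_add; rewrite ?rL2sq_ge0 ?real_gagliardo_ge0//; [exact: rL2sqD|exact: real_gagliardoD].
- move=> a h mh; rewrite /real_Hhalf_sq ge0_sume_distrr; last first.
    by move=> i _; rewrite adde_ge0 ?rL2sq_ge0// real_gagliardo_ge0.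
  apply: eq_bigr => i _; rewrite ge0_muleDr ?rL2sq_ge0 ?real_gagliardo_ge0//.
  rewrite (_ : rloc P i (fun x => a * h x) = (fun x => a * rloc P i h x)); last first.
    by apply/funext => x; rewrite /rloc mulrCA.
  have mh' := measurable_rloc P i mh.
  by rewrite rL2sqZ// real_gagliardoZ.
- by meas.
Qed.

Lemma L2_cmeasurable f : L2 omega dO f -> cmeasurable f.
Proof. by case. Qed.

Lemma HhalfP f : Hhalf P f <-> L2 omega dO f /\ (Hhalf_sq P f < +oo)%E.
Proof.
split=> [[Lf H]|[Lf lf]]; split=> //.
  by apply: lte_sum_pinfty => k _; have [[_ _ l1] l2] := H k; exact: lte_add_pinfty.
move=> k; have [mr mi] := L2_cmeasurable Lf.
have : (Hhalf_rV_sq (localize P k f) < +oo)%E.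
  apply: le_lt_trans lf; rewrite /Hhalf_sq (bigD1 k)//= leeDl//.
  apply: sume_ge0 => i _; rewrite adde_ge0 ?L2sq_ge0//.
  apply: integral_ge0 => x _; apply: integral_ge0 => y _.
  by rewrite lee_fin divr_ge0 ?csqr_ge0// exprn_ge0// sqrtr_ge0.
have g0 : (0 <= gagliardo (localize P k f))%E.
  apply: integral_ge0 => x _; apply: integral_ge0 => y _.
  by rewrite lee_fin divr_ge0 ?csqr_ge0// exprn_ge0// sqrtr_ge0.
move=> lk; split; last by apply: le_lt_trans lk; rewrite leeDr// L2sq_ge0.
split; last by apply: le_lt_trans lk; rewrite leeDl.
  by rewrite -/(rep _) rep_localize; exact: measurable_rloc.
by rewrite -/(imp _) imp_localize; exact: measurable_rloc.
Qed.

Lemma Hhalf_lin z f g : Hhalf P f -> Hhalf P g -> Hhalf P (fun x => z * f x + g x).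
Proof.
move=> /HhalfP[Lf lf] /HhalfP[Lg lg]; apply/HhalfP; split; first exact: L2_lin.
apply: (le_lt_trans (Hhalf_sq_lin z (L2_cmeasurable Lf) (L2_cmeasurable Lg))).
by apply: combination_lty => //; rewrite mulr_ge0// csqr_ge0.
Qed.

Lemma smooth_Hhalf_sq_le : exists2 C : R, 0 <= C & forall v, csmooth v ->
  (Hhalf_sq P v <= C%:E * H1sq Omega v)%E.
Proof.
have [C C0 hC] := smooth_bound oO P; pose N : R := (npatch A)%:R.
exists (N * (2 * C)) => [|v [sr si]]; first by rewrite !mulr_ge0// ler0n.
have mc : cmeasurable v by split; exact: smooth_measurable.
pose E h := (dirichlet (Omega := Omega) h + rL2sq leb Omega h)%E.
have E0 h : (0 <= E h)%E by rewrite adde_ge0 ?rL2sq_ge0// dirichlet_ge0.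
have le1 h : smooth h -> (real_Hhalf_sq h <= (N * (2 * C))%:E * E h)%E.
  move=> sh; apply: (@le_trans _ _ (\sum_(k < npatch A) (2 * C)%:E * E h)%E).
    apply: lee_sum => k _; have [h1 h2] := hC k h sh.
    apply: (le_trans (leeD h1 h2)); rewrite -ge0_muleDl ?lee_fin// -EFinD.
    by rewrite (_ : C + C = 2 * C)//; ring.
  by rewrite sume_const_scale// mulr_ge0.
rewrite Hhalf_sqE//; apply: (le_trans (leeD (le1 _ sr) (le1 _ si))).
rewrite -ge0_muleDr//; apply: lee_wpmul2l; first by rewrite lee_fin !mulr_ge0// ler0n.
have gr : rgrad Omega (rep v) (fun j => partial j (rep v)).
  by split=> [|j]; [exact: (rL2_smooth mO bO sr)|exact: (rweak_smooth oO bO j sr)].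
have gi : rgrad Omega (imp v) (fun j => partial j (imp v)).
  by split=> [|j]; [exact: (rL2_smooth mO bO si)|exact: (rweak_smooth oO bO j si)].
by rewrite (H1sqE oO gr gi) /E addeACA addeC /dirichlet -big_split.
Qed.

Lemma csmooth_cmeasurable v : csmooth v -> cmeasurable v.
Proof. by case=> sr si; split; [exact: smooth_measurable sr|exact: smooth_measurable si]. Qed.

Lemma cfunB f g x : (f - g) x = f x - g x.
Proof. by []. Qed.

Lemma csqrN1 : csqr (-1 : R[i]) = 1.
Proof. by rewrite /csqr /= oppr0 expr0n addr0 sqrrN expr1n. Qed.

Lemma cmeasurableB f g : cmeasurable f -> cmeasurable g ->
  cmeasurable (f - g).
Proof. by move=> mf mg; rewrite subE; exact: cmeasurable_lin. Qed.

Lemma H1B u u' : H1 Omega u -> H1 Omega u' -> H1 Omega (u - u').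
Proof. by move=> Hu Hu'; rewrite subE; exact: H1_lin. Qed.

Lemma Hhalf_sq_near v f : cmeasurable v -> cmeasurable f ->
  (Hhalf_sq P f <= 4%:E * Hhalf_sq P (v - f)%R + 4%:E * Hhalf_sq P v)%E.
Proof.
move=> mv mf; have mvf := cmeasurableB mv mf.
have E : f = (fun x => (-1) * (v - f) x + v x).
  by apply/funext => x; rewrite [(v - f) x]/(v x - f x) mulN1r opprB subrK.
by have := Hhalf_sq_lin (-1) mvf mv; rewrite -E csqrN1 mulr1.
Qed.

Lemma H1sq_near v u : H1 Omega v -> H1 Omega u ->
  (H1sq Omega v <= 4%:E * H1sq Omega (v - u)%R + 4%:E * H1sq Omega u)%E.
Proof.
move=> Hv Hu; have Hvu := H1B Hv Hu.
have E : v = (fun x => 1 * (v - u) x + u x).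
  by apply/funext => x; rewrite [(v - u) x]/(v x - u x) mul1r subrK.
have := H1sq_lin oO 1 Hvu Hu; rewrite -E (_ : csqr 1 = 1) ?mulr1//.
by rewrite /csqr /= expr0n expr1n addr0.
Qed.

Lemma Hhalf_cmeasurable g : Hhalf P g -> cmeasurable g.
Proof. by case=> /L2_cmeasurable. Qed.

(** The bound for smooth functions is transported along the sequence that defines the trace. Each
    passage to the limit costs the factor 4 of the squared triangle inequality, hence [16 C]. *)
Lemma trace_bound : exists2 C : R, 0 <= C & forall u g, dirichlet_trace P u g ->
  (Hhalf_sq P g <= C%:E * H1sq Omega u)%E.
Proof.
have [C C0 hC] := smooth_Hhalf_sq_le.
exists (16 * C) => [|u g [Hu Hg [v_ [sv c1 c2]]]]; first by rewrite mulr_ge0.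
have mg := Hhalf_cmeasurable Hg.
have {}c1 := (cvg0_ereal (fun l => H1sq_ge0 (v_ l - u))).1 c1.
have {}c2 := (cvg0_ereal (fun l => Hhalf_sq_ge0 (v_ l - g))).1 c2.
apply/lee_addgt0Pr => e e0; pose d := e / (4 + 16 * C).
have q0 : 0 < 4 + 16 * C by rewrite ltr_pwDl// mulr_ge0.
have d0 : 0 < d by rewrite divr_gt0.
have [N1 h1] := c1 d d0; have [N2 h2] := c2 d d0.
pose l := maxn N1 N2.
have {}h1 := h1 l (leq_maxl _ _); have {}h2 := h2 l (leq_maxr _ _).
have Hv := H1_smooth oO bO (sv l).
apply: (le_trans (Hhalf_sq_near (csmooth_cmeasurable (sv l)) mg)).
apply: (@le_trans _ _ (4%:E * d%:E + 4%:E * (C%:E * (4%:E * d%:E + 4%:E * H1sq Omega u)))%E).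
  apply: leeD; first exact: lee_wpmul2l.
  apply: lee_wpmul2l => //; apply: (le_trans (hC _ (sv l))).
  apply: lee_wpmul2l; first by rewrite lee_fin.
  by apply: (le_trans (H1sq_near Hv Hu)); apply: leeD2r; exact: lee_wpmul2l.
have X0 := H1sq_ge0 (Omega := Omega) u; move: X0; move: (H1sq _ _) => X X0.
rewrite (ge0_muleDr C%:E) ?mule_ge0 ?lee_fin ?(ltW d0)// (ge0_muleDr 4%:E); last 2 first.
- by pos.
- by pos.
rewrite !muleA -!EFinM addeA -EFinD addeC; apply: leeD.
  by apply: lee_wpmul2r => //; rewrite lee_fin (_ : 4 * C * 4 = 16 * C)//; ring.
rewrite lee_fin (_ : _ + _ = d * (4 + 16 * C)); last by ring.
by rewrite /d divfK// gt_eqF.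
Qed.

Lemma wpartial_H1sq_le u j : (L2sq leb Omega (wpartial Omega j u) <= H1sq Omega u)%E.
Proof.
apply: (@le_trans _ _ (\sum_j L2sq leb Omega (wpartial Omega j u))%E).
  by rewrite (bigD1 j)//= leeDl// sume_ge0// => i _; exact: L2sq_ge0.
by rewrite leeDr// L2sq_ge0.
Qed.

(** [part] is either real or imaginary part, so that the real estimates are prepared for both at
    once. *)
Lemma trace_real_cvg u g (v_ : nat -> V -> R[i]) (part : (V -> R[i]) -> V -> R) :
  part = rep \/ part = imp ->
  (forall l, csmooth (v_ l)) -> H1 Omega u -> cmeasurable g ->
  H1sq Omega (v_ l - u) @[l --> \oo] --> 0%E ->
  Hhalf_sq P (v_ l - g) @[l --> \oo] --> 0%E ->
  forall k, trace_cvg P k (part u) (fun j => part (wpartial Omega j u)) (part g) (fun l => part (v_ l)).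
Proof.
move=> hpart sv Hu mg c1 c2 k e e0.
have [N1 h1] := (cvg0_ereal (fun l => H1sq_ge0 (v_ l - u))).1 c1 e e0.
have [N2 h2] := (cvg0_ereal (fun l => Hhalf_sq_ge0 (v_ l - g))).1 c2 e e0.
exists (maxn N1 N2) => l; rewrite geq_max => /andP[l1 l2].
have {}h1 := h1 l l1; have {}h2 := h2 l l2.
have Hv := H1_smooth oO bO (sv l); have Hvu := H1B Hv Hu.
have partB f f' : part (f - f') = (fun x => part f x - part f' x).
  by case: hpart => ->; [exact: repB|exact: impB].
have le_part D (mD : measurable D) f : L2 leb D f -> (rL2sq leb D (part f) <= L2sq leb D f)%E.
  move=> Lf; have [[mr _] [mi _]] := (L2P leb mD f).1 Lf; rewrite (L2sqE leb mD)//.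
  by case: hpart => ->; [rewrite leeDl//; exact: rL2sq_ge0|rewrite leeDr//; exact: rL2sq_ge0].
have s0 w : (0 <= \sum_j L2sq leb Omega (wpartial Omega j w))%E by apply: sume_ge0 => j _; exact: L2sq_ge0.
split=> [|j|].
- rewrite -partB; apply: le_trans h1; apply: (@le_trans _ _ (L2sq leb Omega (v_ l - u)%R)).
    by apply: le_part => //; case: Hvu.
  by rewrite leeDl.
- apply: le_trans h1; apply: le_trans (wpartial_H1sq_le _ j).
  pose w : V -> R[i] := cpx (partial j (rep (v_ l))) (partial j (imp (v_ l))) - wpartial Omega j u.
  have ww : weak_partial Omega j (v_ l - u) w.
    have [Lu _] := Hu; have [Lv _] := Hv.
    rewrite /w !subE; apply: weak_partial_lin => //; first exact: H1_weak.
    exact: weak_partial_smooth.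
  rewrite (L2sq_wpartial oO ww); apply: le_trans (le_part _ mO w ww.1).
  rewrite /w partB; apply: le_of_eq.
  by case: hpart => ->.
- apply: le_trans h2; rewrite -partB.
  have mvg := cmeasurableB (csmooth_cmeasurable (sv l)) mg.
  rewrite (Hhalf_sqE mvg).
  have le1 (h : V -> R) : (rL2sq leb' setT (rloc P k h) <= real_Hhalf_sq h)%E.
    rewrite /real_Hhalf_sq (bigD1 k)//=.
    apply: (@le_trans _ _ (rL2sq leb' setT (rloc P k h) + real_gagliardo (rloc P k h))%E).
      by rewrite leeDl// real_gagliardo_ge0.
    by rewrite leeDl// sume_ge0// => i _; rewrite adde_ge0 ?rL2sq_ge0// real_gagliardo_ge0.
  apply: (le_trans (le1 _)).
  by case: hpart => ->; [rewrite leeDl// real_Hhalf_sq_ge0|rewrite leeDr// real_Hhalf_sq_ge0].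
Qed.

Lemma trace_surface_bound (eta : R) : 0 < eta -> exists2 C : R, 0 <= C &
  forall u g, dirichlet_trace P u g ->
  (L2sq omega dO g <= eta%:E * \sum_j L2sq leb Omega (wpartial Omega j u) + C%:E * L2sq leb Omega u)%E.
Proof.
move=> eta0; have [C C0 hC] := trace_surface_sq_le oO P eta0.
exists C => // u g [Hu Hg [v_ [sv c1 c2]]].
have mg := Hhalf_cmeasurable Hg; have [mgr mgi] := mg.
have Lu : L2 leb Omega u by case: Hu.
have Lw j := wpartial_L2 j Hu.
have [ru ju] := (L2P leb mO u).1 Lu.
have rw j : rL2 leb Omega (rep (wpartial Omega j u)) by have [] := (L2P leb mO _).1 (Lw j).
have jw j : rL2 leb Omega (imp (wpartial Omega j u)) by have [] := (L2P leb mO _).1 (Lw j).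
have h1 := hC _ _ _ _ (fun l => (sv l).1) ru rw mgr (trace_real_cvg (or_introl erefl) sv Hu mg c1 c2).
have h2 := hC _ _ _ _ (fun l => (sv l).2) ju jw mgi (trace_real_cvg (or_intror erefl) sv Hu mg c1 c2).
rewrite (L2sqE omega mdO)//; apply: (le_trans (leeD h1 h2)).
have -> : (\sum_j L2sq leb Omega (wpartial Omega j u) =
  \sum_j rL2sq leb Omega (rep (wpartial Omega j u)) + \sum_j rL2sq leb Omega (imp (wpartial Omega j u)))%E.
  rewrite -big_split; apply: eq_bigr => j _; rewrite (L2sqE leb mO)//.
    by case: (rw j).
  by case: (jw j).
rewrite (L2sqE leb mO)//; [|by case: ru|by case: ju].
by rewrite combination_add// ?rL2sq_ge0// sume_ge0// => j _; exact: rL2sq_ge0.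
Qed.

Lemma trace_lin z u g u' g' : dirichlet_trace P u g -> dirichlet_trace P u' g' ->
  dirichlet_trace P (fun x => z * u x + u' x) (fun x => z * g x + g' x).
Proof.
move=> [Hu Hg [v_ [sv c1 c2]]] [Hu' Hg' [v'_ [sv' c1' c2']]].
split; [exact: H1_lin|exact: Hhalf_lin|].
exists (fun l x => z * v_ l x + v'_ l x).
have E (a b a' b' : V -> R[i]) : (fun x => z * a x + a' x) - (fun x => z * b x + b' x) =
    (fun x => z * (a - b) x + (a' - b') x).
  by apply/funext => x; rewrite !cfunB opprD addrACA -mulrBr.
have lim (F F' H : nat -> \bar R) : (forall l, 0 <= F l)%E -> (forall l, 0 <= F' l)%E -> (forall l, 0 <= H l)%E ->
    (forall l, H l <= (4 * csqr z)%:E * F l + 4%:E * F' l)%E ->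
    F l @[l --> \oo] --> 0%E -> F' l @[l --> \oo] --> 0%E -> H l @[l --> \oo] --> 0%E.
  move=> F0 F'0 H0 HF /(cvg0_ereal F0) hF /(cvg0_ereal F'0) hF'; apply/(cvg0_ereal H0) => e e0.
  pose d := e / (4 * csqr z + 4); have q0 : 0 < 4 * csqr z + 4 by rewrite ltr_wpDl// mulr_ge0// csqr_ge0.
  have d0 : 0 < d by rewrite divr_gt0.
  have [N1 h1] := hF d d0; have [N2 h2] := hF' d d0.
  exists (maxn N1 N2) => l; rewrite geq_max => /andP[l1 l2]; apply: (le_trans (HF l)).
  have a0 : (0 <= (4 * csqr z)%:E)%E by rewrite lee_fin mulr_ge0// csqr_ge0.
  have b0 : (0 <= 4%:E :> \bar R)%E by pos.
  apply: (le_trans (leeD (lee_wpmul2l a0 (h1 l l1)) (lee_wpmul2l b0 (h2 l l2)))).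
  by rewrite -!EFinM -EFinD lee_fin -mulrDl mulrC /d divfK// gt_eqF.
split=> [l||].
- have [sr si] := sv l; have [sr' si'] := sv' l.
  split; rewrite -/(rep _) -/(imp _) ?rep_lin ?imp_lin.
    by apply: smoothD; [exact: (smoothZ _ sr)|apply: smoothD; [exact: (smoothZ _ si)|exact: sr']].
  by apply: smoothD; [exact: (smoothZ _ si)|apply: smoothD; [exact: (smoothZ _ sr)|exact: si']].
- apply: (lim _ _ _ _ _ _ _ c1 c1') => l; try exact: H1sq_ge0.
  rewrite E; apply: (H1sq_lin oO).
    by apply: H1B Hu; exact: H1_smooth.
  by apply: H1B Hu'; exact: H1_smooth.
- apply: (lim _ _ _ _ _ _ _ c2 c2') => l; try exact: Hhalf_sq_ge0.
  rewrite E; exact: (Hhalf_sq_lin z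
    (cmeasurableB (csmooth_cmeasurable (sv l)) (Hhalf_cmeasurable Hg))
    (cmeasurableB (csmooth_cmeasurable (sv' l)) (Hhalf_cmeasurable Hg'))).
Qed.

Lemma trace_exists u : H1 Omega u -> exists g, dirichlet_trace P u g.
Proof.
move=> Hu; have [G [G' [gr gi]]] := (H1P oO u).1 Hu.
have [gR [vR [sR mR LR cR hR]]] := real_trace_exists oO bO P gr.
have [gI [vI [sI mI LI cI hI]]] := real_trace_exists oO bO P gi.
pose g : V -> R[i] := cpx gR gI; pose v l : V -> R[i] := cpx (vR l) (vI l).
have sv l : csmooth (v l) by split; [exact: sR|exact: sI].
have mg : cmeasurable g by split; exact: measurable_funTS.
have Lg : L2 omega dO g by apply/(L2P omega mdO).
have real_lim (w g0 : V -> R) G0 (w_ : nat -> V -> R) (hc : forall k, trace_cvg P k w G0 g0 w_)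
    (hh : forall e : R, 0 < e -> exists N, forall l, (N <= l)%N ->
    [/\ (rL2sq leb Omega (fun x => (w_ l x - w x)%R) <= e%:E)%E,
       forall j, (rL2sq leb Omega (fun x => (partial j (w_ l) x - G0 j x)%R) <= e%:E)%E &
       forall k, (real_gagliardo (rloc P k (fun x => (w_ l x - g0 x)%R)) <= e%:E)%E]) (e : R) : 0 < e ->
    exists N, forall l, (N <= l)%N -> (real_Hhalf_sq (fun x => (w_ l x - g0 x)%R) <= ((npatch A)%:R * (2 * e))%:E)%E.
  move=> e0; have [|N1 h1] := @uniform_rank _ (fun k l =>
      (rL2sq leb' setT (rloc P k (fun x => (w_ l x - g0 x)%R)) <= e%:E)%E).
    by move=> k; have [N hN] := hc k e e0; exists N => l /hN[].
  have [N2 h2] := hh e e0; exists (maxn N1 N2) => l; rewrite geq_max => /andP[l1 l2].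
  apply: (@le_trans _ _ (\sum_(k < npatch A) (2 * e)%:E * 1)%E); last first.
    by rewrite sume_const_scale ?mule1// mulr_ge0// ltW.
  have [_ _ h3] := h2 l l2.
  apply: lee_sum => k _; apply: (le_trans (leeD (h1 k l l1) (h3 k))).
  by rewrite mule1 -EFinD lee_fin (_ : 2 * e = e + e)//; ring.
have c2 : Hhalf_sq P (v l - g) @[l --> \oo] --> 0%E.
  apply/(cvg0_ereal (fun l => Hhalf_sq_ge0 (v l - g))) => e e0.
  pose N : R := (npatch A)%:R + 1; have N0 : 0 < N by rewrite ltr_wpDl// ler0n.
  pose d := e / (4 * N); have d0 : 0 < d by rewrite divr_gt0// mulr_gt0.
  have [N1 h1] := real_lim _ _ _ _ cR hR d d0; have [N2 h2] := real_lim _ _ _ _ cI hI d d0.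
  exists (maxn N1 N2) => l; rewrite geq_max => /andP[l1 l2].
  rewrite (Hhalf_sqE (cmeasurableB (csmooth_cmeasurable (sv l)) mg)) repB impB.
  apply: (le_trans (leeD (h1 l l1) (h2 l l2))); rewrite -EFinD lee_fin /d.
  rewrite (_ : _ + _ = (npatch A)%:R / N * e); last by field; rewrite gt_eqF.
  by rewrite ler_piMl ?(ltW e0)// ler_pdivrMr// mul1r /N lerDl.
have c1 : H1sq Omega (v l - u) @[l --> \oo] --> 0%E.
  apply/(cvg0_ereal (fun l => H1sq_ge0 (v l - u))) => e e0.
  pose d := e / (2 + 2 * n%:R); have q0 : 0 < 2 + 2 * n%:R :> R by rewrite ltr_wpDr// mulr_ge0// ler0n.
  have d0 : 0 < d by rewrite divr_gt0.
  have [N1 h1] := hR d d0; have [N2 h2] := hI d d0.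
  exists (maxn N1 N2) => l; rewrite geq_max => /andP[l1 l2].
  have [a1 a2 _] := h1 l l1; have [b1 b2 _] := h2 l l2.
  have g1 : rgrad Omega (rep (v l - u)) (fun j x => partial j (vR l) x - G j x).
    rewrite repB; apply: rgradB => //; split=> [|j]; [exact: (rL2_smooth mO bO (sR l))|exact: (rweak_smooth oO bO j (sR l))].
  have g2 : rgrad Omega (imp (v l - u)) (fun j x => partial j (vI l) x - G' j x).
    rewrite impB; apply: rgradB => //; split=> [|j]; [exact: (rL2_smooth mO bO (sI l))|exact: (rweak_smooth oO bO j (sI l))].
  rewrite (H1sqE oO g1 g2) repB impB.
  apply: (@le_trans _ _ ((d%:E + d%:E) + \sum_(j < n) (2 * d)%:E * 1)%E).
    apply: leeD; first exact: leeD.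
    apply: lee_sum => j _; apply: (le_trans (leeD (a2 j) (b2 j))).
    by rewrite mule1 -EFinD lee_fin (_ : 2 * d = d + d)//; ring.
  have d2 : 0 <= 2 * d by pos.
  rewrite (sume_const_scale n 1%E d2) mule1 -!EFinD lee_fin.
  rewrite (_ : _ + _ = d * (2 + 2 * n%:R)); last by ring.
  by rewrite /d divfK// gt_eqF.
have Hg : Hhalf P g.
  apply/HhalfP; split=> //.
  have [N hN] := (cvg0_ereal (fun l => Hhalf_sq_ge0 (v l - g))).1 c2 1 ltr01.
  apply: (le_lt_trans (Hhalf_sq_near (csmooth_cmeasurable (sv N)) mg)).
  apply: combination_lty => //; first by apply: (le_lt_trans (hN N (leqnn _))); rewrite ltry.
  have [C C0 hC] := smooth_Hhalf_sq_le.
  apply: (le_lt_trans (hC _ (sv N))); rewrite lte_mul_pinfty ?lee_fin//.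
  by rewrite -ge0_fin_numE ?H1sq_ge0//; apply: H1sq_fin; exact: H1_smooth.
by exists g; split=> //; exists v.
Qed.

End complex_trace.

(** * The Hilbert space L^2 *)

Lemma csqr_eq0 (R : realType) (z : R[i]) : csqr z <= 0 -> z = 0.
Proof.
case: z => x y; rewrite /csqr /= => h; have /eqP : x ^+ 2 + y ^+ 2 = 0.
  by apply/eqP; rewrite eq_le h addr_ge0// sqr_ge0.
by rewrite paddr_eq0 ?sqr_ge0// !sqrf_eq0 => /andP[/eqP -> /eqP ->].
Qed.

Section complex_inner_product.
Context {d} {T : measurableType d} {R : realType}.
Variables (mu : {measure set T -> \bar R}) (D : set T).
Hypothesis mD : measurable D.
Implicit Types (f g h : T -> R[i]) (z : R[i]).

Lemma rip_linl a (f g h : T -> R) : rL2 mu D f -> rL2 mu D g -> rL2 mu D h ->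
  rip mu D (fun x => a * f x + g x) h = a * rip mu D f h + rip mu D g h.
Proof. by move=> Lf Lg Lh; exact: (semi_ip_linear (rL2_semi_ip mu mD)). Qed.

Lemma ripC (f g : T -> R) : rip mu D f g = rip mu D g f.
Proof. by rewrite /rip; under eq_Rintegral do rewrite mulrC. Qed.

Lemma ipE f g : L2 mu D f -> L2 mu D g -> ip mu D f g =
  (rip mu D (rep f) (rep g) + rip mu D (imp f) (imp g)) +i*
  (rip mu D (rep f) (imp g) - rip mu D (imp f) (rep g)).
Proof.
move=> /(L2P mu mD)[rf jf] /(L2P mu mD)[rg jg]; rewrite /ip /cintegral /rip.
have I1 := rL2_mul_integrable mD rf rg; have I2 := rL2_mul_integrable mD jf jg.
have I3 := rL2_mul_integrable mD rf jg; have I4 := rL2_mul_integrable mD jf rg.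
apply: complex_eq => /=.
  rewrite -RintegralD//; apply: eq_Rintegral => x _.
  by rewrite /rep /imp; case: (f x) => a b; case: (g x) => c e /=; ring.
rewrite -RintegralB//; apply: eq_Rintegral => x _.
by rewrite /rep /imp; case: (f x) => a b; case: (g x) => c e /=; ring.
Qed.

Lemma ipC f g : L2 mu D f -> L2 mu D g -> ip mu D f g = (ip mu D g f)^*.
Proof.
move=> Lf Lg; rewrite !ipE//; apply: complex_eq => /=.
  by rewrite (ripC (rep f)) (ripC (imp f)).
by rewrite (ripC (rep f)) (ripC (imp f)) opprB.
Qed.

Lemma ip_linr z f g h : L2 mu D f -> L2 mu D g -> L2 mu D h ->
  ip mu D h (fun x => z * f x + g x) = z * ip mu D h f + ip mu D h g.
Proof.
move=> Lf Lg Lh; rewrite !ipE//; last exact: L2_lin.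
have [rf jf] := (L2P mu mD f).1 Lf; have [rg jg] := (L2P mu mD g).1 Lg.
have [rh jh] := (L2P mu mD h).1 Lh.
have lin a b (p q s t : T -> R) : rL2 mu D p -> rL2 mu D q -> rL2 mu D s -> rL2 mu D t ->
    rip mu D t (fun x => a * p x + (b * q x + s x)) = a * rip mu D t p + (b * rip mu D t q + rip mu D t s).
  move=> Lp Lq Ls Lt; rewrite ripC rip_linl// ?rip_linl// ?(ripC p) ?(ripC q) ?(ripC s)//.
  by apply: rL2D => //; exact: rL2Z.
rewrite rep_lin imp_lin !lin//; case: z => a b; apply: complex_eq => /=; ring.
Qed.

Lemma ip_linl z f g h : L2 mu D f -> L2 mu D g -> L2 mu D h ->
  ip mu D (fun x => z * f x + g x) h = z^* * ip mu D f h + ip mu D g h.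
Proof.
move=> Lf Lg Lh; rewrite ipC//; last exact: L2_lin.
by rewrite ip_linr// (ipC Lf Lh) (ipC Lg Lh) rmorphD rmorphM.
Qed.

Lemma ip_sq f : L2 mu D f -> ip mu D f f = (fine (L2sq mu D f))%:C.
Proof.
move=> Lf; have [rf jf] := (L2P mu mD f).1 Lf; have [mr _] := rf; have [mi _] := jf.
rewrite ipE// L2sqE// (fineD (rL2_fin rf) (rL2_fin jf)).
by apply: complex_eq => //=; rewrite ripC subrr.
Qed.

Lemma ip_ae f f' g g' : L2 mu D f -> L2 mu D f' -> L2 mu D g -> L2 mu D g' ->
  f = f' %[ae mu in D] -> g = g' %[ae mu in D] ->
  ip mu D f g = ip mu D f' g'.
Proof.
move=> Lf Lf' Lg Lg' ff' gg'; rewrite !ipE//.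
have [[rf _] [jf _]] := (L2P mu mD f).1 Lf; have [[rg _] [jg _]] := (L2P mu mD g).1 Lg.
have [[rf' _] [jf' _]] := (L2P mu mD f').1 Lf'; have [[rg' _] [jg' _]] := (L2P mu mD g').1 Lg'.
have E (p p' q q' : T -> R) : measurable_fun D p -> measurable_fun D p' -> measurable_fun D q -> measurable_fun D q' ->
    p = p' %[ae mu in D] -> q = q' %[ae mu in D] ->
    rip mu D p q = rip mu D p' q'.
  move=> mp mp' mq mq' pp' qq'; rewrite /rip /Rintegral; congr fine.
  apply: ae_eq_integral => //; try (apply/measurable_EFinP; exact: measurable_funM).
  by apply: filterS2 pp' qq' => x h1 h2 Dx; rewrite h1// h2.
have rff : {ae mu, forall x, D x -> rep f x = rep f' x} by apply: filterS ff' => x h Dx; rewrite /rep h.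
have jff : {ae mu, forall x, D x -> imp f x = imp f' x} by apply: filterS ff' => x h Dx; rewrite /imp h.
have rgg : {ae mu, forall x, D x -> rep g x = rep g' x} by apply: filterS gg' => x h Dx; rewrite /rep h.
have jgg : {ae mu, forall x, D x -> imp g x = imp g' x} by apply: filterS gg' => x h Dx; rewrite /imp h.
by congr (_ +i* _); congr (_ + _); try congr (- _); exact: E.
Qed.

Lemma ip_eq0 f : L2 mu D f -> fine (L2sq mu D f) = 0 -> {ae mu, forall x, D x -> f x = 0}.
Proof.
move=> Lf f0; have [[mr _] [mi _]] := (L2P mu mD f).1 Lf.
have mc : measurable_fun D (fun x => (csqr (f x))%:E).
  by apply/measurable_EFinP; apply: measurable_funD; exact: measurable_funX.
have i0 : (\int[mu]_(x in D) `|(csqr (f x))%:E| = 0)%E.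
  transitivity (L2sq mu D f); last by rewrite -(fineK (L2sq_fin Lf)) f0.
  by apply: eq_integral => x _; rewrite gee0_abs// lee_fin csqr_ge0.
have /(ae_eq_integral_abs _ mD mc) ae0 := i0.
by apply: filterS ae0 => x h Dx; apply: csqr_eq0; case: (h Dx) => ->.
Qed.

Lemma ip_real (phi : T -> R) f :
  ip mu D (fun x => (phi x)%:C) f = cintegral mu D (fun x => (phi x)%:C * f x).
Proof.
by congr cintegral; apply/funext => x; congr (_ * _); apply: complex_eq => //=; rewrite oppr0.
Qed.

End complex_inner_product.

Section L2_quotient.
Context {d} {T : measurableType d} {R : realType}.
Variables (mu : {measure set T -> \bar R}) (D : set T).
Hypothesis mD : measurable D.
Local Notation F := (T -> R[i]).
Local Notation "f =ae g" := ({ae mu, forall x, D x -> (f : F) x = (g : F) x}) (at level 70).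
Implicit Types (f g h : F).

Definition ae_class f : set F := [set g | L2 mu D g /\ g =ae f].

Definition ae_repr f : F := xget 0 (ae_class f).

Lemma aeC f g : f =ae g -> g =ae f.
Proof. by apply: filterS => x h Dx; rewrite h. Qed.

Lemma ae_trans f g h : f =ae g -> g =ae h -> f =ae h.
Proof. by move=> fg gh; apply: filterS2 fg gh => x h1 h2 Dx; rewrite h1// h2. Qed.

Lemma ae_reprP f : L2 mu D f -> ae_class f (ae_repr f).
Proof. by move=> Lf; apply: (xgetPex 0); exists f; split=> //; exact: aeW. Qed.

Lemma ae_repr_eq f g : f =ae g -> ae_repr f = ae_repr g.
Proof.
move=> fg; rewrite /ae_repr (_ : ae_class f = ae_class g)//.
apply/seteqP; split=> h [Lh hf]; split=> //; first exact: ae_trans fg.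
exact: (ae_trans hf (aeC fg)).
Qed.

(* The elements of L^2 are canonical representatives of the classes of functions;
   the argument lets the vector space structure be inferred from the type. *)
Record L2_space (measurable_D : measurable D) := L2Space {
  L2_fun :> F ;
  L2_funP : L2 mu D L2_fun ;
  L2_funK : ae_repr L2_fun = L2_fun }.

Local Notation H := (L2_space mD).

Lemma L2_0 : L2 mu D 0.
Proof.
apply/(L2P mu mD); split; split; try exact: measurable_cst;
  by rewrite /rL2sq integral0_eq// => x _; rewrite expr0n.
Qed.

Lemma L2_space_eq (x y : H) : (x : F) =ae y -> x = y.
Proof.
case: x => f Lf fK; case: y => g Lg gK /= fg.
have E : f = g by rewrite -fK -gK; exact: ae_repr_eq.
by subst g; congr L2Space; exact: Prop_irrelevance.
Qed.

(** A total function, with the class of 0 as value outside [L^2]. Canonical representatives turn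
    equality almost everywhere into equality. *)
Definition L2_class f : H :=
  match pselect (L2 mu D f) with
  | left Lf => L2Space mD (ae_reprP Lf).1 (ae_repr_eq (ae_reprP Lf).2)
  | right _ => L2Space mD (ae_reprP L2_0).1 (ae_repr_eq (ae_reprP L2_0).2)
  end.

Lemma L2_classP f : L2 mu D f -> (L2_class f : F) =ae f.
Proof. by rewrite /L2_class; case: pselect => // Lf _; exact: (ae_reprP Lf).2. Qed.

Lemma L2_class_eq f g : L2 mu D f -> L2 mu D g -> f =ae g -> L2_class f = L2_class g.
Proof.
move=> Lf Lg fg; apply: L2_space_eq; apply: (ae_trans (L2_classP Lf)).
exact: (ae_trans fg (aeC (L2_classP Lg))).
Qed.

Lemma L2_classK (x : H) : L2_class x = x.
Proof. by apply: L2_space_eq; apply: L2_classP; exact: L2_funP. Qed.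

(** Sum, opposite and real multiples are all instances of this operation, so one identity almost
    everywhere underlies the vector space axioms. *)
Definition L2_comb (z : R[i]) (x y : H) : H := L2_class (fun t => z * x t + y t).

Lemma L2_combP z x y : (L2_comb z x y : F) =ae (fun t => z * x t + y t).
Proof. by apply: L2_classP; apply: L2_lin => //; exact: L2_funP. Qed.

Definition L2_zero : H := L2_class 0.
Definition L2_add (x y : H) := L2_comb 1 x y.
Definition L2_opp (x : H) := L2_comb (-1) x L2_zero.
Definition L2_scale (a : R) (x : H) := L2_comb a%:C x L2_zero.

Lemma L2_addP x y : (L2_add x y : F) =ae (fun t => x t + y t).
Proof. by apply: filterS (L2_combP 1 x y) => t h Dt; rewrite h// mul1r. Qed.

Lemma L2_zeroP : (L2_zero : F) =ae 0.
Proof. exact: L2_classP L2_0. Qed.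

Lemma L2_oppP x : (L2_opp x : F) =ae (fun t => - x t).
Proof.
by apply: filterS2 (L2_combP (-1) x L2_zero) L2_zeroP => t h1 h2 Dt; rewrite h1// h2// mulN1r addr0.
Qed.

Lemma L2_scaleP a x : (L2_scale a x : F) =ae (fun t => a%:C * x t).
Proof.
by apply: filterS2 (L2_combP a%:C x L2_zero) L2_zeroP => t h1 h2 Dt; rewrite h1// h2// addr0.
Qed.

HB.instance Definition _ := gen_eqMixin H.
HB.instance Definition _ := gen_choiceMixin H.

Let addA : associative L2_add.
Proof.
move=> x y z; apply: L2_space_eq.
have h1 := L2_addP x (L2_add y z); have h2 := L2_addP y z.
have h3 := L2_addP (L2_add x y) z; have h4 := L2_addP x y.
apply: filterS2 (filterI h1 h2) (filterI h3 h4) => t [e1 e2] [e3 e4] Dt.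
by rewrite (e1 Dt) (e2 Dt) (e3 Dt) (e4 Dt) addrA.
Qed.

Let addC : commutative L2_add.
Proof.
move=> x y; apply: L2_space_eq.
by apply: filterS2 (L2_addP x y) (L2_addP y x) => t e1 e2 Dt; rewrite (e1 Dt) (e2 Dt) addrC.
Qed.

Let add0 : left_id L2_zero L2_add.
Proof.
move=> x; apply: L2_space_eq.
by apply: filterS2 (L2_addP L2_zero x) L2_zeroP => t e1 e2 Dt; rewrite (e1 Dt) (e2 Dt) add0r.
Qed.

Let addN : left_inverse L2_zero L2_opp L2_add.
Proof.
move=> x; apply: L2_space_eq.
have h1 := L2_addP (L2_opp x) x; have h2 := L2_oppP x.
apply: filterS2 (filterI h1 h2) L2_zeroP => t [e1 e2] e3 Dt.
by rewrite (e1 Dt) (e2 Dt) (e3 Dt) addNr.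
Qed.

HB.instance Definition _ := GRing.isZmodule.Build H addA addC add0 addN.

Let scaleA a b (x : H) : L2_scale a (L2_scale b x) = L2_scale (a * b) x.
Proof.
apply: L2_space_eq; have h1 := L2_scaleP a (L2_scale b x); have h2 := L2_scaleP b x.
apply: filterS2 (filterI h1 h2) (L2_scaleP (a * b) x) => t [e1 e2] e3 Dt.
by rewrite (e1 Dt) (e2 Dt) (e3 Dt) rmorphM mulrA.
Qed.

Let scale1 : left_id 1 L2_scale.
Proof.
by move=> x; apply: L2_space_eq; apply: filterS (L2_scaleP 1 x) => t e1 Dt; rewrite (e1 Dt) mul1r.
Qed.

Let scaleDr : right_distributive L2_scale +%R.
Proof.
move=> a x y; change (L2_scale a (L2_add x y) = L2_add (L2_scale a x) (L2_scale a y)).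
apply: L2_space_eq; have h1 := L2_scaleP a (L2_add x y); have h2 := L2_addP x y.
have h3 := L2_addP (L2_scale a x) (L2_scale a y); have h4 := L2_scaleP a x; have h5 := L2_scaleP a y.
apply: filterS2 (filterI h1 h2) (filterI h3 (filterI h4 h5)) => t [e1 e2] [e3 [e4 e5]] Dt.
by etransitivity; [exact: (e1 Dt)|rewrite (e2 Dt) mulrDr; apply: esym; etransitivity;
  [exact: (e3 Dt)|congr (_ + _); [exact: (e4 Dt)|exact: (e5 Dt)]]].
Qed.

Let scaleDl x : {morph L2_scale^~ x : a b / a + b}.
Proof.
move=> a b; change (L2_scale (a + b) x = L2_add (L2_scale a x) (L2_scale b x)).
apply: L2_space_eq; have h1 := L2_scaleP (a + b) x.
have h3 := L2_addP (L2_scale a x) (L2_scale b x); have h4 := L2_scaleP a x; have h5 := L2_scaleP b x.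
apply: filterS2 h1 (filterI h3 (filterI h4 h5)) => t e1 [e3 [e4 e5]] Dt.
by etransitivity; [exact: (e1 Dt)|rewrite rmorphD mulrDl; apply: esym; etransitivity;
  [exact: (e3 Dt)|congr (_ + _); [exact: (e4 Dt)|exact: (e5 Dt)]]].
Qed.

HB.instance Definition _ := GRing.Zmodule_isLmodule.Build R H scaleA scale1 scaleDr scaleDl.

Definition L2_ip (x y : H) : R := complex.Re (ip mu D x y).

Lemma L2_combE a (x y : H) : ((a *: x + y : H) : F) =ae (fun t => a%:C * x t + y t).
Proof.
have h1 := L2_addP (L2_scale a x) y; have h2 := L2_scaleP a x.
by apply: filterS2 h1 h2 => t e1 e2 Dt; rewrite [LHS]e1// e2.
Qed.

Lemma L2_subE (x y : H) : ((x - y : H) : F) =ae (fun t => x t - y t).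
Proof.
have h1 := L2_addP x (L2_opp y); have h2 := L2_oppP y.
by apply: filterS2 h1 h2 => t e1 e2 Dt; rewrite [LHS]e1// e2.
Qed.

Lemma ae_refl f : f =ae f. Proof. exact: aeW. Qed.

Lemma L2_ip_class f g : L2 mu D f -> L2 mu D g ->
  L2_ip (L2_class f) (L2_class g) = complex.Re (ip mu D f g).
Proof.
by move=> Lf Lg; congr complex.Re; apply: ip_ae => //; try exact: L2_funP; exact: L2_classP.
Qed.

Lemma L2_semi_ip : semi_ip setT L2_ip.
Proof.
split=> //.
- move=> a x y z _ _ _; rewrite /L2_ip.
  have Lx := L2_funP x; have Ly := L2_funP y; have Lz := L2_funP z.
  rewrite (@ip_ae _ _ _ mu D mD _ (fun t => a%:C * x t + y t) _ z) ?ip_linl//.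
  + by case: (ip mu D x z) => p q; case: (ip mu D y z) => p' q' /=; ring.
  + exact: L2_funP.
  + exact: L2_lin.
  + exact: L2_combE.
  + exact: ae_refl.
- by move=> x y _ _; rewrite /L2_ip (ipC mD (L2_funP x) (L2_funP y)); case: (ip _ _ _ _).
- move=> x _; rewrite /L2_ip (ip_sq mD (L2_funP x))/=.
  by rewrite fine_ge0// L2sq_ge0.
Qed.

Lemma L2_ip_def (x : H) : L2_ip x x = 0 -> x = 0.
Proof.
rewrite /L2_ip (ip_sq mD (L2_funP x))/= => x0.
apply: L2_space_eq; have h := ip_eq0 mD (L2_funP x) x0.
by apply: filterS2 h L2_zeroP => t e1 e2 Dt; rewrite e1// [RHS]e2.
Qed.

Lemma L2_ip_sub (x y : H) : L2_ip (x - y) (x - y) = fine (L2sq mu D ((x : F) - (y : F))).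
Proof.
have Lxy : L2 mu D ((x : F) - (y : F)) by rewrite subE; apply: L2_lin => //; exact: L2_funP.
rewrite /L2_ip (@ip_ae _ _ _ mu D mD _ ((x : F) - (y : F)) _ ((x : F) - (y : F))) ?ip_sq//; [exact: L2_funP|exact: L2_funP|exact: L2_subE|exact: L2_subE].
Qed.

Lemma L2_ip_complete : semi_complete setT L2_ip.
Proof.
move=> x_ _ cx.
have part (p : F -> T -> R) : p = @rep R T \/ p = @imp R T ->
    exists2 f, rL2 mu D f & vanishing (fun m => rip mu D (fun t => p (x_ m) t - f t) (fun t => p (x_ m) t - f t)).
  move=> hp; have Lp m : rL2 mu D (p (x_ m)).
    by have [h1 h2] := (L2P mu mD _).1 (L2_funP (x_ m)); case: hp => ->.
  apply: (rL2_semi_complete mD Lp) => e e0; have [N hN] := cx e e0; exists N => m k Nm Nk.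
  apply: le_lt_trans (hN m k Nm Nk); rewrite L2_ip_sub.
  have Ls : L2 mu D ((x_ m : F) - (x_ k : F)) by rewrite subE; apply: L2_lin => //; exact: L2_funP.
  have [h1 h2] := (L2P mu mD _).1 Ls.
  have := ip_sq mD Ls; rewrite ipE// => -[<- _].
  have ge0 (f : T -> R) : rL2 mu D f -> 0 <= rip mu D f f by exact: (semi_ip_ge0 (rL2_semi_ip mu mD)).
  case: hp => ->.
    by rewrite repB in h1 *; rewrite lerDl; exact: ge0.
  by rewrite impB in h2 *; rewrite lerDr; exact: ge0.
have [f Lf fc] := part _ (or_introl erefl); have [g Lg gc] := part _ (or_intror erefl).
have Lfg : L2 mu D (cpx f g) by apply/(L2P mu mD).
exists (L2_class (cpx f g)) => //.
apply: vanishing_le (vanishingD fc gc) => m; rewrite L2_ip_sub.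
have Ls : L2 mu D ((x_ m : F) - cpx f g) by rewrite subE; apply: L2_lin => //; exact: L2_funP.
have Ls' : L2 mu D ((x_ m : F) - (L2_class (cpx f g) : F)) by rewrite subE; apply: L2_lin => //; exact: L2_funP.
have := ip_sq mD Ls'; rewrite (@ip_ae _ _ _ mu D mD _ ((x_ m : F) - cpx f g) _ ((x_ m : F) - cpx f g))//; last 2 first.
- by apply: filterS (L2_classP Lfg) => t h Dt; rewrite [LHS]/(x_ m t - _) h.
- by apply: filterS (L2_classP Lfg) => t h Dt; rewrite [LHS]/(x_ m t - _) h.
by rewrite ipE// repB impB => -[<- _].
Qed.

Definition L2_hilbert : hilbert R := Hilbert L2_semi_ip L2_ip_def L2_ip_complete.

Definition L2_J (x : H) : H := L2_class (fun t => (0 +i* 1) * x t).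

Lemma L2_i f : L2 mu D f -> L2 mu D (fun t => (0 +i* 1) * f t).
Proof.
move=> Lf; have := @L2_lin _ _ _ mu D mD (0 +i* 1) f 0 Lf L2_0.
by congr (L2 mu D); apply/funext => t; rewrite addr0.
Qed.

Lemma L2_JP x : (L2_J x : F) =ae (fun t => (0 +i* 1) * x t).
Proof. by apply: L2_classP; apply: L2_i; exact: L2_funP. Qed.

Lemma ip_il f g : L2 mu D f -> L2 mu D g -> ip mu D (fun t => (0 +i* 1) * f t) g = (0 -i* 1) * ip mu D f g.
Proof.
move=> Lf Lg; have := ip_linl mD (0 +i* 1) Lf L2_0 Lg.
have -> : (fun t => (0 +i* 1) * f t + (0 : F) t) = (fun t => (0 +i* 1) * f t).
  by apply/funext => t; rewrite addr0.
move=> ->; have := ip_linl mD (-1) L2_0 L2_0 Lg.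
have -> : (fun t => -1 * (0 : F) t + (0 : F) t) = 0 by apply/funext => t; rewrite addr0 mulr0.
rewrite rmorphN1 mulN1r addNr => ->.
by rewrite addr0.
Qed.

Lemma ip_ir f g : L2 mu D f -> L2 mu D g -> ip mu D f (fun t => (0 +i* 1) * g t) = (0 +i* 1) * ip mu D f g.
Proof.
move=> Lf Lg; rewrite (ipC mD Lf (L2_i Lg)) (ip_il Lg Lf) (ipC mD Lf Lg).
by case: (ip mu D g f) => a b; apply: complex_eq => /=; ring.
Qed.

Lemma L2_J_facts :
  [/\ forall x y : H, L2_J (x + y) = L2_J x + L2_J y, forall a (x : H), L2_J (a *: x) = a *: L2_J x,
      forall x y : H, L2_ip (L2_J x) (L2_J y) = L2_ip x y & forall x : H, L2_J (L2_J x) = - x].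
Proof.
split=> [x y|a x|x y|x].
- change (L2_J (L2_add x y) = L2_add (L2_J x) (L2_J y)); apply: L2_space_eq.
  have h1 := L2_JP (L2_add x y); have h2 := L2_addP x y.
  have h3 := L2_addP (L2_J x) (L2_J y); have h4 := L2_JP x; have h5 := L2_JP y.
  apply: filterS2 (filterI h1 h2) (filterI h3 (filterI h4 h5)) => t [e1 e2] [e3 [e4 e5]] Dt.
  by rewrite (e1 Dt) (e2 Dt) (e3 Dt) (e4 Dt) (e5 Dt) mulrDr.
- change (L2_J (L2_scale a x) = L2_scale a (L2_J x)); apply: L2_space_eq.
  have h1 := L2_JP (L2_scale a x); have h2 := L2_scaleP a x.
  have h3 := L2_scaleP a (L2_J x); have h4 := L2_JP x.
  apply: filterS2 (filterI h1 h2) (filterI h3 h4) => t [e1 e2] [e3 e4] Dt.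
  by rewrite (e1 Dt) (e2 Dt) (e3 Dt) (e4 Dt) mulrCA.
- have Lx := L2_funP x; have Ly := L2_funP y.
  rewrite /L2_J L2_ip_class; try exact: L2_i.
  rewrite (ip_il Lx (L2_i Ly)) (ip_ir Lx Ly) /L2_ip.
  by case: (ip mu D x y) => p q /=; ring.
- change (L2_J (L2_J x) = L2_opp x); apply: L2_space_eq.
  have h1 := L2_JP (L2_J x); have h2 := L2_JP x; have h3 := L2_oppP x.
  apply: filterS2 (filterI h1 h2) h3 => t [e1 e2] e3 Dt.
  rewrite (e1 Dt) (e2 Dt) (e3 Dt) mulrA; case: (x t) => p q; apply: complex_eq => /=; ring.
Qed.

End L2_quotient.

(** * Operators as graphs *)

Section operator_graphs.
Context {d} {T : measurableType d} {R : realType}.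
Variables (mu : {measure set T -> \bar R}) (D : set T).
Hypothesis mD : measurable D.
Local Notation F := (T -> R[i]).
Local Notation H := (L2_hilbert mu mD).
Local Notation J := (@L2_J _ _ _ mu D mD : H -> H).
Local Notation cls f := (@L2_class _ _ _ mu D mD f : H).
Local Notation fn := (@L2_fun _ _ _ mu D mD).
Implicit Types (G S : H -> H -> Prop) (f g : F).

(** The relation is pulled back along the class map, which makes the graph saturated under equality
    almost everywhere. *)
Definition L2_graph G : set (F * F) :=
  [set uw | [/\ L2 mu D uw.1, L2 mu D uw.2 & G (cls uw.1) (cls uw.2)]].

Lemma hip_re f g : L2 mu D f -> L2 mu D g -> hip (cls f : H) (cls g) = complex.Re (ip mu D f g).
Proof. by move=> Lf Lg; exact: L2_ip_class. Qed.

Lemma class_i f : L2 mu D f -> cls (fun t => (0 +i* 1) * f t) = J (cls f).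
Proof.
move=> Lf; apply: L2_class_eq; [exact: L2_i|exact: (L2_i mD (L2_funP _))|].
by apply: filterS (L2_classP mD Lf) => t h Dt; rewrite h.
Qed.

Lemma re_i (z : R[i]) : complex.Re ((0 +i* 1) * z) = - complex.Im z.
Proof. by case: z => a b /=; ring. Qed.

(** Real self-adjointness gives the real part of the adjoint identity. The imaginary part is the
    real part for the pair multiplied by [i], which lies in the graph by invariance under [J]. *)
Lemma graph_adjoint G : relation_sa G -> relation_invariant J G ->
  L2_graph G = adjoint mu D (L2_graph G).
Proof.
move=> sG iG; apply/seteqP; split=> -[v x] [Lv Lx Gvx].
  split=> // u w [Lu Lw Guw]; rewrite /= in Lv Lx Gvx Lu Lw Guw *.
  apply: complex_eq; first by rewrite -(hip_re Lv Lw) -(hip_re Lx Lu); exact: ((sG _ _).1 Gvx).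
  apply: oppr_inj; rewrite -(re_i (ip mu D v w)) -(re_i (ip mu D x u)) -(ip_ir mD Lv Lw) -(ip_ir mD Lx Lu).
  rewrite -(hip_re Lv (L2_i mD Lw)) -(hip_re Lx (L2_i mD Lu)) (class_i Lw) (class_i Lu).
  exact: ((sG _ _).1 Gvx _ _ (iG _ _ Guw)).
split=> //; rewrite /= in Lv Lx Gvx *.
apply/sG => u w Guw.
have Lu := L2_funP u; have Lw := L2_funP w.
have /(congr1 (@complex.Re R)) : ip mu D v w = ip mu D x u.
  by apply: Gvx; split=> //=; rewrite !L2_classK.
by rewrite -(hip_re Lv Lw) -(hip_re Lx Lu) (L2_classK u) (L2_classK w).
Qed.

Lemma graph_im0 G u w : relation_sa G -> relation_invariant J G -> L2_graph G (u, w) ->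
  complex.Im (ip mu D u w) = 0.
Proof.
move=> sG iG Guw; have h0 := Guw; rewrite (graph_adjoint sG iG) in h0.
case: h0 => Lu Lw /(_ u w Guw); rewrite (ipC mD Lw Lu); set z := ip mu D u w.
case: z => a b [] h.
by rewrite /=; move: h; lra.
Qed.

Lemma graph_nonneg G : relation_sa G -> relation_invariant J G -> relation_nonneg G ->
  nonnegative mu D (L2_graph G).
Proof.
move=> sG iG nG u w Guw; have im0 := graph_im0 sG iG Guw.
have [/= Lu Lw G'] := Guw; have := nG _ _ G'; rewrite hip_re// => re0.
by rewrite lecE im0 eqxx.
Qed.

Lemma graph_dense G : relation_sa G -> relation_dense G -> dense_in_L2 mu D (op_domain (L2_graph G)).
Proof.
move=> sG dG f Lf e e0.
have [||||m [w Gmw] lt] := @semi_dense _ _ setT _ (hip_semi H) [set m : H | exists w : H, G m w]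
    (hip_complete (h := H)) _ _ _ _ (cls f) e I e0.
- by [].
- by exists 0; exact: relation_sa0.
- by move=> a x y [wx Gx] [wy Gy]; exists (a *: wx + wy); exact: relation_sa_linear.
- by move=> u _ h; rewrite (dG u) ?hip0l// => v w Gvw; apply: h; exists w.
exists (fn m).
  by exists w; split; rewrite /= ?L2_classK//; exact: L2_funP.
have Lm := L2_funP m.
have Lfm : L2 mu D (f - (fn m)) by rewrite subE; exact: L2_lin.
have Lcm : L2 mu D ((fn (cls f)) - (fn m)) by rewrite subE; apply: L2_lin => //; exact: L2_funP.
rewrite -(fineK (L2sq_fin Lfm)) lte_fin.
have aefm : {ae mu, forall t, D t -> (f - (fn m)) t = ((fn (cls f)) - (fn m)) t}.
  by apply: filterS (L2_classP mD Lf) => t h Dt; rewrite [RHS]/(fn (cls f) t - _) h.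
have := ip_ae mD Lfm Lcm Lfm Lcm aefm aefm; rewrite !ip_sq// => -[->].
by rewrite -L2_ip_sub.
Qed.

Lemma graph_comp G S : then_apply (L2_graph G) (L2_graph S) = L2_graph (relation_comp G S).
Proof.
apply/seteqP; split=> -[u w] /=.
  by move=> [v [[/= Lu Lv Guv] [/= _ Lw Svw]]]; split=> //; exists (cls v).
move=> [/= Lu Lw [v [Guv Svw]]]; exists (fn v).
by split; split; rewrite /= ?L2_classK//; exact: L2_funP.
Qed.

Lemma graph_ext G S : (forall u w : H, G u w <-> S u w) -> L2_graph G = L2_graph S.
Proof. by move=> h; apply/seteqP; split=> -[u w] [/= Lu Lw /h]. Qed.

(** Any competing root [S'] is shown to come from a relation [r] on classes that is self-adjoint and
    nonnegative in the real sense. Uniqueness of roots of relations then identifies it with [S]. *)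
Lemma sqrt_graph G S : relation_sa S -> relation_nonneg S -> relation_dense S ->
  relation_invariant J S -> (forall u w : H, relation_comp S S u w <-> G u w) ->
  operator_sqrt mu D (L2_graph G) = L2_graph S.
Proof.
move=> sS nS dS iS SG.
have SGE : then_apply (L2_graph S) (L2_graph S) = L2_graph G.
  by rewrite graph_comp; exact: graph_ext.
rewrite /operator_sqrt; apply: xget_unique.
  split=> //; last exact: graph_nonneg.
  by split; [exact: graph_dense|exact: graph_adjoint].
move=> S' [[_ aS'] nS' S'G].
pose r (x w : H) := S' (fn x, fn w).
(* [S'] equals its adjoint, which is defined by inner products and so does not see null sets. *)
have sat u w : S' (u, w) <-> [/\ L2 mu D u, L2 mu D w & r (cls u) (cls w)].
  rewrite /r aS'; split=> [[/= Lu Lw h]|[Lu Lw [/= _ _ h]]].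
    split=> //; split; rewrite /=; try exact: L2_funP.
    move=> u' w' S'u'; have := S'u'; rewrite aS' => -[/= Lu' Lw' _].
    have := h _ _ S'u'.
    have aeU := aeC (L2_classP mD Lu); have aeW' := aeC (L2_classP mD Lw).
    have r1 : w' = w' %[ae mu in D] by exact: ae_refl.
    have r2 : u' = u' %[ae mu in D] by exact: ae_refl.
    by rewrite (ip_ae mD Lu (L2_funP _) Lw' Lw' aeU r1) (ip_ae mD Lw (L2_funP _) Lu' Lu' aeW' r2).
  split=> //= u' w' S'u'; have := S'u'; rewrite aS' => -[/= Lu' Lw' _].
  have := h _ _ S'u'.
  have aeU := aeC (L2_classP mD Lu); have aeW' := aeC (L2_classP mD Lw).
  have r1 : w' = w' %[ae mu in D] by exact: ae_refl.
  have r2 : u' = u' %[ae mu in D] by exact: ae_refl.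
  by rewrite (ip_ae mD Lu (L2_funP _) Lw' Lw' aeU r1) (ip_ae mD Lw (L2_funP _) Lu' Lu' aeW' r2).
have S'E : S' = L2_graph r by apply/seteqP; split=> -[u w]; [move/sat|move=> h; exact/sat].
(* An adjoint is closed under multiplication by [i]; this recovers the imaginary parts when [r] is
   shown to be self-adjoint. *)
have mulI u w : S' (u, w) -> S' ((fun t => (0 +i* 1) * u t), (fun t => (0 +i* 1) * w t)).
  move=> h; rewrite aS' in h; case: h => Lu Lw h'; rewrite /= in Lu Lw h'.
  rewrite aS'; split; [exact: (L2_i mD Lu)|exact: (L2_i mD Lw)|].
  move=> u' w' S'u'; have h := S'u'; rewrite aS' in h; case: h => Lu' Lw' _; rewrite /= in Lu' Lw' *.
  by rewrite (ip_il mD Lu Lw') (ip_il mD Lw Lu') (h' _ _ S'u').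
have sr : relation_sa r.
  move=> v x; split=> [rvx u w ruw|h].
    move: rvx; rewrite /r aS' => -[/= Lv Lx /(_ _ _ ruw)].
    by move=> e; rewrite [LHS]/(complex.Re _) e.
  rewrite /r aS'; split; try exact: L2_funP.
  move=> /= u w S'uw; have [Lu Lw ruw] := (sat u w).1 S'uw.
  have Lv := L2_funP v; have Lx := L2_funP x.
  apply: complex_eq.
    by have := h _ _ ruw; rewrite -{1}(L2_classK v) -{1}(L2_classK x) !hip_re.
  apply: oppr_inj; rewrite -(re_i (ip mu D v w)) -(re_i (ip mu D x u)) -(ip_ir mD Lv Lw) -(ip_ir mD Lx Lu).
  rewrite -(hip_re Lv (L2_i mD Lw)) -(hip_re Lx (L2_i mD Lu)) (L2_classK v) (L2_classK x).
  by apply: h; have [_ _] := (sat _ _).1 (mulI _ _ S'uw).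
have nr : relation_nonneg r.
  move=> u w ruw; have := nS' _ _ ruw; rewrite lecE => /andP[_].
  by [].
rewrite S'E; apply: graph_ext => u w.
apply: relation_root_unique => // {}u {}w; rewrite SG.
have -> : relation_comp r r u w <-> then_apply S' S' (fn u, fn w).
  rewrite S'E graph_comp; split=> [h|[/= _ _]]; last by rewrite !L2_classK.
  by split; rewrite /= ?L2_classK//; exact: L2_funP.
rewrite S'G; split=> [[/= _ _]|h]; first by rewrite !L2_classK.
by split; rewrite /= ?L2_classK//; exact: L2_funP.
Qed.

End operator_graphs.

(** * Completeness of H^1 *)

Lemma vanishing_sum (R : realType) (I : finType) (s : I -> nat -> R) :
  (forall i, vanishing (s i)) -> vanishing (fun l => \sum_i s i l).
Proof.
move=> h; elim: (index_enum I) => [|i r ih].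
  by move=> e e0; exists 0%N => l _; rewrite big_nil.
by apply: vanishing_le (vanishingD (h i) ih) => l; rewrite big_cons.
Qed.

Section L2_limits.
Context {d} {T : measurableType d} {R : realType}.
Variables (mu : {measure set T -> \bar R}) (D : set T).
Hypothesis mD : measurable D.
Local Notation F := (T -> R[i]).
Implicit Types f g p u : F.

Definition L2norm_sq f : R := fine (L2sq mu D f).

Lemma L2norm_sq_ge0 f : 0 <= L2norm_sq f.
Proof. by rewrite fine_ge0// L2sq_ge0. Qed.

Lemma L2norm_sqE f : L2 mu D f -> L2norm_sq f = complex.Re (ip mu D f f).
Proof. by move=> Lf; rewrite (ip_sq mD Lf). Qed.

Lemma L2_sub f g : L2 mu D f -> L2 mu D g -> L2 mu D (f - g).
Proof. by move=> Lf Lg; rewrite subE; exact: L2_lin. Qed.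

Lemma ip_Br p f g : L2 mu D p -> L2 mu D f -> L2 mu D g ->
  ip mu D p (f - g) = ip mu D p f - ip mu D p g.
Proof. by move=> Lp Lf Lg; rewrite subE ip_linr// mulN1r addrC. Qed.

Lemma ip_re_CS f g : L2 mu D f -> L2 mu D g ->
  complex.Re (ip mu D f g) ^+ 2 <= L2norm_sq f * L2norm_sq g.
Proof.
move=> Lf Lg; rewrite !L2norm_sqE// -(hip_re mD Lf Lg) -(hip_re mD Lf Lf) -(hip_re mD Lg Lg).
exact: hip_CS.
Qed.

(** The real inequality bounds the real part and, with [i g] in place of [g], the imaginary part;
    hence the factor 2, which is harmless in limits. *)
Lemma ip_CS f g : L2 mu D f -> L2 mu D g ->
  csqr (ip mu D f g) <= 2 * (L2norm_sq f * L2norm_sq g).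
Proof.
move=> Lf Lg; have Lig := L2_i mD Lg.
have h1 := ip_re_CS Lf Lg; have := ip_re_CS Lf Lig.
have -> : L2norm_sq (fun t => (0 +i* 1) * g t) = L2norm_sq g.
  by rewrite !L2norm_sqE// (ip_il mD Lg Lig) (ip_ir mD Lg Lg); case: (ip mu D g g) => x y /=; ring.
rewrite (ip_ir mD Lf Lg) re_i sqrrN => h2; rewrite /csqr; apply: le_trans (lerD h1 h2) _.
by rewrite mulr_natl mulr2n.
Qed.

(** Closedness of weak differentiation: with [p] a test function and [p'] its partial derivative,
    the defining identity survives limits in [L^2]. *)
Lemma ip_limit p p' (u_ g_ : nat -> F) u g : L2 mu D p -> L2 mu D p' ->
  (forall l, L2 mu D (u_ l)) -> (forall l, L2 mu D (g_ l)) -> L2 mu D u -> L2 mu D g ->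
  vanishing (fun l => L2norm_sq (u_ l - u)) -> vanishing (fun l => L2norm_sq (g_ l - g)) ->
  (forall l, ip mu D p (g_ l) = - ip mu D p' (u_ l)) -> ip mu D p g = - ip mu D p' u.
Proof.
move=> Lp Lp' Lu_ Lg_ Lu Lg hu hg E.
pose z := ip mu D p g + ip mu D p' u.
have zE l : - z = ip mu D p (g_ l - g) + ip mu D p' (u_ l - u).
  by rewrite !ip_Br// E /z opprD addrACA addNr add0r.
have b1 : 0 <= 4 * L2norm_sq p by rewrite mulr_ge0// L2norm_sq_ge0.
have b2 : 0 <= 4 * L2norm_sq p' by rewrite mulr_ge0// L2norm_sq_ge0.
have := vanishing_le0 (x := csqr z) (vanishingD (vanishingZ b1 hg) (vanishingZ b2 hu)) _.
have le l : csqr z <= 4 * L2norm_sq p * L2norm_sq (g_ l - g) + 4 * L2norm_sq p' * L2norm_sq (u_ l - u).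
  have -> : csqr z = csqr (- z) by rewrite /csqr; case: z {zE} => x y /=; rewrite !sqrrN.
  rewrite (zE l); have h1 := ip_CS Lp (L2_sub (Lg_ l) Lg); have h2 := ip_CS Lp' (L2_sub (Lu_ l) Lu).
  move: h1 h2; case: (ip mu D p _) => x y; case: (ip mu D p' _) => x' y'; rewrite /csqr /=.
  move: (L2norm_sq p) (L2norm_sq p') (L2norm_sq _) (L2norm_sq _) => s t s' t' h1 h2.
  have := sqr_ge0 (x - x'); have := sqr_ge0 (y - y'); move: h1 h2; nra.
move=> /(_ le) /csqr_eq0 z0.
by apply/eqP; rewrite -subr_eq0 opprK; apply/eqP.
Qed.

Lemma L2_complete (u_ : nat -> F) : (forall l, L2 mu D (u_ l)) ->
  (forall e : R, 0 < e -> exists N, forall l k, (N <= l)%N -> (N <= k)%N ->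
    L2norm_sq (u_ l - u_ k) < e) ->
  exists2 u, L2 mu D u & vanishing (fun l => L2norm_sq (u_ l - u)).
Proof.
move=> Lu cu.
have E f g : L2 mu D f -> L2 mu D g ->
    L2_ip (L2_class mu mD f - L2_class mu mD g) (L2_class mu mD f - L2_class mu mD g) = L2norm_sq (f - g).
  move=> Lf Lg; rewrite L2_ip_sub; set f' := L2_fun _; set g' := L2_fun _.
  have Lf' : L2 mu D f' by exact: L2_funP.
  have Lg' : L2 mu D g' by exact: L2_funP.
  have hae : {ae mu, forall x, D x -> (f' - g') x = (f - g) x}.
    apply: filterS2 (L2_classP mD Lf) (L2_classP mD Lg) => x h1 h2 Dx.
    by rewrite [LHS]/(f' x - g' x) /f' /g' (h1 Dx) (h2 Dx).
  have L1 := L2_sub Lf' Lg'; have L2' := L2_sub Lf Lg.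
  have := ip_ae mD L1 L2' L1 L2' hae hae; rewrite (ip_sq mD L1) (ip_sq mD L2') => -[e].
  exact: e.
have [|x _ hx] := @L2_ip_complete _ _ _ mu D mD (fun l => L2_class mu mD (u_ l)) (fun _ => I).
  by move=> e /cu[N hN]; exists N => l k Nl Nk; rewrite E//; exact: hN.
exists (L2_fun x); first exact: L2_funP.
apply: vanishing_le hx => l; rewrite -{2 3}(L2_classK x) E//.
exact: L2_funP.
Qed.

End L2_limits.

Section H1_complete.
Context {R : realType} {m : nat} {Omega : set 'rV[R]_m.+2}.
Hypotheses (oO : open Omega) (bO : bounded_set Omega).
Local Notation n := m.+2.
Local Notation V := 'rV[R]_n.
Local Notation leb := (rV_lebesgue R n).
Implicit Types (u v f g : V -> R[i]).
Local Notation N0 := (L2norm_sq leb Omega).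

Let mO : measurable Omega := open_measurable_rV oO.

Definition gradnorm_sq u : R := \sum_j N0 (wpartial Omega j u).

Lemma gradnorm_sq_ge0 u : 0 <= gradnorm_sq u.
Proof. by apply: sumr_ge0 => j _; exact: L2norm_sq_ge0. Qed.

Lemma fine_grad u : H1 Omega u ->
  (\sum_j L2sq leb Omega (wpartial Omega j u) = (gradnorm_sq u)%:E)%E.
Proof.
move=> Hu; rewrite /gradnorm_sq -sumEFin; apply: eq_bigr => j _.
by rewrite fineK//; apply: L2sq_fin; exact: wpartial_L2.
Qed.

Lemma fine_L2 u : H1 Omega u -> (L2sq leb Omega u = (N0 u)%:E)%E.
Proof. by case=> Lu _; rewrite fineK//; exact: L2sq_fin. Qed.

Lemma fine_H1 u : H1 Omega u -> H1sq Omega u = (N0 u + gradnorm_sq u)%:E.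
Proof. by move=> Hu; rewrite /H1sq (fine_grad Hu) (fine_L2 Hu). Qed.

Lemma weak_partial_ip j u g : L2 leb Omega u -> weak_partial Omega j u g <-> L2 leb Omega g /\
  forall phi, test_function Omega phi ->
    ip leb Omega (fun x => (phi x)%:C) g = - ip leb Omega (fun x => (partial j phi x)%:C) u.
Proof.
by move=> Lu; split=> -[Lg h]; split=> // phi tphi; have := h phi tphi; rewrite ?ip_real.
Qed.

Lemma test_L2 phi : test_function Omega phi -> L2 leb Omega (fun x => (phi x)%:C).
Proof.
move=> [sp _ _]; have [] := H1_smooth oO bO (v := fun x => (phi x)%:C) => //.
by split=> //; exact: smooth_cst.
Qed.

Lemma wpartialB_ae j u v : H1 Omega u -> H1 Omega v ->
  {ae leb, forall x, Omega x -> wpartial Omega j (u - v) x = (wpartial Omega j u - wpartial Omega j v) x}.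
Proof.
move=> Hu Hv; apply: (wpartial_ae oO); rewrite !subE.
by apply: weak_partial_lin => //; [case: Hv|case: Hu|exact: H1_weak|exact: H1_weak].
Qed.

Lemma L2norm_sq_ae f g : L2 leb Omega f -> L2 leb Omega g ->
  f = g %[ae leb in Omega] -> N0 f = N0 g.
Proof. by move=> Lf Lg fg; rewrite /L2norm_sq (L2sq_ae oO Lf Lg fg). Qed.

Lemma H1_complete (u_ : nat -> V -> R[i]) : (forall l, H1 Omega (u_ l)) ->
  (forall e : R, 0 < e -> exists N, forall l k, (N <= l)%N -> (N <= k)%N ->
    N0 (u_ l - u_ k) + gradnorm_sq (u_ l - u_ k) < e) ->
  exists2 u, H1 Omega u & vanishing (fun l => N0 (u_ l - u) + gradnorm_sq (u_ l - u)).
Proof.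
move=> Hu cu.
have Lu l : L2 leb Omega (u_ l) by case: (Hu l).
have [|u L2u uc] := L2_complete mO Lu.
  move=> e /cu[N hN]; exists N => l k Nl Nk; apply: le_lt_trans (hN l k Nl Nk).
  by rewrite lerDl gradnorm_sq_ge0.
have Lw j l := wpartial_L2 j (Hu l).
have /choice[g_ hg_] j : exists g, L2 leb Omega g /\ vanishing (fun l => N0 (wpartial Omega j (u_ l) - g)).
  have [|g Lg gc] := L2_complete mO (Lw j); last by exists g.
  move=> e /cu[N hN]; exists N => l k Nl Nk; apply: le_lt_trans (hN l k Nl Nk).
  rewrite -(L2norm_sq_ae (wpartial_L2 j (H1B oO (Hu l) (Hu k))) (L2_sub mO (Lw j l) (Lw j k)) (wpartialB_ae j (Hu l) (Hu k))).
  rewrite /gradnorm_sq (bigD1 j)//= addrCA lerDl addr_ge0 ?L2norm_sq_ge0//.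
  by apply: sumr_ge0 => i _; exact: L2norm_sq_ge0.
have wu j : weak_partial Omega j u (g_ j).
  have [Lg gc] := hg_ j; apply/weak_partial_ip => //; split=> // phi tphi.
  apply: (ip_limit mO (test_L2 tphi) (test_L2 (test_partial j tphi)) Lu (Lw j) L2u Lg uc gc) => l.
  by have [_] := (weak_partial_ip j (wpartial Omega j (u_ l)) (Lu l)).1 (H1_weak j (Hu l)); exact.
have H1u : H1 Omega u by split=> // j; exists (g_ j).
exists u => //.
have sumv := vanishing_sum (fun j => (hg_ j).2).
apply: vanishing_le (vanishingD uc sumv) => l; rewrite lerD2l /gradnorm_sq.
apply: ler_sum => j _; have Hl := H1B oO (Hu l) H1u.
apply: le_of_eq; apply: L2norm_sq_ae.
- exact: wpartial_L2.
- exact: (L2_sub mO (Lw j l) (hg_ j).1).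
apply: filterS2 (wpartialB_ae j (Hu l) H1u) (wpartial_ae oO (wu j)) => x h1 h2 Ox.
by rewrite (h1 Ox) [LHS]/(wpartial Omega j (u_ l) x - _) (h2 Ox).
Qed.

End H1_complete.

(** * The Robin Laplacian *)

Section robin_form.
Context {R : realType} {m : nat} {Omega : set 'rV[R]_m.+2} {A : lipschitz_atlas Omega}.
Hypotheses (oO : open Omega) (bO : bounded_set Omega).
Variable P : partition_of_unity A.
Local Notation n := m.+2.
Local Notation V := 'rV[R]_n.
Local Notation F := (V -> R[i]).
Local Notation leb := (rV_lebesgue R n).
Local Notation omega := (surface_measure P).
Local Notation dO := (boundary Omega).
Implicit Types (u v f g Phi : F) (z : R[i]).
Local Notation N0 := (L2norm_sq leb Omega).

Let mO : measurable Omega := open_measurable_rV oO.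
Let mdO : measurable dO := measurable_boundary.

Let csmooth_real (phi : V -> R) : smooth phi -> csmooth (fun x => (phi x)%:C).
Proof. by move=> sp; split; [exact: sp|exact: smooth_cst]. Qed.

Lemma ip0r f : L2 leb Omega f -> ip leb Omega f 0 = 0.
Proof.
move=> Lf; have L0 := L2_0 leb mO; have := ip_Br mO Lf L0 L0; rewrite subr0 => e.
by rewrite e subrr.
Qed.

Lemma weak_partial_ae j u u' g : L2 leb Omega u -> L2 leb Omega u' ->
  u = u' %[ae leb in Omega] -> weak_partial Omega j u g -> weak_partial Omega j u' g.
Proof.
move=> Lu Lu' uu' /(weak_partial_ip _ _ Lu)[Lg h]; apply/(weak_partial_ip _ _ Lu').
split=> // phi tphi; rewrite h//; congr (- _); have Lp := test_L2 oO bO (test_partial j tphi).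
by apply: (ip_ae mO) => //; exact: aeW.
Qed.

Lemma H1_ae u u' : H1 Omega u -> L2 leb Omega u' ->
  u = u' %[ae leb in Omega] -> H1 Omega u'.
Proof.
move=> Hu Lu' uu'; have [Lu _] := Hu; split=> // j; exists (wpartial Omega j u).
exact: weak_partial_ae (H1_weak j Hu).
Qed.

Lemma wpartial_ae_eq j u u' : H1 Omega u -> H1 Omega u' ->
  u = u' %[ae leb in Omega] ->
  {ae leb, forall x, Omega x -> wpartial Omega j u x = wpartial Omega j u' x}.
Proof.
move=> Hu [Lu' _] uu'; have [Lu _] := Hu; have w := weak_partial_ae Lu Lu' uu' (H1_weak j Hu).
exact: filterS (fun x (e : Omega x -> _) Ox => esym (e Ox)) (wpartial_ae oO w).
Qed.

Lemma L2sq_ae0 f : L2 leb Omega f -> {ae leb, forall x, Omega x -> f x = 0} ->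
  L2sq leb Omega f = 0%E.
Proof.
move=> Lf f0; have L0 : L2 leb Omega (0 : V -> R[i]).
  by apply/(L2P leb mO); split; exact: (@rL2_cst _ _ _ 0).
rewrite (L2sq_ae oO Lf L0)// /L2sq; apply: integral0_eq => x _.
by rewrite /csqr /= expr0n addr0.
Qed.

Lemma wpartial_ae0 j u : L2 leb Omega u -> {ae leb, forall x, Omega x -> u x = 0} ->
  L2sq leb Omega (wpartial Omega j u) = 0%E.
Proof.
move=> Lu u0; have L0 := L2_0 leb mO.
have w0 : weak_partial Omega j 0 0.
  apply/weak_partial_ip => //; split=> // phi tphi.
  by rewrite !ip0r ?oppr0//; apply: test_L2 => //; exact: test_partial.
rewrite (L2sq_wpartial oO (weak_partial_ae L0 Lu _ w0)) ?L2sq_ae0//; first exact: aeW.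
by apply: filterS u0 => x h Ox; rewrite h.
Qed.

(** The bound of the trace in [L^2] of the boundary makes it depend only on the class of [u],
    although [dirichlet_trace] relates functions. *)
Lemma trace_ae u g : dirichlet_trace P u g -> {ae leb, forall x, Omega x -> u x = 0} ->
  ae_eq omega dO g 0.
Proof.
move=> tr u0; have [[Lu _] [Lg _] _] := tr; have [C C0 hC] := trace_surface_bound oO bO P ltr01.
apply: (ip_eq0 mdO Lg); have := hC u g tr; rewrite (L2sq_ae0 Lu u0) big1 => [|j _]; last exact: wpartial_ae0.
by rewrite !mule0 adde0 => h; have -> : L2sq omega dO g = 0%E by apply/eqP; rewrite eq_le h L2sq_ge0.
Qed.

Lemma trace_unique u g u' g' : dirichlet_trace P u g -> dirichlet_trace P u' g' ->
  u = u' %[ae leb in Omega] -> ae_eq omega dO g g'.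
Proof.
move=> t t' uu'; have d0 : {ae leb, forall x, Omega x -> -1 * u' x + u x = 0}.
  by apply: filterS uu' => x h Ox; rewrite h// mulN1r addNr.
have := trace_ae (trace_lin oO bO (-1) t' t) d0; apply: filterS => x h Ox.
by have := h Ox; rewrite mulN1r addrC => /eqP; rewrite subr_eq0 => /eqP.
Qed.

Lemma Hhalf_sq_localize0 f : (forall k x, localize P k f x = 0) -> Hhalf_sq P f = 0%E.
Proof.
move=> f0; rewrite /Hhalf_sq big1// => k _; rewrite /Hhalf_rV_sq /L2sq /gagliardo.
have c0 : csqr (0 : R[i]) = 0 by rewrite /csqr /= expr0n addr0.
rewrite integral0_eq => [|x _]; last by rewrite f0 c0.
rewrite integral0_eq ?adde0// => x _; apply: integral0_eq => y _.
by rewrite !f0 subr0 c0 mul0r.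
Qed.

(** The domain is open, so a test function vanishes on its boundary, and the constant sequence
    approximates both [phi] and the trace 0. *)
Lemma trace_test (phi : V -> R) : test_function Omega phi ->
  dirichlet_trace P (fun x => (phi x)%:C) 0.
Proof.
move=> tphi; have [sp _ _] := tphi.
have cs := csmooth_real sp.
have loc0 f : (forall x, dO x -> f x = 0) -> forall k x, localize P k f x = 0.
  move=> f0 k x; rewrite /localize.
  have [->|/cutoff_boundary dx] := eqVneq (cutoff P k (graph_point (coords k) x)) 0; first by rewrite mul0r.
  by rewrite f0// mulr0.
have pd x : dO x -> (phi x)%:C = 0.
  move=> [_ nx]; have [->//|/(test_supp tphi) Ox] := eqVneq (phi x) 0.
  by exfalso; apply: nx; rewrite /interior; exact: open_nbhs_nbhs.
split; first exact: H1_smooth.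
  apply/HhalfP; split; last by rewrite Hhalf_sq_localize0//; exact: loc0.
  by apply/(L2P omega mdO); split; split; [exact: measurable_cst| |exact: measurable_cst|];
    rewrite /rL2sq integral0_eq// => x _; rewrite expr0n.
exists (fun _ x => (phi x)%:C); split => //.
- rewrite subrr (_ : H1sq Omega 0 = 0%E); first exact: cvg_cst.
  have L0 : L2 leb Omega (0 : V -> R[i]) by apply/(L2P leb mO); split; exact: (@rL2_cst _ _ _ 0).
  have a0 : {ae leb, forall x, Omega x -> (0 : V -> R[i]) x = 0} by exact: aeW.
  by rewrite /H1sq (L2sq_ae0 L0 a0) big1 ?adde0// => j _; exact: wpartial_ae0.
- rewrite subr0 Hhalf_sq_localize0; first exact: cvg_cst.
  exact: loc0.
Qed.

Variables (a : F -> F -> R[i]) (c : R) (Theta : F -> F -> R[i]).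
Hypotheses (a_form : form_sesquilinear P a) (a_sym : form_symmetric P a).
Hypotheses (a_bounded : form_bounded_below P a c) (Theta_bounded : bounded_operator P Theta).
Hypothesis Theta_assoc : forall f g, Hhalf P f -> Hhalf P g -> pairing f (Theta g) = a f g.

Variable trace : F -> F.
Hypothesis traceP : forall u, H1 Omega u -> dirichlet_trace P u (trace u).

Lemma trace_Hhalf u : H1 Omega u -> Hhalf P (trace u).
Proof. by move=> /traceP[]. Qed.

Definition robin_form u v : R[i] := grad_ip Omega u v + a (trace u) (trace v).

(** [trace] is an arbitrary selection of traces. Two traces of one function agree almost everywhere
    on the boundary, and [a] does not distinguish them. *)
Lemma form_trace u g v h : dirichlet_trace P u g -> dirichlet_trace P v h ->
  a (trace u) (trace v) = a g h.
Proof.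
move=> tu tv; have [Hu Hg _] := tu; have [Hv Hh _] := tv; have [_ _ ae] := a_form.
have r w : {ae leb, forall x, Omega x -> w x = w x :> R[i]} by exact: aeW.
exact: (ae _ _ _ _ (trace_Hhalf Hu) Hg (trace_Hhalf Hv) Hh
  (trace_unique (traceP Hu) tu (r u)) (trace_unique (traceP Hv) tv (r v))).
Qed.

Lemma robin_form_ae u u' v v' : H1 Omega u -> H1 Omega u' -> H1 Omega v -> H1 Omega v' ->
  u = u' %[ae leb in Omega] -> v = v' %[ae leb in Omega] ->
  robin_form u v = robin_form u' v'.
Proof.
move=> Hu Hu' Hv Hv' uu' vv'.
have e1 : grad_ip Omega u v = grad_ip Omega u' v'.
  apply: eq_bigr => j _; apply: (ip_ae mO).
  - exact: wpartial_L2.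
  - exact: wpartial_L2.
  - exact: wpartial_L2.
  - exact: wpartial_L2.
  - exact: wpartial_ae_eq.
  - exact: wpartial_ae_eq.
have [_ _ ae] := a_form.
have e2 := ae _ _ _ _ (trace_Hhalf Hu) (trace_Hhalf Hu') (trace_Hhalf Hv) (trace_Hhalf Hv')
  (trace_unique (traceP Hu) (traceP Hu') uu') (trace_unique (traceP Hv) (traceP Hv') vv').
by rewrite /robin_form e1 e2.
Qed.

Lemma robin_formC u v : H1 Omega u -> H1 Omega v -> robin_form u v = (robin_form v u)^*.
Proof.
move=> Hu Hv; rewrite /robin_form rmorphD rmorph_sum; congr (_ + _).
  by apply: eq_bigr => j _; apply: (ipC mO); exact: wpartial_L2.
by apply: a_sym; exact: trace_Hhalf.
Qed.

Lemma robin_form_linr z u u' v : H1 Omega u -> H1 Omega u' -> H1 Omega v ->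
  robin_form v (fun x => z * u x + u' x) = z * robin_form v u + robin_form v u'.
Proof.
move=> Hu Hu' Hv; have [Lu _] := Hu; have [Lu' _] := Hu'; rewrite /robin_form.
rewrite (form_trace (traceP Hv) (trace_lin oO bO z (traceP Hu) (traceP Hu'))).
have [_ lin _] := a_form; rewrite (lin _ _ _ _ (trace_Hhalf Hu) (trace_Hhalf Hu') (trace_Hhalf Hv)).
have -> : grad_ip Omega v (fun x => z * u x + u' x) = z * grad_ip Omega v u + grad_ip Omega v u'.
  rewrite /grad_ip mulr_sumr -big_split; apply: eq_bigr => j _.
  have w := weak_partial_lin oO z Lu Lu' (H1_weak j Hu) (H1_weak j Hu').
  apply: etrans (ip_linr mO z (wpartial_L2 j Hu) (wpartial_L2 j Hu') (wpartial_L2 j Hv)).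
  apply: (ip_ae mO (wpartial_L2 j Hv) (wpartial_L2 j Hv)).
  - by apply: wpartial_L2; exact: H1_lin.
  - by case: w.
  - exact: ae_refl.
  - exact: (wpartial_ae oO w).
by rewrite mulrDr addrACA.
Qed.

Lemma robin_form_linl z u u' v : H1 Omega u -> H1 Omega u' -> H1 Omega v ->
  robin_form (fun x => z * u x + u' x) v = z^* * robin_form u v + robin_form u' v.
Proof.
move=> Hu Hu' Hv; rewrite (robin_formC (H1_lin oO z Hu Hu') Hv) robin_form_linr//.
by rewrite (robin_formC Hu Hv) (robin_formC Hu' Hv) rmorphD rmorphM.
Qed.

Lemma H1_0 : H1 Omega (0 : F).
Proof. by have [] := trace_test (test_function0 Omega). Qed.

Lemma robin_formZl z u v : H1 Omega u -> H1 Omega v ->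
  robin_form (fun x => z * u x) v = z^* * robin_form u v.
Proof.
move=> Hu Hv; have := robin_form_linl (-1) H1_0 H1_0 Hv.
have -> : (fun x => -1 * (0 : F) x + (0 : F) x) = 0 by apply/funext => x; rewrite addr0 mulr0.
rewrite rmorphN1 mulN1r addNr => r0; have := robin_form_linl z Hu H1_0 Hv; rewrite r0 addr0.
by have -> : (fun x => z * u x + (0 : F) x) = (fun x => z * u x) by apply/funext => x; rewrite addr0.
Qed.

Lemma H1_scale z f : H1 Omega f -> H1 Omega (fun x => z * f x).
Proof.
move=> Hf; have := H1_lin oO z Hf H1_0; congr H1.
by apply/funext => x; rewrite addr0.
Qed.

Lemma robin_formZr z u v : H1 Omega u -> H1 Omega v ->
  robin_form u (fun x => z * v x) = z * robin_form u v.
Proof.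
move=> Hu Hv; rewrite (robin_formC Hu (H1_scale z Hv)) robin_formZl// (robin_formC Hv Hu).
by case: z => s t; case: (robin_form u v) => s' t'; apply: complex_eq => /=; ring.
Qed.

Lemma robin_form_diag u : H1 Omega u ->
  complex.Re (robin_form u u) = gradnorm_sq (Omega := Omega) u + complex.Re (a (trace u) (trace u)).
Proof.
move=> Hu; rewrite /robin_form raddfD /=; congr (_ + _).
rewrite /grad_ip raddf_sum /gradnorm_sq; apply: eq_bigr => j _.
by rewrite (ip_sq mO (wpartial_L2 j Hu)).
Qed.

Lemma robin_form_lower : exists2 K : R, 0 <= K & forall u, H1 Omega u ->
  2^-1 * gradnorm_sq (Omega := Omega) u - K * N0 u <= complex.Re (robin_form u u).
Proof.
(* Chosen so that [|c| eta <= 1/2]: the negative part of the boundary form then consumes at most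
   half of the gradient term. *)
pose eta := (2 * (`|c| + 1))^-1; have eta0 : 0 < eta by rewrite invr_gt0 mulr_gt0// ltr_wpDl.
have [C C0 hC] := trace_surface_bound oO bO P eta0.
exists (`|c| * C) => [|u Hu]; first by rewrite mulr_ge0.
have Hg := trace_Hhalf Hu; have [Lg _] := Hg.
have := hC u _ (traceP Hu); rewrite (fine_grad Hu) (fine_L2 Hu) -!EFinM -EFinD.
rewrite -(fineK (L2sq_fin Lg)) lee_fin => le1.
have := a_bounded Hg; rewrite lecE /= => /andP[_ le2].
rewrite robin_form_diag//.
have s0 : 0 <= fine (L2sq omega dO (trace u)) by rewrite fine_ge0// L2sq_ge0.
have G0 := gradnorm_sq_ge0 (Omega := Omega) u; have n0 := L2norm_sq_ge0 leb Omega u.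
move: le1 le2 s0 G0 n0; move: (fine _) (gradnorm_sq u) (N0 u) => s G N le1 le2 s0 G0 n0.
have h1 : `|c| * s <= `|c| * (eta * G + C * N) by rewrite ler_wpM2l.
have h2 : - (`|c| * s) <= c * s.
  by rewrite -mulNr ler_wpM2r// -normrN; have := ler_norm (- c); lra.
have h3 : `|c| * eta <= 2^-1.
  by rewrite /eta invfM mulrCA ler_piMr ?invr_ge0// ler_pdivrMr ?ltr_wpDl// mul1r lerDl.
have h4 : `|c| * eta * G <= 2^-1 * G by rewrite ler_wpM2r.
by move: h1 h2 h4 le2; rewrite mulrDr !mulrA; lra.
Qed.

Lemma robin_form_upper : exists2 M : R, 0 <= M & forall u, H1 Omega u ->
  `|complex.Re (robin_form u u)| <= M * (N0 u + gradnorm_sq (Omega := Omega) u).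
Proof.
have [B B0 hB] := trace_bound oO bO P.
have [_ _ [C hC]] := Theta_bounded.
(* The constant [C] in [bounded_operator] bounds a square and may be negative; [|C| + 1] bounds the
   modulus itself, as [|C| <= (|C| + 1)^2]. *)
exists (1 + (`|C| + 1) * B) => [|u Hu]; first by rewrite addr_ge0// mulr_ge0// addr_ge0.
have Hg := trace_Hhalf Hu; have fH : Hhalf_sq P (trace u) \is a fin_num.
  by rewrite ge0_fin_numE ?Hhalf_sq_ge0//; have [_] := (HhalfP P _).1 Hg.
have := hB u _ (traceP Hu); rewrite (fine_H1 Hu) -EFinM -{1}(fineK fH) lee_fin => le1.
have := hC _ _ Hg Hg; have := Theta_assoc Hg Hg; rewrite /pairing => -> le2.
rewrite robin_form_diag//.
have s0 : 0 <= fine (Hhalf_sq P (trace u)) by rewrite fine_ge0// Hhalf_sq_ge0.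
have G0 := gradnorm_sq_ge0 (Omega := Omega) u; have n0 := L2norm_sq_ge0 leb Omega u.
move: le1 le2 s0 G0 n0; case: (a _ _) => x y; rewrite /csqr /=.
move: (fine _) (gradnorm_sq u) (N0 u) => s G N le1 le2 s0 G0 n0.
have h1 : `|x| <= (`|C| + 1) * s.
  rewrite -(@ler_pXn2r _ 2) ?nnegrE//; last by rewrite mulr_ge0// addr_ge0.
  rewrite real_normK ?num_real//.
  have : C * s * s <= `|C| * s * s by rewrite -!mulrA ler_wpM2r ?mulr_ge0// ler_norm.
  have C1 := normr_ge0 C; have := sqr_ge0 y; move: le2 C1; set t := `|C|.
  have : 0 <= s * s by rewrite mulr_ge0.
  move=> ss le2 t0 y0 h; rewrite exprMn.
  have : t * (s * s) <= (t + 1) ^+ 2 * (s * s) by rewrite ler_wpM2r//; nra.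
  by rewrite expr2 in le2 *; move: h; rewrite -!mulrA; lra.
apply: le_trans (ler_normD _ _) _; rewrite ger0_norm//.
have : (`|C| + 1) * s <= (`|C| + 1) * (B * (N + G)) by rewrite ler_wpM2l// addr_ge0.
by rewrite mulrDl mul1r mulrA; lra.
Qed.

Lemma test_orthogonal f : L2 leb Omega f ->
  (forall phi, test_function Omega phi -> ip leb Omega (fun x => (phi x)%:C) f = 0) ->
  {ae leb, forall x, Omega x -> f x = 0}.
Proof.
move=> Lf h; have [rf jf] := (L2P leb mO f).1 Lf.
have E phi : test_function Omega phi ->
    rip leb Omega (rep f) phi = 0 /\ rip leb Omega (imp f) phi = 0.
  move=> tphi; have h0 := h phi tphi; rewrite (ipE mO (test_L2 oO bO tphi) Lf) in h0.
  have z (g : V -> R) : rip leb Omega (imp (fun x => (phi x)%:C)) g = 0.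
    by rewrite /rip /Rintegral integral0_eq// => x _; rewrite /imp /= mul0r.
  have h1 : rip leb Omega phi (rep f) + rip leb Omega (imp (fun x => (phi x)%:C)) (imp f) = 0.
    exact: (congr1 (@complex.Re R) h0).
  have h2 : rip leb Omega phi (imp f) - rip leb Omega (imp (fun x => (phi x)%:C)) (rep f) = 0.
    exact: (congr1 (@complex.Im R) h0).
  by rewrite z addr0 in h1; rewrite z subr0 in h2; rewrite !(ripC leb Omega _ phi).
have h1 := fundamental_lemma oO rf (fun phi t => (E phi t).1).
have h2 := fundamental_lemma oO jf (fun phi t => (E phi t).2).
by apply: filterS2 h1 h2 => x e1 e2 Ox; apply: complex_eq; [exact: e1|exact: e2].
Qed.

Lemma ip_sum_real (I : finType) (g_ : I -> V -> R) u : (forall j, test_function Omega (g_ j)) ->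
  L2 leb Omega u -> ip leb Omega (fun x => (\sum_j g_ j x)%:C) u =
  \sum_j ip leb Omega (fun x => (g_ j x)%:C) u.
Proof.
move=> tg Lu; have L0 : L2 leb Omega (fun=> 0 : R[i]) by exact: (L2_0 leb mO).
suff H (r : seq I) : L2 leb Omega (fun x => (\sum_(j <- r) g_ j x)%:C) /\
    ip leb Omega (fun x => (\sum_(j <- r) g_ j x)%:C) u = \sum_(j <- r) ip leb Omega (fun x => (g_ j x)%:C) u.
  by have [] := H (index_enum I).
elim: r => [|j r [Lr ih]].
  have E : (fun x => (\sum_(j <- [::]) g_ j x)%:C) = (fun=> 0) by apply/funext => x; rewrite big_nil.
  split; rewrite E ?big_nil//.
  have := ip_linl mO (-1) L0 L0 Lu.
  rewrite (_ : (fun x => -1 * 0 + 0) = (fun=> 0)); last by apply/funext => x; rewrite mulr0 addr0.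
  by rewrite rmorphN1 mulN1r addNr.
have E : (fun x => (\sum_(i <- j :: r) g_ i x)%:C) = (fun x => 1 * (g_ j x)%:C + (\sum_(i <- r) g_ i x)%:C).
  by apply/funext => x; rewrite big_cons rmorphD mul1r.
have Lj := test_L2 oO bO (tg j).
split; rewrite E; first exact: L2_lin.
by rewrite (ip_linl mO 1 Lj Lr Lu) ih big_cons rmorph1 mul1r.
Qed.

Lemma weak_laplacian_ip u v : weak_laplacian Omega u v <-> L2 leb Omega v /\
  forall phi, test_function Omega phi -> ip leb Omega (fun x => (phi x)%:C) v =
    ip leb Omega (fun x => (\sum_j partial j (partial j phi) x)%:C) u.
Proof.
by split=> -[Lv h]; split=> // phi tphi; have := h phi tphi; rewrite ?ip_real.
Qed.

Lemma weak_laplacian_unique u v v' : weak_laplacian Omega u v -> weak_laplacian Omega u v' ->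
  v = v' %[ae leb in Omega].
Proof.
move=> /weak_laplacian_ip[Lv hv] /weak_laplacian_ip[Lv' hv'].
have L := L2_sub mO Lv Lv'.
have h := test_orthogonal L _; apply: filterS (h _) => [x e Ox|phi tphi].
  by have /eqP := e Ox; rewrite [(v - v') x]/(v x - v' x) subr_eq0 => /eqP.
by rewrite (ip_Br mO (test_L2 oO bO tphi) Lv Lv') hv// hv'// subrr.
Qed.

Lemma form0l h : Hhalf P h -> a 0 h = 0.
Proof.
move=> Hh; have H0 : Hhalf P (0 : F).
  by have [] := trace_test (test_function0 Omega).
have [lin _ _] := a_form; have := lin (-1) 0 0 h H0 H0 Hh.
rewrite (_ : (fun x => -1 * (0 : F) x + (0 : F) x) = 0); last by apply/funext => x; rewrite mulr0 addr0.
by rewrite rmorphN1 mulN1r addNr.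
Qed.

(** Test functions have trace 0, so the boundary term disappears and the form reduces to the
    distributional Laplacian of [u]. *)
Lemma robin_form_test u phi : H1 Omega u -> test_function Omega phi ->
  robin_form (fun x => (phi x)%:C) u =
  - ip leb Omega (fun x => (\sum_j partial j (partial j phi) x)%:C) u.
Proof.
move=> Hu tphi; have [Lu _] := Hu; have [sp _ _] := tphi.
have tt := trace_test tphi; have [Hphi _ _] := tt.
rewrite /robin_form (form_trace tt (traceP Hu)) (form0l (trace_Hhalf Hu)) addr0.
rewrite (ip_sum_real (fun j => test_partial j (test_partial j tphi)) Lu) -sumrN.
apply: eq_bigr => j _.
have cs := csmooth_real sp.
have [_ hw] := (weak_partial_ip j (wpartial Omega j u) Lu).1 (H1_weak j Hu).
rewrite -(hw _ (test_partial j tphi)).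
have Lp := test_L2 oO bO (test_partial j tphi).
apply: (ip_ae mO) => //; try exact: wpartial_L2; try exact: ae_refl.
have w := weak_partial_smooth oO bO j cs.
apply: filterS (wpartial_ae oO w) => x e Ox; rewrite (e Ox).
apply: complex_eq => //=; rewrite /imp /=.
by rewrite /partial (_ : (fun x => _) = cst 0)// derive_cst.
Qed.

(** Forwards, Green's formula for the Neumann trace is combined with the boundary condition.
    Backwards, test functions identify [w] with the negative Laplacian, and the remaining boundary
    term exhibits the Neumann trace. *)
Lemma robinP u w : robin_laplacian P Theta (u, w) <-> [/\ H1 Omega u, L2 leb Omega w &
  forall Phi, H1 Omega Phi -> robin_form Phi u = ip leb Omega Phi w].
Proof.
have oppE f : - f = (fun x => -1 * f x + (0 : F) x) by apply/funext => x; rewrite mulN1r addr0.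
have L0 := L2_0 leb mO.
have Lopp f : L2 leb Omega f -> L2 leb Omega (- f) by move=> Lf; rewrite oppE; exact: L2_lin.
have ipN p f : L2 leb Omega p -> L2 leb Omega f -> ip leb Omega p (- f) = - ip leb Omega p f.
  by move=> Lp Lf; rewrite -[- f]add0r (ip_Br mO Lp L0 Lf) ip0r// sub0r.
have wl v : weak_laplacian Omega u v -> {ae leb, forall x, Omega x -> wlaplacian Omega u x = v x} /\ L2 leb Omega (wlaplacian Omega u).
  move=> hv; have hw : weak_laplacian Omega u (wlaplacian Omega u) := xgetPex 0 (ex_intro _ v hv).
  by split; [exact: weak_laplacian_unique hw hv|case: hw].
split=> [[/= [Hu _ [g [ell [tu [_ neu] rob]]]] lap]|[Hu Lw H]].
  have Lw : L2 leb Omega w by have [/Lopp + _] := lap; rewrite opprK.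
  have [wae Lwl] := wl _ lap; have [_ Hg _] := tu.
  split=> // Phi HPhi; have [LPhi _] := HPhi; have HP := trace_Hhalf HPhi.
  have := neu _ _ HP (traceP HPhi).
  have := rob _ HP; rewrite (Theta_assoc HP Hg) => e1 e2.
  rewrite /robin_form (form_trace (traceP HPhi) tu).
  have e3 : ip leb Omega Phi (wlaplacian Omega u) = - ip leb Omega Phi w.
    rewrite -ipN//; apply: (ip_ae mO) => //; first exact: Lopp.
    exact: ae_refl.
  have /eqP : grad_ip Omega Phi u + a (trace Phi) g - ip leb Omega Phi w = 0.
    by rewrite -e1 e2 e3 addrAC.
  by rewrite subr_eq0 => /eqP.
have lap : weak_laplacian Omega u (- w).
  apply/weak_laplacian_ip; split; first exact: Lopp.
  move=> phi tphi; have Lp := test_L2 oO bO tphi.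
  have [Hp _ _] := trace_test tphi.
  by rewrite ipN// -(H _ Hp) (robin_form_test Hu tphi) opprK.
split=> //; split=> //; first by exists (- w).
have Hg := trace_Hhalf Hu; have [TH _ [C hC]] := Theta_bounded.
have [Tlin [C' hC']] := TH _ Hg.
(* The boundary condition dictates the Neumann trace; that this functional satisfies Green's formula
   is the variational identity. *)
exists (trace u), (fun phi => - Theta (trace u) phi); split; first exact: traceP.
  split; last first.
    move=> phi Phi Hphi tPhi; have [HPhi _ _] := tPhi; have [LPhi _] := HPhi.
    have [wae Lwl] := wl _ lap.
    have e3 : ip leb Omega Phi (wlaplacian Omega u) = - ip leb Omega Phi w.
      rewrite -ipN//; apply: (ip_ae mO) => //; first exact: Lopp.
      exact: ae_refl.
    rewrite /pairing e3 -(H _ HPhi) /robin_form (form_trace tPhi (traceP Hu)).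
    have := Theta_assoc Hphi Hg; rewrite /pairing => ->.
    by rewrite opprD addrA subrr sub0r.
  split=> [z f g Hf Hg'|]; first by rewrite Tlin// opprD mulrN.
  exists C' => f Hf; apply: le_trans (hC' f Hf).
  by rewrite /csqr; case: (Theta _ _) => x y /=; rewrite !sqrrN.
by move=> phi Hphi; rewrite /pairing addNr.
Qed.

Local Notation H := (L2_hilbert leb mO).
Local Notation cls f := (@L2_class _ _ _ leb Omega mO f : H).
Local Notation fn := (@L2_fun _ _ _ leb Omega mO).
Local Notation J := (@L2_J _ _ _ leb Omega mO : H -> H).

Definition form_domain : set H := [set x : H | H1 Omega (fn x)].
Definition real_form (x y : H) : R := complex.Re (robin_form (fn x) (fn y)).
Local Notation h1 := form_domain.
Local Notation q := real_form.

Let fnL (x : H) : L2 leb Omega (fn x). Proof. exact: L2_funP. Qed.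

Let clsP f : L2 leb Omega f -> {ae leb, forall x, Omega x -> fn (cls f) x = f x}.
Proof. exact: L2_classP. Qed.

Lemma H1_class f : H1 Omega f -> H1 Omega (fn (cls f)).
Proof.
move=> Hf; have [Lf _] := Hf; apply: (H1_ae Hf (fnL _)).
by apply: aeC; exact: clsP.
Qed.

Let combP al (x y : H) : {ae leb, forall t, Omega t -> fn (al *: x + y) t = al%:C * fn x t + fn y t}.
Proof. exact: L2_combE. Qed.

Let subP (x y : H) : {ae leb, forall t, Omega t -> fn (x - y) t = (fn x - fn y) t}.
Proof. exact: L2_subE. Qed.

Let h1_comb al (x y : H) : h1 x -> h1 y -> h1 (al *: x + y).
Proof.
move=> Hx Hy; apply: (H1_ae (H1_lin oO al%:C Hx Hy) (fnL _)).
by apply: aeC; exact: combP.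
Qed.

Let normE (x : H) : hip x x = N0 (fn x).
Proof. by rewrite (L2norm_sqE mO (fnL x)). Qed.

Let q_comb al (x y w : H) : h1 x -> h1 y -> h1 w -> q (al *: x + y) w = al * q x w + q y w.
Proof.
move=> Hx Hy Hw; rewrite /q.
rewrite (robin_form_ae (h1_comb al Hx Hy) (H1_lin oO al%:C Hx Hy) Hw Hw (combP al x y) (ae_refl _ _ (fn w))).
rewrite (robin_form_linl _ Hx Hy Hw).
by case: (robin_form (fn x) _) => s t; case: (robin_form (fn y) _) => s' t' /=; ring.
Qed.

Let q_sym (x y : H) : h1 x -> h1 y -> q x y = q y x.
Proof.
by move=> Hx Hy; rewrite /q (robin_formC Hx Hy); case: (robin_form _ _).
Qed.

Let energy f := N0 f + gradnorm_sq (Omega := Omega) f.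

Let energy_ae f g : H1 Omega f -> H1 Omega g -> f = g %[ae leb in Omega] ->
  energy f = energy g.
Proof.
move=> Hf Hg fg; have [Lf _] := Hf; have [Lg _] := Hg.
have e1 := L2norm_sq_ae oO Lf Lg fg.
have e2 : gradnorm_sq (Omega := Omega) f = gradnorm_sq (Omega := Omega) g.
  apply: eq_bigr => j _; apply: (L2norm_sq_ae oO).
  - exact: wpartial_L2.
  - exact: wpartial_L2.
  - exact: wpartial_ae_eq.
by rewrite /energy e1 e2.
Qed.

Let energy_sub (x y : H) : h1 x -> h1 y -> energy (fn (x - y)) = energy (fn x - fn y).
Proof.
move=> Hx Hy; have Hxy := H1B oO Hx Hy; apply: energy_ae (subP x y) => //.
by apply: (H1_ae Hxy (fnL _)); apply: aeC; exact: subP.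
Qed.

Let h1_sub (x y : H) : h1 x -> h1 y -> h1 (x - y).
Proof.
move=> Hx Hy; apply: (H1_ae (H1B oO Hx Hy) (fnL _)).
by apply: aeC; exact: subP.
Qed.

Lemma robin_class u w : robin_laplacian P Theta (u, w) <->
  L2_graph (form_operator h1 q) (u, w).
Proof.
rewrite robinP; split.
  move=> [Hu Lw E]; have [Lu _] := Hu; have Hc := H1_class Hu.
  split=> //; split=> // v Hv; rewrite /q.
  rewrite (robin_form_ae Hv Hv Hc Hu (ae_refl _ _ (fn v)) (clsP Lu)) (E _ Hv).
  by rewrite -(hip_re mO (fnL v) Lw) L2_classK.
move=> [/= Lu Lw [Hc E]]; have Hu : H1 Omega u by apply: (H1_ae Hc Lu); exact: clsP.
split=> // Phi HPhi; have [LPhi _] := HPhi.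
have re f : H1 Omega f -> complex.Re (robin_form f u) = complex.Re (ip leb Omega f w).
  move=> Hf; have [Lf _] := Hf; have Hcf := H1_class Hf; have := E (cls f) Hcf.
  rewrite /q (robin_form_ae Hcf Hf Hc Hu (clsP Lf) (clsP Lu)) => ->.
  by rewrite (hip_re mO Lf Lw).
(* The relation on classes knows only real parts; testing with [i Phi] recovers the imaginary
   part. *)
have Hi := H1_scale (0 +i* 1) HPhi.
have fi : robin_form (fun t => (0 +i* 1) * Phi t) u = (0 -i* 1) * robin_form Phi u.
  exact: robin_formZl.
have r1 := re _ HPhi; have r2 := re _ Hi; rewrite fi (ip_il mO LPhi Lw) in r2.
apply: complex_eq => //; move: r2; case: (robin_form Phi u) => s t; case: (ip leb Omega Phi w) => s' t' /=.
by rewrite !mul0r !sub0r !mulN1r !opprK.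
Qed.

Lemma robin_graph : robin_laplacian P Theta = L2_graph (form_operator h1 q).
Proof. by apply/seteqP; split=> -[u w] /robin_class. Qed.

(** Real orthogonality to [phi] and to [i phi], for test functions [phi], yields complex
    orthogonality, to which the fundamental lemma applies. *)
Lemma form_domain_dense (x : H) : (forall v : H, h1 v -> hip x v = 0) -> x = 0.
Proof.
move=> h; have re f : H1 Omega f -> complex.Re (ip leb Omega (fn x) f) = 0.
  move=> Hf; have [Lf _] := Hf; have := h (cls f) (H1_class Hf).
  by rewrite -{1}(L2_classK x) (hip_re mO (fnL x) Lf).
have x0 : {ae leb, forall t, Omega t -> fn x t = 0}.
  apply: (test_orthogonal (fnL x)) => phi tphi.
  have [Hp _ _] := trace_test tphi; have Lp := test_L2 oO bO tphi.
  have r1 := re _ Hp; have r2 := re _ (H1_scale (0 +i* 1) Hp).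
  rewrite (ip_ir mO (fnL x) Lp) re_i in r2; rewrite (ipC mO Lp (fnL x)).
  move: r1 r2; case: (ip leb Omega (fn x) _) => s t /= -> /eqP; rewrite oppr_eq0 => /eqP ->.
  by rewrite oppr0.
apply: L2_space_eq; apply: (ae_trans x0); apply: aeC; exact: L2_zeroP.
Qed.

Theorem robin_selfadjoint :
  [/\ selfadjoint leb Omega (robin_laplacian P Theta),
      bounded_from_below leb Omega (robin_laplacian P Theta) &
      op_domain (operator_sqrt leb Omega (operator_abs leb Omega (robin_laplacian P Theta)))
      = H1 Omega].
Proof.
have [K K0 hK] := robin_form_lower.
have [M M0 hM] := robin_form_upper.
(* With this choice [q + C |.|^2] is at least [|grad u|^2 / 2 + 2 |u|^2]. The outer factor [C >= 2]
   of the shifted form then dominates the squared norm of [H^1]. *)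
pose C := K + 2; have C2 : 2 <= C by rewrite lerDr.
have C0 : 0 < C by apply: lt_le_trans C2.
pose q1 := shifted_form q C.
have lower (x : H) : h1 x -> energy (fn x) <= q1 x x.
  move=> Hx; rewrite /q1 /shifted_form /energy normE.
  have := hK _ Hx; rewrite -/(q x x).
  have G0 := gradnorm_sq_ge0 (Omega := Omega) (fn x); have n0 := L2norm_sq_ge0 leb Omega (fn x).
  move: G0 n0; move: (q x x) (gradnorm_sq _) (N0 _) => s G N G0 n0 h.
  have h2 : 2^-1 * G + 2 * N <= s + C * N by rewrite /C; lra.
  have h3 : 0 <= 2^-1 * G + 2 * N by rewrite addr_ge0// mulr_ge0// invr_ge0.
  have : 2 * (2^-1 * G + 2 * N) <= C * (s + C * N) by apply: ler_pM.
  by lra.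
have upper (x : H) : h1 x -> q1 x x <= C * (M + C) * energy (fn x).
  move=> Hx; rewrite /q1 /shifted_form /energy normE -mulrA; apply: ler_wpM2l; first exact: ltW.
  have := hM _ Hx; rewrite -/(q x x) => h; have := ler_norm (q x x).
  have G0 := gradnorm_sq_ge0 (Omega := Omega) (fn x).
  have : C * N0 (fn x) <= C * (N0 (fn x) + gradnorm_sq (Omega := Omega) (fn x)).
    by rewrite ler_wpM2l ?(ltW C0)// lerDl.
  by move: h; rewrite mulrDl; lra.
have q1_ge (x : H) : h1 x -> C * hip x x <= q1 x x.
  move=> Hx; rewrite /q1 /shifted_form normE; apply: ler_wpM2l; first exact: ltW.
  have := hK _ Hx; rewrite -/(q x x).
  have G0 := gradnorm_sq_ge0 (Omega := Omega) (fn x); have n0 := L2norm_sq_ge0 leb Omega (fn x).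
  move: G0 n0; move: (q x x) (gradnorm_sq _) (N0 _) => s G N G0 n0 h; rewrite /C; lra.
have q1_semi : semi_ip h1 q1.
  split.
  - by rewrite /h1 /=; apply: (H1_ae H1_0 (fnL 0)); apply: aeC; exact: L2_zeroP.
  - exact: h1_comb.
  - move=> al x y w Hx Hy Hw; rewrite /q1 /shifted_form q_comb// hipDl hipZl; ring.
  - by move=> x y Hx Hy; rewrite /q1 /shifted_form q_sym// hipC.
  - by move=> x Hx; apply: le_trans (q1_ge x Hx); rewrite mulr_ge0 ?hip_ge0// ltW.
have q1_complete : semi_complete h1 q1.
  move=> x_ Hx_ cx.
  (* By [lower] a Cauchy sequence for [q1] is Cauchy in [H^1], and by [upper] convergence in [H^1]
     implies convergence for [q1]. *)
  have [|u Hu uc] := H1_complete oO bO (u_ := fun l => fn (x_ l)) Hx_.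
    move=> e /cx[N hN]; exists N => l k Nl Nk; apply: le_lt_trans (hN l k Nl Nk).
    by have := lower _ (h1_sub (Hx_ l) (Hx_ k)); rewrite (energy_sub (Hx_ l) (Hx_ k)).
  have Hc := H1_class Hu; exists (cls u) => //.
  have k0 : 0 <= C * (M + C) by rewrite mulr_ge0 ?(ltW C0)// addr_ge0// ltW.
  apply: vanishing_le (vanishingZ k0 uc) => l.
  apply: le_trans (upper _ (h1_sub (Hx_ l) Hc)) _; rewrite (energy_sub (Hx_ l) Hc).
  rewrite (energy_ae (H1B oO (Hx_ l) Hc) (H1B oO (Hx_ l) Hu))//.
  have [Lu _] := Hu; apply: filterS (clsP Lu) => t e Ot.
  by rewrite [LHS]/(fn (x_ l) t - _) (e Ot).
have [JD JZ Jip JJ] := @L2_J_facts _ _ _ leb Omega mO.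
have JP (x : H) : {ae leb, forall t, Omega t -> fn (J x) t = (0 +i* 1) * fn x t} by exact: L2_JP.
have Jh1 (x : H) : h1 x -> h1 (J x).
  move=> Hx; apply: (H1_ae (H1_scale (0 +i* 1) Hx) (fnL _)); apply: aeC; exact: JP.
have Jq (x y : H) : h1 x -> h1 y -> q (J x) (J y) = q x y.
  move=> Hx Hy; rewrite /q.
  rewrite (robin_form_ae (Jh1 _ Hx) (H1_scale _ Hx) (Jh1 _ Hy) (H1_scale _ Hy) (JP x) (JP y)).
  rewrite (robin_formZl _ Hx (H1_scale _ Hy)).
  rewrite (robin_formZr _ Hx Hy).
  by case: (robin_form _ _) => s t /=; ring.
have [saT dT [B [S [[saB nB dB iB BB] [saS nS dS iS SS] dom]]]] :=
  form_operator_roots C2 q1_semi q1_complete q1_ge form_domain_dense JD JZ Jip JJ Jh1 Jq.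
have iT := @form_operator_invariant R H h1 q C q1_semi J JZ Jip JJ Jh1 Jq.
rewrite robin_graph; have adj := graph_adjoint saT iT.
split.
- by split=> //; exact: graph_dense.
- exists (- K) => u w uw; have im0 := graph_im0 saT iT uw.
  have := uw; rewrite -robin_graph robinP => -[Hu Lw E].
  have := hK _ Hu; rewrite (E _ Hu) lecE im0 eqxx /= -/(N0 u).
  by have := gradnorm_sq_ge0 (Omega := Omega) u; lra.
(* The operator is its own adjoint, so the product under the root is [T T]. Its root is the graph of
   [B], whose root in turn is the graph of [S]. *)
rewrite /operator_abs -adj graph_comp (sqrt_graph saB nB dB iB BB) (sqrt_graph saS nS dS iS SS).
apply/seteqP; split=> u /=.
  by move=> [w [/= Lu _ Suw]]; apply: (H1_ae ((dom _).2 (ex_intro _ _ Suw)) Lu); exact: clsP.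
move=> Hu; have [Lu _] := Hu; have [w Sw] := (dom (cls u)).1 (H1_class Hu).
by exists (fn w); split=> //=; rewrite L2_classK.
Qed.

End robin_form.

Theorem theorem2p6 (R : realType) (n : nat) (hn : (2 <= n)%N)
    (Omega : set 'rV[R]_n)
    (Omega_open : open Omega) (Omega_bounded : bounded_set Omega)
    (Omega_nonempty : Omega !=set0)
    (A : lipschitz_atlas Omega) (P : partition_of_unity A)
    (a : ('rV[R]_n -> R[i]) -> ('rV[R]_n -> R[i]) -> R[i]) (c : R)
    (a_form : form_sesquilinear P a) (a_sym : form_symmetric P a)
    (a_bounded : form_bounded_below P a c) (a_closed : form_closed P a c)
    (Theta : ('rV[R]_n -> R[i]) -> (('rV[R]_n -> R[i]) -> R[i]))
    (Theta_bounded : bounded_operator P Theta)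
    (Theta_assoc : forall f g, Hhalf P f -> Hhalf P g ->
       pairing f (Theta g) = a f g) :
  [/\ selfadjoint (rV_lebesgue R n) Omega (robin_laplacian P Theta),
      bounded_from_below (rV_lebesgue R n) Omega (robin_laplacian P Theta) &
      op_domain (operator_sqrt (rV_lebesgue R n) Omega
               (operator_abs (rV_lebesgue R n) Omega (robin_laplacian P Theta)))
      = H1 Omega].
Proof.
(* Writing [n] as [m.+2] turns the number [n.-1] of tangential variables into the successor [m.+1]
   by computation. *)
case: n hn Omega Omega_open Omega_bounded Omega_nonempty A P a a_form a_sym a_bounded
  a_closed Theta Theta_bounded Theta_assoc => [//|[//|m]] _ Omega oO bO _ A P a a_form a_sym
  a_bounded _ Theta Theta_bounded Theta_assoc.
pose trace u := xget 0 [set g | dirichlet_trace P u g].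
apply: (robin_selfadjoint oO bO a_form a_sym a_bounded Theta_bounded Theta_assoc (trace := trace)).
move=> u Hu; have [g tg] := trace_exists oO bO P Hu.
exact: (xgetPex 0 (ex_intro _ g tg)).
Qed.
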